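(* For $n\geq 2$, there exists a closed non-Abelian subgroup $H$ of $\mathrm{SU}(n,1)$ that satisfies the following properties. (1) For every $\lambda>n$, the $C^*$-algebra $\mathcal{T}^{(\lambda)}(\mathcal{A}^H)$ is commutative on the weighted Bergman space $\mathcal{A}^2_\lambda(\mathbb{B}^n)$. (2) There is an $H$-orbit $M$ in $\mathbb{B}^n$ which is $n$-dimensional, non-flat, Lagrangian and totally geodesic. In particular, the sets of symbols $\mathcal{A}$ that define commutative $C^*$-algebras $\mathcal{T}^{(\lambda)}(\mathcal{A})$ for every $\lambda>n$ are not exhausted by taking $\mathcal{A}=\mathcal{A}^{H'}$ with $H'$ a connected maximal Abelian subgroup of $\mathrm{SU}(n,1)$, even if we require (2) to hold; that is, there is a subgroup $H$ satisfying (1) and (2) such that $\mathcal{A}^H\neq\mathcal{A}^{H'}$ for every connected maximal Abelian subgroup $H'$ of $\mathrm{SU}(n,1)$.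
   Context: $\mathbb{B}^n$ is the unit ball in $\mathbb{C}^n$, on which $\mathrm{SU}(n,1)$ acts by biholomorphisms: for $g=\begin{pmatrix}A&B\\C&D\end{pmatrix}\in\mathrm{SU}(n,1)$, with $A$ of size $n\times n$, and $z\in\mathbb{B}^n$ a column vector, $g\cdot z=(Az+B)(Cz+D)^{-1}$. $\mathbb{B}^n$ carries the Bergman metric (a Kähler metric invariant under this action); ''Lagrangian'' refers to the associated Kähler form, ''totally geodesic'' to the Bergman metric, and ''non-flat'' to the metric induced on $M$. For $\lambda>n$, $\mu_\lambda$ is the probability measure $d\mu_\lambda(z)=c_\lambda(1-|z|^2)^{\lambda-n-1}dz$ on $\mathbb{B}^n$ ($dz$ Lebesgue measure, $c_\lambda$ a normalizing constant), and $\mathcal{A}^2_\lambda(\mathbb{B}^n)$ is the closed subspace of holomorphic functions in $L^2(\mathbb{B}^n,\mu_\lambda)$, with orthogonal projection $B_\lambda:L^2(\mathbb{B}^n,\mu_\lambda)\to\mathcal{A}^2_\lambda(\mathbb{B}^n)$. For $\varphi\in L^\infty(\mathbb{B}^n)$, the Toeplitz operator is $T^{(\lambda)}_\varphi=B_\lambda\circ M_\varphi$ on $\mathcal{A}^2_\lambda(\mathbb{B}^n)$, where $M_\varphi$ is multiplication by $\varphi$. For a subgroup $H$ of $\mathrm{SU}(n,1)$, $\mathcal{A}^H$ is the space of $\varphi\in L^\infty(\mathbb{B}^n)$ that are $H$-invariant: for every $h\in H$, $\varphi(hz)=\varphi(z)$ for a.e. $z$. For $\mathcal{A}\subset L^\infty(\mathbb{B}^n)$,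 $\mathcal{T}^{(\lambda)}(\mathcal{A})$ is the norm-closed subalgebra of the bounded operators on $\mathcal{A}^2_\lambda(\mathbb{B}^n)$ generated by $\{T^{(\lambda)}_\varphi:\varphi\in\mathcal{A}\}$; it is a $C^*$-algebra when $\mathcal{A}$ is closed under complex conjugation. *)

(* Defs.v *)
From HB Require Import structures.
From mathcomp Require Import all_boot all_order all_algebra.
From mathcomp Require Import complex.
From mathcomp Require Import all_classical all_reals all_analysis.

Set Implicit Arguments.
Unset Strict Implicit.
Unset Printing Implicit Defensive.

Import Order.TTheory GRing.Theory Num.Theory.
Import numFieldNormedType.Exports.

Local Open Scope classical_set_scope.
Local Open Scope ring_scope.
Local Open Scope complex_scope.

HB.instance Definition _ (R : realType) := NormedModule.copy R[i] R[i]^o.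

Section Ball.
Variables (R : realType) (n : nat).

Definition hdot (z w : 'cV[R[i]]_n) : R[i] := \sum_(i < n) z i 0 * (w i 0)^*.

Definition sqnorm (z : 'cV[R[i]]_n) : R := complex.Re (hdot z z).

Definition unit_ball : set 'cV[R[i]]_n := [set z | sqnorm z < 1].

Definition form_n1 : 'M[R[i]]_(n + 1) := block_mx 1%:M 0 0 (-1)%:M.

Definition SU_n1 : set 'M[R[i]]_(n + 1) :=
  [set g | (map_mx conjc g)^T *m form_n1 *m g = form_n1 /\ \det g = 1].

Definition ball_act (g : 'M[R[i]]_(n + 1)) (z : 'cV[R[i]]_n) : 'cV[R[i]]_n :=
  ((dlsubmx g *m z + drsubmx g) 0 0)^-1 *: (ulsubmx g *m z + ursubmx g).

Definition is_subgroup (H : set 'M[R[i]]_(n + 1)) : Prop :=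
  [/\ H `<=` SU_n1, H 1%:M,
      (forall g h, H g -> H h -> H (g *m h)) &
      (forall g, H g -> H (invmx g))].

Definition is_abelian (H : set 'M[R[i]]_(n + 1)) : Prop :=
  forall g h, H g -> H h -> g *m h = h *m g.

(* Maximality is among connected Abelian subgroups: such a group need not
   contain the finite center of SU(n,1).  A connected group which is maximal
   among all Abelian subgroups is in particular of this kind. *)
Definition connected_maximal_abelian (H : set 'M[R[i]]_(n + 1)) : Prop :=
  [/\ is_subgroup H, connected H, is_abelian H &
      forall K : set 'M[R[i]]_(n + 1), is_subgroup K -> connected K ->
        is_abelian K -> H `<=` K -> K = H].

Definition ball_orbit (H : set 'M[R[i]]_(n + 1)) (z : 'cV[R[i]]_n) :
  set 'cV[R[i]]_n := [set ball_act h z | h in H].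

End Ball.

Section SigmaFiniteProduct.
Local Open Scope ereal_scope.
Variables (d1 d2 : measure_display).
Variables (T1 : measurableType d1) (T2 : measurableType d2) (R : realType).
Variable m1 : {sigma_finite_measure set T1 -> \bar R}.
Variable m2 : {sigma_finite_measure set T2 -> \bar R}.

(* The library's sigma-finite instance on [m1 \x m2] is shadowed by the
   one for subprobabilities, hence this alias. *)
Definition sigma_finite_prod : set (T1 * T2) -> \bar R := m1 \x m2.

HB.instance Definition _ := Measure.on sigma_finite_prod.

Let sigma_finite_prodT : sigma_finite setT sigma_finite_prod.
Proof.
have /sigma_finiteP[F [TF ndF Foo]] := sigma_finiteT m1.
have /sigma_finiteP[G [TG ndG Goo]] := sigma_finiteT m2.
exists (fun n => F n `*` G n).
  rewrite -setXTT TF TG predeqE => -[x y]; split.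
    move=> [/= [n _ Fnx] [k _ Gky]]; exists (maxn n k) => //; split.
    - by move: x Fnx; exact/subsetPset/ndF/leq_maxl.
    - by move: y Gky; exact/subsetPset/ndG/leq_maxr.
  by move=> [n _ []/= ? ?]; split; exists n.
move=> k; have [? ?] := Foo k; have [? ?] := Goo k.
split; first exact: measurableX.
rewrite /sigma_finite_prod product_measure1E//.
by rewrite lte_mul_pinfty// ge0_fin_numE.
Qed.

HB.instance Definition _ :=
  Measure_isSigmaFinite.Build _ _ _ sigma_finite_prod sigma_finite_prodT.

End SigmaFiniteProduct.

Section Lebesgue.
Variable R : realType.

(* C^n as the product of n copies of R * R, with z_1 first; [cvec] below is the
   identification with column vectors. *)
Fixpoint cpow_display (n : nat) : measure_display :=
  if n is n'.+1 then
    measure_prod_display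
      (measure_prod_display ((R.-ocitv.-measurable).-sigma,
                             (R.-ocitv.-measurable).-sigma)%mdisp,
       cpow_display n')
  else default_measure_display.

Fixpoint cpow (n : nat) : measurableType (cpow_display n) :=
  match n return measurableType (cpow_display n) with
  | 0 => unit
  | n'.+1 => ((measurableTypeR R * measurableTypeR R) * cpow n')%type
  end.

Fixpoint lebesgue_Cn (n : nat) :
    {sigma_finite_measure set (cpow n) -> \bar R} :=
  match n return {sigma_finite_measure set (cpow n) -> \bar R} with
  | 0 => \d_ tt
  | n'.+1 => sigma_finite_prod
      (sigma_finite_prod (@lebesgue_measure R) (@lebesgue_measure R))
      (lebesgue_Cn n')
  end.

Fixpoint cvec (n : nat) : cpow n -> 'cV[R[i]]_n :=
  match n return cpow n -> 'cV[R[i]]_n with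
  | 0 => fun=> 0
  | n'.+1 => fun t => col_mx (t.1.1 +i* t.1.2)%:M (cvec t.2)
  end.

End Lebesgue.

Section Bergman.
Variables (R : realType) (n : nat) (lambda : R).

Local Notation V := 'cV[R[i]]_n.
Local Notation leb := (lebesgue_Cn R n).

Definition mball : set (cpow R n) := [set t | unit_ball (cvec t)].

Definition ae_ball (P : V -> Prop) : Prop :=
  {ae leb, forall t, mball t -> P (cvec t)}.

Definition measurable_on_ball (f : V -> R[i]) : Prop :=
  measurable_fun mball (fun t => complex.Re (f (cvec t))) /\
  measurable_fun mball (fun t => complex.Im (f (cvec t))).

Definition weight (z : V) : R := (1 - sqnorm z) `^ (lambda - n%:R - 1).

Definition c_lambda : R := (\int[leb]_(t in mball) weight (cvec t))^-1.

(* d mu_lambda = c_lambda * weight(z) dz *)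
Definition integral_mu (f : V -> R[i]) : R[i] :=
  (c_lambda * \int[leb]_(t in mball)
     (complex.Re (f (cvec t)) * weight (cvec t))) +i*
  (c_lambda * \int[leb]_(t in mball)
     (complex.Im (f (cvec t)) * weight (cvec t))).

Definition L2 (f : V -> R[i]) : Prop :=
  measurable_on_ball f /\
  leb.-integrable mball
    (fun t => ((ComplexField.Normc.normc (f (cvec t))) ^+ 2 * weight (cvec t))%:E).

Definition ip (f g : V -> R[i]) : R[i] :=
  integral_mu (fun z => f z * (g z)^*).

Definition L2norm (f : V -> R[i]) : R := Num.sqrt (complex.Re (ip f f)).

(* Functions are only relevant on the ball; the elements of the Bergman space
   are extended by 0, so that they are determined by their values there. *)
Definition bergman_space : set (V -> R[i]) :=
  [set f | [/\ L2 f,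
              (forall z, unit_ball z -> differentiable f z) &
              (forall z, ~ unit_ball z -> f z = 0)]].

Definition bergman_proj (f : V -> R[i]) : V -> R[i] :=
  xget (fun=> 0) [set h | bergman_space h /\
    forall g, bergman_space g -> ip (fun z => f z - h z) g = 0].

Definition toeplitz (phi : V -> R[i]) (f : V -> R[i]) : V -> R[i] :=
  bergman_proj (fun z => phi z * f z).

Definition operator := (V -> R[i]) -> (V -> R[i]).

Definition bounded_operator (S : operator) : Prop :=
  [/\ (forall f, bergman_space f -> bergman_space (S f)),
      (forall (a : R[i]) f g, bergman_space f -> bergman_space g ->
         S (fun z => a * f z + g z) = (fun z => a * S f z + S g z)) &
      exists M : R, forall f, bergman_space f -> L2norm (S f) <= M * L2norm f].

(* [S] is at distance at most [e] of [S'] in operator norm. *)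
Definition op_dist_le (S S' : operator) (e : R) : Prop :=
  forall f, bergman_space f ->
    L2norm (fun z => S f z - S' f z) <= e * L2norm f.

Definition closed_subalgebra (A : set operator) : Prop :=
  [/\ A `<=` bounded_operator,
      A (fun _ _ => 0),
      (forall (a : R[i]) S T, A S -> A T -> A (fun f z => a * S f z + T f z)),
      (forall S T, A S -> A T -> A (fun f => S (T f))) &
      (forall S, bounded_operator S ->
         (forall e : R, 0 < e -> exists2 T, A T & op_dist_le S T e) -> A S)].

Definition adjoint_closed (A : set operator) : Prop :=
  forall S, A S -> exists2 S', A S' &
    forall f g, bergman_space f -> bergman_space g -> ip (S f) g = ip f (S' g).

Definition Cstar_algebra (A : set operator) : Prop :=
  closed_subalgebra A /\ adjoint_closed A.

Definition commutative_algebra (A : set operator) : Prop :=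
  forall S T, A S -> A T -> forall f, bergman_space f -> S (T f) = T (S f).

Definition toeplitz_algebra (X : set (V -> R[i])) : set operator :=
  smallest closed_subalgebra [set toeplitz phi | phi in X].

End Bergman.

Section Symbols.
Variables (R : realType) (n : nat).

Local Notation V := 'cV[R[i]]_n.

Definition Linfty (phi : V -> R[i]) : Prop :=
  measurable_on_ball phi /\
  exists M : R, ae_ball (fun z => ComplexField.Normc.normc (phi z) <= M).

(* The space A^H; it is saturated for almost everywhere equality. *)
Definition invariant_symbols (H : set 'M[R[i]]_(n + 1)) : set (V -> R[i]) :=
  [set phi | Linfty phi /\
    forall h, H h -> ae_ball (fun z => phi (ball_act h z) = phi z)].

End Symbols.

Section Riemannian.
Variable R : realType.

Definition pd (m : nat) (i : 'I_m) (f : 'rV[R]_m -> R) (x : 'rV[R]_m) : R :=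
  'D_(delta_mx 0 i) f x.

Fixpoint Ck (m : nat) (k : nat) (U : set 'rV[R]_m) (f : 'rV[R]_m -> R) : Prop :=
  (forall x, U x -> {for x, continuous f}) /\
  if k is k'.+1 then
    forall i : 'I_m,
      (forall x, U x -> derivable f x (delta_mx 0 i)) /\ Ck k' U (pd i f)
  else True.

Definition smooth (m N : nat) (U : set 'rV[R]_m) (X : 'rV[R]_m -> 'rV[R]_N) :=
  forall (k : nat) (j : 'I_N), Ck k U (fun x => X x 0 j).

(* The rows are the partial derivatives of X, so that the row space at a point
   is the tangent space of the image. *)
Definition jac (m N : nat) (X : 'rV[R]_m -> 'rV[R]_N) (x : 'rV[R]_m) :
  'M[R]_(m, N) := \matrix_(i, j) pd i (fun y => X y 0 j) x.

(* Smooth local parametrizations (inverses of charts) of a subset M of R^N: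
   immersions that are homeomorphisms onto an open subset of M. *)
Definition local_param (d N : nat) (M : set 'rV[R]_N)
    (U : set 'rV[R]_d) (X : 'rV[R]_d -> 'rV[R]_N) : Prop :=
  [/\ open U, smooth U X, (forall x, U x -> \rank (jac X x) = d),
      (forall x y, U x -> U y -> X x = X y -> x = y) &
      forall U' : set 'rV[R]_d, open U' -> U' `<=` U ->
        exists2 W : set 'rV[R]_N, open W & X @` U' = M `&` W].

Definition submanifold (d N : nat) (M : set 'rV[R]_N) : Prop :=
  M !=set0 /\ forall p, M p -> exists U X,
    local_param M U X /\ exists2 x : 'rV[R]_d, U x & X x = p.

Definition christoffel (m : nat) (G : 'rV[R]_m -> 'M[R]_m) (k i j : 'I_m)
    (x : 'rV[R]_m) : R :=
  2^-1 * \sum_(l < m) invmx (G x) k l *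
    (pd i (fun y => G y j l) x + pd j (fun y => G y i l) x
     - pd l (fun y => G y i j) x).

(* The component R^l_kij of R(d_i, d_j) d_k. *)
Definition riemann (m : nat) (G : 'rV[R]_m -> 'M[R]_m) (l k i j : 'I_m)
    (x : 'rV[R]_m) : R :=
  pd i (christoffel G l j k) x - pd j (christoffel G l i k) x
  + \sum_(s < m) (christoffel G l i s x * christoffel G s j k x
                  - christoffel G l j s x * christoffel G s i k x).

(* Below, G is a Riemannian metric on (a neighborhood of M in) R^N. *)

Definition induced_metric (d N : nat) (G : 'rV[R]_N -> 'M[R]_N)
    (X : 'rV[R]_d -> 'rV[R]_N) (x : 'rV[R]_d) : 'M[R]_d :=
  jac X x *m G (X x) *m (jac X x)^T.

Definition flat (d N : nat) (G : 'rV[R]_N -> 'M[R]_N) (M : set 'rV[R]_N) :=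
  forall (U : set 'rV[R]_d) X, local_param M U X ->
  forall x, U x -> forall l k i j, riemann (induced_metric G X) l k i j x = 0.

(* The ambient covariant derivative of d_j X in the direction d_i X. *)
Definition cov_deriv (d N : nat) (G : 'rV[R]_N -> 'M[R]_N)
    (X : 'rV[R]_d -> 'rV[R]_N) (i j : 'I_d) (x : 'rV[R]_d) : 'rV[R]_N :=
  \row_k (pd i (pd j (fun y => X y 0 k)) x
    + \sum_(a < N) \sum_(b < N)
        christoffel G k a b (X x) * jac X x i a * jac X x j b).

(* Vanishing of the second fundamental form: the Levi-Civita connection of the
   ambient space preserves tangency to M. *)
Definition totally_geodesic (d N : nat) (G : 'rV[R]_N -> 'M[R]_N)
    (M : set 'rV[R]_N) :=
  forall (U : set 'rV[R]_d) X, local_param M U X ->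
  forall x, U x -> forall i j, (cov_deriv G X i j x <= jac X x)%MS.

End Riemannian.

Section BergmanMetric.
Variables (R : realType) (n : nat).

Definition to_complex (p : 'rV[R]_(n + n)) : 'cV[R[i]]_n :=
  \col_j (p 0 (lshift n j) +i* p 0 (rshift n j)).

(* Multiplication by i, acting on row vectors: (x, y) |-> (- y, x). *)
Definition mul_i : 'M[R]_(n + n) := block_mx 0 1%:M (- 1%:M) 0.

(* The Bergman kernel of the ball, for the normalized Lebesgue measure. *)
Definition bergman_kernel (z w : 'cV[R[i]]_n) : R[i] :=
  (1 - hdot z w) ^- n.+1.

Definition bergman_potential (p : 'rV[R]_(n + n)) : R :=
  ln (complex.Re (bergman_kernel (to_complex p) (to_complex p))).

(* The real part of the Hermitian form with coefficients
   d^2 (log K(z,z)) / dz_j dzbar_k: for real tangent vectors u and v it is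
   1/4 (D_u D_v + D_(iu) D_(iv)) log K. *)
Definition bergman_metric (p : 'rV[R]_(n + n)) : 'M[R]_(n + n) :=
  \matrix_(a, b)
    let u : 'rV[R]_(n + n) := delta_mx 0 a in
    let v : 'rV[R]_(n + n) := delta_mx 0 b in
    4^-1 * ('D_u (fun q => 'D_v bergman_potential q) p
            + 'D_(u *m mul_i) (fun q => 'D_(v *m mul_i) bergman_potential q) p).

(* omega(u, v) = g(iu, v) *)
Definition kahler_form (p : 'rV[R]_(n + n)) : 'M[R]_(n + n) :=
  mul_i *m bergman_metric p.

Definition lagrangian (M : set 'rV[R]_(n + n)) : Prop :=
  submanifold n M /\
  forall (U : set 'rV[R]_n) X, local_param M U X ->
  forall x, U x -> jac X x *m kahler_form (X x) *m (jac X x)^T = 0.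

Definition real_orbit (H : set 'M[R[i]]_(n + 1)) (z : 'cV[R[i]]_n) :
  set 'rV[R]_(n + n) := [set p | ball_orbit H z (to_complex p)].

End BergmanMetric.

(* Main.v *)
(** H consists of the elements of SU(n,1) that are real up to a scalar, so that
    it is SO(n,1) up to phases, and the orbit of 0 is the real ball.

    Commutativity: let S = T_phi with phi invariant.  Differentiating the
    invariance of the sesquilinear form [int phi f conj(g) dmu] along the boosts
    in the i-th real direction shows that S is skew for the raising operator
    X_i = d_i - z_i (E + lambda), E the Euler operator; since -1 acts on the
    ball through H, S also preserves the parity of the degree.  Both properties
    pass to sums, limits and products.  Induction on the total degree then shows
    that the matrix of S in the monomials is symmetric.  As the monomials of a
    given degree form a Parseval frame up to a constant, a product of symmetric
    matrices which is again symmetric commutes: ST = (ST)^t = TS.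

    Symbols: for g in H', the function z |-> <g z, z> / <z, z> (lifted to
    homogeneous coordinates, indefinite form) is H'-invariant as H' is Abelian.
    If all these functions were H-invariant, g would commute with H and be
    scalar, so that every bounded symbol would be H'-invariant, hence invariant
    under z |-> -z, which z_1 is not.

    Geometry: conjugation is an isometry whose fixed points form the real ball,
    which kills the mixed coefficients of the metric and the normal Christoffel
    symbols; the induced metric is the Klein model of hyperbolic space. *)
From HB Require Import structures.
Require Import Defs.
From mathcomp Require Import all_boot all_order all_algebra.
From mathcomp Require Import perm complex.
From mathcomp Require Import all_classical all_reals all_analysis.
From mathcomp Require Import measurable_realfun.
From mathcomp Require Import ring lra zify.

Import Order.TTheory GRing.Theory Num.Theory.
Import numFieldNormedType.Exports.

Set Implicit Arguments.
Unset Strict Implicit.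
Unset Printing Implicit Defensive.

Local Open Scope classical_set_scope.
Local Open Scope ring_scope.

(** Having a symmetric matrix is not preserved by products, so it cannot be checked on the
    generators alone. Skewness for the X_i together with parity is preserved, and symmetry is
    deduced from it only at the end. The obstacle is that X_i is unbounded: carrying skewness to a
    product S T is an integration by parts in an infinite expansion, whose boundary term has to be
    shown to vanish. That expansion requires the polynomials to be dense in the Bergman space.
    Density comes from Cauchy theory along complex lines, developed from Goursat's theorem on
    rectangles and carried to annuli by the exponential. Bounded functionals and adjoints are then
    built directly from values on monomials. The Jacobian of a boost is found by writing the boost
    as a projective inversion between two affine changes of one coordinate; unitary maps and the
    inversion are both handled by the uniqueness of Haar measure. *)

Local Notation cj := Num.conj.

(** * Measurability of complex-valued functions *)

Section ComplexMeasurability.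
Context d (T : measurableType d) (R : realType).
Local Open Scope complex_scope.
Implicit Types (D : set T) (f g : T -> R[i]).

Definition cmeasurable D f := measurable_fun D (fun x => complex.Re (f x)) /\
  measurable_fun D (fun x => complex.Im (f x)).

Lemma cmeas_cst D (c : R[i]) : cmeasurable D (fun=> c).
Proof. by split; exact: measurable_cst. Qed.

Lemma cReD (a b : R[i]) : complex.Re (a + b) = complex.Re a + complex.Re b.
Proof. by case: a; case: b. Qed.
Lemma cImD (a b : R[i]) : complex.Im (a + b) = complex.Im a + complex.Im b.
Proof. by case: a; case: b. Qed.
Lemma cReN (a : R[i]) : complex.Re (- a) = - complex.Re a.
Proof. by case: a. Qed.
Lemma cImN (a : R[i]) : complex.Im (- a) = - complex.Im a.
Proof. by case: a. Qed.
Lemma cReM (a b : R[i]) : complex.Re (a * b) =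
  complex.Re a * complex.Re b - complex.Im a * complex.Im b.
Proof. by case: a; case: b. Qed.
Lemma cImM (a b : R[i]) : complex.Im (a * b) =
  complex.Re a * complex.Im b + complex.Im a * complex.Re b.
Proof. by case: a; case: b. Qed.
Lemma cReV (a : R[i]) : complex.Re a^-1 =
  complex.Re a * (complex.Re a ^+ 2 + complex.Im a ^+ 2)^-1.
Proof. by case: a. Qed.
Lemma cImV (a : R[i]) : complex.Im a^-1 =
  - (complex.Im a * (complex.Re a ^+ 2 + complex.Im a ^+ 2)^-1).
Proof. by case: a. Qed.
Lemma cReJ (a : R[i]) : complex.Re (cj a) = complex.Re a.
Proof. by case: a. Qed.
Lemma cImJ (a : R[i]) : complex.Im (cj a) = - complex.Im a.
Proof. by case: a. Qed.

Lemma conjM (a b : R[i]) : cj (a * b) = cj a * cj b.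
Proof. exact: rmorphM. Qed.
Lemma conjD (a b : R[i]) : cj (a + b) = cj a + cj b.
Proof. exact: rmorphD. Qed.
Lemma conjN (a : R[i]) : cj (- a) = - cj a.
Proof. exact: rmorphN. Qed.
Lemma conj_real (x : R) : cj x%:C = x%:C.
Proof. exact: conjc_real. Qed.

Lemma cmeasD D f g : cmeasurable D f -> cmeasurable D g ->
  cmeasurable D (fun x => f x + g x).
Proof.
move=> [f1 f2] [g1 g2]; split.
  by under eq_fun do rewrite cReD; exact: measurable_funD.
by under eq_fun do rewrite cImD; exact: measurable_funD.
Qed.

Lemma cmeasN D f : cmeasurable D f -> cmeasurable D (fun x => - f x).
Proof.
move=> [f1 f2]; split.
  by under eq_fun do rewrite cReN; exact: measurableT_comp.
by under eq_fun do rewrite cImN; exact: measurableT_comp.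
Qed.

Lemma cmeasB D f g : cmeasurable D f -> cmeasurable D g ->
  cmeasurable D (fun x => f x - g x).
Proof. by move=> mf mg; apply: cmeasD => //; exact: cmeasN. Qed.

Lemma cmeasM D f g : cmeasurable D f -> cmeasurable D g ->
  cmeasurable D (fun x => f x * g x).
Proof.
move=> [f1 f2] [g1 g2]; split.
  by under eq_fun do rewrite cReM; apply: measurable_funB; exact: measurable_funM.
by under eq_fun do rewrite cImM; apply: measurable_funD; exact: measurable_funM.
Qed.

Lemma cmeasJ D f : cmeasurable D f -> cmeasurable D (fun x => cj (f x)).
Proof.
move=> [f1 f2]; split; first by under eq_fun do rewrite cReJ.
by under eq_fun do rewrite cImJ; exact: measurableT_comp.
Qed.

(** Inversion is discontinuous at 0, so the line is cut into the singleton {0}, on which every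
    function is measurable, and its open complement. *)
Lemma measurable_funV_real D (h : T -> R) : measurable_fun D h ->
  measurable_fun D (fun x => (h x)^-1).
Proof.
move=> mh; apply: (@measurableT_comp _ _ _ _ _ _ (@GRing.inv R)) => //.
rewrite -(setUv [set 0 : R]); apply/measurable_funU => //.
  exact: measurableC.
split; first exact: measurable_fun_set1.
apply: open_continuous_measurable_fun; first by rewrite openC; exact/accessible_closed_set1/hausdorff_accessible/Rhausdorff.
by move=> x; rewrite inE /= => /eqP x0; exact: inv_continuous.
Qed.

Lemma cmeasV D f : cmeasurable D f -> cmeasurable D (fun x => (f x)^-1).
Proof.
move=> [f1 f2]; split.
  under eq_fun do rewrite cReV; apply: measurable_funM => //.
  by apply: measurable_funV_real; apply: measurable_funD; exact: measurable_funX.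
under eq_fun do rewrite cImV; apply: measurableT_comp => //.
apply: measurable_funM => //.
by apply: measurable_funV_real; apply: measurable_funD; exact: measurable_funX.
Qed.

Lemma cmeas_sum D (I : Type) (s : seq I) (P : pred I) (h : I -> T -> R[i]) :
  (forall i, cmeasurable D (h i)) ->
  cmeasurable D (fun x => \sum_(i <- s | P i) h i x).
Proof.
move=> mh; elim: s => [|i s IH].
  by under eq_fun do rewrite big_nil; exact: cmeas_cst.
under eq_fun do rewrite big_cons; case: (P i) => //.
exact: cmeasD.
Qed.

Lemma cmeas_prod D (I : Type) (s : seq I) (h : I -> T -> R[i]) :
  (forall i, cmeasurable D (h i)) ->
  cmeasurable D (fun x => \prod_(i <- s) h i x).
Proof.
move=> mh; elim: s => [|i s IH].
  by under eq_fun do rewrite big_nil; exact: cmeas_cst.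
under eq_fun do rewrite big_cons.
exact: cmeasM.
Qed.

Lemma cmeasS D D' f : measurable D' -> D `<=` D' -> cmeasurable D' f ->
  cmeasurable D f.
Proof. by move=> mD DD' [f1 f2]; split; exact: (measurable_funS mD DD'). Qed.

End ComplexMeasurability.

Lemma measurable_fun_pair_on d d1 d2 (T : measurableType d) (T1 : measurableType d1)
    (T2 : measurableType d2) (D : set T) (f : T -> T1) (g : T -> T2) :
  measurable_fun D f -> measurable_fun D g ->
  measurable_fun D (fun x => (f x, g x)).
Proof.
move=> mf mg.
pose G := preimage_set_system setT (@fst T1 T2) measurable `|`
          preimage_set_system setT (@snd T1 T2) measurable.
move=> mD; apply: (@measurability _ _ T (T1 * T2)%type D _ G) => //.
move=> _ [A [[C mC <-]|[C mC <-]] <-]; rewrite setTI.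
  exact: mf.
exact: mg.
Qed.

(** * Column vectors against the iterated product of planes *)

Section CoordinateSpace.
Context (R : realType).
Local Open Scope complex_scope.
Local Notation C := R[i].

(** The sigma-algebra lives on [cpow R n]; a function of a column vector is composed with a
    vector-valued map by factoring through this inverse of [cvec]. *)
Fixpoint cinv (n : nat) : 'cV[C]_n -> cpow R n :=
  match n return 'cV[C]_n -> cpow R n with
  | 0 => fun=> tt
  | n'.+1 => fun v => ((complex.Re (v 0 0), complex.Im (v 0 0)),
      @cinv n' (@dsubmx _ 1 n' 1 v))
  end.

Lemma cvec_0 n (t : cpow R n.+1) : cvec t 0 0 = t.1.1 +i* t.1.2.
Proof.
rewrite /= (_ : (0 : 'I_n.+1) = @lshift 1 n 0); last exact: val_inj.
by rewrite (@col_mxEu _ 1 n 1) mxE eqxx mulr1n.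
Qed.

Lemma cvec_lift n (t : cpow R n.+1) (i : 'I_n) :
  cvec t (lift ord0 i) 0 = cvec t.2 i 0.
Proof.
rewrite /= (_ : lift ord0 i = @rshift 1 n i); last exact: val_inj.
by rewrite (@col_mxEd _ 1 n 1).
Qed.

Lemma cinvK n : cancel (@cinv n) (@cvec R n).
Proof.
elim: n => [v|n IH v]; first by apply/matrixP => -[].
apply/matrixP => i j; rewrite ord1; case: (unliftP ord0 i) => [k|] ->.
  rewrite cvec_lift /= IH !mxE; congr (v _ _); exact: val_inj.
by rewrite cvec_0 /=; case: (v 0 0).
Qed.

Lemma cmeas_cvec n (i : 'I_n) :
  cmeasurable setT (fun t : cpow R n => cvec t i 0).
Proof.
elim: n i => [[]//|n IH] i; case: (unliftP ord0 i) => [k|] ->.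
  rewrite (_ : (fun t : cpow R n.+1 => _) = (fun t : cpow R n => cvec t k 0) \o snd).
    have [h1 h2] := IH k.
    by split; apply: (measurableT_comp (f := fun t => _ (cvec t k 0))) => //;
      exact: measurable_snd.
  by apply/funext => t /=; rewrite -cvec_lift.
rewrite (_ : (fun t : cpow R n.+1 => _) = (fun t => t.1.1 +i* t.1.2)); last first.
  by apply/funext => t; rewrite cvec_0.
by split => /=; apply: measurableT_comp => //; exact: measurable_fst.
Qed.

Lemma measurable_cinv d (T : measurableType d) D n (G : T -> 'cV[C]_n) :
  (forall i, cmeasurable D (fun x => G x i 0)) ->
  measurable_fun D (fun x => cinv (G x)).
Proof.
elim: n G => [|n IH] G mG; first exact: measurable_cst.
have [m1 m2] := mG 0.
suff mG' : measurable_fun D (fun x => cinv (@dsubmx _ 1 n 1 (G x))).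
  exact (measurable_fun_pair_on (measurable_fun_pair_on m1 m2) mG').
apply: IH => i.
rewrite (_ : (fun x => _) = (fun x => G x (rshift 1 i) 0)) //.
by apply/funext => x; rewrite mxE.
Qed.

Lemma meas_comp_cinv d (T : measurableType d) d' (Y : measurableType d') D n
    (F : 'cV[C]_n -> Y) (G : T -> 'cV[C]_n) :
  measurable_fun setT (fun t => F (cvec t)) ->
  (forall i, cmeasurable D (fun x => G x i 0)) ->
  measurable_fun D (fun x => F (G x)).
Proof.
move=> mF mG; rewrite (_ : (fun x => F (G x)) =
  (fun t => F (cvec t)) \o (fun x => cinv (G x))); last first.
  by apply/funext => x /=; rewrite cinvK.
by apply: measurableT_comp => //; exact: measurable_cinv.
Qed.

Lemma cmeas_comp_cinv d (T : measurableType d) D n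
    (F : 'cV[C]_n -> C) (G : T -> 'cV[C]_n) :
  cmeasurable setT (fun t => F (cvec t)) ->
  (forall i, cmeasurable D (fun x => G x i 0)) ->
  cmeasurable D (fun x => F (G x)).
Proof.
by move=> [m1 m2] mG; split;
  exact: (@meas_comp_cinv _ _ _ _ _ _ (fun v => _ (F v))).
Qed.

Lemma cmeas_comp_cvec d (T : measurableType d) D n (g : T -> cpow R n) i :
  measurable_fun D g -> cmeasurable D (fun x => cvec (g x) i 0).
Proof.
move=> mg; have [m1 m2] := @cmeas_cvec n i.
by split; apply: (measurableT_comp (f := fun t => _ (cvec t i 0))).
Qed.

End CoordinateSpace.

(** * Translations and dilations of the real line *)

Section OneDimensional.
Context (R : realType).
Local Open Scope ereal_scope.
Local Notation mu := (@lebesgue_measure R).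
Implicit Types f : R -> \bar R.

(** The pushforward of Lebesgue measure by the translation has the right values on the intervals
    []b, c]], hence is Lebesgue measure. *)
Lemma integral_translate f (a : R) : measurable_fun setT f -> (forall x, 0 <= f x) ->
  \int[mu]_x f (x + a)%R = \int[mu]_x f x.
Proof.
move=> mf f0.
pose phi : measurableTypeR R -> measurableTypeR R := fun x => (x + a)%R.
have mphi : measurable_fun setT phi by exact: measurable_funD.
have H A : measurable A -> mu A = pushforward mu phi A.
  apply: lebesgue_measure_unique => X [[b c]] _ <-.
  rewrite -[RHS]/(mu (phi @^-1` `]b, c]%classic)).
  rewrite (_ : phi @^-1` _ = `](b - a)%R, (c - a)%R]%classic).
    rewrite !lebesgue_measure_itv /= !lte_fin ltrD2r; case: ifP => // _.
    by rewrite -!EFinB; congr EFin; ring.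
  by apply/seteqP; split => x; rewrite /phi /= !in_itv /= ltrBlDr lerBrDr.
rewrite -[LHS](@ge0_integral_pushforward _ _ _ _ _ phi mphi mu setT f) //.
  by apply: eq_measure_integral => A mA _; apply/esym; exact: H.
Qed.

Lemma integral_scale f (r : R) : r != 0%R -> measurable_fun setT f ->
  (forall x, 0 <= f x) ->
  `|r|%:E * \int[mu]_x f (r * x)%R = \int[mu]_x f x.
Proof.
move=> r0 mf f0.
pose phi : measurableTypeR R -> measurableTypeR R := fun x => (r * x)%R.
have mphi : measurable_fun setT phi by exact: mulrl_measurable.
have nr : (0 <= `|r|)%R by [].
have H A : measurable A -> mu A = mscale (NngNum nr) (pushforward mu phi) A.
  apply: lebesgue_measure_unique => X [[b c]] _ <-.
  rewrite -[RHS]/(`|r|%:E * mu (phi @^-1` `]b, c]%classic)).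
  have [rp|rn] := ltP 0%R r.
    rewrite (_ : phi @^-1` _ = `](r^-1 * b)%R, (r^-1 * c)%R]%classic).
      rewrite !lebesgue_measure_itv /= !lte_fin ltr_pM2l ?invr_gt0//.
      case: ifP => // _; last by rewrite mule0.
      rewrite -!EFinB -EFinM (gtr0_norm rp); congr EFin; by field.
    apply/seteqP; split => x; rewrite /phi /= !in_itv /=.
      by rewrite ltr_pdivrMl// ler_pdivlMl.
    by rewrite ltr_pdivrMl// ler_pdivlMl.
  (* For negative [r] the preimage of []b, c]] has its ends swapped and is closed on the left
     instead; its length is still divided by |r|. *)
  have {}rn : (r < 0)%R by rewrite lt_neqAle r0.
  rewrite (_ : phi @^-1` _ = `[(r^-1 * c)%R, (r^-1 * b)%R[%classic).
    rewrite !lebesgue_measure_itv /= !lte_fin ltr_nM2l ?invr_lt0//.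
    case: ifP => // _; last by rewrite mule0.
    rewrite -!EFinB -EFinM (ltr0_norm rn); congr EFin; by field.
  apply/seteqP; split => x; rewrite /phi /= !in_itv /=.
    by rewrite andbC ltr_ndivlMl// ler_ndivrMl.
  by rewrite andbC ltr_ndivlMl// ler_ndivrMl.
rewrite -[X in _ * X](@ge0_integral_pushforward _ _ _ _ _ phi mphi mu setT f) //.
rewrite -(@ge0_integral_mscale _ _ _ (pushforward mu phi) setT measurableT (NngNum nr) f) //.
by apply: eq_measure_integral => A mA _; apply/esym; exact: H.
Qed.

End OneDimensional.

(** * Integration over C and C^n, one coordinate at a time *)

Section VectorIntegral.
Context (R : realType).
Local Open Scope complex_scope.
Local Open Scope ereal_scope.
Local Notation C := R[i].
Local Notation V n := 'cV[C]_n.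
Local Notation mu := (@lebesgue_measure R).
Local Notation mu2 := (sigma_finite_prod mu mu).

(** All changes of variables are first proved for nonnegative measurable functions of complex
    variables, where Tonelli's theorem requires no integrability. *)
Definition IC (f : C -> \bar R) := \int[mu2]_p f (p.1 +i* p.2)%C.
Definition IV n (F : V n -> \bar R) := \int[lebesgue_Cn R n]_t F (cvec t).
Definition mC (f : C -> \bar R) :=
  measurable_fun setT (fun p : measurableTypeR R * measurableTypeR R => f (p.1 +i* p.2)%C).
Definition mV n (F : V n -> \bar R) :=
  measurable_fun setT (fun t : cpow R n => F (cvec t)).

Definition consV n (w : C) (v : V n) : V n.+1 := @col_mx _ 1 n 1 w%:M v.

Lemma consV0 n w (v : V n) : consV w v 0%R 0%R = w.
Proof.
rewrite /consV (_ : (0%R : 'I_n.+1) = @lshift 1 n 0%R); last exact: val_inj.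
by rewrite (@col_mxEu _ 1 n 1) mxE eqxx mulr1n.
Qed.

Lemma consV_lift n w (v : V n) i : consV w v (lift ord0 i) 0%R = v i 0%R.
Proof.
rewrite /consV (_ : lift ord0 i = @rshift 1 n i); last exact: val_inj.
by rewrite (@col_mxEd _ 1 n 1).
Qed.

Lemma consV_eta n (u : V n.+1) : u = consV (u 0%R 0%R) (@dsubmx _ 1 n 1 u).
Proof.
apply/matrixP => i j; rewrite ord1; case: (unliftP ord0 i) => [k|] ->.
  by rewrite consV_lift mxE; congr (u _ _); exact: val_inj.
by rewrite consV0.
Qed.

Lemma cmeas_id2 : cmeasurable setT
  (fun p : measurableTypeR R * measurableTypeR R => (p.1 +i* p.2)%C : C).
Proof. by split => /=; [exact: measurable_fst|exact: measurable_snd]. Qed.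

Lemma meas_compC d (T : measurableType d) d' (Y : measurableType d') D
    (f : C -> Y) (g : T -> C) :
  measurable_fun setT (fun p : measurableTypeR R * measurableTypeR R => f (p.1 +i* p.2)%C) ->
  cmeasurable D g -> measurable_fun D (fun x => f (g x)).
Proof.
move=> mf [m1 m2]; rewrite (_ : (fun x => f (g x)) =
  (fun p : measurableTypeR R * measurableTypeR R => f (p.1 +i* p.2)%C) \o
  (fun x => (complex.Re (g x), complex.Im (g x)))); last first.
  by apply/funext => x /=; case: (g x).
by apply: measurableT_comp => //; exact: measurable_fun_pair_on.
Qed.

Lemma cmeas_consV d (T : measurableType d) (D : set T) n (w : T -> C) (v : T -> V n) :
  cmeasurable D w -> (forall i, cmeasurable D (fun x => v x i 0%R)) ->
  forall i, cmeasurable D (fun x => consV (w x) (v x) i 0%R).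
Proof.
move=> mw mv i; case: (unliftP ord0 i) => [k|] ->.
  by under eq_fun do rewrite consV_lift.
by under eq_fun do rewrite consV0.
Qed.

Lemma mV_consr n (F : V n.+1 -> \bar R) w : mV F -> mV (fun v => F (consV w v)).
Proof.
move=> mF; apply: (@meas_comp_cinv R _ _ _ _ setT _ F (fun t => consV w (cvec t))) => // i.
apply: (@cmeas_consV _ _ _ _ (fun=> w) (@cvec R n)); last exact: cmeas_cvec.
exact: cmeas_cst.
Qed.

Section Tonelli.
Variables (n : nat) (F : V n.+1 -> \bar R).
Hypotheses (mF : mV F) (F0 : forall v, 0 <= F v).

Lemma IV_consl : IV F = IC (fun w => IV (fun v => F (consV w v))).
Proof. exact: (fubini_tonelli1 (m1 := mu2) (m2 := lebesgue_Cn R n)). Qed.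

Lemma mC_IV : mC (fun w => IV (fun v => F (consV w v))).
Proof. exact: (measurable_fun_fubini_tonelli_F (m2 := lebesgue_Cn R n)
  (fun t : cpow R n.+1 => F (cvec t))). Qed.

End Tonelli.

Lemma IV0 (F : V 0 -> \bar R) : mV F -> IV F = F 0%R.
Proof. by move=> mF; rewrite /IV integral_dirac //= diracE in_setT mul1e. Qed.

Lemma IC_E (f : C -> \bar R) : mC f -> (forall z, 0 <= f z) ->
  IC f = \int[mu]_x \int[mu]_y f (x +i* y)%C.
Proof. by move=> mf f0; exact: (fubini_tonelli1 (m1 := mu) (m2 := mu)). Qed.

Lemma mIC_E (f : C -> \bar R) : mC f -> (forall z, 0 <= f z) ->
  measurable_fun setT (fun x => \int[mu]_y f (x +i* y)%C).
Proof. by move=> mf f0; exact: (measurable_fun_fubini_tonelli_F (m2 := mu)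
  (fun p : measurableTypeR R * measurableTypeR R => f (p.1 +i* p.2)%C)). Qed.

Lemma mC_sect (f : C -> \bar R) x : mC f -> measurable_fun setT (fun y => f (x +i* y)%C).
Proof.
move=> mf; apply: (meas_compC mf); split => //=; exact: measurable_cst.
Qed.

Lemma eq_IV n (F G : V n -> \bar R) : F =1 G -> IV F = IV G.
Proof. by move=> FG; apply: eq_integral => t _; exact: FG. Qed.

Lemma eq_IC (F G : C -> \bar R) : F =1 G -> IC F = IC G.
Proof. by move=> FG; apply: eq_integral => t _; exact: FG. Qed.

Lemma IV_ge0 n (F : V n -> \bar R) : (forall v, 0 <= F v) -> 0 <= IV F.
Proof. by move=> F0; exact: integral_ge0. Qed.

Lemma IC_ge0 (F : C -> \bar R) : (forall v, 0 <= F v) -> 0 <= IC F.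
Proof. by move=> F0; exact: integral_ge0. Qed.

Lemma IC_Zl (f : C -> \bar R) (k : R) : mC f -> (forall z, 0 <= f z) -> (0 <= k)%R ->
  IC (fun w => k%:E * f w) = k%:E * IC f.
Proof. by move=> mf f0 k0; rewrite /IC ge0_integralZl_EFin. Qed.

Lemma IV_Zl n (f : V n -> \bar R) (k : R) : mV f -> (forall z, 0 <= f z) -> (0 <= k)%R ->
  IV (fun w => k%:E * f w) = k%:E * IV f.
Proof. by move=> mf f0 k0; rewrite /IV ge0_integralZl_EFin. Qed.

Lemma IC_Zr (f : C -> \bar R) (k : \bar R) : mC f -> (forall z, 0 <= f z) -> 0 <= k ->
  IC (fun w => f w * k) = IC f * k.
Proof. by move=> mf f0 k0; rewrite /IC ge0_integralZr. Qed.

Lemma IV_Zr n (f : V n -> \bar R) (k : \bar R) : mV f -> (forall z, 0 <= f z) -> 0 <= k ->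
  IV (fun w => f w * k) = IV f * k.
Proof. by move=> mf f0 k0; rewrite /IV ge0_integralZr. Qed.

Lemma le_IV n (f g : V n -> \bar R) : mV f -> mV g -> (forall z, 0 <= f z) ->
  (forall z, f z <= g z) -> IV f <= IV g.
Proof. by move=> mf mg f0 fg; apply: ge0_le_integral => // t _; apply: le_trans (fg _). Qed.

Lemma le_IC (f g : C -> \bar R) : mC f -> mC g -> (forall z, 0 <= f z) ->
  (forall z, f z <= g z) -> IC f <= IC g.
Proof. by move=> mf mg f0 fg; apply: ge0_le_integral => // t _; apply: le_trans (fg _). Qed.

Lemma IC_eq0 (g : C -> \bar R) : (forall y, g y = 0) -> IC g = 0.
Proof. by move=> g0; rewrite /IC integral0_eq // => p _; exact: g0. Qed.

Lemma IV_eq0 n (g : V n -> \bar R) : (forall y, g y = 0) -> IV g = 0.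
Proof. by move=> g0; rewrite /IV integral0_eq // => p _; exact: g0. Qed.

Opaque IC IV.

Lemma IC_translate (f : C -> \bar R) a : mC f -> (forall z, 0 <= f z) ->
  IC (fun w => f (w + a)%R) = IC f.
Proof.
move=> mf f0.
have m1 : mC (fun w => f (w + a)%R).
  by apply: (meas_compC mf); apply: cmeasD;
    [exact: cmeas_id2|exact: cmeas_cst].
rewrite (IC_E m1 (fun z => f0 _)) (IC_E mf f0).
transitivity (\int[mu]_x (fun x => \int[mu]_y f (x +i* y)%C) (x + complex.Re a)%R).
  apply: eq_integral => x _.
  rewrite -(@integral_translate _ (fun y => f ((x + complex.Re a)%R +i* y)%C) (complex.Im a)) //.
    by apply: eq_integral => y _; case: a {m1}.
  exact: mC_sect.
rewrite (@integral_translate _ (fun x => \int[mu]_y f (x +i* y)%C)) //.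
  exact: mIC_E.
by move=> x; exact: integral_ge0.
Qed.

Lemma IC_scale (f : C -> \bar R) (r : R) : r != 0%R -> mC f -> (forall z, 0 <= f z) ->
  (r ^+ 2)%:E * IC (fun w => f (r%:C * w)%R) = IC f.
Proof.
move=> r0 mf f0.
have m1 : mC (fun w => f (r%:C * w)%R).
  by apply: (meas_compC mf); apply: cmeasM;
    [exact: cmeas_cst|exact: cmeas_id2].
have r2 : (r ^+ 2)%:E = `|r|%:E * `|r|%:E by rewrite -EFinM -normrM ger0_norm -?expr2// sqr_ge0.
rewrite (IC_E m1 (fun z => f0 _)) (IC_E mf f0) r2 -muleA.
rewrite -(@integral_scale _ (fun x => \int[mu]_y f (x +i* y)%C) r r0 (mIC_E mf f0)); last first.
  by move=> x; exact: integral_ge0.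
congr (_ * _).
rewrite -ge0_integralZl//; last 2 first.
  exact: (mIC_E m1).
  by move=> x _; exact: integral_ge0.
apply: eq_integral => x _.
rewrite -(@integral_scale _ (fun y => f ((r * x)%R +i* y)%C) r)//.
  congr (_ * _); apply: eq_integral => y _; congr f.
  by apply/eqP; rewrite eq_complex /= !mul0r subr0 addr0 !eqxx.
exact: mC_sect.
Qed.

Lemma mV_translate n (F : V n -> \bar R) a : mV F -> mV (fun v => F (v + a)%R).
Proof.
move=> mF; apply: (@meas_comp_cinv R _ _ _ _ setT n F (fun t => cvec t + a)%R) => // i.
under eq_fun do rewrite mxE; apply: cmeasD; first exact: cmeas_cvec.
exact: cmeas_cst.
Qed.

Lemma mV_scale n (F : V n -> \bar R) c : mV F -> mV (fun v => F (c *: v)%R).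
Proof.
move=> mF; apply: (@meas_comp_cinv R _ _ _ _ setT n F (fun t => c *: cvec t)) => // i.
under eq_fun do rewrite mxE; apply: cmeasM; first exact: cmeas_cst.
exact: cmeas_cvec.
Qed.

Lemma consV_add n (w : C) (v : V n) (a : V n.+1) :
  (consV w v + a = consV (w + a 0 0) (v + @dsubmx _ 1 n 1 a))%R.
Proof.
by rewrite {1}[a]consV_eta /consV (@add_col_mx _ 1 n 1) -raddfD.
Qed.

Lemma consV_scale n (w c : C) (v : V n) :
  (c *: consV w v = consV (c * w) (c *: v))%R.
Proof. by rewrite /consV (@scale_col_mx _ 1 n 1) scale_scalar_mx. Qed.

Lemma IV_translate n (F : V n -> \bar R) a : mV F -> (forall v, 0 <= F v) ->
  IV (fun v => F (v + a)%R) = IV F.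
Proof.
elim: n F a => [|n IH] F a mF F0.
  rewrite (IV0 (mV_translate _ mF)) (IV0 mF).
  by congr F; apply/matrixP => -[].
rewrite (IV_consl (mV_translate _ mF) (fun z => F0 _)) (IV_consl mF F0).
rewrite -(@IC_translate (fun w => IV (fun v => F (consV w v))) (a 0%R 0%R)); last 2 first.
- exact: mC_IV.
- by move=> w; apply: IV_ge0.
apply: eq_IC => w.
rewrite -(IH (fun v => F (consV _ v)) (@dsubmx _ 1 n 1 a) (mV_consr _ mF) (fun=> F0 _)).
by apply: eq_IV => v; rewrite consV_add.
Qed.

Lemma IV_scale n (F : V n -> \bar R) (r : R) : r != 0%R -> mV F -> (forall v, 0 <= F v) ->
  ((r ^+ 2) ^+ n)%:E * IV (fun v => F (r%:C *: v)%R) = IV F.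
Proof.
move=> r0; elim: n F => [|n IH] F mF F0.
  rewrite (IV0 (mV_scale _ mF)) (IV0 mF).
  by rewrite expr0 mul1e; congr F; apply/matrixP => -[].
rewrite (IV_consl (mV_scale _ mF) (fun z => F0 _)) (IV_consl mF F0).
rewrite -(@IC_scale (fun w => IV (fun v => F (consV w v))) r r0); last 2 first.
- exact: mC_IV.
- by move=> w; apply: IV_ge0.
rewrite exprS EFinM -muleA; congr (_ * _).
rewrite -IC_Zl; last 3 first.
- exact: (mC_IV (mV_scale _ mF)).
- by move=> w; apply: IV_ge0.
- by rewrite exprn_ge0// sqr_ge0.
apply: eq_IC => w.
rewrite -(IH (fun v => F (consV _ v)) (mV_consr _ mF) (fun=> F0 _)).
by congr (_ * _); apply: eq_IV => v; rewrite consV_scale.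
Qed.

End VectorIntegral.

(** * Volume of boxes and of the ball; unitary invariance *)

Section Boxes.
Context (R : realType).
Local Open Scope complex_scope.
Local Open Scope ereal_scope.
Local Notation C := R[i].
Local Notation V n := 'cV[C]_n.
Local Notation mu := (@lebesgue_measure R).

Definition csq (c : C) : R := (complex.Re c ^+ 2 + complex.Im c ^+ 2)%R.

Lemma csq_ge0 c : (0 <= csq c)%R. Proof. by rewrite addr_ge0// sqr_ge0. Qed.

Lemma csqM a b : csq (a * b)%R = (csq a * csq b)%R.
Proof. by case: a => a a'; case: b => b b'; rewrite /csq /=; ring. Qed.

Lemma csq_eq0 c : (csq c == 0%R) = (c == 0%R).
Proof. by rewrite /csq paddr_eq0 ?sqr_ge0// !sqrf_eq0 eq_complex. Qed.

Lemma csq1 : csq 1%R = 1%R.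
Proof. by rewrite /csq /= expr1n expr0n addr0. Qed.

Lemma csq0 : csq 0%R = 0%R. Proof. by apply/eqP; rewrite csq_eq0. Qed.

Lemma csqV c : csq c^-1%R = (csq c)^-1%R.
Proof.
have [->|c0] := eqVneq c 0%R; first by rewrite invr0 csq0 invr0.
have c0' : csq c != 0%R by rewrite csq_eq0.
by apply: (mulfI c0'); rewrite -csqM !divff// csq1.
Qed.

Lemma csq_real (r : R) : csq r%:C%C = (r ^+ 2)%R.
Proof. by rewrite /csq /= expr0n addr0. Qed.

Lemma csqE (c : C) : (csq c)%:C%C = (c * cj c)%R.
Proof.
case: c => a b; apply/eqP; rewrite eq_complex /csq /=.
by apply/andP; split; apply/eqP; ring.
Qed.

Lemma csqJ (c : C) : csq (cj c) = csq c.
Proof. by case: c => a b; rewrite /csq /= sqrrN. Qed.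

Lemma csqN (c : C) : csq (- c)%R = csq c.
Proof. by case: c => a b; rewrite /csq /= !sqrrN. Qed.

Lemma sqnormE n (v : V n) : sqnorm v = (\sum_i csq (v i ord0))%R.
Proof.
rewrite /sqnorm /hdot.
have -> : (\sum_(i < n) v i ord0 * cj (v i ord0) = (\sum_i csq (v i ord0))%:C%C)%R.
  by rewrite rmorph_sum; apply: eq_bigr => i _; rewrite -csqE.
by [].
Qed.

Lemma hdotE n (v w : V n) : hdot v w = (\sum_i v i ord0 * cj (w i ord0))%R.
Proof. by []. Qed.

Lemma hdot_sq n (v : V n) : hdot v v = (sqnorm v)%:C%C.
Proof.
rewrite sqnormE rmorph_sum; apply: eq_bigr => i _.
by rewrite -csqE.
Qed.

Lemma measurable_csq d (T : measurableType d) (D : set T) (f : T -> C) :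
  cmeasurable D f -> measurable_fun D (fun x => csq (f x)).
Proof. by move=> [m1 m2]; apply: measurable_funD; exact: measurable_funX. Qed.

Lemma measurable_fun_sumr d (T : measurableType d) (D : set T) (I : Type) (s : seq I)
  (h : I -> T -> R) : (forall i, measurable_fun D (h i)) ->
  measurable_fun D (fun x => \sum_(i <- s) h i x)%R.
Proof.
move=> mh; elim: s => [|i s IH].
  by under eq_fun do rewrite big_nil; exact: measurable_cst.
by under eq_fun do rewrite big_cons; exact: measurable_funD.
Qed.

Lemma measurable_fun_prodr d (T : measurableType d) (D : set T) (I : Type) (s : seq I)
  (h : I -> T -> R) : (forall i, measurable_fun D (h i)) ->
  measurable_fun D (fun x => \prod_(i <- s) h i x)%R.
Proof.
move=> mh; elim: s => [|i s IH].
  by under eq_fun do rewrite big_nil; exact: measurable_cst.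
by under eq_fun do rewrite big_cons; exact: measurable_funM.
Qed.

Lemma measurable_sqnorm d (T : measurableType d) (D : set T) n (f : T -> V n) :
  (forall i, cmeasurable D (fun x => f x i ord0)) ->
  measurable_fun D (fun x => sqnorm (f x)).
Proof.
move=> mf; under eq_fun do rewrite sqnormE.
by apply: measurable_fun_sumr => i; exact: measurable_csq.
Qed.

Lemma measurable_ind d (T : measurableType d) (D : set T) (b : T -> bool) :
  measurable_fun D b -> measurable_fun D (fun x => (b x)%:R : R).
Proof.
by move=> mb; apply: (measurableT_comp (f := fun x : bool => x%:R : R)).
Qed.

Definition cbox (e : R) (a w : C) : bool :=
  (`|complex.Re a - complex.Re w| < e)%R && (`|complex.Im a - complex.Im w| < e)%R.

Lemma measurable_cbox d (T : measurableType d) (D : set T) e a (f : T -> C) :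
  cmeasurable D f -> measurable_fun D (fun x => (cbox e a (f x))%:R : R).
Proof.
move=> [m1 m2]; apply: measurable_ind; apply: measurable_and.
  apply: measurable_fun_ltr; last exact: measurable_cst.
  apply: measurableT_comp => //; apply: measurable_funB => //; exact: measurable_cst.
apply: measurable_fun_ltr; last exact: measurable_cst.
apply: measurableT_comp => //; apply: measurable_funB => //; exact: measurable_cst.
Qed.

Lemma integral_ball (a e : R) : (0 <= e)%R ->
  \int[mu]_x ((`|a - x| < e)%R%:R)%:E = (e *+ 2)%:E.
Proof.
move=> e0; rewrite -(lebesgue_measure_ball a e0).
rewrite -[RHS]mul1e -integral_cst; last exact: measurable_ball.
rewrite integral_mkcond; apply: eq_integral => x _.
rewrite patchE /ball /=; case: ifPn; first by rewrite inE /= => ->.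
by rewrite notin_setE /= => /negP/negbTE ->.
Qed.

Lemma IC_cbox (e : R) a : (0 <= e)%R ->
  IC (fun w => ((cbox e a w)%:R : R)%:E) = ((e *+ 2) ^+ 2)%:E.
Proof.
move=> e0; rewrite IC_E; last 2 first.
- apply/measurable_EFinP; apply: measurable_cbox; exact: cmeas_id2.
- by move=> z; rewrite lee_fin.
transitivity (\int[mu]_x (((`|complex.Re a - x| < e)%R%:R)%:E * (e *+ 2)%:E)).
  apply: eq_integral => x _.
  rewrite -(integral_ball (complex.Im a) e0) -ge0_integralZl_EFin //.
  - by apply: eq_integral => y _; rewrite /cbox /= -EFinM -natrM mulnb.
  - apply/measurable_EFinP/measurable_ind/measurable_fun_ltr; last exact: measurable_cst.
    by apply: measurableT_comp => //; apply: measurable_funB => //; exact: measurable_cst.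
rewrite ge0_integralZr//.
- by rewrite integral_ball// expr2 EFinM.
- apply/measurable_EFinP/measurable_ind/measurable_fun_ltr; last exact: measurable_cst.
  by apply: measurableT_comp => //; apply: measurable_funB => //; exact: measurable_cst.
- by rewrite lee_fin mulrn_wge0.
Qed.

Definition box n e (a v : V n) : R := (\prod_(i < n) (cbox e (a i ord0) (v i ord0))%:R)%R.

Lemma box_ge0 n e (a v : V n) : (0 <= box e a v)%R.
Proof. by apply: prodr_ge0. Qed.

Lemma box_cons n e (a : V n.+1) w v :
  box e a (consV w v) =
  ((cbox e (a ord0 ord0) w)%:R * box e (@dsubmx _ 1 n 1 a) v)%R.
Proof.
rewrite /box big_ord_recl consV0; congr (_ * _)%R.
apply: eq_bigr => i _; rewrite consV_lift mxE; congr ((cbox _ (a _ _) _)%:R)%R.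
exact: val_inj.
Qed.

Lemma mV_box n e (a : V n) : mV (fun v => (box e a v)%:E).
Proof.
apply/measurable_EFinP/measurable_fun_prodr => i; apply: measurable_cbox.
exact: cmeas_cvec.
Qed.

Lemma IV_box n e (a : V n) : (0 <= e)%R ->
  IV (fun v => (box e a v)%:E) = (((e *+ 2) ^+ 2) ^+ n)%:E.
Proof.
move=> e0; elim: n a => [|n IH] a.
  by rewrite IV0; [rewrite /box big_ord0 expr0|exact: mV_box].
rewrite IV_consl; last 2 first.
- exact: mV_box.
- by move=> v; rewrite lee_fin box_ge0.
transitivity (IC (fun w => (((cbox e (a ord0 ord0) w)%:R : R)%:E * (((e *+ 2) ^+ 2) ^+ n)%:E))).
  apply: eq_IC => w; rewrite -(IH (@dsubmx _ 1 n 1 a)) -IV_Zl//.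
  - by apply: eq_IV => v; rewrite box_cons EFinM.
  - exact: mV_box.
  - by move=> v; rewrite lee_fin box_ge0.
rewrite IC_Zr.
- by rewrite IC_cbox// -EFinM -exprS.
- apply/measurable_EFinP/measurable_cbox; exact: cmeas_id2.
- by move=> z; rewrite lee_fin.
- by rewrite lee_fin exprn_ge0// sqr_ge0.
Qed.

Definition ballI n (v : V n) : R := ((sqnorm v < 1)%R)%:R%R.

Lemma ballI_ge0 n (v : V n) : (0 <= ballI v)%R. Proof. by []. Qed.

Lemma measurable_ballI d (T : measurableType d) (D : set T) n (f : T -> V n) :
  (forall i, cmeasurable D (fun x => f x i ord0)) ->
  measurable_fun D (fun x => ballI (f x)).
Proof.
move=> mf; apply: measurable_ind; apply: measurable_fun_ltr; last exact: measurable_cst.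
exact: measurable_sqnorm.
Qed.

Lemma mV_ballI n : mV (fun v : V n => (ballI v)%:E).
Proof.
by apply/measurable_EFinP/measurable_ballI => i; exact: cmeas_cvec.
Qed.

Lemma box_subset n e (a v : V n) : (0 < box e a v)%R -> forall i, cbox e (a i ord0) (v i ord0).
Proof.
move=> h i; case H : cbox => //; move: h.
by rewrite /box (bigD1 i)//= H mul0r ltxx.
Qed.

Lemma box_val n e (a v : V n) : box e a v = 0%R \/ (box e a v = 1%R /\
  forall i, cbox e (a i ord0) (v i ord0)).
Proof.
have [h|h] := boolP [forall i, cbox e (a i ord0) (v i ord0)].
  right; split; last by move=> i; exact: (forallP h).
  by rewrite /box big1 // => i _; rewrite (forallP h).
left; move: h; rewrite negb_forall => /existsP[i /negbTE hi].
by rewrite /box (bigD1 i)//= hi mul0r.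
Qed.

Lemma cbox_csq e (a w : C) : cbox e a w -> (csq (a - w)%R <= e ^+ 2 *+ 2)%R.
Proof.
case: a w => a a' [w w'] /andP[/= h1 h2]; rewrite /csq /= mulr2n.
by rewrite lerD// -real_normK ?num_real// ler_sqr ?nnegrE// ?ltW// (le_lt_trans _ h1)//.
Qed.

Lemma IV_ballI_lty n : IV (fun v : V n => (ballI v)%:E) < +oo.
Proof.
apply: (@le_lt_trans _ _ (IV (fun v : V n => (box 2 0%R v)%:E))); last first.
  by rewrite IV_box// ltry.
apply: le_IV; [exact: mV_ballI|exact: mV_box|by move=> z; rewrite lee_fin|].
move=> v; rewrite lee_fin /ballI; case: ltP => h; last exact: box_ge0.
rewrite /box big1 // => i _; rewrite mxE /cbox /= !sub0r !normrN.
have hi : (csq (v i ord0) < 1)%R.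
  apply: le_lt_trans h; rewrite sqnormE (bigD1 i)//= lerDl.
  by apply: sumr_ge0 => *; exact: csq_ge0.
have hh (x : R) : (x ^+ 2 <= csq (v i ord0) -> `|x| < 2)%R.
  move=> hx; have := le_lt_trans hx hi.
  rewrite -real_normK ?num_real// expr_lt1// => /lt_trans; apply.
  by rewrite ltr1n.
by rewrite !hh// /csq ?lerDl ?lerDr ?sqr_ge0.
Qed.

Lemma IV_ballI_gt0 n : 0 < IV (fun v : V n => (ballI v)%:E).
Proof.
(* On the box each |v_i|^2 is at most 2 e^2 <= e, as 2 e <= 1, and the sum of n such terms is at
   most n / (2 (n + 1)) < 1. *)
pose e : R := ((n.+1)%:R *+ 2)^-1%R.
have e0 : (0 < e)%R by rewrite invr_gt0 pmulrn_lgt0// ltr0n.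
apply: (@lt_le_trans _ _ (IV (fun v : V n => (box e 0%R v)%:E))).
  by rewrite IV_box ?ltW// lte_fin !exprn_gt0// mulrn_wgt0.
apply: le_IV; [exact: mV_box|exact: mV_ballI|by move=> z; rewrite lee_fin box_ge0|].
move=> v; rewrite lee_fin; have [->|[-> h]] := box_val e 0%R v; first exact: ballI_ge0.
rewrite /ballI; suff -> : (sqnorm v < 1)%R by [].
rewrite sqnormE; apply: (@le_lt_trans _ _ (\sum_(i < n) e)%R).
  apply: ler_sum => i _; have := cbox_csq (h i); rewrite mxE sub0r csqN => /le_trans; apply.
  suff e2 : (e * 2 <= 1)%R by rewrite -mulr_natr expr2 -mulrA; exact: ler_piMr (ltW e0) e2.
  rewrite /e -[X in (X^-1)%R]mulr_natr invfM -mulrA mulVf// mulr1.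
  by rewrite invf_le1 ?ler1n// ltr0n.
rewrite sumr_const card_ord -mulr_natr /e mulrC ltr_pdivrMr ?mul1r -?mulrnA ?ltr0n ?ltr_nat; lia.
Qed.

Lemma mulmx_coord n (U : 'M[C]_n) (v : V n) i :
  (U *m v) i ord0 = (\sum_j U i j * v j ord0)%R.
Proof. by rewrite mxE. Qed.

Lemma cmeas_mulmx d (T : measurableType d) (D : set T) n (U : 'M[C]_n) (f : T -> V n) :
  (forall i, cmeasurable D (fun x => f x i ord0)) ->
  forall i, cmeasurable D (fun x => (U *m f x) i ord0).
Proof.
move=> mf i; under eq_fun do rewrite mulmx_coord.
apply: cmeas_sum => j; apply: cmeasM => //; exact: cmeas_cst.
Qed.

Lemma cmeas_addmx d (T : measurableType d) (D : set T) n (f g : T -> V n) :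
  (forall i, cmeasurable D (fun x => f x i ord0)) ->
  (forall i, cmeasurable D (fun x => g x i ord0)) ->
  forall i, cmeasurable D (fun x => (f x + g x)%R i ord0).
Proof. by move=> mf mg i; under eq_fun do rewrite mxE; exact: cmeasD. Qed.

Lemma cmeas_oppmx d (T : measurableType d) (D : set T) n (f : T -> V n) :
  (forall i, cmeasurable D (fun x => f x i ord0)) ->
  forall i, cmeasurable D (fun x => (- f x)%R i ord0).
Proof. by move=> mf i; under eq_fun do rewrite mxE; exact: cmeasN. Qed.

Definition unitary n (U : 'M[C]_n) : Prop := (map_mx conjc U)^T *m U = 1%:M.

Lemma hdot_mx n (v w : V n) : (hdot v w)%:M = (map_mx conjc w)^T *m v.
Proof.
apply/matrixP => i j; rewrite !ord1 !mxE eqxx mulr1n.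
by apply: eq_bigr => k _; rewrite !mxE mulrC.
Qed.

Lemma unitary_hdot n (U : 'M[C]_n) (v w : V n) : unitary U ->
  hdot (U *m v) (U *m w) = hdot v w.
Proof.
move=> hU; suff : (hdot (U *m v) (U *m w))%:M = (hdot v w)%:M :> 'M[C]_1.
  by move=> /matrixP /(_ ord0 ord0); rewrite !mxE eqxx !mulr1n.
rewrite !hdot_mx map_mxM trmx_mul mulmxA -[(_ *m _ *m U)%R]mulmxA.
by rewrite hU mulmx1.
Qed.

Lemma unitary_sqnorm n (U : 'M[C]_n) (v : V n) : unitary U -> sqnorm (U *m v) = sqnorm v.
Proof. by move=> hU; rewrite /sqnorm unitary_hdot. Qed.

Lemma unitaryN n (U : 'M[C]_n) : unitary U -> unitary (- U)%R.
Proof. by move=> hU; rewrite /unitary map_mxN linearN /= linearN /= mulNmx opprK. Qed.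

Lemma IV_swap n m (G : V n -> V m -> \bar R) :
  measurable_fun setT (fun p : cpow R n * cpow R m => G (cvec p.1) (cvec p.2)) ->
  (forall x y, 0 <= G x y) ->
  IV (fun x => IV (fun y => G x y)) = IV (fun y => IV (fun x => G x y)).
Proof.
move=> mG G0; exact: (@fubini_tonelli _ _ _ _ _ (lebesgue_Cn R n) (lebesgue_Cn R m)
  (fun p => G (cvec p.1) (cvec p.2))).
Qed.

Lemma fin_num_ballI n : IV (fun v : V n => (ballI v)%:E) \is a fin_num.
Proof. by rewrite fin_numElt IV_ballI_lty (lt_le_trans _ (ltW (IV_ballI_gt0 n)))// ltNy0. Qed.

Lemma mule_pcancel (b x y : \bar R) : 0 < b -> b \is a fin_num -> b * x = b * y -> x = y.
Proof.
case: b => [r| |] //; rewrite lte_fin => r0 _ /(congr1 (fun t => (r^-1)%:E * t)).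
by rewrite !muleA -!EFinM mulVf ?gt_eqF// !mul1e.
Qed.

(* Uniqueness of Haar measure: in [int int F(x) B(U y + x) dx dy], translating
   either variable gives both [(int F)(int B)] and [(int B)(int F(- U y))]. *)
Lemma IV_unitary n (U : 'M[C]_n) (F : V n -> \bar R) : unitary U ->
  mV F -> (forall v, 0 <= F v) -> IV (fun v => F (U *m v)) = IV F.
Proof.
move=> hU; have {hU} [U' hU' ->] : exists2 U', unitary U' & U = (- U')%R.
  by exists (- U)%R; [exact: unitaryN|rewrite opprK].
move: hU' => {U}; move: U' => U hU mF F0.
have UU : U *m (map_mx conjc U)^T = 1%:M by apply: mulmx1C.
(* The indicator of the unit ball is invariant under unitary maps and has a positive finite
   integral, which can be cancelled at the end. *)
pose B (v : V n) : \bar R := (ballI v)%:E.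
have mB : mV B by exact: mV_ballI.
have B0 v : 0 <= B v by rewrite lee_fin.
have mUF (W : 'M[C]_n) (H : V n -> \bar R) : mV H -> mV (fun v => H (W *m v)).
  move=> mH; apply: (@meas_comp_cinv R _ _ _ _ setT n H (fun t => W *m cvec t)) => //.
  by apply: cmeas_mulmx; exact: cmeas_cvec.
have mp1 i : cmeasurable setT (fun p : cpow R n * cpow R n => cvec p.1 i ord0).
  by apply: cmeas_comp_cvec; exact: measurable_fst.
have mp2 i : cmeasurable setT (fun p : cpow R n * cpow R n => cvec p.2 i ord0).
  by apply: cmeas_comp_cvec; exact: measurable_snd.
have e1 : IV (fun x => F x * IV B) = IV (fun x => IV (fun y => F x * B (U *m y + x)%R)).
  apply: eq_IV => x.
  have -> : IV B = IV (fun y => B (U *m y + x)%R).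
    transitivity (IV (fun y => B (U *m y))).
      by apply: eq_IV => v; rewrite /B /ballI unitary_sqnorm.
    rewrite -(@IV_translate _ _ (fun y => B (U *m y)) ((map_mx conjc U)^T *m x)) //.
      by apply: eq_IV => y; rewrite mulmxDr mulmxA UU mul1mx.
    exact: mUF.
  Transparent IV.
  rewrite /IV -ge0_integralZl//.
  Opaque IV.
  apply: (@meas_comp_cinv R _ _ _ _ setT n B (fun t => U *m cvec t + x)%R) => //.
  apply: cmeas_addmx; last by move=> i; exact: cmeas_cst.
  by apply: cmeas_mulmx; exact: cmeas_cvec.
have e2 : IV (fun x => IV (fun y => F x * B (U *m y + x)%R)) =
    IV (fun y => IV (fun x => F (x - U *m y)%R * B x)).
  rewrite IV_swap; last 2 first.
  - apply: emeasurable_funM.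
      by apply: (@meas_comp_cinv R _ _ _ _ setT n F (fun p : cpow R n * cpow R n => cvec p.1)).
    apply: (@meas_comp_cinv R _ _ _ _ setT n B
      (fun p : cpow R n * cpow R n => U *m cvec p.2 + cvec p.1)%R) => //.
    by apply: cmeas_addmx => //; exact: cmeas_mulmx.
  - by move=> x y; rewrite mule_ge0.
  apply: eq_IV => y.
  rewrite -(@IV_translate _ _ (fun x => F (x - U *m y)%R * B x) (U *m y)); last 2 first.
  - by apply: emeasurable_funM => //; exact: mV_translate.
  - by move=> x; rewrite mule_ge0.
  by apply: eq_IV => x; rewrite addrK addrC.
have e3 : IV (fun y => IV (fun x => F (x - U *m y)%R * B x)) =
    IV (fun x => B x * IV (fun y => F (- (U *m y))%R)).
  rewrite IV_swap; last 2 first.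
  - apply: emeasurable_funM; last first.
      by apply: (@meas_comp_cinv R _ _ _ _ setT n B (fun p : cpow R n * cpow R n => cvec p.2)).
    apply: (meas_comp_cinv mF).
    apply: (cmeas_addmx mp2); apply: cmeas_oppmx.
    exact: (cmeas_mulmx U mp1).
  - by move=> x y; rewrite mule_ge0.
  apply: eq_IV => x.
  have mG : mV (fun y => F (x - U *m y)%R).
    have mx i : cmeasurable setT (fun _ : cpow R n => x i ord0) by exact: cmeas_cst.
    apply: (meas_comp_cinv mF); apply: (cmeas_addmx mx).
    by apply: cmeas_oppmx; apply: (cmeas_mulmx U); exact: cmeas_cvec.
  rewrite (IV_Zr mG (fun=> F0 _) (B0 x)) muleC; congr (_ * _).
  rewrite -(IV_translate ((map_mx conjc U)^T *m x) mG (fun=> F0 _)).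
  apply: eq_IV => y; congr F.
  by rewrite mulmxDr mulmxA UU mul1mx opprD addrCA subrr addr0.
have IB0 : 0 <= IV B by exact: IV_ge0.
move: e1; rewrite e2 e3 (IV_Zr mF F0 IB0).
rewrite (IV_Zr mB B0); last by apply: IV_ge0.
rewrite muleC => /(mule_pcancel (IV_ballI_gt0 n) (fin_num_ballI n)) ->.
by apply: eq_IV => v; rewrite mulNmx.
Qed.

Lemma IC_V1 (f : C -> \bar R) : mC f -> (forall w, 0 <= f w) ->
  IV (fun v : V 1 => f (v ord0 ord0)) = IC f.
Proof.
move=> mf f0.
have m1 : mV (fun v : V 1 => f (v ord0 ord0)).
  by apply: (meas_compC mf); exact: cmeas_cvec.
rewrite IV_consl//; apply: eq_IC => w.
have E : (fun v : V 0 => f (consV w v ord0 ord0)) = (fun=> f w).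
  by apply/funext => v; rewrite consV0.
by rewrite E IV0 //; exact: measurable_cst.
Qed.

Lemma mC_scale (f : C -> \bar R) c : mC f -> mC (fun w => f (c * w)%R).
Proof.
move=> mf; apply: (meas_compC mf); apply: cmeasM; last exact: cmeas_id2.
exact: cmeas_cst.
Qed.

Lemma unitary_scalar n (c : C) : csq c = 1%R -> unitary (c%:M : 'M[C]_n).
Proof.
move=> c1; rewrite /unitary map_scalar_mx tr_scalar_mx -scalar_mxM.
by rewrite mulrC -csqE c1.
Qed.

Lemma csq_polar (c : C) : c != 0%R -> exists r u, [/\ r != 0%R :> R, csq u = 1%R,
  c = (r%:C%C * u)%R & csq c = (r ^+ 2)%R].
Proof.
move=> c0; have p0 : (0 < csq c)%R by rewrite lt_neqAle csq_ge0 eq_sym csq_eq0 c0.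
have r0 : (Num.sqrt (csq c) != 0)%R by rewrite gt_eqF// sqrtr_gt0.
have r0' : ((Num.sqrt (csq c))%:C%C != 0)%R.
  by apply: contra_neq r0 => /(congr1 (@complex.Re R)).
exists (Num.sqrt (csq c)), (c / (Num.sqrt (csq c))%:C%C)%R; split => //.
- by rewrite csqM csqV csq_real sqr_sqrtr ?csq_ge0// divff// gt_eqF.
- by rewrite mulrCA divff ?mulr1.
- by rewrite sqr_sqrtr// csq_ge0.
Qed.

(** A nonzero complex scalar is a real dilation times a unitary scalar matrix. *)
Lemma IV_cscale n (c : C) (F : V n -> \bar R) : c != 0%R -> mV F -> (forall v, 0 <= F v) ->
  ((csq c) ^+ n)%:E * IV (fun v => F (c *: v)%R) = IV F.
Proof.
move=> /csq_polar[r [u [r0 u1 -> ->]]] mF F0.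
rewrite -(IV_scale r0 mF F0); congr (_ * _).
rewrite -(@IV_unitary _ u%:M (fun v => F (r%:C%C *: v)%R)) //; last 2 first.
- exact: unitary_scalar.
- exact: mV_scale.
by apply: eq_IV => v; rewrite mul_scalar_mx scalerA.
Qed.

Lemma IC_cscale (c : C) (f : C -> \bar R) : c != 0%R -> mC f -> (forall v, 0 <= f v) ->
  (csq c)%:E * IC (fun w => f (c * w)%R) = IC f.
Proof.
move=> c0 mf f0; rewrite -(IC_V1 mf f0) -(IC_V1 (mC_scale c mf) (fun=> f0 _)).
rewrite -(@IV_cscale 1 c (fun v => f (v ord0 ord0)) c0) ?expr1 //.
  by congr (_ * _); apply: eq_IV => v; rewrite mxE.
by apply: (meas_compC mf); exact: cmeas_cvec.
Qed.

Lemma IC_swap (G : C -> C -> \bar R) :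
  measurable_fun setT (fun p : (measurableTypeR R * measurableTypeR R) *
     (measurableTypeR R * measurableTypeR R) =>
       G (p.1.1 +i* p.1.2)%C (p.2.1 +i* p.2.2)%C) ->
  (forall x y, 0 <= G x y) ->
  IC (fun x => IC (fun y => G x y)) = IC (fun y => IC (fun x => G x y)).
Proof.
Transparent IC.
move=> mG G0; exact: (@fubini_tonelli _ _ _ _ _
  (sigma_finite_prod mu mu) (sigma_finite_prod mu mu)
  (fun p => G (p.1.1 +i* p.1.2)%C (p.2.1 +i* p.2.2)%C)).
Opaque IC.
Qed.

End Boxes.

Transparent IC IV.

(** * The substitution w -> 1/w in the complex plane *)

Section Inversion.
Context (R : realType).
Local Open Scope complex_scope.
Local Open Scope ereal_scope.
Local Notation C := R[i].
Local Notation V n := 'cV[C]_n.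
Local Notation C2 := (measurableTypeR R * measurableTypeR R)%type.
Implicit Types f g : C -> \bar R.

Lemma cmeas_fst2 : cmeasurable setT (fun p : C2 * C2 => (p.1.1 +i* p.1.2)%C).
Proof.
by split => /=; apply: measurableT_comp => //; exact: measurable_fst.
Qed.

Lemma cmeas_snd2 : cmeasurable setT (fun p : C2 * C2 => (p.2.1 +i* p.2.2)%C).
Proof.
by split => /=; apply: measurableT_comp => //; exact: measurable_snd.
Qed.

(** Density of the multiplicative Haar measure of C minus 0. The convention 1/0 = 0 makes it vanish
    at 0, so the origin drops out without any restriction of the domain. *)
Let k (w : C) : \bar R := ((csq w)^-1)%:E.
Let M f := IC (fun w => f w * k w).

Let k_ge0 w : 0 <= k w. Proof. by rewrite lee_fin invr_ge0 csq_ge0. Qed.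
Let k0 : k 0%R = 0. Proof. by rewrite /k csq0 invr0. Qed.

Let mk d (T : measurableType d) (h : T -> C) :
  cmeasurable setT h -> measurable_fun setT (fun x => k (h x)).
Proof.
by move=> mh; apply/measurable_EFinP/measurable_funV_real/measurable_csq.
Qed.

Let mMk f : mC f -> mC (fun w => f w * k w).
Proof. by move=> mf; apply: emeasurable_funM => //; apply: mk; exact: cmeas_id2. Qed.

Let Mk_ge0 f : (forall w, 0 <= f w) -> forall w, 0 <= f w * k w.
Proof. by move=> f0 w; rewrite mule_ge0. Qed.

Let M_ge0 f : (forall w, 0 <= f w) -> 0 <= M f.
Proof. by move=> f0; apply: IC_ge0; exact: Mk_ge0. Qed.

Let M_mul c f : c != 0%R -> mC f -> (forall w, 0 <= f w) ->
  M (fun w => f (c * w)%R) = M f.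
Proof.
move=> c0 mf f0; rewrite /M -(IC_cscale c0 (mMk mf) (Mk_ge0 f0)).
have c0' : csq c != 0%R by rewrite csq_eq0.
rewrite -IC_Zl; last 3 first.
- exact: (mC_scale c (mMk mf)).
- by move=> w; exact: Mk_ge0.
- exact: csq_ge0.
apply: eq_IC => w; rewrite /k csqM invfM EFinM.
by rewrite [RHS]muleCA; congr (_ * _); rewrite -!EFinM mulrA divff// mul1r.
Qed.

(** The test function of the Haar argument: a square around 1 that stays away from 0, where the
    density lies between 1/4 and 4, so that 0 < [M b] < oo. *)
Let b (w : C) : \bar R := ((cbox 4^-1 1%R w)%:R : R)%:E.
Let b_ge0 w : 0 <= b w. Proof. by rewrite lee_fin. Qed.
Let mb : mC b. Proof. by apply/measurable_EFinP/measurable_cbox; exact: cmeas_id2. Qed.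

Let cbox_bounds (w : C) : cbox 4^-1 1%R w -> (4^-1 <= (csq w)^-1 <= 4)%R.
Proof.
case: w => x y; rewrite /cbox /csq /= !ltr_norml => /andP[/andP[x1 x2] /andP[y1 y2]].
have h1 : (4^-1 <= x ^+ 2 + y ^+ 2)%R by nra.
have h2 : (x ^+ 2 + y ^+ 2 <= 4)%R by nra.
have h0 : (0 < x ^+ 2 + y ^+ 2)%R by lra.
by rewrite lef_pV2 ?posrE//= h2/= -[leRHS]invrK lef_pV2 ?posrE//; lra.
Qed.

Let b_cases w : b w = 0 \/ (b w = 1 /\ (4^-1 <= (csq w)^-1 <= 4)%R).
Proof.
by rewrite /b; case h : (cbox _ _ w); [right; split => //; exact: cbox_bounds|left].
Qed.

Let mZ (r : R) : mC (fun w => r%:E * b w).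
Proof. by apply: emeasurable_funM => //; exact: measurable_cst. Qed.

Let Mb_gt0 : 0 < M b.
Proof.
apply: (@lt_le_trans _ _ ((4^-1)%:E * IC b)).
  have -> : IC b = ((4^-1 *+ 2) ^+ 2)%:E by rewrite /b IC_cbox// invr_ge0.
  by rewrite -EFinM lte_fin mulr_gt0// ?invr_gt0// exprn_gt0// pmulrn_lgt0// invr_gt0.
rewrite -IC_Zl//.
apply: le_IC; [exact: mZ|exact: mMk|by move=> w; rewrite mule_ge0// lee_fin|].
move=> w; case: (b_cases w) => [->|[-> /andP[h _]]]; first by rewrite mule0 mul0e.
by rewrite mule1 mul1e lee_fin.
Qed.

Let Mb_lty : M b < +oo.
Proof.
apply: (@le_lt_trans _ _ (4%:E * IC b)); last first.
  have -> : IC b = ((4^-1 *+ 2) ^+ 2)%:E by rewrite /b IC_cbox// invr_ge0.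
  by rewrite -EFinM ltry.
rewrite -IC_Zl//.
apply: le_IC; [exact: mMk|exact: mZ|exact: Mk_ge0|].
move=> w; case: (b_cases w) => [->|[-> /andP[_ h]]]; first by rewrite mule0 mul0e.
by rewrite mule1 mul1e lee_fin.
Qed.

(* The measure [dw / |w|^2] is invariant under dilations of C^*; as this group
   is commutative, the Haar uniqueness argument makes it inversion invariant. *)
Let M_inv f : mC f -> (forall w, 0 <= f w) -> M f = M (fun w => f w^-1%R).
Proof.
move=> mf f0.
have mfi : mC (fun w => f w^-1%R).
  by apply: (meas_compC mf); apply: cmeasV; exact: cmeas_id2.
have m1 := cmeas_fst2; have m2 := cmeas_snd2.
have Mb0 : 0 <= M b by exact: M_ge0.
have mG : measurable_fun setT (fun p : C2 * C2 =>
    f (p.1.1 +i* p.1.2)%C * k (p.1.1 +i* p.1.2)%C *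
    (b ((p.1.1 +i* p.1.2)%C * (p.2.1 +i* p.2.2)%C)%R * k (p.2.1 +i* p.2.2)%C)).
  apply: emeasurable_funM; apply: emeasurable_funM.
  - exact: (meas_compC mf).
  - exact: mk.
  - by apply: (meas_compC mb); exact: cmeasM.
  - exact: mk.
have mH : measurable_fun setT (fun p : C2 * C2 =>
    f ((p.2.1 +i* p.2.2)%C * (p.1.1 +i* p.1.2)%C^-1)%R * b (p.2.1 +i* p.2.2)%C
    * k (p.2.1 +i* p.2.2)%C * k (p.1.1 +i* p.1.2)%C).
  apply: emeasurable_funM; [apply: emeasurable_funM; [apply: emeasurable_funM|]|].
  - by apply: (meas_compC mf); apply: cmeasM => //; exact: cmeasV.
  - exact: (meas_compC mb).
  - exact: mk.
  - exact: mk.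
have e1 : M f * M b = IC (fun x => IC (fun y => f x * k x * (b (x * y)%R * k y))).
  rewrite -(IC_Zr (mMk mf) (Mk_ge0 f0) Mb0); apply: eq_IC => x.
  have [->|x0] := eqVneq x 0%R.
    by rewrite k0 mule0 mul0e IC_eq0// => y; rewrite mul0e.
  rewrite -(M_mul x0 mb b_ge0) muleC /M.
  rewrite -(IC_Zr (mMk (mC_scale x mb)) (Mk_ge0 (fun=> b_ge0 _))); last exact: Mk_ge0.
  by apply: eq_IC => y; rewrite muleC.
have e2 : IC (fun x => IC (fun y => f x * k x * (b (x * y)%R * k y))) =
    IC (fun y => IC (fun x => f (x * y^-1)%R * b x * k x * k y)).
  rewrite (@IC_swap _ (fun x y => f x * k x * (b (x * y)%R * k y)) mG); last first.
    by move=> x y; rewrite !mule_ge0.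
  apply: eq_IC => y; have [->|y0] := eqVneq y 0%R.
    by rewrite !IC_eq0// => x; rewrite k0 !mule0.
  pose h x := f (x * y^-1)%R * b x.
  have mh : mC h.
    apply: emeasurable_funM => //; apply: (meas_compC mf).
    by apply: cmeasM; [exact: cmeas_id2|exact: cmeas_cst].
  have h0 w : 0 <= h w by rewrite mule_ge0.
  rewrite [RHS](IC_Zr (mMk mh) (Mk_ge0 h0) (k_ge0 y)) -/(M h) -(M_mul y0 mh h0).
  rewrite /M -(IC_Zr (mMk (mC_scale y mh)) (Mk_ge0 (fun=> h0 _)) (k_ge0 y)).
  apply: eq_IC => x; rewrite /h mulrAC divff// mul1r [(y * x)%R]mulrC muleA; congr (_ * _).
  by rewrite -!muleA; congr (_ * _); rewrite muleC.
have e3 : IC (fun y => IC (fun x => f (x * y^-1)%R * b x * k x * k y)) =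
    IC (fun x => b x * k x * M (fun w => f w^-1%R)).
  rewrite (@IC_swap _ (fun y x => f (x * y^-1)%R * b x * k x * k y) mH); last first.
    by move=> y x; rewrite !mule_ge0.
  apply: eq_IC => x; have [->|x0] := eqVneq x 0%R.
    by rewrite k0 mule0 mul0e IC_eq0// => y; rewrite mule0 mul0e.
  have xV0 : x^-1%R != 0%R by rewrite invr_eq0.
  rewrite -(M_mul xV0 mfi (fun=> f0 _)) [RHS]muleC /M.
  rewrite -(IC_Zr (mMk (mC_scale x^-1%R mfi)) (Mk_ge0 (fun=> f0 _))); last exact: Mk_ge0.
  by apply: eq_IC => y; rewrite invfM invrK -!muleA; congr (_ * _); rewrite muleA muleC.
move: e1; rewrite e2 e3 (IC_Zr (mMk mb) (Mk_ge0 b_ge0)); last by apply: M_ge0.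
have Mbf : M b \is a fin_num by rewrite ge0_fin_numE.
by rewrite muleC -/(M b) => /(mule_pcancel Mb_gt0 Mbf).
Qed.

(** The Jacobian of w -> 1/w is |w|^-4: apply [M_inv] to f w = g w |w|^2. The value [g 0] enters
    because 0 is its own inverse by convention. *)
Lemma IC_inv g : mC g -> (forall w, 0 <= g w) -> g 0%R = 0 ->
  IC (fun w => g w^-1%R * ((csq w)^-2)%:E) = IC g.
Proof.
move=> mg g0 g00; pose f w := g w * (csq w)%:E.
have mf : mC f.
  apply: emeasurable_funM => //; apply/measurable_EFinP/measurable_csq.
  exact: cmeas_id2.
have f0 w : 0 <= f w by rewrite mule_ge0// lee_fin csq_ge0.
transitivity (M (fun w => f w^-1%R)).
  apply: eq_IC => w; rewrite /f csqV -muleA -EFinM.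
  by rewrite -exprVn expr2.
rewrite -M_inv//; apply: eq_IC => w; rewrite /f /k -muleA -EFinM.
have [->|w0] := eqVneq w 0%R; first by rewrite g00 mul0e.
by rewrite divff ?mule1// csq_eq0.
Qed.

End Inversion.

(** * Jacobian of the boosts *)

Section Boost.
Context (R : realType).
Local Open Scope complex_scope.
Local Open Scope ereal_scope.
Local Notation C := R[i].
Local Notation V n := 'cV[C]_n.

Lemma cmeas_dsub n i :
  cmeasurable setT (fun t : cpow R n.+1 => @dsubmx _ 1 n 1 (cvec t) i ord0).
Proof. by under eq_fun do rewrite mxE; exact: cmeas_cvec. Qed.

Lemma dsub_consV n w (v : V n) : @dsubmx _ 1 n 1 (consV w v) = v.
Proof. exact: col_mxKd. Qed.

(** For u = (u_0, u') the map is (1/u_0, u'/u_0). Inverting the first coordinate contributes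
    |u_0|^-4 and scaling the n others |u_0|^(-2n). *)
Lemma IV_proj n (F : V n.+1 -> \bar R) : mV F -> (forall v, 0 <= F v) ->
  (forall v, F (consV 0%R v) = 0) ->
  IV (fun u => F (consV (u ord0 ord0)^-1%R ((u ord0 ord0)^-1%R *: @dsubmx _ 1 n 1 u))
      * ((csq (u ord0 ord0))^-1 ^+ n.+2)%:E) = IV F.
Proof.
move=> mF F0 F00.
have mc : cmeasurable setT (fun t : cpow R n.+1 => (cvec t ord0 ord0)^-1%R).
  by apply: cmeasV; exact: cmeas_cvec.
have mL : mV (fun u => F (consV (u ord0 ord0)^-1%R ((u ord0 ord0)^-1%R *: @dsubmx _ 1 n 1 u))
      * ((csq (u ord0 ord0))^-1 ^+ n.+2)%:E).
  apply: emeasurable_funM.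
    apply: (meas_comp_cinv mF); apply: cmeas_consV => // i.
    under eq_fun do rewrite mxE; apply: cmeasM => //.
    exact: cmeas_dsub.
  apply/measurable_EFinP/measurable_funX/measurable_funV_real/measurable_csq.
  exact: cmeas_cvec.
rewrite (IV_consl mL); last first.
  by move=> v; rewrite mule_ge0// lee_fin exprn_ge0// invr_ge0 csq_ge0.
rewrite (IV_consl mF F0).
pose g w := IV (fun v => F (consV w v)).
have mg : mC g by exact: mC_IV.
have g0 w : 0 <= g w by exact: IV_ge0.
have g00 : g 0%R = 0.
  by apply: IV_eq0 => v; exact: F00.
rewrite -/g -(IC_inv mg g0 g00); apply: eq_IC => w.
have [->|w0] := eqVneq w 0%R.
  rewrite invr0 g00 mul0e.
  by apply: IV_eq0 => v; rewrite !consV0 csq0 !invr0 expr0n mule0.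
have w0' : w^-1%R != 0%R by rewrite invr_eq0.
rewrite /g -(IV_cscale w0' (mV_consr _ mF) (fun=> F0 _)) muleC muleA.
rewrite csqV -exprVn -EFinM -exprD add2n -IV_Zl; last 3 first.
- by apply: (mV_scale (F := fun v => F (consV _ v))); exact: mV_consr.
- by move=> v.
- by rewrite exprn_ge0// invr_ge0 csq_ge0.
by apply: eq_IV => v; rewrite consV0 dsub_consV muleC.
Qed.

Lemma IV_affine0 n (F : V n.+1 -> \bar R) (a r : R) : r != 0%R -> mV F ->
  (forall v, 0 <= F v) ->
  (r ^+ 2)%:E * IV (fun u => F (consV (a%:C%C + r%:C%C * u ord0 ord0)%R
     (@dsubmx _ 1 n 1 u))) = IV F.
Proof.
move=> r0 mF F0.
have mL : mV (fun u => F (consV (a%:C%C + r%:C%C * u ord0 ord0)%R (@dsubmx _ 1 n 1 u))).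
  apply: (meas_comp_cinv mF); apply: cmeas_consV; last exact: cmeas_dsub.
  apply: cmeasD; first exact: cmeas_cst.
  by apply: cmeasM; [exact: cmeas_cst|exact: cmeas_cvec].
rewrite (IV_consl mL (fun=> F0 _)) (IV_consl mF F0).
have mg : mC (fun w => IV (fun v => F (consV w v))) by exact: mC_IV.
have g0 w : 0 <= IV (fun v => F (consV w v)) by exact: IV_ge0.
rewrite -(IC_translate a%:C%C mg g0).
have mgt : mC (fun w => IV (fun v => F (consV (w + a%:C%C)%R v))).
  by apply: (meas_compC mg); apply: cmeasD;
    [exact: cmeas_id2|exact: cmeas_cst].
rewrite -(IC_scale r0 mgt (fun=> g0 _)); congr (_ * _).
by apply: eq_IC => w; apply: eq_IV => v; rewrite consV0 dsub_consV addrC.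
Qed.

(** Hyperbolic translation along the i-th real axis; [s] is the hyperbolic sine and sqrt (1 + s^2)
    the hyperbolic cosine. *)
Definition boost n (i : 'I_n) (s : R) (z : V n) : V n :=
  let c := Num.sqrt (1 + s ^+ 2)%R in
  ((c%:C%C + s%:C%C * z i ord0)^-1 *:
    (\col_j (if j == i then c%:C%C * z i ord0 + s%:C%C else z j ord0)))%R.

Definition boost_den n (i : 'I_n) (s : R) (z : V n) : C :=
  ((Num.sqrt (1 + s ^+ 2))%:C%C + s%:C%C * z i ord0)%R.

Lemma boostE n (i : 'I_n) (s : R) (z : V n) j :
  boost i s z j ord0 = ((boost_den i s z)^-1 *
   (if j == i then (Num.sqrt (1 + s ^+ 2))%:C%C * z i ord0 + s%:C%C else z j ord0))%R.
Proof. by rewrite !mxE. Qed.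

Lemma cmeas_boost n (i : 'I_n) s j :
  cmeasurable setT (fun t : cpow R n => boost i s (cvec t) j ord0).
Proof.
have mz k : cmeasurable setT (fun t : cpow R n => cvec t k ord0) by exact: cmeas_cvec.
have mc (c : C) : cmeasurable setT (fun t : cpow R n => c) by exact: cmeas_cst.
under eq_fun do rewrite !mxE; apply: cmeasM.
  by apply: cmeasV; apply: cmeasD => //; exact: cmeasM.
by case: (j == i) => //; apply: cmeasD => //; exact: cmeasM.
Qed.

Lemma sqrt_boost_sq (s : R) : ((Num.sqrt (1 + s ^+ 2)) ^+ 2 = 1 + s ^+ 2)%R.
Proof. by rewrite sqr_sqrtr// addr_ge0// sqr_ge0. Qed.

(** With w = c + s z_0, the first coordinate (c z_0 + s) / w of the boost equals c/s - 1/(s w),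
    because c^2 - s^2 = 1. The boost is therefore the map of [IV_proj] between two affine changes of
    the first coordinate. *)
Lemma IV_boost0 n (F : V n.+1 -> \bar R) s : s != 0%R -> mV F -> (forall v, 0 <= F v) ->
  (forall v, (1 <= sqnorm v)%R -> F v = 0) ->
  IV (fun z => F (boost ord0 s z) * ((csq (boost_den ord0 s z))^-1 ^+ n.+2)%:E) = IV F.
Proof.
move=> s0 mF F0 FB.
set c := Num.sqrt (1 + s ^+ 2)%R.
have s0' : s^-1%R != 0%R by rewrite invr_eq0.
have sC : (s%:C%C != 0 :> C)%R by apply: contra_neq s0 => /(congr1 (@complex.Re R)).
have cs : (c%:C%C ^+ 2 = 1 + s%:C%C ^+ 2 :> C)%R.
  by rewrite -!rmorphXn /= sqrt_boost_sq rmorphD rmorph1.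
pose Fh (u : V n.+1) := F (consV ((c / s)%:C%C + (- s^-1)%:C%C * u ord0 ord0)%R
   (@dsubmx _ 1 n 1 u)).
have mFh : mV Fh.
  apply: (meas_comp_cinv mF); apply: cmeas_consV; last exact: cmeas_dsub.
  apply: cmeasD; first exact: cmeas_cst.
  by apply: cmeasM; [exact: cmeas_cst|exact: cmeas_cvec].
have Fh0 v : 0 <= Fh v by exact: F0.
(* The hyperplane 1/w = 0 is sent to points with first coordinate c/s, of modulus at least 1; they
   lie outside the ball, where [F] vanishes. *)
have Fh00 v : Fh (consV 0%R v) = 0.
  rewrite /Fh consV0 mulr0 addr0; apply: FB.
  rewrite sqnormE (bigD1 ord0)//= consV0 csq_real exprMn exprVn sqrt_boost_sq.
  have s2 : (0 < s ^+ 2)%R by rewrite lt_neqAle sqr_ge0 eq_sym sqrf_eq0 s0.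
  apply: (@le_trans _ _ ((1 + s ^+ 2) / s ^+ 2)%R).
    by rewrite ler_pdivlMr// mul1r lerDr.
  by rewrite lerDl sumr_ge0// => *; exact: csq_ge0.
have E1 : IV Fh = (s ^+ 2)%:E * IV F.
  have Ns0 : (- s^-1 != 0)%R by rewrite oppr_eq0.
  rewrite -(IV_affine0 (c / s) Ns0 mF F0) muleA -EFinM sqrrN -exprMn divff// expr1n.
  by rewrite mul1e.
pose G (u : V n.+1) := Fh (consV (u ord0 ord0)^-1%R ((u ord0 ord0)^-1%R *: @dsubmx _ 1 n 1 u))
      * ((csq (u ord0 ord0))^-1 ^+ n.+2)%:E.
have mG : mV G.
  have mc : cmeasurable setT (fun t : cpow R n.+1 => (cvec t ord0 ord0)^-1%R).
    by apply: cmeasV; exact: cmeas_cvec.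
  apply: emeasurable_funM.
    apply: (meas_comp_cinv mFh); apply: cmeas_consV => // i.
    under eq_fun do rewrite mxE; apply: cmeasM => //.
    exact: cmeas_dsub.
  apply/measurable_EFinP/measurable_funX/measurable_funV_real/measurable_csq.
  exact: cmeas_cvec.
have G0 v : 0 <= G v.
  by rewrite mule_ge0// lee_fin exprn_ge0// invr_ge0 csq_ge0.
have E2 := IV_proj mFh Fh0 Fh00; rewrite -/G E1 -(IV_affine0 c s0 mG G0) in E2.
have s2 : 0 < (s ^+ 2)%:E by rewrite lte_fin lt_neqAle sqr_ge0 eq_sym sqrf_eq0 s0.
rewrite -(mule_pcancel s2 _ E2)//; apply: eq_IV => z.
rewrite /G consV0 dsub_consV -/c.
rewrite -[(c%:C%C + _)%R]/(boost_den ord0 s z); set w := boost_den _ _ _.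
have [->|w0] := eqVneq w 0%R; first by rewrite csq0 invr0 expr0n /= !mule0.
congr (_ * _); rewrite /Fh consV0 dsub_consV; congr F.
apply/matrixP => j k; rewrite ord1 {k} boostE -/w -/c; case: (unliftP ord0 j) => [k|] ->.
  rewrite consV_lift !mxE; congr (_ * z _ _)%R; exact: val_inj.
rewrite consV0 eqxx.
have wE : w = (c%:C%C + s%:C%C * z ord0 ord0)%R by [].
rewrite rmorphM rmorphN !fmorphV /=.
have H : (c%:C%C * w - 1 = s%:C%C * (c%:C%C * z ord0 ord0 + s%:C%C))%R.
  have -> : (c%:C%C * w - 1 = c%:C%C ^+ 2 - 1 + c%:C%C * s%:C%C * z ord0 ord0)%R by rewrite wE; ring.
  by rewrite cs; ring.
transitivity ((c%:C%C * w - 1) / (s%:C%C * w))%R; last by field; rewrite w0 sC.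
by rewrite H; field; rewrite w0 sC.
Qed.

Lemma boost_perm n (i : 'I_n.+1) s (z : V n.+1) :
  boost i s z = tperm_mx ord0 i *m boost ord0 s (tperm_mx ord0 i *m z) /\
  boost_den i s z = boost_den ord0 s (tperm_mx ord0 i *m z).
Proof.
have P (v : V n.+1) j : (tperm_mx ord0 i *m v) j ord0 = v (tperm ord0 i j) ord0.
  by rewrite -row_permE mxE.
split; last by rewrite /boost_den P tpermL.
apply/matrixP => j k; rewrite ord1 P !boostE /boost_den !P tpermL tpermK; congr (_ * _)%R.
by rewrite (can2_eq (tpermK ord0 i) (tpermK ord0 i)) tpermL.
Qed.

Lemma unitary_tperm n (i j : 'I_n) : unitary (tperm_mx i j : 'M[C]_n).
Proof.
rewrite /unitary map_perm_mx tr_perm_mx -perm_mxM.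
by rewrite tpermV tperm2 perm_mx1.
Qed.

(** The transposition of the coordinates 0 and i is unitary and conjugates the two boosts. *)
Lemma IV_boost n (i : 'I_n.+1) (F : V n.+1 -> \bar R) s : s != 0%R -> mV F ->
  (forall v, 0 <= F v) -> (forall v, (1 <= sqnorm v)%R -> F v = 0) ->
  IV (fun z => F (boost i s z) * ((csq (boost_den i s z))^-1 ^+ n.+2)%:E) = IV F.
Proof.
move=> s0 mF F0 FB; set P : 'M[C]_n.+1 := tperm_mx ord0 i.
have hP : unitary P by exact: unitary_tperm.
have mPF : mV (fun v => F (P *m v)).
  by apply: (meas_comp_cinv mF); apply: cmeas_mulmx; exact: cmeas_cvec.
rewrite -(IV_unitary hP mF F0).
rewrite -(IV_boost0 s0 mPF (fun=> F0 _)); last first.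
  by move=> v hv; apply: FB; rewrite unitary_sqnorm.
rewrite -(IV_unitary hP (F := fun z => F (P *m boost ord0 s z) *
  ((csq (boost_den ord0 s z))^-1 ^+ n.+2)%:E)); last 2 first.
- apply: emeasurable_funM.
    apply: (meas_comp_cinv mF); apply: cmeas_mulmx.
    exact: cmeas_boost.
  apply/measurable_EFinP/measurable_funX/measurable_funV_real/measurable_csq.
  apply: cmeasD; first exact: cmeas_cst.
  apply: cmeasM; [exact: cmeas_cst|exact: cmeas_cvec].
- by move=> v; rewrite mule_ge0// lee_fin exprn_ge0// invr_ge0 csq_ge0.
by apply: eq_IV => z; have [-> ->] := boost_perm i s z.
Qed.

End Boost.

(** * Finiteness of the weighted volume *)

Section WeightedIntegral.
Context (R : realType) (m : nat).
Local Open Scope complex_scope.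
Local Notation n := m.+1.
Local Notation C := R[i].
Local Notation V := 'cV[C]_n.
Variable lambda : R.
Hypothesis lam_gt : n%:R < lambda.

(** Extended by 0 so that integrals over the ball are integrals over the whole space, where the
    changes of variables are available. *)
Definition wt (z : V) : R := ballI z * weight lambda z.

Lemma wt_ge0 z : 0 <= wt z.
Proof. by rewrite mulr_ge0// powR_ge0. Qed.

Lemma wt_ball z : sqnorm z < 1 -> wt z = weight lambda z.
Proof. by move=> h; rewrite /wt /ballI h mul1r. Qed.

Lemma wt_gt0 z : sqnorm z < 1 -> 0 < wt z.
Proof. by move=> h; rewrite wt_ball// powR_gt0// subr_gt0. Qed.

Lemma wt_out z : 1 <= sqnorm z -> wt z = 0.
Proof. by move=> h; rewrite /wt /ballI ltNge h mul0r. Qed.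

Lemma measurable_wt d (T : measurableType d) (D : set T) (f : T -> V) :
  (forall i, cmeasurable D (fun x => f x i ord0)) ->
  measurable_fun D (fun x => wt (f x)).
Proof.
move=> mf; apply: measurable_funM; first exact: measurable_ballI.
apply: (measurableT_comp (f := fun x : R => x `^ (lambda - n%:R - 1))).
  exact: measurable_powR.
by apply: measurable_funB; [exact: measurable_cst|exact: measurable_sqnorm].
Qed.

Lemma mV_wt : mV (fun z => (wt z)%:E).
Proof. by apply/measurable_EFinP/measurable_wt => i; exact: cmeas_cvec. Qed.

Lemma sqnorm_ge0 k (z : 'cV[C]_k) : 0 <= sqnorm z.
Proof. by rewrite sqnormE sumr_ge0// => *; exact: csq_ge0. Qed.

Lemma sqnormZ k (c : C) (z : 'cV[C]_k) : sqnorm (c *: z) = csq c * sqnorm z.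
Proof. by rewrite !sqnormE mulr_sumr; apply: eq_bigr => i _; rewrite mxE csqM. Qed.

Local Open Scope ereal_scope.

Definition vol : \bar R := IV (fun v : V => (ballI v)%:E).

Lemma volE : exists2 r : R, (0 < r)%R & vol = r%:E.
Proof.
have := fin_num_ballI R n; have := IV_ballI_gt0 R n; rewrite -/vol.
by case: vol => // r; rewrite lte_fin => r0 _; exists r.
Qed.

Lemma bernoulli_pow (t : R) k : (0 <= t <= 1)%R -> (1 - k%:R * t <= (1 - t) ^+ k)%R.
Proof.
move=> /andP[t0 t1]; elim: k => [|k IH]; first by rewrite mul0r subr0 expr0.
rewrite exprS; apply: (@le_trans _ _ ((1 - t) * (1 - k%:R * t))%R); last first.
  by rewrite ler_wpM2l// subr_ge0.
have k0 : (0 <= (k%:R : R))%R by [].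
rewrite -natr1; nra.
Qed.

(* Volume of a shell [1 - t <= |z|^2 < 1], from the scaling of the volume. *)
Lemma vol_shell (t : R) : (0 < t < 1)%R ->
  IV (fun v : V => (ballI v * (1 - t <= sqnorm v)%R%:R)%:E) <= (n%:R * t)%:E * vol.
Proof.
move=> /andP[t0 t1].
have [r r0 volr] := volE.
pose q := Num.sqrt (1 - t)%R.
have q2 : (q ^+ 2 = 1 - t)%R by rewrite sqr_sqrtr// subr_ge0 ltW.
have q0 : (q != 0)%R by rewrite gt_eqF// sqrtr_gt0 subr_gt0.
pose S (v : V) : \bar R := (ballI v * (1 - t <= sqnorm v)%R%:R)%:E.
pose B (v : V) : \bar R := ((sqnorm v < 1 - t)%R%:R : R)%:E.
have mq (D : set (cpow R n)) : measurable_fun D (fun x => sqnorm (cvec x) : R).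
  by apply: measurable_sqnorm => i; apply: cmeas_comp_cvec; exact: measurable_id.
have mS : mV S.
  apply/measurable_EFinP/measurable_funM.
    by apply: measurable_ballI => i; exact: cmeas_cvec.
  by apply: measurable_ind; apply: measurable_fun_ler => //; exact: measurable_cst.
have mB : mV B.
  apply/measurable_EFinP; apply: measurable_ind.
  by apply: measurable_fun_ltr => //; exact: measurable_cst.
have S0 v : 0 <= S v by rewrite lee_fin mulr_ge0.
have B0 v : 0 <= B v by rewrite lee_fin.
have BE : ((1 - t) ^+ n)%:E * vol = IV B.
  rewrite -(IV_scale q0 mB B0) q2; congr (_ * _); apply: eq_IV => v.
  rewrite /B sqnormZ csq_real q2 /ballI.
  by rewrite -[X in _ = ((_ < X)%R%:R)%:E]mulr1 ltr_pM2l// subr_gt0.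
have SB : IV S + IV B = vol.
  rewrite /vol /IV -ge0_integralD//.
  apply: eq_integral => x _; rewrite /S /B -EFinD; congr EFin.
  rewrite /ballI; case: (ltP (sqnorm _) (1 - t)%R) => h.
    by rewrite mulr0 add0r (lt_trans h)// ltrBlDr ltrDl.
  by rewrite mulr1 addr0.
have B1 : IV B = ((1 - t) ^+ n * r)%:E by rewrite -BE volr.
move: SB; rewrite B1 volr -/S.
have : 0 <= IV S by exact: IV_ge0.
case: (IV S) => [s| |] //; rewrite lee_fin => s0 [sr].
rewrite -EFinM lee_fin.
have := @bernoulli_pow t n; rewrite ltW//= ltW// => /(_ isT) h.
by nra.
Qed.

Let a : R := (lambda - n%:R - 1)%R.

Let a_gt : (-1 < a)%R.
Proof. by rewrite /a ltrBrDr addNr subr_gt0. Qed.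

Lemma dyadic_shell (u : R) : (0 < u <= 1)%R ->
  exists k, (2^-1 ^+ k.+1 < u <= 2^-1 ^+ k)%R.
Proof.
move=> /andP[u0 u1].
have [N hN] : exists N, (2^-1 ^+ N < u)%R.
  have : (geometric 1 (2^-1 : R)) @ \oo --> (0 : R)%R.
    by apply: cvg_geometric; rewrite ger0_norm ?invr_ge0// invf_lt1// ltr1n.
  move=> /cvgrPdist_lt /(_ _ u0) [N _ /(_ N (leqnn N))] /=.
  rewrite sub0r normrN mul1r ger0_norm ?exprn_ge0 ?invr_ge0// => h.
  by exists N.
have ex : exists N, (2^-1 ^+ N < u)%R by exists N.
case: (ex_minnP ex) => -[|k] hk mink.
  by move: hk; rewrite expr0 ltNge u1.
exists k; rewrite hk /= leNgt; apply/negP => /mink; by rewrite ltnn.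
Qed.

(** For a nonnegative exponent a = lambda - n - 1 the weight is at most 1. Otherwise the ball is cut
    into shells where 1 - |z|^2 lies between 2^-(k+1) and 2^-k: the k-th has volume O(2^-k) and
    weight at most 2^(-(k+1) a), so the series has ratio 2^-(1+a), which is less than 1 as a >
    -1. *)
Lemma IV_wt_lty : IV (fun v : V => (wt v)%:E) < +oo.
Proof.
have [a0|a0] := leP 0%R a.
  apply: (@le_lt_trans _ _ vol); last first.
    by have [r _ ->] := volE; rewrite ltry.
  apply: le_IV; [exact: mV_wt|exact: mV_ballI|by move=> z; rewrite lee_fin wt_ge0|].
  move=> z; rewrite lee_fin; have [h|h] := leP 1%R (sqnorm z); first by rewrite wt_out.
  rewrite /wt ler_piMr// /weight -/a.
  rewrite -[leRHS](_ : (1 `^ a = 1 :> R)%R); last by rewrite powR1.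
  have s1 : (1 - sqnorm z <= 1)%R by rewrite gerBl sqnorm_ge0.
  by apply: ge0_ler_powR s1 => //; rewrite nnegrE ?ler01// subr_ge0 ltW.
have [r r0 volr] := volE.
pose x k : R := ((2^-1 ^+ k.+1) `^ a)%R.
pose f k (v : V) : \bar R := (x k)%:E * (ballI v * (1 - 2^-1 ^+ k <= sqnorm v)%R%:R)%:E.
have f0 k v : 0 <= f k v by rewrite mule_ge0// lee_fin ?powR_ge0// mulr_ge0.
have mS k : mV (fun v : V => (ballI v * (1 - 2^-1 ^+ k <= sqnorm v)%R%:R)%:E).
  apply/measurable_EFinP/measurable_funM.
    by apply: measurable_ballI => i; exact: cmeas_cvec.
  apply: measurable_ind; apply: measurable_fun_ler; first exact: measurable_cst.
  by apply: measurable_sqnorm => i; exact: cmeas_cvec.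
have mf k : mV (f k).
  by apply: emeasurable_funM (mS k); exact: measurable_cst.
apply: (@le_lt_trans _ _ (IV (fun v => \sum_(k <oo) f k v))).
  apply: le_IV; [exact: mV_wt| |by move=> z; rewrite lee_fin wt_ge0|].
    apply: (ge0_emeasurable_sum (h := fun k t => f k (cvec t))) => // k _.
    exact: mf.
  move=> z; have [h|h] := leP 1%R (sqnorm z).
    by rewrite wt_out//; apply: nneseries_ge0 => k _ _.
  have [k /andP[k1 k2]] : exists k, (2^-1 ^+ k.+1 < 1 - sqnorm z <= 2^-1 ^+ k)%R.
    by apply: dyadic_shell; rewrite subr_gt0 h /= lerBlDr lerDl sqnorm_ge0.
  apply: (@le_trans _ _ (f k z)).
    rewrite /f /ballI h mul1r lerBlDr -lerBlDl k2 mule1 lee_fin wt_ball// /x /weight -/a.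
    have P (t : R) : (t `^ a = (t `^ (- a))^-1)%R by rewrite -powRN opprK.
    have hk : (0 < (2^-1 : R) ^+ k.+1)%R by rewrite exprn_gt0// invr_gt0.
    have hz : (0 < 1 - sqnorm z)%R by rewrite subr_gt0.
    have a0' : (0 <= - a)%R by rewrite oppr_ge0 ltW.
    rewrite !P lef_pV2 ?posrE ?powR_gt0//.
    by apply: ge0_ler_powR (ltW k1) => //; rewrite nnegrE ltW.
  rewrite (@nneseries_split _ _ 0%N k.+1) ?add0n//.
  rewrite big_mkord (bigD1 (Ordinal (ltnSn k)))//= -addeA leeDl// adde_ge0//.
    by apply: sume_ge0.
  by apply: nneseries_ge0 => j _ _.
have -> : IV (fun v => \sum_(k <oo) f k v) = \sum_(k <oo) IV (f k).
  by rewrite /IV integral_nneseries.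
pose y : R := (2^-1 `^ (1 + a))%R.
have y1 : (`|y| < 1)%R.
  rewrite ger0_norm ?powR_ge0// /y /powR invr_eq0 pnatr_eq0 /= expR_lt1.
  rewrite lnV ?posrE// mulrN oppr_lt0 mulr_gt0 ?ln_gt0 ?ltr1n//.
  by rewrite -ltrBlDl sub0r.
(* The second summand accounts for k = 0, where the shell is the whole ball and [vol_shell] does not
   apply. *)
pose c : R := (2^-1 `^ a * (n%:R * r) + 2^-1 `^ a * r)%R.
have le_f k : IV (f k) <= (geometric c y k)%:E.
  rewrite /f IV_Zl ?powR_ge0//; last by move=> v; rewrite lee_fin mulr_ge0.
  have -> : (geometric c y k = x k * ((n%:R * 2^-1 ^+ k) * r + 2^-1 ^+ k * r))%R.
    rewrite /geometric /= /c /x /y -!powR_mulrn ?invr_ge0// -!powRrM ?invr_ge0//.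
    have nz t u : (t + u == 0 :> R)%R ==> ((2^-1 : R) != 0)%R.
      by rewrite invr_eq0 pnatr_eq0 implybT.
    have -> : ((1 + a) * k%:R = k%:R + a * k%:R)%R by ring.
    have -> : (k.+1%:R * a = a + a * k%:R)%R by rewrite -natr1; ring.
    by rewrite !powRD //; ring.
  rewrite EFinM lee_wpmul2l ?lee_fin ?powR_ge0//.
  case: k => [|k].
    apply: (@le_trans _ _ vol).
      apply: le_IV; [exact: mS|exact: mV_ballI|by move=> z; rewrite lee_fin mulr_ge0|].
      by move=> z; rewrite lee_fin ler_piMr// lern1 leq_b1.
    by rewrite volr lee_fin expr0 mulr1 mul1r lerDr mulr_ge0 ?ltW.
  apply: le_trans (@vol_shell (2^-1 ^+ k.+1) _) _.
    rewrite exprn_gt0 ?invr_gt0//= exprn_ilt1 ?invr_ge0//.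
    by rewrite invf_lt1// ltr1n.
  by rewrite volr -EFinM lee_fin lerDl mulr_ge0 ?exprn_ge0 ?invr_ge0 ?ltW.
apply: (@le_lt_trans _ _ (\sum_(k <oo) (geometric c y k)%:E)).
  apply: lee_nneseries => [k _ _|k _]; last exact: le_f.
  by apply: IV_ge0.
have cv := @cvg_geometric_series R c y y1.
have -> : \sum_(k <oo) (geometric c y k)%:E = (c * (1 - y)^-1)%:E.
  apply: cvg_lim => //.
  rewrite (_ : (fun _ => _) = EFin \o series (geometric c y)); last first.
    by apply/funext => k /=; rewrite /series /= sumEFin.
  by apply: cvg_EFin => //; exact: nearW.
exact: ltry.
Qed.

End WeightedIntegral.

(** * Quasi-invariance of the weighted measure *)

Section BallIntegral.
Context (R : realType) (m : nat).
Local Open Scope complex_scope.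
Local Notation n := m.+1.
Local Notation C := R[i].
Local Notation V := 'cV[C]_n.
Variable lambda : R.
Hypothesis lam_gt : n%:R < lambda.
Local Notation leb := (lebesgue_Cn R n).
Local Notation wt := (@wt R m lambda).

Definition bmeas (h : V -> R) := measurable_fun (@mball R n) (fun t => h (cvec t)).

Lemma measurable_mball : measurable (@mball R n).
Proof.
rewrite (_ : @mball R n = (fun t => sqnorm (cvec t) : R) @^-1` [set x | x < 1]); last first.
  by [].
rewrite -[X in measurable X]setTI; apply: measurable_sqnorm => //.
  by move=> i; exact: cmeas_cvec.
rewrite (_ : [set x | x < 1] = `]-oo, (1:R)[%classic) //.
Qed.

Lemma bmeas_wt (h : V -> R) : bmeas h ->
  measurable_fun setT (fun t : cpow R n => h (cvec t) * wt (cvec t)).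
Proof.
move=> mh.
have -> : (fun t : cpow R n => h (cvec t) * wt (cvec t)) =
    (fun t => h (cvec t) * wt (cvec t)) \_ (@mball R n).
  apply/funext => t; rewrite patchE; case: ifPn => //; rewrite notin_setE /mball /unit_ball /=.
  by move/negP; rewrite -leNgt => /(wt_out lambda) ->; rewrite mulr0.
have mw : measurable_fun (@mball R n) (fun t => h (cvec t) * wt (cvec t)).
  apply: measurable_funM => //; apply: measurable_wt => i.
  by apply: (@cmeasS _ _ _ _ setT) => //; exact: cmeas_cvec.
exact: (iffLR (measurable_restrictT _ measurable_mball) mw).
Qed.

Lemma bmeasT (h : V -> R) : measurable_fun setT (fun t => h (cvec t)) -> bmeas h.
Proof. by move=> mh; apply: measurable_funTS. Qed.

Local Open Scope ereal_scope.

Definition EV (G : V -> R) : \bar R := \int[leb]_t (G (cvec t))%:E.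

(** Through positive and negative parts, the invariances of [IV] pass to signed integrands without
    integrability. *)
Lemma EV_posneg (G : V -> R) :
  EV G = IV (fun v => (Num.max (G v) 0)%:E) - IV (fun v => (Num.max (- G v) 0)%:E).
Proof.
rewrite /EV integralE; congr (_ - _).
  by apply: eq_integral => t _; rewrite funeposE EFin_max.
by apply: eq_integral => t _; rewrite funenegE EFin_max.
Qed.

Lemma maxr_mulr (x k : R) : (0 <= k)%R -> (Num.max (x * k) 0 = Num.max x 0 * k)%R.
Proof. by move=> k0; rewrite maxr_pMl// mul0r. Qed.

Lemma measurable_max0 (G : V -> R) : measurable_fun setT (fun t => G (cvec t)) ->
  mV (fun v => (Num.max (G v) 0)%:E) /\ mV (fun v => (Num.max (- G v) 0)%:E).
Proof.
move=> mG; split; apply/measurable_EFinP; apply: measurable_maxr => //.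
by apply: measurableT_comp.
Qed.

Lemma EV_unitary (U : 'M[C]_n) (G : V -> R) : unitary U ->
  measurable_fun setT (fun t => G (cvec t)) -> EV (fun v => G (U *m v)) = EV G.
Proof.
move=> hU /measurable_max0[m1 m2]; rewrite !EV_posneg.
rewrite (IV_unitary hU m1) ?(IV_unitary hU m2) //.
  by move=> v; rewrite lee_fin le_max lexx orbT.
by move=> v; rewrite lee_fin le_max lexx orbT.
Qed.

Lemma EV_boost i s (G : V -> R) : s != 0%R ->
  measurable_fun setT (fun t => G (cvec t)) ->
  (forall v, (1 <= sqnorm v)%R -> G v = 0%R) ->
  EV (fun z => G (boost i s z) * (csq (boost_den i s z))^-1 ^+ n.+1)%R = EV G.
Proof.
move=> s0 /measurable_max0[m1 m2] G0.
have k0 z : (0 <= (csq (boost_den i s z))^-1 ^+ n.+1)%R.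
  by rewrite exprn_ge0// invr_ge0 csq_ge0.
rewrite !EV_posneg -(IV_boost i s0 m1) -?(IV_boost i s0 m2).
- congr (_ - _); apply: eq_IV => z; rewrite -EFinM; congr EFin.
    by rewrite maxr_mulr.
  by rewrite -mulNr maxr_mulr.
- by move=> v; rewrite lee_fin le_max lexx orbT.
- by move=> v /G0 ->; rewrite oppr0 maxxx.
- by move=> v; rewrite lee_fin le_max lexx orbT.
- by move=> v /G0 ->; rewrite maxxx.
Qed.

Definition EI (h : V -> R) : \bar R := EV (fun z => h z * wt z)%R.
Definition RI (h : V -> R) : R := fine (EI h).

Lemma EI_unitary (U : 'M[C]_n) (h : V -> R) : unitary U -> bmeas h ->
  EI (fun v => h (U *m v)) = EI h.
Proof.
move=> hU mh; rewrite /EI -(EV_unitary hU (bmeas_wt mh)).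
congr EV; apply/funext => v; congr (_ * _)%R.
by rewrite /wt /ballI /weight unitary_sqnorm.
Qed.

Lemma sqnorm_boost i s (z : V) : boost_den i s z != 0%R ->
  (1 - sqnorm (boost i s z) = (1 - sqnorm z) / csq (boost_den i s z))%R.
Proof.
move=> w0; have q0 : csq (boost_den i s z) != 0%R by rewrite csq_eq0.
apply: (mulIf q0); rewrite divfK // mulrBl mul1r.
have -> : (sqnorm (boost i s z) * csq (boost_den i s z) =
   csq ((Num.sqrt (1 + s ^+ 2))%:C%C * z i ord0 + s%:C%C) + \sum_(j < n | j != i) csq (z j ord0))%R.
  rewrite sqnormE (bigD1 i)//= boostE eqxx csqM csqV mulrDl mulrAC mulVf// mul1r; congr (_ + _)%R.
  rewrite mulr_suml; apply: eq_bigr => j /negbTE ji.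
  by rewrite boostE ji csqM csqV mulrAC mulVf// mul1r.
rewrite (sqnormE z) [in RHS](bigD1 i)//= /boost_den.
have := sqrt_boost_sq s; set c := Num.sqrt _.
case: (z i ord0) => x y; rewrite /csq /= => h.
have : (c * c = 1 + s * s)%R by rewrite -!expr2.
move=> hc.
have E : (((c + (s * x - 0 * y)) ^+ 2 + (0 + (s * y + 0 * x)) ^+ 2) -
  ((c * x - 0 * y + s) ^+ 2 + (c * y + 0 * x + 0) ^+ 2) =
  (c * c - s * s) * (1 - (x ^+ 2 + y ^+ 2)))%R by ring.
rewrite opprD addrA [in RHS]opprD [in RHS]addrA; congr (_ - _)%R.
by rewrite E hc; ring.
Qed.

Lemma boost_den_neq0 i s (z : V) : (sqnorm z < 1)%R -> boost_den i s z != 0%R.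
Proof.
move=> h; apply/negP => /eqP /(congr1 (fun c : C => c - (Num.sqrt (1 + s ^+ 2))%:C%C)%R).
rewrite /boost_den addrAC subrr add0r sub0r => /(congr1 (@csq R)).
rewrite csqM csqN !csq_real sqrt_boost_sq => e.
have : (csq (z i ord0) < 1)%R.
  apply: le_lt_trans h; rewrite sqnormE (bigD1 i)//= lerDl.
  by apply: sumr_ge0 => *; exact: csq_ge0.
have := csq_ge0 (z i ord0); have := sqr_ge0 s; nra.
Qed.

(** The Jacobian is the (n+1)-st power of 1/|den|^2, and by [sqnorm_boost] the weight changes by the
    power lambda - n - 1 of the same quantity; the exponents add up to lambda. *)
Lemma EI_boost i s (h : V -> R) : s != 0%R -> bmeas h ->
  EI (fun z => h (boost i s z) * (csq (boost_den i s z)) `^ (- lambda))%R = EI h.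
Proof.
move=> s0 mh; rewrite /EI -[RHS](EV_boost i s0 (bmeas_wt mh)); last first.
  by move=> v /(wt_out lambda) ->; rewrite mulr0.
congr EV; apply/funext => z; rewrite -[LHS]mulrA -[RHS]mulrA; congr (_ * _)%R.
have [z1|z1] := ltP (sqnorm z) 1%R; last first.
  rewrite (wt_out lambda z1) mulr0; have [->|w0] := eqVneq (boost_den i s z) 0%R.
    by rewrite csq0 invr0 expr0n mulr0.
  suff hb : (1 <= sqnorm (boost i s z))%R by rewrite (wt_out lambda hb) mul0r.
  rewrite -subr_le0 sqnorm_boost// mulr_le0_ge0 ?subr_le0//.
  by rewrite invr_ge0 csq_ge0.
have w0 := boost_den_neq0 i s z1.
have q0 : (0 < csq (boost_den i s z))%R by rewrite lt_neqAle csq_ge0 eq_sym csq_eq0 w0.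
have sb := sqnorm_boost w0.
have b1 : (sqnorm (boost i s z) < 1)%R.
  by rewrite -subr_gt0 sb divr_gt0// subr_gt0.
rewrite !wt_ball// /weight sb.
set q := csq _ in q0 *; set u := (1 - sqnorm z)%R.
have u0 : (0 < u)%R by rewrite subr_gt0.
rewrite powRM ?ltW ?invr_gt0// [in LHS]mulrC -mulrA; congr (_ * _)%R.
have -> : (q^-1 = q `^ (-1))%R by rewrite powR_inv1// ltW.
rewrite -powRrM -powR_mulrn ?powR_ge0// -powRrM -powRD; last by rewrite (gt_eqF q0) implybT.
by congr (_ `^ _)%R; rewrite -[m.+2%:R]natr1; ring.
Qed.

End BallIntegral.

Lemma ae_imply d (T : measurableType d) (R : realType) (mu : set T -> \bar R)
    (P Q : T -> Prop) : (forall t, P t -> Q t) ->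
  {ae mu, forall t, P t} -> {ae mu, forall t, Q t}.
Proof.
by move=> PQ [N [mN N0 PN]]; exists N; split => // t /= nQ; apply: PN => /PQ.
Qed.

(** * Integration on the ball, L^2 and its inner product *)

Section ComplexBallIntegral.
Context (R : realType) (m : nat).
Local Open Scope complex_scope.
Local Notation n := m.+1.
Local Notation C := R[i].
Local Notation V := 'cV[C]_n.
Variable lambda : R.
Hypothesis lam_gt : n%:R < lambda.
Local Notation leb := (lebesgue_Cn R n).
Local Notation wt := (@wt R m lambda).
Local Notation RI := (@RI R m lambda).
Local Notation EI := (@EI R m lambda).

Definition IntB (h : V -> R) : Prop :=
  leb.-integrable setT (fun t => (h (cvec t) * wt (cvec t))%:E).

Lemma IntB_le (h g : V -> R) : bmeas h -> IntB g ->
  (forall z, sqnorm z < 1 -> `|h z| <= g z) -> IntB h.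
Proof.
move=> mh ig hg; apply: le_integrable ig => //.
  by apply/measurable_EFinP; exact: bmeas_wt.
move=> t _; rewrite lee_fin.
have [z1|z1] := ltP (sqnorm (cvec t)) 1; last by rewrite (wt_out lambda z1) !mulr0.
rewrite !normrM ler_wpM2r//; apply: le_trans (hg _ z1) _; exact: ler_norm.
Qed.

Lemma IntB1 : IntB (fun=> 1).
Proof.
apply/integrableP; split.
  by apply/measurable_EFinP; apply: (bmeas_wt lambda (h := fun=> 1)); exact: measurable_cst.
apply: le_lt_trans (IV_wt_lty lam_gt); rewrite le_eqVlt; apply/orP; left; apply/eqP.
apply: eq_integral => t _ /=; rewrite mul1r ger0_norm //; exact: wt_ge0.
Qed.

Lemma IntBZ (k : R) h : IntB h -> IntB (fun z => k * h z).
Proof.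
move=> /(integrableZl measurableT k); apply: eq_integrable => // t _.
by rewrite -EFinM mulrA.
Qed.

Lemma IntB_bounded (h : V -> R) (M : R) : bmeas h ->
  (forall z, sqnorm z < 1 -> `|h z| <= M) -> IntB h.
Proof.
move=> mh hM; apply: (IntB_le mh (IntBZ M IntB1)) => z z1.
by rewrite mulr1 hM.
Qed.

Lemma IntBD h g : IntB h -> IntB g -> IntB (fun z => h z + g z).
Proof.
move=> ih ig; have := integrableD measurableT ih ig.
by apply: eq_integrable => // t _; rewrite /= -EFinD mulrDl.
Qed.

Lemma IntBN h : IntB h -> IntB (fun z => - h z).
Proof. by move=> /(IntBZ (-1)); under eq_fun do rewrite mulN1r. Qed.

(** The weight is positive on the ball and can be divided out. *)
Lemma IntB_bmeas h : IntB h -> bmeas h.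
Proof.
move=> /measurable_int /measurable_EFinP /= mh.
have mw : measurable_fun (@mball R n) (fun t => h (cvec t) * wt (cvec t) * (wt (cvec t))^-1).
  apply: measurable_funM; first exact: measurable_funTS.
  apply: measurable_funV_real; apply: measurable_wt => i.
  by apply: (@cmeasS _ _ _ _ setT) => //; exact: cmeas_cvec.
apply: eq_measurable_fun mw => t; rewrite inE => tB.
by rewrite -mulrA divff ?mulr1// gt_eqF// wt_gt0.
Qed.

Lemma RID h g : IntB h -> IntB g -> RI (fun z => h z + g z) = RI h + RI g.
Proof.
move=> ih ig; rewrite /RI /EI /EV.
under eq_integral do rewrite mulrDl EFinD.
rewrite integralD// fineD//; exact: integrable_fin_num.
Qed.

Lemma RIZ (k : R) h : IntB h -> RI (fun z => k * h z) = k * RI h.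
Proof.
move=> ih; rewrite /RI /EI /EV.
under eq_integral do rewrite -mulrA EFinM.
rewrite integralZl// fineM//; exact: integrable_fin_num.
Qed.

Lemma RIN h : IntB h -> RI (fun z => - h z) = - RI h.
Proof.
by move=> ih; rewrite -mulN1r -RIZ//; congr RI; apply/funext => z; rewrite mulN1r.
Qed.

Lemma eq_RI h g : (forall z, sqnorm z < 1 -> h z = g z) -> RI h = RI g.
Proof.
move=> hg; congr fine; apply: eq_integral => t _.
have [z1|z1] := ltP (sqnorm (cvec t)) 1; first by rewrite hg.
by rewrite (wt_out lambda z1) !mulr0.
Qed.

Lemma eq_IntB h g : (forall z, sqnorm z < 1 -> h z = g z) -> IntB h -> IntB g.
Proof.
move=> hg; apply: eq_integrable => // t _.
have [z1|z1] := ltP (sqnorm (cvec t)) 1; first by rewrite hg.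
by rewrite (wt_out lambda z1) !mulr0.
Qed.

Lemma RI_ge0 h : (forall z, sqnorm z < 1 -> 0 <= h z) -> 0 <= RI h.
Proof.
move=> h0; apply: fine_ge0; apply: integral_ge0 => t _; rewrite lee_fin.
have [z1|z1] := ltP (sqnorm (cvec t)) 1; first by rewrite mulr_ge0 ?h0// wt_ge0.
by rewrite (wt_out lambda z1) mulr0.
Qed.

Lemma RI_le h g : IntB h -> IntB g -> (forall z, sqnorm z < 1 -> h z <= g z) ->
  RI h <= RI g.
Proof.
move=> ih ig hg; rewrite -subr_ge0 -RIN// -RID//; last exact: IntBN.
by apply: RI_ge0 => z z1; rewrite subr_ge0 hg.
Qed.

(** If the integral were 0, the weight would vanish almost everywhere, and the ball, where it is
    positive, would have volume 0. *)
Lemma RI1_gt0 : 0 < RI (fun=> 1).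
Proof.
rewrite lt_neqAle RI_ge0// andbT eq_sym; apply/negP => /eqP.
rewrite /RI => e.
have fin := integrable_fin_num measurableT IntB1.
have e0 : (\int[leb]_t `|(1 * wt (cvec t))%:E| = 0)%E.
  rewrite -[RHS](_ : EI (fun=> 1%R) = 0%E); last by rewrite -[LHS]fineK// e.
  by apply: eq_integral => t _; rewrite /= ger0_norm// mul1r wt_ge0.
have mw : measurable_fun setT (fun t : cpow R n => (1 * wt (cvec t))%:E).
  by apply/measurable_EFinP; apply: (bmeas_wt lambda (h := fun=> 1)); exact: measurable_cst.
have /(ae_eq_integral_abs _ measurableT mw).1 ae0 := e0.
have := IV_ballI_gt0 R n.
suff -> : IV (fun v : V => (ballI v)%:E) = 0%E by rewrite ltxx.
rewrite /IV (ge0_ae_eq_integral (g := cst 0%E) measurableT)//.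
- by rewrite integral0.
- exact: mV_ballI.
- by move=> t _; rewrite lee_fin.
- apply: ae_imply ae0 => t h _; have := h I; rewrite /= mul1r => -[w0].
  have [z1|z1] := ltP (sqnorm (cvec t)) 1.
    by have := wt_gt0 lambda z1; rewrite w0 ltxx.
  by rewrite /ballI ltNge z1.
Qed.

Lemma ae_RI h g : bmeas h -> bmeas g -> ae_ball (fun z => h z = g z) -> RI h = RI g.
Proof.
move=> mh mg hg; congr fine; apply: ae_eq_integral => //.
- by apply/measurable_EFinP; exact: bmeas_wt.
- by apply/measurable_EFinP; exact: bmeas_wt.
apply: ae_imply hg => t htg _ /=.
have [z1|z1] := ltP (sqnorm (cvec t)) 1; first by rewrite htg.
by rewrite (wt_out lambda z1) !mulr0.
Qed.

Lemma Rintegral_ball h :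
  \int[leb]_(t in @mball R n) (h (cvec t) * weight lambda (cvec t)) = RI h.
Proof.
rewrite /Rintegral /RI integral_mkcond; congr fine; apply: eq_integral => t _.
rewrite patchE; case: ifPn.
  by rewrite inE /mball /unit_ball /= => tB; rewrite wt_ball.
rewrite notin_setE /mball /unit_ball /= => /negP; rewrite -leNgt => /(wt_out lambda) ->.
by rewrite mulr0.
Qed.

Lemma c_lambdaE : c_lambda n lambda = (RI (fun=> 1))^-1.
Proof.
rewrite /c_lambda -Rintegral_ball; congr (_^-1).
by apply: eq_Rintegral => t _; rewrite mul1r.
Qed.

Lemma c_lambda_gt0 : 0 < c_lambda n lambda.
Proof. by rewrite c_lambdaE invr_gt0 RI1_gt0. Qed.

Definition bcmeas (f : V -> C) := cmeasurable (@mball R n) (fun t => f (cvec t)).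
Definition CInt (f : V -> C) := IntB (fun z => complex.Re (f z)) /\
  IntB (fun z => complex.Im (f z)).
Definition CI (f : V -> C) : C :=
  RI (fun z => complex.Re (f z)) +i* RI (fun z => complex.Im (f z)).

Lemma integral_muE f : integral_mu lambda f = (c_lambda n lambda)%:C * CI f.
Proof.
rewrite /integral_mu (Rintegral_ball (fun z => complex.Re (f z))).
rewrite (Rintegral_ball (fun z => complex.Im (f z))).
by apply/eqP; rewrite eq_complex /= !mul0r subr0 addr0 !eqxx.
Qed.

Lemma CIntD f g : CInt f -> CInt g -> CInt (fun z => f z + g z).
Proof.
move=> [f1 f2] [g1 g2]; split.
  by under eq_fun do rewrite cReD; exact: IntBD.
by under eq_fun do rewrite cImD; exact: IntBD.
Qed.

Lemma CID f g : CInt f -> CInt g -> CI (fun z => f z + g z) = CI f + CI g.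
Proof.
move=> [f1 f2] [g1 g2]; rewrite /CI.
under [X in RI X]eq_fun do rewrite cReD.
under [X in _ +i* RI X]eq_fun do rewrite cImD.
by rewrite !RID.
Qed.

Lemma CIntZ (k : C) f : CInt f -> CInt (fun z => k * f z).
Proof.
move=> [f1 f2]; split.
  under eq_fun do rewrite cReM -mulNr; apply: IntBD; exact: IntBZ.
under eq_fun do rewrite cImM; apply: IntBD; exact: IntBZ.
Qed.

Lemma CIZ (k : C) f : CInt f -> CI (fun z => k * f z) = k * CI f.
Proof.
move=> [f1 f2]; rewrite /CI.
under [X in RI X]eq_fun do rewrite cReM -mulNr.
under [X in _ +i* RI X]eq_fun do rewrite cImM.
rewrite !RID ?RIZ //; try exact: IntBZ.
case: k => a b /=; apply/eqP; rewrite eq_complex /= mulNr.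
by rewrite eqxx /= eqxx.
Qed.

Lemma CIJ f : CInt f -> CI (fun z => cj (f z)) = cj (CI f).
Proof.
move=> [f1 f2]; rewrite /CI.
under [X in RI X]eq_fun do rewrite cReJ.
under [X in _ +i* RI X]eq_fun do rewrite cImJ.
by rewrite RIN.
Qed.

Lemma eq_CI f g : (forall z, sqnorm z < 1 -> f z = g z) -> CI f = CI g.
Proof. by move=> fg; congr Complex; apply: eq_RI => z /fg ->. Qed.

Lemma eq_CInt f g : (forall z, sqnorm z < 1 -> f z = g z) -> CInt f -> CInt g.
Proof. by move=> fg [i1 i2]; split; [apply: eq_IntB i1|apply: eq_IntB i2] => z /fg ->. Qed.

Lemma normr_Re (x : C) (r : R) : csq x <= r ^+ 2 -> 0 <= r ->
  `|complex.Re x| <= r /\ `|complex.Im x| <= r.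
Proof.
move=> xr r0; split; rewrite -ler_sqr ?nnegrE// real_normK ?num_real//;
  apply: le_trans xr; rewrite /csq ?lerDl ?lerDr sqr_ge0 //.
Qed.

Lemma CInt_le f (g : V -> R) : bcmeas f -> IntB g ->
  (forall z, sqnorm z < 1 -> 0 <= g z /\ csq (f z) <= g z ^+ 2) -> CInt f.
Proof.
move=> [m1 m2] ig fg; split; apply: (IntB_le _ ig) => // z /fg[g0 h].
  by case: (normr_Re h g0).
by case: (normr_Re h g0).
Qed.

Definition L2B (f : V -> C) := bcmeas f /\ IntB (fun z => csq (f z)).

Lemma bmeas_csq f : bcmeas f -> bmeas (fun z => csq (f z)).
Proof. by move=> mf; exact: measurable_csq. Qed.

Lemma normc_sq (x : C) : ComplexField.Normc.normc x ^+ 2 = csq x.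
Proof. by case: x => a b; rewrite /csq /= sqr_sqrtr// addr_ge0// sqr_ge0. Qed.

Lemma L2E f : L2 lambda f <-> L2B f.
Proof.
split=> -[mf i1]; split=> //.
  move: i1 => /(integrable_mkcond _ (@measurable_mball R m)); apply: eq_integrable => // t _.
  rewrite patchE normc_sq; case: ifPn.
    by rewrite inE /mball /unit_ball /= => tB; rewrite wt_ball.
  rewrite notin_setE /mball /unit_ball /= => /negP; rewrite -leNgt => /(wt_out lambda) ->.
  by rewrite mulr0.
apply/(integrable_mkcond _ (@measurable_mball R m)).
move: i1; apply: eq_integrable => // t _.
rewrite patchE normc_sq; case: ifPn.
  by rewrite inE /mball /unit_ball /= => tB; rewrite wt_ball.
rewrite notin_setE /mball /unit_ball /= => /negP; rewrite -leNgt => /(wt_out lambda) ->.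
by rewrite mulr0.
Qed.

Lemma csq_add_le (a b : C) : csq (a + b) <= 2 * csq a + 2 * csq b.
Proof.
case: a => a a'; case: b => b b'; rewrite /csq /=.
have := sqr_ge0 (a - b); have := sqr_ge0 (a' - b'); nra.
Qed.

Lemma L2D f g : L2B f -> L2B g -> L2B (fun z => f z + g z).
Proof.
move=> [mf f2] [mg g2]; split; first exact: cmeasD.
apply: (IntB_le _ (IntBD (IntBZ 2 f2) (IntBZ 2 g2))).
  by apply: bmeas_csq; exact: cmeasD.
by move=> z _; rewrite ger0_norm ?csq_ge0// csq_add_le.
Qed.

Lemma L2Z (k : C) f : L2B f -> L2B (fun z => k * f z).
Proof.
move=> [mf f2]; split; first by apply: cmeasM => //; exact: cmeas_cst.
by under eq_fun do rewrite csqM; exact: IntBZ.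
Qed.

Lemma L2N f : L2B f -> L2B (fun z => - f z).
Proof. by move=> /(L2Z (-1)); under eq_fun do rewrite mulN1r. Qed.

Lemma L2_sub f g : L2B f -> L2B g -> L2B (fun z => f z - g z).
Proof. by move=> hf hg; apply: L2D => //; exact: L2N. Qed.

Lemma eq_L2 f g : (forall z, sqnorm z < 1 -> f z = g z) -> L2B f -> L2B g.
Proof.
move=> fg [[m1 m2] f2]; split.
  split; [apply: eq_measurable_fun m1|apply: eq_measurable_fun m2];
    by move=> t; rewrite inE => tB; rewrite fg.
by apply: eq_IntB f2 => z /fg ->.
Qed.

Lemma L2_mulb (phi f : V -> C) (M : R) : bcmeas phi ->
  (forall z, sqnorm z < 1 -> csq (phi z) <= M) -> L2B f -> L2B (fun z => phi z * f z).
Proof.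
move=> mp hM [mf f2]; split; first exact: cmeasM.
apply: (IntB_le _ (IntBZ M f2)); first by apply: bmeas_csq; exact: cmeasM.
move=> z /hM h; rewrite ger0_norm ?csq_ge0// csqM ler_wpM2r//; exact: csq_ge0.
Qed.

Lemma L2_bounded f (M : R) : bcmeas f -> (forall z, sqnorm z < 1 -> csq (f z) <= M) -> L2B f.
Proof.
move=> mf hM; split => //; apply: (IntB_bounded (M := M) (bmeas_csq mf)) => z /hM h.
by rewrite ger0_norm // csq_ge0.
Qed.

Lemma CInt_mulJ f g : L2B f -> L2B g -> CInt (fun z => f z * cj (g z)).
Proof.
move=> [mf f2] [mg g2]; apply: (CInt_le _ (IntBD f2 g2)).
  by apply: cmeasM => //; exact: cmeasJ.
move=> z _; split; first by rewrite addr_ge0// csq_ge0.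
rewrite csqM csqJ; have := csq_ge0 (f z); have := csq_ge0 (g z); nra.
Qed.

Local Notation ip := (@ip R n lambda).
Local Notation cl := (c_lambda n lambda).

Lemma ipE f g : ip f g = cl%:C * CI (fun z => f z * cj (g z)).
Proof. exact: integral_muE. Qed.

Lemma eq_ip f f' g g' : (forall z, sqnorm z < 1 -> f z = f' z) ->
  (forall z, sqnorm z < 1 -> g z = g' z) -> ip f g = ip f' g'.
Proof. by move=> hf hg; rewrite !ipE; congr (_ * _); apply: eq_CI => z z1; rewrite hf// hg. Qed.

Lemma ipDl f g h : L2B f -> L2B g -> L2B h -> ip (fun z => f z + g z) h = ip f h + ip g h.
Proof.
move=> f2 g2 h2; rewrite !ipE -mulrDr -CID; [|exact: CInt_mulJ|exact: CInt_mulJ].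
by congr (_ * CI _); apply/funext => z; rewrite mulrDl.
Qed.

Lemma ipZl (k : C) f h : L2B f -> L2B h -> ip (fun z => k * f z) h = k * ip f h.
Proof.
move=> f2 h2; rewrite !ipE mulrCA -(CIZ k (CInt_mulJ f2 h2)).
by congr (_ * CI _); apply/funext => z; rewrite mulrA.
Qed.

Lemma ipJ f g : L2B f -> L2B g -> ip g f = cj (ip f g).
Proof.
move=> f2 g2; rewrite !ipE conjM conj_real -(CIJ (CInt_mulJ f2 g2)).
congr (_ * CI _).
by apply/funext => z; rewrite conjM conjCK mulrC.
Qed.

Lemma ipZr (k : C) f h : L2B f -> L2B h -> ip h (fun z => k * f z) = cj k * ip h f.
Proof.
by move=> f2 h2; rewrite (ipJ (L2Z k f2) h2) (ipZl k f2 h2) conjM (ipJ f2 h2).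
Qed.

Lemma ipDr f g h : L2B f -> L2B g -> L2B h -> ip h (fun z => f z + g z) = ip h f + ip h g.
Proof.
by move=> f2 g2 h2; rewrite (ipJ (L2D f2 g2) h2) (ipDl f2 g2 h2) conjD (ipJ f2 h2) (ipJ g2 h2).
Qed.

Definition N2 f : R := cl * RI (fun z => csq (f z)).

Lemma N2_ge0 f : 0 <= N2 f.
Proof.
by rewrite mulr_ge0 ?(ltW c_lambda_gt0)//; apply: RI_ge0 => z _; exact: csq_ge0.
Qed.

Lemma ip_N2 f : ip f f = (N2 f)%:C.
Proof.
rewrite ipE /CI /N2.
have -> : RI (fun z => complex.Re (f z * cj (f z))) = RI (fun z => csq (f z)).
  by congr RI; apply/funext => z; rewrite -csqE.
have -> : RI (fun z => complex.Im (f z * cj (f z))) = RI (fun z => 0 * 1).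
  by congr RI; apply/funext => z; rewrite -csqE /= mul0r.
rewrite RIZ ?mul0r; last exact: IntB1.
by rewrite -complexr0 rmorphM.
Qed.

Lemma L2normE f : L2norm lambda f = Num.sqrt (N2 f).
Proof. by rewrite /L2norm ip_N2. Qed.

Lemma N2Z (k : C) f : L2B f -> N2 (fun z => k * f z) = csq k * N2 f.
Proof.
move=> [_ f2]; rewrite /N2; under [X in RI X]eq_fun do rewrite csqM.
by rewrite RIZ// mulrCA.
Qed.

Lemma N2D f g : L2B f -> L2B g ->
  N2 (fun z => f z + g z) = N2 f + N2 g + 2 * complex.Re (ip f g).
Proof.
move=> f2 g2; apply: complexI; rewrite -ip_N2.
have fg := L2D f2 g2.
rewrite ipDl// !ipDr// !ip_N2 (ipJ f2 g2).
case: (ip f g) => a b; apply/eqP; rewrite eq_complex /=.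
by apply/andP; split; apply/eqP; ring.
Qed.

Lemma ip0l f : ip (fun=> 0) f = 0.
Proof.
rewrite ipE (_ : CI _ = CI (fun=> 0 * 0)); last by apply: eq_CI => z _; rewrite !mul0r.
by rewrite CIZ ?mul0r ?mulr0//; split => /=; apply: (IntB_bounded (M := 0)) => //;
  try exact: measurable_cst; move=> z _; rewrite normr0.
Qed.

(** The squared norm of f - t <f,g> g is nonnegative for every real t. Take t = 1 / [N2 g], or t
    large when [N2 g] = 0. *)
Lemma cauchy_schwarz f g : L2B f -> L2B g -> csq (ip f g) <= N2 f * N2 g.
Proof.
move=> f2 g2.
have key (t : R) : 0 <= N2 f + t ^+ 2 * csq (ip f g) * N2 g - 2 * t * csq (ip f g).
  have h2 := L2Z (- (t%:C * ip f g)) g2.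
  have := N2_ge0 (fun z => f z + (- (t%:C * ip f g)) * g z).
  rewrite N2D// N2Z// ipZr// csqN csqM csq_real.
  have -> : complex.Re (cj (- (t%:C * ip f g)) * ip f g) = - t * csq (ip f g).
    by case: (ip f g) => a b; rewrite /csq /=; ring.
  by move=> h; apply: le_trans h _; rewrite le_eqVlt; apply/orP; left; apply/eqP; ring.
have c0 := csq_ge0 (ip f g); have g0 := N2_ge0 g; have f0 := N2_ge0 f.
have [gp|] := ltP 0 (N2 g).
  have := key (N2 g)^-1; rewrite -(ler_pM2r gp) mul0r.
  have -> : (N2 f + (N2 g)^-1 ^+ 2 * csq (ip f g) * N2 g - 2 * (N2 g)^-1 * csq (ip f g)) * N2 g
    = N2 f * N2 g - csq (ip f g) by field; rewrite gt_eqF.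
  by rewrite subr_ge0.
move=> g0'; have gz : N2 g = 0 by apply/eqP; rewrite eq_le g0' g0.
rewrite gz mulr0; rewrite leNgt; apply/negP => cp.
(* With this t the nonnegative quantity becomes N2 f - 2 (N2 f + 1), which is negative. *)
have := key ((N2 f + 1) / csq (ip f g)); rewrite gz mulr0 addr0.
have -> : 2 * ((N2 f + 1) / csq (ip f g)) * csq (ip f g) = 2 * (N2 f + 1).
  by field; rewrite gt_eqF.
lra.
Qed.

End ComplexBallIntegral.

(** * The real-valued modulus *)

Section ComplexNorm.
Context (R : realType).
Local Open Scope complex_scope.
Local Notation C := R[i].
Implicit Types z w : C.

(** The modulus as an element of [R]; the norm of [R[i]] takes its values in [R[i]]. *)
Definition cn z : R := Num.sqrt (csq z).

Lemma cnE z : ComplexField.Normc.normc z = cn z.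
Proof. by case: z. Qed.

Lemma cn_ge0 z : 0 <= cn z. Proof. exact: sqrtr_ge0. Qed.

Lemma cn_sq z : cn z ^+ 2 = csq z. Proof. by rewrite sqr_sqrtr// csq_ge0. Qed.

Lemma cnM z w : cn (z * w) = cn z * cn w.
Proof. by rewrite /cn csqM sqrtrM// csq_ge0. Qed.

Lemma cn_eq0 z : (cn z == 0) = (z == 0).
Proof. by rewrite -sqrf_eq0 cn_sq csq_eq0. Qed.

Lemma cn0 : cn 0 = 0. Proof. by apply/eqP; rewrite cn_eq0. Qed.

Lemma cn1 : cn 1 = 1. Proof. by rewrite /cn csq1 sqrtr1. Qed.

Lemma cn_gt0 z : (0 < cn z) = (z != 0).
Proof. by rewrite lt_neqAle eq_sym cn_eq0 cn_ge0 andbT. Qed.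

Lemma cnN z : cn (- z) = cn z. Proof. by rewrite /cn csqN. Qed.

Lemma cnV z : cn z^-1 = (cn z)^-1. Proof. by rewrite /cn csqV sqrtrV// csq_ge0. Qed.

Lemma cnD z w : cn (z + w) <= cn z + cn w.
Proof. by rewrite -!cnE; exact: le_normcD. Qed.

Lemma cnB z w : cn (z - w) <= cn z + cn w.
Proof. by apply: le_trans (cnD _ _) _; rewrite cnN. Qed.

Lemma cn_real (r : R) : cn r%:C = `|r|.
Proof. by rewrite /cn csq_real sqrtr_sqr. Qed.

Lemma cnX z k : cn (z ^+ k) = cn z ^+ k.
Proof. by elim: k => [|k IH]; rewrite ?expr0 ?cn1// !exprS cnM IH. Qed.

Lemma cn_i : cn 'i = 1. Proof. by rewrite /cn /csq /= expr0n expr1n add0r sqrtr1. Qed.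

Lemma cnJ z : cn (cj z) = cn z. Proof. by rewrite /cn csqJ. Qed.

Lemma Re_le_cn z : `|complex.Re z| <= cn z.
Proof.
by rewrite -ler_sqr ?nnegrE ?cn_ge0// cn_sq real_normK ?num_real// lerDl sqr_ge0.
Qed.

Lemma Im_le_cn z : `|complex.Im z| <= cn z.
Proof.
by rewrite -ler_sqr ?nnegrE ?cn_ge0// cn_sq real_normK ?num_real// lerDr sqr_ge0.
Qed.

Lemma cn_le_ReIm z : cn z <= `|complex.Re z| + `|complex.Im z|.
Proof.
rewrite -ler_sqr ?nnegrE ?cn_ge0 ?addr_ge0// cn_sq sqrrD.
rewrite /csq -[X in X + _ <= _]real_normK ?num_real// -[X in _ + X <= _]real_normK ?num_real//.
by rewrite addrAC lerDl mulrn_wge0// mulr_ge0.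
Qed.

Lemma cn_sum (I : Type) (s : seq I) (P : pred I) (F : I -> C) :
  cn (\sum_(i <- s | P i) F i) <= \sum_(i <- s | P i) cn (F i).
Proof.
elim/big_rec2: _ => [|i y x _ h]; first by rewrite cn0.
by apply: le_trans (cnD _ _) _; rewrite lerD2l.
Qed.

Lemma cn_dist z w u : cn (z - u) <= cn (z - w) + cn (w - u).
Proof. by rewrite (_ : z - u = (z - w) + (w - u)) ?cnD//; ring. Qed.

Lemma cn_small z : (forall e, 0 < e -> cn z <= e) -> z = 0.
Proof.
move=> h; apply/eqP; rewrite -cn_eq0 eq_le cn_ge0 andbT leNgt; apply/negP => z0.
by have := h (cn z / 2) (divr_gt0 z0 (ltr0n _ 2)); lra.
Qed.

End ComplexNorm.

(** * Integrals of complex functions on segments *)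

Section ComplexLineIntegral.
Context (R : realType).
Local Open Scope complex_scope.
Local Notation C := R[i].
Local Notation mu := (@lebesgue_measure R).
Implicit Types (f g : R -> C) (a b c d : R).

Definition cint a b f : C :=
  (\int[mu]_(x in `[a, b]) complex.Re (f x)) +i* (\int[mu]_(x in `[a, b]) complex.Im (f x)).

(** Continuity and derivatives are given by explicit bounds in [R], which keeps all the estimates of
    the Cauchy theory in the real field. *)
Definition ccont_at (f : R -> C) (x : R) := forall e : R, 0 < e ->
  exists2 r : R, 0 < r & forall y : R, `|y - x| < r -> cn (f y - f x) < e.

Definition ccont (a b : R) (f : R -> C) := forall x, a <= x <= b -> ccont_at f x.

Lemma ccontW a b c d f : a <= c -> d <= b -> ccont a b f -> ccont c d f.
Proof. by move=> ac db h x /andP[h1 h2]; apply: h; rewrite (le_trans ac h1) (le_trans h2). Qed.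

Lemma ccont_ReIm a b f : ccont a b f ->
  {within `[a, b], continuous (fun x => complex.Re (f x))} /\
  {within `[a, b], continuous (fun x => complex.Im (f x))}.
Proof.
move=> cf; split; apply: continuous_in_subspaceT => x /set_mem /=;
  rewrite in_itv => /= /cf h; apply/cvgrPdist_lt => e /h [r r0 hr];
  apply/nbhs_ballP; exists r => //= y; rewrite /ball /= distrC => /hr.
  by apply: le_lt_trans; rewrite distrC -cReN -cReD; exact: Re_le_cn.
by apply: le_lt_trans; rewrite distrC -cImN -cImD; exact: Im_le_cn.
Qed.

Lemma ccont_integrable a b f : ccont a b f ->
  mu.-integrable `[a, b] (EFin \o (fun x => complex.Re (f x))) /\
  mu.-integrable `[a, b] (EFin \o (fun x => complex.Im (f x))).
Proof.
move=> /ccont_ReIm[c1 c2].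
split; apply: continuous_compact_integrable => //; exact: segment_compact.
Qed.

Lemma ccontD a b f g : ccont a b f -> ccont a b g -> ccont a b (fun x => f x + g x).
Proof.
move=> cf cg x xab e e0; have e2 : 0 < e / 2 by rewrite divr_gt0.
have [r r0 hr] := cf x xab _ e2; have [s s0 hs] := cg x xab _ e2.
exists (Num.min r s); first by rewrite lt_min r0.
move=> y; rewrite lt_min => /andP[/hr h1 /hs h2].
rewrite (_ : _ - _ = (f y - f x) + (g y - g x)); last by ring.
by apply: le_lt_trans (cnD _ _) _; lra.
Qed.

Lemma ccontZ a b (k : C) f : ccont a b f -> ccont a b (fun x => k * f x).
Proof.
move=> cf x xab e e0.
have k0 : 0 < cn k + 1 by rewrite ltr_wpDl// cn_ge0.
have [r r0 hr] := cf x xab _ (divr_gt0 e0 k0).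
exists r => // y /hr; rewrite ltr_pdivlMr// -mulrBr cnM => h.
by apply: le_lt_trans h; rewrite mulrC mulrDr mulr1 lerDl cn_ge0.
Qed.

Lemma ccontN a b f : ccont a b f -> ccont a b (fun x => - f x).
Proof.
move=> cf x xab e e0; have [r r0 hr] := cf x xab _ e0.
by exists r => // y /hr; rewrite -opprD cnN.
Qed.

Lemma ccontB a b f g : ccont a b f -> ccont a b g -> ccont a b (fun x => f x - g x).
Proof. by move=> cf cg; apply: ccontD => //; exact: ccontN. Qed.

Lemma ccont_cst a b (k : C) : ccont a b (fun=> k).
Proof. by move=> x _ e e0; exists 1 => // y _; rewrite subrr cn0. Qed.

Lemma cintD a b f g : ccont a b f -> ccont a b g ->
  cint a b (fun x => f x + g x) = cint a b f + cint a b g.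
Proof.
move=> /ccont_integrable[f1 f2] /ccont_integrable[g1 g2]; rewrite /cint.
under [X in X +i* _]eq_Rintegral do rewrite cReD.
under [X in _ +i* X]eq_Rintegral do rewrite cImD.
by rewrite !RintegralD.
Qed.

Lemma cintZ a b (k : C) f : ccont a b f -> cint a b (fun x => k * f x) = k * cint a b f.
Proof.
move=> /ccont_integrable[f1 f2]; rewrite /cint.
under [X in X +i* _]eq_Rintegral do rewrite cReM.
under [X in _ +i* X]eq_Rintegral do rewrite cImM.
have z1 (r : R) : mu.-integrable `[a, b] (EFin \o (fun x => r * complex.Re (f x))).
  by have := @integrableZl _ _ R mu `[a, b] (measurable_itv _) r _ f1; apply: eq_integrable => // x _.
have z2 (r : R) : mu.-integrable `[a, b] (EFin \o (fun x => r * complex.Im (f x))).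
  by have := @integrableZl _ _ R mu `[a, b] (measurable_itv _) r _ f2; apply: eq_integrable => // x _.
rewrite RintegralB ?RintegralD ?RintegralZl //.
by case: k => u v; apply/eqP; rewrite eq_complex /= eqxx /= eqxx.
Qed.

Lemma cintN a b f : ccont a b f -> cint a b (fun x => - f x) = - cint a b f.
Proof.
move=> cf; rewrite -mulN1r -cintZ//; congr (cint a b _).
by apply/funext => x; rewrite mulN1r.
Qed.

Lemma cintB a b f g : ccont a b f -> ccont a b g ->
  cint a b (fun x => f x - g x) = cint a b f - cint a b g.
Proof. by move=> cf cg; rewrite cintD ?cintN//; exact: ccontN. Qed.

Lemma eq_cint a b f g : (forall x, a <= x <= b -> f x = g x) -> cint a b f = cint a b g.
Proof.
by move=> fg; congr Complex; apply: eq_Rintegral => x; rewrite inE /= in_itv /= => /fg ->.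
Qed.

Lemma cint_split a b c f : a <= b -> b <= c -> ccont a c f ->
  cint a c f = cint a b f + cint b c f.
Proof.
move=> ab bc cf; have [i1 i2] := ccont_integrable cf.
have [j1 j2] := ccont_integrable (ccontW ab (lexx c) cf).
have H (h : R -> R) : mu.-integrable `[a, c] (EFin \o h) ->
    mu.-integrable `[b, c] (EFin \o h) ->
    \int[mu]_(x in `[a, c]) h x = \int[mu]_(x in `[a, b]) h x + \int[mu]_(x in `[b, c]) h x.
  move=> ih jh; rewrite -(@Rintegral_itv_obnd_cbnd _ b (BRight c)).
    rewrite -(@Rintegral_itvB _ h (BLeft a) (BRight c) b) ?bnd_simp//.
    by rewrite addrC subrK.
  by apply: integrableS jh => // x /=; rewrite !in_itv /= => /andP[/ltW -> ->].
by rewrite /cint (H _ i1 j1) (H _ i2 j2).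
Qed.

Lemma cint_cst a b (k : C) : a <= b -> cint a b (fun=> k) = k * (b - a)%:C.
Proof.
move=> ab; rewrite /cint !Rintegral_cst//= lebesgue_measure_itv /= lte_fin.
case: ltP => [_|ba]; last first.
  have -> : b = a by apply/eqP; rewrite eq_le ba ab.
  by rewrite subrr !mulr0.
by rewrite -EFinB; case: k => u v; apply/eqP; rewrite eq_complex /= !mulr0 subr0 add0r !eqxx.
Qed.

(** Real and imaginary parts are bounded separately, at the price of the factor 2. *)
Lemma cint_le a b f (M : R) : a <= b -> ccont a b f ->
  (forall x, a <= x <= b -> cn (f x) <= M) -> cn (cint a b f) <= 2 * (M * (b - a)).
Proof.
move=> ab cf fM; have [i1 i2] := ccont_integrable cf.
have ic : mu.-integrable `[a, b] (EFin \o (fun=> M)).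
  have [] := @ccont_integrable a b (fun=> M%:C) (@ccont_cst _ _ _) => h _.
  exact: h.
have H (h : R -> R) : mu.-integrable `[a, b] (EFin \o h) ->
    (forall x, a <= x <= b -> `|h x| <= M) ->
    `|\int[mu]_(x in `[a, b]) h x| <= M * (b - a).
  move=> ih hM; apply: le_trans (le_normr_Rintegral _ ih) _ => //.
  have -> : M * (b - a) = \int[mu]_(x in `[a, b]) M.
    have := congr1 (@complex.Re R) (@cint_cst a b M%:C ab).
    by rewrite /= mul0r subr0 => ->.
  by apply: le_Rintegral => //; exact: integrable_norm.
apply: le_trans (cn_le_ReIm _) _; rewrite /= mulr_natl mulr2n; apply: lerD; apply: H => // x /fM h.
  by apply: le_trans h; exact: Re_le_cn.
by apply: le_trans h; exact: Im_le_cn.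
Qed.

End ComplexLineIntegral.

(** * Goursat's theorem on rectangles *)

Section Goursat.
Context (R : realType).
Local Open Scope complex_scope.
Local Notation C := R[i].
Variable G : R -> R -> C.
Implicit Types (a b c d u t : R).

Definition inrect a b c d u t := (a <= u <= b) && (c <= t <= d).

Definition sep_cont a b c d :=
  (forall t, c <= t <= d -> ccont a b (G^~ t)) /\ (forall u, a <= u <= b -> ccont c d (G u)).

(* The integral of G(u,t) (du + i dt) along the boundary of [a,b] x [c,d]. *)
Definition rect_int a b c d : C :=
  cint a b (fun u => G u c - G u d) + 'i * cint c d (fun t => G b t - G a t).

(** Complex differentiability in u + i t: the differential is multiplication of du + i dt by one
    number [k], which is the content of the Cauchy-Riemann equations. *)
Definition cdiff2_at u0 t0 := exists k : C, forall e : R, 0 < e ->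
  exists2 r : R, 0 < r & forall u t, `|u - u0| < r -> `|t - t0| < r ->
    cn (G u t - G u0 t0 - k * ((u - u0)%:C + 'i * (t - t0)%:C)) <= e * (`|u - u0| + `|t - t0|).

Lemma sep_contW a b c d a' b' c' d' : a <= a' -> b' <= b -> c <= c' -> d' <= d ->
  sep_cont a b c d -> sep_cont a' b' c' d'.
Proof.
move=> ha hb hc hd [h1 h2]; split=> [t /andP[t1 t2]|u /andP[u1 u2]].
  by apply: ccontW ha hb _; apply: h1; rewrite (le_trans hc t1) (le_trans t2).
by apply: ccontW hc hd _; apply: h2; rewrite (le_trans ha u1) (le_trans u2).
Qed.

Lemma rect_split_l a m b c d : a <= m -> m <= b -> c <= d -> sep_cont a b c d ->
  rect_int a b c d = rect_int a m c d + rect_int m b c d.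
Proof.
move=> am mb cd [h1 h2]; have ab := le_trans am mb.
have cc : ccont a b (fun u => G u c - G u d) by apply: ccontB; apply: h1; rewrite lexx ?cd.
rewrite /rect_int (cint_split am mb cc).
have H t e f : c <= t <= d -> a <= e -> f <= b -> ccont e f (G^~ t).
  by move=> tb ae fb; apply: ccontW ae fb _; exact: h1.
rewrite !cintB; try by [apply: h2; rewrite ?lexx ?ab ?am ?mb | apply: H; rewrite ?lexx ?cd].
by ring.
Qed.

Lemma rect_split_r a b c m d : a <= b -> c <= m -> m <= d -> sep_cont a b c d ->
  rect_int a b c d = rect_int a b c m + rect_int a b m d.
Proof.
move=> ab cm md [h1 h2]; have cd := le_trans cm md.
have cc : ccont c d (fun t => G b t - G a t) by apply: ccontB; apply: h2; rewrite lexx ?ab.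
rewrite /rect_int (cint_split cm md cc).
have H u e f : a <= u <= b -> c <= e -> f <= d -> ccont e f (G u).
  by move=> ub ce fd; apply: ccontW ce fd _; exact: h2.
rewrite !cintB; try by [apply: h1; rewrite ?lexx ?cd ?cm ?md | apply: H; rewrite ?lexx ?ab].
by ring.
Qed.

(** The boundary integral of the affine function k + l (u + i t) is 0, so only the deviation of [G]
    from it counts. Opposite sides are paired, hence 2 M, and [cint_le] doubles this. *)
Lemma rect_int_le a b c d (k l : C) (M : R) : a <= b -> c <= d -> sep_cont a b c d ->
  (forall u t, inrect a b c d u t -> cn (G u t - k - l * (u%:C + 'i * t%:C)) <= M) ->
  cn (rect_int a b c d) <= 4 * (M * ((b - a) + (d - c))).
Proof.
move=> ab cd [h1 h2] hM.
have c1 : ccont a b (fun u => G u c - G u d) by apply: ccontB; apply: h1; rewrite lexx ?cd.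
have c2 : ccont c d (fun t => G b t - G a t) by apply: ccontB; apply: h2; rewrite lexx ?ab.
set k1 := l * ('i * (c - d)%:C); set k2 := l * (b - a)%:C.
have e1 : cint a b (fun u => G u c - G u d - k1) = cint a b (fun u => G u c - G u d) - k1 * (b - a)%:C.
  by rewrite (cintB c1 (@ccont_cst _ a b k1)) cint_cst.
have e2 : cint c d (fun t => G b t - G a t - k2) = cint c d (fun t => G b t - G a t) - k2 * (d - c)%:C.
  by rewrite (cintB c2 (@ccont_cst _ c d k2)) cint_cst.
have -> : rect_int a b c d = cint a b (fun u => G u c - G u d - k1) +
    'i * cint c d (fun t => G b t - G a t - k2).
  rewrite e1 e2 /rect_int /k1 /k2 -(opprB d c) rmorphN /=; ring.
have b1 : cn (cint a b (fun u => G u c - G u d - k1)) <= 2 * (2 * M * (b - a)).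
  apply: cint_le => //; first by apply: ccontB => //; exact: ccont_cst.
  move=> u ub; rewrite (_ : _ - _ = (G u c - k - l * (u%:C + 'i * c%:C)) -
      (G u d - k - l * (u%:C + 'i * d%:C))); last by rewrite /k1 rmorphB /=; ring.
  apply: le_trans (cnB _ _) _; rewrite mulr_natl mulr2n.
  by apply: lerD; apply: hM; rewrite /inrect ub lexx ?cd.
have b2 : cn (cint c d (fun t => G b t - G a t - k2)) <= 2 * (2 * M * (d - c)).
  apply: cint_le => //; first by apply: ccontB => //; exact: ccont_cst.
  move=> t tb; rewrite (_ : _ - _ = (G b t - k - l * (b%:C + 'i * t%:C)) -
      (G a t - k - l * (a%:C + 'i * t%:C))); last by rewrite /k2 rmorphB /=; ring.
  apply: le_trans (cnB _ _) _; rewrite mulr_natl mulr2n.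
  by apply: lerD; apply: hM; rewrite /inrect tb lexx ?ab.
apply: le_trans (cnD _ _) _; rewrite cnM cn_i mul1r.
by apply: le_trans (lerD b1 b2) _; lra.
Qed.

Definition rect := (R * R * R * R)%type.
Definition rint (Q : rect) := let: (a, b, c, d) := Q in rect_int a b c d.

(** Keeps a half that carries at least half of the integral in modulus. A bisection in each
    direction makes one step of the subdivision. *)
Definition half_l (Q : rect) : rect := let: (a, b, c, d) := Q in
  if cn (rect_int a b c d) <= 2 * cn (rect_int a ((a + b) / 2) c d)
  then (a, (a + b) / 2, c, d) else ((a + b) / 2, b, c, d).

Definition half_r (Q : rect) : rect := let: (a, b, c, d) := Q in
  if cn (rect_int a b c d) <= 2 * cn (rect_int a b c ((c + d) / 2))
  then (a, b, c, (c + d) / 2) else (a, b, (c + d) / 2, d).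

Definition quarter Q := half_r (half_l Q).

Definition subrect (Q Q' : rect) := let: (a, b, c, d) := Q in let: (a', b', c', d') := Q' in
  [/\ a <= a', a' <= b', b' <= b & [/\ c <= c', c' <= d' & d' <= d]].

Definition sep_contr (Q : rect) := sep_cont Q.1.1.1 Q.1.1.2 Q.1.2 Q.2.

Let half_aux (x y z : R) : z <= x + y -> 2 * x < z -> z <= 2 * y.
Proof. by lra. Qed.

Let midpoint (a b : R) : a <= b -> [/\ a <= (a + b) / 2, (a + b) / 2 <= b,
  (a + b) / 2 - a = (b - a) / 2 & b - (a + b) / 2 = (b - a) / 2].
Proof. by move=> ab; split; lra. Qed.

Lemma quarterP Q : subrect Q Q -> sep_contr Q ->
  subrect Q (quarter Q) /\ cn (rint Q) <= 4 * cn (rint (quarter Q)) /\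
  ((quarter Q).1.1.2 - (quarter Q).1.1.1 = (Q.1.1.2 - Q.1.1.1) / 2 /\
   (quarter Q).2 - (quarter Q).1.2 = (Q.2 - Q.1.2) / 2).
Proof.
case: Q => [[[a b] c] d] [_ ab _ [_ cd _]] sc; rewrite /quarter.
have [am mb ma bm] := midpoint ab; have [ck kd kc dk] := midpoint cd.
have : exists a' b', [/\ half_l (a, b, c, d) = (a', b', c, d), [/\ a <= a', a' <= b' & b' <= b],
    b' - a' = (b - a) / 2 & cn (rect_int a b c d) <= 2 * cn (rect_int a' b' c d)].
  rewrite /half_l; case: ifPn => h; first by exists a, ((a + b) / 2).
  exists ((a + b) / 2), b; split=> //; move: h; rewrite -ltNge; apply: half_aux.
  by rewrite (rect_split_l am mb cd sc) cnD.
move=> [a' [b' [-> [aa ab' bb] w1 n1]]].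
have sc' : sep_cont a' b' c d by apply: sep_contW sc.
have : exists c' d', [/\ half_r (a', b', c, d) = (a', b', c', d'), [/\ c <= c', c' <= d' & d' <= d],
    d' - c' = (d - c) / 2 & cn (rect_int a' b' c d) <= 2 * cn (rect_int a' b' c' d')].
  rewrite /half_r; case: ifPn => h; first by exists c, ((c + d) / 2).
  exists ((c + d) / 2), d; split=> //; move: h; rewrite -ltNge; apply: half_aux.
  by rewrite (rect_split_r ab' ck kd sc') cnD.
move=> [c' [d' [-> [cc cd' dd] w2 n2]]] /=; split=> //; split=> //.
by clear -n1 n2; lra.
Qed.

Lemma nested_point (A B : nat -> R) :
  (forall k, A k <= A k.+1) -> (forall k, B k.+1 <= B k) -> (forall k, A k <= B k) ->
  exists x, forall k, A k <= x <= B k.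
Proof.
move=> hA hB hAB.
have mA i j : (i <= j)%N -> A i <= A j.
  by move=> /subnK <-; elim: (j - i)%N => // m IH; exact: le_trans IH (hA _).
have mB i j : (i <= j)%N -> B j <= B i.
  by move=> /subnK <-; elim: (j - i)%N => // m IH; exact: le_trans (hB _) IH.
have AB i j : A i <= B j.
  apply: le_trans (mA _ _ (leq_maxl i j)) _.
  by apply: le_trans (hAB _) (mB _ _ (leq_maxr i j)).
exists (sup (range A)) => k; apply/andP; split.
  apply: ub_le_sup; last by exists k.
  by exists (B 0) => _ [i _ <-].
apply: ge_sup; first by exists (A 0); exists 0%N.
by move=> _ [i _ <-].
Qed.

Theorem goursat a b c d : a <= b -> c <= d -> sep_cont a b c d ->
  (forall u t, inrect a b c d u t -> cdiff2_at u t) -> rect_int a b c d = 0.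
Proof.
move=> ab cd sc hd; apply/eqP; rewrite -cn_eq0; apply/negPn/negP => n0.
have K0 : 0 < cn (rect_int a b c d) by rewrite lt_neqAle eq_sym n0 cn_ge0.
set K := cn _ in K0.
pose Q k := iter k quarter (a, b, c, d).
have QP k : [/\ subrect (a, b, c, d) (Q k), K <= 4 ^+ k * cn (rint (Q k)),
   (Q k).1.1.2 - (Q k).1.1.1 = (b - a) / 2 ^+ k & (Q k).2 - (Q k).1.2 = (d - c) / 2 ^+ k].
  elim: k => [|k [s1 s2 s3 s4]]; first by rewrite /= !expr0 mul1r !divr1.
  have ss : subrect (Q k) (Q k).
    by move: s1; case: (Q k) => [[[? ?] ?] ?] [] ? ? ? [] ? ? ?.
  have sk : sep_contr (Q k).
    by move: s1; rewrite /sep_contr; case: (Q k) => [[[? ?] ?] ?] [] h1 h2 h3 [] h4 h5 h6; apply: sep_contW sc.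
  have [q1 [q2 [q3 q4]]] := quarterP ss sk.
  rewrite -[Q k.+1]/(quarter (Q k)) q3 q4 s3 s4; split.
  - move: s1 q1; case: (Q k) => [[[? ?] ?] ?] [] h1 h2 h3 [] h4 h5 h6.
    case: (quarter _) => [[[? ?] ?] ?] [] h1' h2' h3' [] h4' h5' h6'.
    split; [exact: le_trans h1'|by []|exact: le_trans h3|].
    by split; [exact: le_trans h4'|by []|exact: le_trans h6].
  - apply: le_trans s2 _; rewrite exprSr -mulrA ler_wpM2l// exprn_ge0//.
  - by rewrite exprSr invfM; ring.
  - by rewrite exprSr invfM; ring.
have Qs k : subrect (Q k) (Q k.+1).
  have [s1 _ _ _] := QP k.
  have ss : subrect (Q k) (Q k).
    by move: s1; case: (Q k) => [[[? ?] ?] ?] [] ? ? ? [] ? ? ?.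
  have sk : sep_contr (Q k).
    by move: s1; rewrite /sep_contr; case: (Q k) => [[[? ?] ?] ?] [] h1 h2 h3 [] h4 h5 h6; apply: sep_contW sc.
  by have [] := quarterP ss sk.
have [x hx] : exists x, forall k, (Q k).1.1.1 <= x <= (Q k).1.1.2.
  apply: nested_point => k.
  - by have := Qs k; case: (Q k) => [[[? ?] ?] ?]; case: (Q k.+1) => [[[? ?] ?] ?] [].
  - by have := Qs k; case: (Q k) => [[[? ?] ?] ?]; case: (Q k.+1) => [[[? ?] ?] ?] [].
  - by have [] := QP k; case: (Q k) => [[[? ?] ?] ?] [].
have [y hy] : exists y, forall k, (Q k).1.2 <= y <= (Q k).2.
  apply: nested_point => k.
  - by have := Qs k; case: (Q k) => [[[? ?] ?] ?]; case: (Q k.+1) => [[[? ?] ?] ?] [] _ _ _ [].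
  - by have := Qs k; case: (Q k) => [[[? ?] ?] ?]; case: (Q k.+1) => [[[? ?] ?] ?] [] _ _ _ [].
  - by have [] := QP k; case: (Q k) => [[[? ?] ?] ?] [] _ _ _ [].
have [|l hl] := hd x y; first by rewrite /inrect (hx 0%N) (hy 0%N).
set w := (b - a) + (d - c).
have w0 : 0 <= w by rewrite /w; lra.
(* With the error rate K / (8 (w^2 + 1)), the factor 4^k cancels the two factors 2^-k and leaves the
   bound K w^2 / (2 (w^2 + 1)), which is less than K. *)
have den0 : 0 < 8 * (w ^+ 2 + 1) by rewrite mulr_gt0// ltr_wpDl// sqr_ge0.
have [r r0 hr] := hl _ (divr_gt0 K0 den0).
have [k hk] : exists k, w / 2 ^+ k < r.
  exists (Num.truncn (w / r)).+1; rewrite ltr_pdivrMr ?exprn_gt0// mulrC -ltr_pdivrMr//.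
  apply: lt_trans (truncnS_gt _) _; rewrite -natrX ltr_nat; exact: ltn_expl.
have [s1 s2 s3 s4] := QP k; have hxk := hx k; have hyk := hy k.
move: s1 s2 s3 s4 hxk hyk; case: (Q k) => [[[a' b'] c'] d'] /= [h1 h2 h3 [h4 h5 h6]] s2 s3 s4.
move=> /andP[x1 x2] /andP[y1 y2].
have W : (b' - a') + (d' - c') = w / 2 ^+ k by rewrite s3 s4 -mulrDl.
have bnd u t : inrect a' b' c' d' u t -> cn (G u t - (G x y - l * (x%:C + 'i * y%:C)) -
    l * (u%:C + 'i * t%:C)) <= K / (8 * (w ^+ 2 + 1)) * (w / 2 ^+ k).
  move=> /andP[/andP[u1 u2] /andP[t1 t2]].
  have ux : `|u - x| <= b' - a' by rewrite ler_norml; apply/andP; split; lra.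
  have ty : `|t - y| <= d' - c' by rewrite ler_norml; apply/andP; split; lra.
  have := hr u t; rewrite (_ : _ - _ - _ = G u t - (G x y - l * (x%:C + 'i * y%:C)) -
     l * (u%:C + 'i * t%:C)); last by rewrite !rmorphB /=; ring.
  move=> h; apply: le_trans (h _ _) _; try by apply: le_lt_trans hk; lra.
  by rewrite ler_wpM2l ?divr_ge0 ?(ltW K0) ?(ltW den0)//; lra.
have := rect_int_le h2 h5 (sep_contW h1 h3 h4 h6 sc) bnd.
rewrite W => H.
have : K <= 4 ^+ k * (4 * (K / (8 * (w ^+ 2 + 1)) * (w / 2 ^+ k) * (w / 2 ^+ k))).
  by apply: le_trans s2 _; rewrite ler_wpM2l// exprn_ge0.
have -> : 4 ^+ k * (4 * (K / (8 * (w ^+ 2 + 1)) * (w / 2 ^+ k) * (w / 2 ^+ k))) =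
   K * (w ^+ 2 / (2 * (w ^+ 2 + 1))).
  have -> : (4 : R) = 2 * 2 by rewrite -natrM.
  have p2 : (2 : R) ^+ k != 0 by rewrite expf_neq0.
  have wn : w ^+ 2 + 1 != 0 by rewrite gt_eqF// ltr_wpDl// sqr_ge0.
  by rewrite exprMn; field; rewrite wn p2.
apply/negP; rewrite -ltNge -[ltRHS]mulr1 ltr_pM2l// ltr_pdivrMr ?mul1r.
  by have := sqr_ge0 w; lra.
by rewrite mulr_gt0// ltr_wpDl// sqr_ge0.
Qed.

End Goursat.

(** * Goursat's theorem with one exceptional point *)

Section GoursatException.
Context (R : realType).
Local Open Scope complex_scope.
Local Notation C := R[i].
Implicit Types (a b c d u t : R).

(** A small square around the point is cut out: the four remaining rectangles contribute 0, and the
    square a multiple of its side. The exception serves the quotient (g z - g rho) / (z - rho) of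
    Cauchy's formula, known to be continuous at rho but not differentiable. *)
Lemma goursat_exception (G : R -> R -> C) a b c d p q :
  a < p < b -> c < q < d -> sep_cont G a b c d ->
  (forall u t, inrect a b c d u t -> (u, t) != (p, q) -> cdiff2_at G u t) ->
  (exists M r : R, 0 < r /\ forall u t, `|u - p| < r -> `|t - q| < r -> cn (G u t) <= M) ->
  rect_int G a b c d = 0.
Proof.
move=> /andP[ap pb] /andP[cq qd] sc hd [M [r [r0 hM]]].
apply: cn_small => e e0.
pose M1 := `|M| + 1; have M10 : 0 < M1 by rewrite /M1 ltr_wpDl.
(* For a square of side 2 s and zero affine part, [rect_int_le] gives 4 (M1 (2 s + 2 s)) = 16 M1
   s. *)
pose s := Num.min (Num.min (r / 2) (e / (16 * M1))) (Num.min (Num.min (p - a) (b - p)) (Num.min (q - c) (d - q))).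
have s0 : 0 < s by rewrite /s !lt_min !divr_gt0 ?mulr_gt0// !subr_gt0 ap pb cq qd.
have [sr [se [sa [sb [sqc sd]]]]] : s <= r / 2 /\ s <= e / (16 * M1) /\ s <= p - a /\ s <= b - p /\
    s <= q - c /\ s <= d - q.
  by rewrite /s !ge_min !lexx ?orbT.
have sM : 16 * (M1 * s) <= e.
  by rewrite mulrA mulrC -ler_pdivlMr// mulr_gt0.
have Z a' b' c' d' : a <= a' -> a' <= b' -> b' <= b -> c <= c' -> c' <= d' -> d' <= d ->
    (b' < p) || (p < a') || (d' < q) || (q < c') -> rect_int G a' b' c' d' = 0.
  move=> h1 h2 h3 h4 h5 h6 hh; apply: goursat => //; first exact: sep_contW sc.
  move=> u t /andP[/andP[u1 u2] /andP[t1 t2]]; apply: hd.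
    by rewrite /inrect (le_trans h1 u1) (le_trans u2 h3) (le_trans h4 t1) (le_trans t2 h6).
  apply/eqP => -[up tq]; move: u1 u2 t1 t2 hh; rewrite up tq => u1 u2 t1 t2.
  by rewrite !ltNge u1 u2 t1 t2.
have MM1 : M <= M1 by rewrite /M1; apply: le_trans (ler_norm _) _; rewrite lerDl.
clear hd; clearbody s M1.
have [a1 a2 a3] : [/\ a <= p - s, p - s <= p + s & p + s <= b] by split; lra.
have [c1 c2 c3] : [/\ c <= q - s, q - s <= q + s & q + s <= d] by split; lra.
have cd : c <= d by lra.
have a23 := le_trans a2 a3; have c23 := le_trans c2 c3.
have ps : p - s < p by lra.
have ps' : p < p + s by lra.
have qs : q - s < q by lra.
have qs' : q < q + s by lra.
rewrite (rect_split_l a1 a23 cd sc) (rect_split_l a2 a3 cd (sep_contW a1 (lexx b) (lexx c) (lexx d) sc)).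
have sc2 := sep_contW a1 a3 (lexx c) (lexx d) sc.
rewrite (rect_split_r a2 c1 c23 sc2).
rewrite (rect_split_r a2 c2 c3 (sep_contW (lexx _) (lexx _) c1 (lexx d) sc2)).
rewrite (Z a (p - s) c d) ?lexx ?ps ?a1 ?(le_trans a2)//.
rewrite (Z (p + s) b c d) ?lexx ?ps' ?orbT ?(le_trans a1)//.
rewrite (Z (p - s) (p + s) c (q - s)) ?lexx ?qs ?orbT ?(le_trans c2)//.
rewrite (Z (p - s) (p + s) (q + s) d) ?lexx ?qs' ?orbT ?(le_trans c1)//.
rewrite !add0r !addr0.
have := @rect_int_le _ G (p - s) (p + s) (q - s) (q + s) 0 0 M1 a2 c2
  (sep_contW (lexx _) (lexx _) c1 c3 sc2).
move=> H; apply: le_trans (H _) _.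
  move=> u t /andP[/andP[u1 u2] /andP[t1 t2]].
  rewrite subr0 mul0r subr0; apply: le_trans (hM _ _ _ _) _.
  - by rewrite ltr_norml; apply/andP; split; lra.
  - by rewrite ltr_norml; apply/andP; split; lra.
  - exact: MM1.
by lra.
Qed.

End GoursatException.

(** * Complex derivatives in one variable *)

Section ComplexDerivative.
Context (R : realType).
Local Open Scope complex_scope.
Local Notation C := R[i].
Implicit Types (f g : C -> C) (z w k l : C).

Definition cder f z k := forall e : R, 0 < e -> exists2 r : R, 0 < r &
  forall w, cn (w - z) < r -> cn (f w - f z - k * (w - z)) <= e * cn (w - z).

Definition ccontz f z := forall e : R, 0 < e -> exists2 r : R, 0 < r &
  forall w, cn (w - z) < r -> cn (f w - f z) <= e.

Lemma cder_lip f z k : cder f z k -> exists2 r : R, 0 < r &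
  forall w, cn (w - z) < r -> cn (f w - f z) <= (cn k + 1) * cn (w - z).
Proof.
move=> h; have [r r0 hr] := h 1 ltr01; exists r => // w /hr.
rewrite mul1r mulrDl mul1r -cnM => hw.
rewrite (_ : f w - f z = k * (w - z) + (f w - f z - k * (w - z))); last by ring.
by apply: le_trans (cnD _ _) _; rewrite lerD2l.
Qed.

Lemma cder_cont f z k : cder f z k -> ccontz f z.
Proof.
move=> /cder_lip[r r0 hr] e e0.
have k0 : 0 < cn k + 1 by rewrite ltr_wpDl// cn_ge0.
exists (Num.min r (e / (cn k + 1))); first by rewrite lt_min r0 divr_gt0.
move=> w; rewrite lt_min => /andP[/hr h1 h2]; apply: le_trans h1 _.
by rewrite mulrC -ler_pdivlMr// ltW.
Qed.

Lemma cder_cst k z : cder (fun=> k) z 0.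
Proof. by move=> e e0; exists 1 => // w _; rewrite subrr mul0r subr0 cn0 mulr_ge0 ?cn_ge0 ?ltW. Qed.

Lemma cder_id z : cder id z 1.
Proof. by move=> e e0; exists 1 => // w _; rewrite mul1r subrr cn0 mulr_ge0 ?cn_ge0 ?ltW. Qed.

Lemma cderD f g z k l : cder f z k -> cder g z l -> cder (fun x => f x + g x) z (k + l).
Proof.
move=> hf hg e e0; have e2 : 0 < e / 2 by rewrite divr_gt0.
have [r r0 hr] := hf _ e2; have [s s0 hs] := hg _ e2.
exists (Num.min r s); first by rewrite lt_min r0.
move=> w; rewrite lt_min => /andP[/hr h1 /hs h2].
rewrite (_ : _ - _ - _ = (f w - f z - k * (w - z)) + (g w - g z - l * (w - z))); last by ring.
by apply: le_trans (cnD _ _) _; lra.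
Qed.

Lemma cderM f g z k l : cder f z k -> cder g z l ->
  cder (fun x => f x * g x) z (k * g z + f z * l).
Proof.
move=> hf hg e e0.
have [r1 r10 h1] := cder_lip hf.
have gz0 : 0 < cn (g z) + 1 by rewrite ltr_wpDl// cn_ge0.
have fz0 : 0 < cn (f z) + 1 by rewrite ltr_wpDl// cn_ge0.
have k0 : 0 < cn k + 1 by rewrite ltr_wpDl// cn_ge0.
have l0 : 0 < cn l + 1 by rewrite ltr_wpDl// cn_ge0.
have [r2 r20 h2] := hf _ (divr_gt0 (divr_gt0 e0 (ltr0n _ 3)) gz0).
have [r3 r30 h3] := hg _ (divr_gt0 (divr_gt0 e0 (ltr0n _ 3)) fz0).
have [r4 r40 h4] := cder_cont hg (divr_gt0 (divr_gt0 e0 (ltr0n _ 3)) k0).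
exists (Num.min (Num.min r1 r2) (Num.min r3 r4)); first by rewrite !lt_min r10 r20 r30 r40.
move=> w; rewrite !lt_min => /andP[/andP[/h1 q1 /h2 q2] /andP[/h3 q3 /h4 q4]].
rewrite (_ : _ - _ - _ = (f w - f z) * (g w - g z) + (f w - f z - k * (w - z)) * g z +
   f z * (g w - g z - l * (w - z))); last by ring.
have a1 : cn ((f w - f z) * (g w - g z)) <= e / 3 * cn (w - z).
  rewrite cnM; apply: le_trans (ler_pM (cn_ge0 _) (cn_ge0 _) q1 q4) _.
  by rewrite le_eqVlt; apply/orP; left; apply/eqP; field; rewrite gt_eqF.
have a2 : cn ((f w - f z - k * (w - z)) * g z) <= e / 3 * cn (w - z).
  rewrite cnM; apply: le_trans (ler_pM (cn_ge0 _) (cn_ge0 _) q2 (_ : _ <= cn (g z) + 1)) _.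
    by rewrite lerDl.
  by rewrite le_eqVlt; apply/orP; left; apply/eqP; field; rewrite gt_eqF.
have a3 : cn (f z * (g w - g z - l * (w - z))) <= e / 3 * cn (w - z).
  rewrite cnM; apply: le_trans (ler_pM (cn_ge0 _) (cn_ge0 _) (_ : _ <= cn (f z) + 1) q3) _.
    by rewrite lerDl.
  by rewrite le_eqVlt; apply/orP; left; apply/eqP; field; rewrite gt_eqF.
apply: le_trans (cnD _ _) _; apply: le_trans (lerD (cnD _ _) (lexx _)) _.
by apply: le_trans (lerD (lerD a1 a2) a3) _; lra.
Qed.

Lemma cderX f z k n : cder f z k -> exists l, cder (fun x => f x ^+ n) z l.
Proof.
move=> hf; elim: n => [|n [l hl]]; first by exists 0; exact: cder_cst.
by exists (k * f z ^+ n + f z * l); under eq_fun do rewrite exprS; exact: cderM.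
Qed.

Lemma cderV f z k : f z != 0 -> cder f z k -> cder (fun x => (f x)^-1) z (- k / f z ^+ 2).
Proof.
move=> fz0 hf e e0; have F0 : 0 < cn (f z) by rewrite cn_gt0.
have [r1 r10 h1] := cder_lip hf.
have [r2 r20 h2] := cder_cont hf (divr_gt0 F0 (ltr0n _ 2)).
have k0 : 0 < cn k + 1 by rewrite ltr_wpDl// cn_ge0.
(* This radius makes the quadratic part of the error, at most ((|k| + 1) |w - z|)^2 divided by |f
   z|^2 |f z| / 2, no larger than e/2 |w - z|. *)
have c1 : 0 < e / 2 * cn (f z) ^+ 3 / 2 / (cn k + 1) ^+ 2.
  by rewrite !divr_gt0 ?mulr_gt0 ?exprn_gt0 ?divr_gt0.
have [r3 r30 h3] := hf _ (mulr_gt0 (divr_gt0 e0 (ltr0n _ 2)) (exprn_gt0 2 F0)).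
exists (Num.min (Num.min r1 r2) (Num.min r3 (e / 2 * cn (f z) ^+ 3 / 2 / (cn k + 1) ^+ 2))).
  by rewrite !lt_min r10 r20 r30 c1.
move=> w; rewrite !lt_min => /andP[/andP[/h1 q1 /h2 q2] /andP[/h3 q3 q4]].
have fw : cn (f z) / 2 <= cn (f w).
  by have := cn_dist (f z) (f w) 0; rewrite !subr0 -(cnN (f z - f w)) opprB; lra.
have W0 : 0 < cn (f w) by apply: lt_le_trans fw; rewrite divr_gt0.
have fw0 : f w != 0 by rewrite -cn_gt0.
rewrite (_ : _ - _ - _ = (f w - f z) ^+ 2 / (f z ^+ 2 * f w) -
  (f w - f z - k * (w - z)) / f z ^+ 2); last by field; rewrite fz0.
have a1 : cn ((f w - f z) ^+ 2 / (f z ^+ 2 * f w)) <= e / 2 * cn (w - z).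
  rewrite cnM cnV cnX cnM cnX ler_pdivrMr ?mulr_gt0 ?exprn_gt0//.
  apply: le_trans (_ : ((cn k + 1) * cn (w - z)) ^+ 2 <= _).
    by rewrite ler_sqr ?nnegrE ?cn_ge0// mulr_ge0 ?cn_ge0// ltW.
  apply: le_trans (_ : e / 2 * cn (w - z) * (cn (f z) ^+ 2 * (cn (f z) / 2)) <= _); last first.
    apply: ler_wpM2l; first by rewrite mulr_ge0 ?cn_ge0// divr_ge0// ltW.
    by apply: ler_wpM2l => //; rewrite exprn_ge0// cn_ge0.
  move: q4; rewrite ltr_pdivlMr ?exprn_gt0// => /ltW q4.
  rewrite exprMn; have := ler_wpM2r (cn_ge0 (w - z)) q4.
  by congr (_ <= _); [ring|field].
have a2 : cn ((f w - f z - k * (w - z)) / f z ^+ 2) <= e / 2 * cn (w - z).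
  rewrite cnM cnV cnX ler_pdivrMr ?exprn_gt0//.
  by apply: le_trans q3 _; rewrite le_eqVlt; apply/orP; left; apply/eqP; ring.
by apply: le_trans (cnB _ _) _; lra.
Qed.

Lemma cder_near f g z k (r : R) : 0 < r -> (forall w, cn (w - z) < r -> f w = g w) ->
  cder f z k -> cder g z k.
Proof.
move=> r0 fg hf e e0; have [s s0 hs] := hf _ e0.
exists (Num.min r s); first by rewrite lt_min r0.
move=> w; rewrite lt_min => /andP[h1 /hs]; rewrite !fg// subrr cn0//.
Qed.

Lemma ccontzM f g z : ccontz f z -> ccontz g z -> ccontz (fun x => f x * g x) z.
Proof.
move=> hf hg e e0.
have gz0 : 0 < cn (g z) + 1 by rewrite ltr_wpDl// cn_ge0.
have fz0 : 0 < cn (f z) + 1 by rewrite ltr_wpDl// cn_ge0.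
have [r1 r10 h1] := hf _ (divr_gt0 (divr_gt0 e0 (ltr0n _ 3)) gz0).
have [r2 r20 h2] := hg _ (divr_gt0 (divr_gt0 e0 (ltr0n _ 3)) fz0).
have [r3 r30 h3] := hf _ ltr01.
have [r4 r40 h4] := hg _ (divr_gt0 e0 (ltr0n _ 3)).
exists (Num.min (Num.min r1 r2) (Num.min r3 r4)); first by rewrite !lt_min r10 r20 r30 r40.
move=> w; rewrite !lt_min => /andP[/andP[/h1 q1 /h2 q2] /andP[/h3 q3 /h4 q4]].
rewrite (_ : _ - _ = (f w - f z) * (g w - g z) + (f w - f z) * g z + f z * (g w - g z)); last by ring.
have a1 : cn ((f w - f z) * (g w - g z)) <= e / 3.
  by rewrite cnM; apply: le_trans (ler_pM (cn_ge0 _) (cn_ge0 _) q3 q4) _; rewrite mul1r.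
have a2 : cn ((f w - f z) * g z) <= e / 3.
  rewrite cnM; apply: le_trans (ler_pM (cn_ge0 _) (cn_ge0 _) q1 (_ : _ <= cn (g z) + 1)) _.
    by rewrite lerDl.
  by rewrite divfK// gt_eqF.
have a3 : cn (f z * (g w - g z)) <= e / 3.
  rewrite cnM; apply: le_trans (ler_pM (cn_ge0 _) (cn_ge0 _) (_ : _ <= cn (f z) + 1) q2) _.
    by rewrite lerDl.
  by rewrite mulrC divfK// gt_eqF.
apply: le_trans (cnD _ _) _; apply: le_trans (lerD (cnD _ _) (lexx _)) _.
by apply: le_trans (lerD (lerD a1 a2) a3) _; lra.
Qed.

End ComplexDerivative.

(** * Cauchy's theorem and formula on circles *)

Section PolarCoordinates.
Context (R : realType).
Local Open Scope complex_scope.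
Local Notation C := R[i].
Implicit Types (u t : R) (z w k l : C) (h g : C -> C).

Lemma is_derive_eps (f : R -> R) (x l : R) : is_derive x 1 f l ->
  forall e : R, 0 < e -> exists2 r : R, 0 < r &
    forall y, `|y| < r -> `|f (x + y) - f x - l * y| <= e * `|y|.
Proof.
move=> [df dl] e e0.
have : (fun y : R => y^-1 *: (f (y *: (1 : R) + x) - f x)) @ 0^' --> l.
  by rewrite -dl; exact: df.
move/cvgrPdist_le => /(_ _ e0) /nbhs_ballP[r /= r0 hr].
exists r => // y yr; have [->|y0] := eqVneq y 0.
  by rewrite addr0 subrr mulr0 subr0 normr0 mulr0.
have := hr y; rewrite /ball /= sub0r normrN => /(_ yr y0).
rewrite distrC -[X in `|_ - X|](mulfK y0) -[_^-1 *: _]/(_^-1 * _) [_^-1 * _]mulrC -mulrBl normrM normfV.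
by rewrite ler_pdivrMr ?normr_gt0// -[y *: 1]/(y * 1) mulr1 (addrC y).
Qed.

Definition cis t : C := cos t +i* sin t.

Lemma cis0 : cis 0 = 1. Proof. by rewrite /cis cos0 sin0. Qed.

Lemma cisD s t : cis (s + t) = cis s * cis t.
Proof.
by rewrite /cis cosD sinD; apply/eqP; rewrite eq_complex /= !eqxx /= addrC mulrC [X in _ + X]mulrC eqxx.
Qed.

Lemma csq_cis t : csq (cis t) = 1. Proof. by rewrite /csq /= cos2Dsin2. Qed.

Lemma cn_cis t : cn (cis t) = 1. Proof. by rewrite /cn csq_cis sqrtr1. Qed.

Lemma cisNpi : cis (- pi) = cis pi.
Proof. by rewrite /cis cosN sinN sinpi oppr0. Qed.

Lemma cis_eq1 t : - pi < t < pi -> cis t = 1 -> t = 0.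
Proof.
move=> /andP[t1 t2] [ct _].
have h (s : R) : 0 <= s <= pi -> cos s = 1 -> s = 0.
  move=> sb; rewrite -cos0 => /cos_inj; apply; rewrite in_itv //=.
  by rewrite lexx pi_ge0.
have [t0|t0] := leP 0 t; first by apply: h => //; rewrite t0 ltW.
by apply/eqP; rewrite -oppr_eq0 (h (- t))// ?cosN//; apply/andP; split; lra.
Qed.

(** exp (u + i t): it maps a rectangle with t in [-pi, pi] onto an annulus, so that Goursat's
    theorem on rectangles compares the two boundary circles. *)
Definition epol u t : C := (expR u)%:C * cis t.

Lemma epolD u u' t t' : epol (u + u') (t + t') = epol u t * epol u' t'.
Proof. by rewrite /epol expRD cisD rmorphM /=; ring. Qed.

Lemma cn_epol u t : cn (epol u t) = expR u.
Proof. by rewrite cnM cn_real cn_cis mulr1 gtr0_norm ?expR_gt0. Qed.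

Lemma epol_der (e : R) : 0 < e -> exists2 r : R, 0 < r & forall u t, `|u| < r -> `|t| < r ->
  cn (epol u t - 1 - (u%:C + 'i * t%:C)) <= e * (`|u| + `|t|).
Proof.
move=> e0; have e8 : 0 < e / 8 by rewrite divr_gt0.
have [r1 r10 h1] := is_derive_eps (is_derive_expR (0 : R)) e8.
have [r2 r20 h2] := is_derive_eps (is_derive_cos (0 : R)) e8.
have [r3 r30 h3] := is_derive_eps (is_derive_sin (0 : R)) e8.
have [r4 r40 h4] := is_derive_eps (is_derive_expR (0 : R)) ltr01.
exists (Num.min (Num.min r1 r2) (Num.min (Num.min r3 r4) (Num.min (e / 8) (1 / 2)))).
  by rewrite !lt_min r10 r20 r30 r40 e8 divr_gt0.
move=> u t; rewrite !lt_min => /andP[/andP[/h1 a1 _] /andP[/andP[_ /h4 a4] /andP[ue u2]]].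
move=> /andP[/andP[_ /h2 a2] /andP[/andP[/h3 a3 _] /andP[te t2]]].
move: a1 a2 a3 a4; rewrite !add0r expR0 cos0 sin0 oppr0 !mul0r !mul1r !subr0 ?addr0 => a1 a2 a3 a4.
have x2 : `|expR u| <= 2.
  rewrite (_ : expR u = (expR u - 1 - u) + (1 + u)); last by ring.
  apply: le_trans (ler_normD _ _) _; apply: le_trans (lerD a4 (ler_normD _ _)) _.
  by rewrite normr1; lra.
have x1 : `|expR u - 1| <= 2 * `|u|.
  rewrite (_ : expR u - 1 = (expR u - 1 - u) + u); last by ring.
  by apply: le_trans (ler_normD _ _) _; lra.
apply: le_trans (cn_le_ReIm _) _.
have -> : complex.Re (epol u t - 1 - (u%:C + 'i * t%:C)) = expR u * (cos t - 1) + (expR u - 1 - u).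
  by rewrite /epol /cis /=; ring.
have -> : complex.Im (epol u t - 1 - (u%:C + 'i * t%:C)) = expR u * (sin t - t) + (expR u - 1) * t.
  by rewrite /epol /cis /=; ring.
have b1 : `|expR u * (cos t - 1) + (expR u - 1 - u)| <= 2 * (e / 8 * `|t|) + e / 8 * `|u|.
  by apply: le_trans (ler_normD _ _) _; rewrite normrM; apply: lerD => //; exact: ler_pM.
have b2 : `|expR u * (sin t - t) + (expR u - 1) * t| <= 2 * (e / 8 * `|t|) + 2 * `|u| * (e / 8).
  apply: le_trans (ler_normD _ _) _; rewrite !normrM.
  by apply: lerD; apply: ler_pM => //; exact: ltW.
have u0 := normr_ge0 u; have t0 := normr_ge0 t.
apply: le_trans (lerD b1 b2) _.
have : 0 <= e * `|u| by rewrite mulr_ge0// ltW.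
have : 0 <= e * `|t| by rewrite mulr_ge0// ltW.
by lra.
Qed.

Lemma epol_near u0 t0 (e : R) : 0 < e -> exists2 r : R, 0 < r & forall u t,
  `|u - u0| < r -> `|t - t0| < r -> cn (epol u t - epol u0 t0) < e.
Proof.
move=> e0; have [r r0 hr] := epol_der ltr01.
set K := 4 * expR u0; have K0 : 0 < K by rewrite mulr_gt0// expR_gt0.
exists (Num.min r (e / K)); first by rewrite lt_min r0 divr_gt0.
move=> u t; rewrite !lt_min => /andP[h1 h2] /andP[h3 h4].
have := hr _ _ h1 h3.
have -> : epol u t - epol u0 t0 = (epol (u - u0) (t - t0) - 1) * epol u0 t0.
  by rewrite mulrBl mul1r -epolD !subrK.
rewrite cnM cn_epol mul1r => H.
have : cn (epol (u - u0) (t - t0) - 1) <= 2 * (`|u - u0| + `|t - t0|).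
  set d := (u - u0)%:C + 'i * (t - t0)%:C in H.
  have dd : cn d <= `|u - u0| + `|t - t0|.
    by apply: le_trans (cnD _ _) _; rewrite cnM cn_i mul1r !cn_real.
  rewrite (_ : _ - 1 = (epol (u - u0) (t - t0) - 1 - d) + d); last by ring.
  by apply: le_trans (cnD _ _) _; lra.
move: h2 h4; rewrite !ltr_pdivlMr// /K => h2 h4 hh.
apply: le_lt_trans (ler_wpM2r (ltW (expR_gt0 u0)) hh) _; lra.
Qed.

Lemma cder_epol h u0 t0 k : cder h (epol u0 t0) k ->
  cdiff2_at (fun u t => h (epol u t)) u0 t0.
Proof.
move=> hh; set E := epol u0 t0 in hh *; exists (k * E) => e e0.
have E0 : 0 < cn E by rewrite cn_epol expR_gt0.
have kE0 : 0 < 2 * (cn (k * E) + 1) by rewrite mulr_gt0// ltr_wpDl// cn_ge0.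
have E40 : 0 < 4 * cn E by rewrite mulr_gt0.
have [r1 r10 h1] := hh _ (divr_gt0 e0 E40).
have [r2 r20 h2] := epol_near u0 t0 r10.
have [r3 r30 h3] := epol_der (divr_gt0 e0 kE0).
have [r4 r40 h4] := epol_der ltr01.
exists (Num.min r2 (Num.min r3 r4)); first by rewrite !lt_min r20 r30 r40.
move=> u t; rewrite !lt_min => /andP[p2 /andP[p3 p4]] /andP[q2 /andP[q3 q4]].
have a1 := h1 _ (h2 _ _ p2 q2); have a3 := h3 _ _ p3 q3; have a4 := h4 _ _ p4 q4.
rewrite -/E in a1 *.
set d := (u - u0)%:C + 'i * (t - t0)%:C in a3 a4 *.
set D := `|u - u0| + `|t - t0| in a3 a4 *.
have dd : cn d <= D.
  by apply: le_trans (cnD _ _) _; rewrite cnM cn_i mul1r !cn_real.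
have wE : epol u t - E = E * (epol (u - u0) (t - t0) - 1).
  by rewrite mulrBr mulr1 /E -epolD !(addrC _ (_ - _)) !subrK.
have b1 : cn (epol u t - E) <= cn E * (2 * D).
  rewrite wE cnM ler_pM2l//.
  rewrite (_ : _ - 1 = (epol (u - u0) (t - t0) - 1 - d) + d); last by ring.
  by apply: le_trans (cnD _ _) _; lra.
rewrite (_ : _ - _ - _ = (h (epol u t) - h E - k * (epol u t - E)) +
    k * E * (epol (u - u0) (t - t0) - 1 - d)); last by rewrite wE; ring.
have c1 : cn (h (epol u t) - h E - k * (epol u t - E)) <= e / 2 * D.
  apply: le_trans a1 _; apply: le_trans (ler_wpM2l _ b1) _.
    by rewrite divr_ge0 ?ltW.
  by rewrite le_eqVlt; apply/orP; left; apply/eqP; field; rewrite gt_eqF.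
have c2 : cn (k * E * (epol (u - u0) (t - t0) - 1 - d)) <= e / 2 * D.
  rewrite cnM; apply: le_trans (ler_pM (cn_ge0 _) (cn_ge0 _) (_ : _ <= cn (k * E) + 1) a3) _.
    by rewrite lerDl.
  rewrite le_eqVlt; apply/orP; left; apply/eqP; field.
  by rewrite gt_eqF// ltr_wpDl// cn_ge0.
by apply: le_trans (cnD _ _) _; lra.
Qed.

Lemma ccontz_epol h u0 t0 : ccontz h (epol u0 t0) -> forall e : R, 0 < e ->
  exists2 r : R, 0 < r & forall u t, `|u - u0| < r -> `|t - t0| < r ->
    cn (h (epol u t) - h (epol u0 t0)) < e.
Proof.
move=> hc e e0; have [r r0 hr] := hc _ (divr_gt0 e0 (ltr0n _ 2)).
have [s s0 hs] := epol_near u0 t0 r0; exists s => // u t us ts.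
by apply: le_lt_trans (hr _ (hs _ _ us ts)) _; lra.
Qed.

Lemma sep_cont_epol h a b c d : (forall u t, a <= u <= b -> ccontz h (epol u t)) ->
  sep_cont (fun u t => h (epol u t)) a b c d.
Proof.
move=> hc; split=> [t _ u ub e e0|u ub t _ e e0].
  have [r r0 hr] := ccontz_epol (hc u t ub) e0; exists r => // u' hu.
  by apply: hr => //; rewrite subrr normr0.
have [r r0 hr] := ccontz_epol (hc u t ub) e0; exists r => // t' ht.
by apply: hr => //; rewrite subrr normr0.
Qed.

(** The contour integral of h z dz / (i z) along the circle of radius [r]; it is 2 pi times the mean
    of [h]. *)
Definition cmean h (r : R) := cint (- pi) pi (fun t => h (r%:C * cis t)).

Lemma epol_ln r t : 0 < r -> epol (ln r) t = r%:C * cis t.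
Proof. by move=> r0; rewrite /epol lnK. Qed.

(** In logarithmic coordinates the sides t = pi and t = - pi cancel by periodicity, which leaves the
    difference of the two circle integrals. The exceptional point is real and positive, hence at t =
    0, inside the rectangle. *)
Lemma cmean_annulus h (r0 rho r1 : R) : 0 < r0 -> r0 < rho < r1 ->
  (forall z, r0 <= cn z <= r1 -> ccontz h z) ->
  (forall z, r0 <= cn z <= r1 -> z != rho%:C -> exists k, cder h z k) ->
  cmean h r0 = cmean h r1.
Proof.
move=> r00 /andP[h1 h2] hc hd.
have rho0 := lt_trans r00 h1; have r10 := lt_trans rho0 h2.
have bnd u : ln r0 <= u <= ln r1 -> r0 <= expR u <= r1.
  by rewrite -(ler_expR (ln r0)) -(ler_expR u) !lnK.
have sc : sep_cont (fun u t => h (epol u t)) (ln r0) (ln r1) (- pi) pi.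
  by apply: sep_cont_epol => u t /bnd hu; apply: hc; rewrite cn_epol.
have pi0 := pi_gt0 R.
have ab : ln r0 <= ln r1 by rewrite ler_ln ?posrE// ltW// (lt_trans h1).
have : rect_int (fun u t => h (epol u t)) (ln r0) (ln r1) (- pi) pi = 0.
  apply: (@goursat_exception R _ _ _ _ _ (ln rho) 0).
  - by rewrite !ltr_ln ?posrE// h1.
  - by rewrite oppr_lt0 pi0.
  - exact: sc.
  - move=> u t /andP[ub /andP[t1 t2]] ne.
    have [k hk] : exists k, cder h (epol u t) k.
      (* z = -r is reached twice, at t = pi and t = - pi *)
      apply: hd; first by rewrite cn_epol bnd.
      apply: contra_neq ne => Eq.
      have eu : expR u = rho by rewrite -(cn_epol u t) Eq cn_real gtr0_norm.
      have c1 : cis t = 1.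
        apply: (@mulfI _ rho%:C); first by rewrite -cn_eq0 cn_real gtr0_norm// gt_eqF.
        by rewrite mulr1 -[RHS]Eq /epol eu.
      rewrite -eu expRK (@cis_eq1 t)//; rewrite !lt_neqAle t1 t2 !andbT.
      apply/andP; split; apply/eqP => tp; move: c1.
        by rewrite -tp cisNpi /cis cospi => -[] /eqP; rewrite eqNr oner_eq0.
      by rewrite tp /cis cospi => -[] /eqP; rewrite eqNr oner_eq0.
    exact: cder_epol hk.
  - have [|r rr hr] := @ccontz_epol h (ln rho) 0 _ 1 ltr01.
      by apply: hc; rewrite cn_epol lnK ?posrE// !ltW.
    exists (cn (h (epol (ln rho) 0)) + 1), r; split=> // u t us ts.
    rewrite -[h (epol u t)](subrK (h (epol (ln rho) 0))).
    by apply: le_trans (cnD _ _) _; rewrite addrC lerD2l ltW// hr.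
rewrite /rect_int (_ : cint _ _ _ = 0); last first.
  rewrite (_ : (fun u => _) = fun=> 0); last first.
    by apply/funext => u; rewrite /epol cisNpi subrr.
  by rewrite cint_cst// mul0r.
rewrite add0r => /eqP; rewrite mulf_eq0 -[_ == 0]cn_eq0 cn_i oner_eq0 /=.
rewrite cintB; try by apply: sc.2; rewrite ?lexx ?ab.
rewrite subr_eq0 => /eqP Eq; apply/esym; move: Eq.
by rewrite /cmean => Eq; apply: eq_trans (eq_trans Eq _); congr (cint _ _ _); apply/funext => t; rewrite epol_ln.
Qed.

Definition holo_disk (g : C -> C) (R0 : R) := forall z, cn z < R0 -> exists k, cder g z k.

Lemma ccont_circle a b h (r : R) : 0 < r -> (forall z, cn z = r -> ccontz h z) ->
  ccont a b (fun t => h (r%:C * cis t)).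
Proof.
move=> r0 hc.
have [_ h2] : sep_cont (fun u t => h (epol u t)) (ln r) (ln r) a b.
  apply: sep_cont_epol => u t /le_anti <-; apply: hc; rewrite cn_epol lnK// posrE.
have := h2 (ln r); rewrite lexx => /(_ isT).
by congr (ccont _ _ _); apply/funext => t; rewrite epol_ln.
Qed.

Lemma pi2_gt0 : 0 < pi - (- pi) :> R. Proof. by have := pi_gt0 R; lra. Qed.

Lemma cmean_le h (r M : R) : 0 < r -> (forall z, cn z = r -> ccontz h z) ->
  (forall z, cn z = r -> cn (h z) <= M) -> cn (cmean h r) <= 2 * (M * (pi - - pi)).
Proof.
move=> r0 hc hM; apply: cint_le; first by have := pi_gt0 R; lra.
  exact: ccont_circle.
by move=> t _; apply: hM; rewrite cnM cn_real cn_cis mulr1 gtr0_norm.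
Qed.

(** The integral does not change when the circle shrinks inside rho, and it tends to 0 with [h]. *)
Lemma cmean_vanish h (R0 rho r : R) : 0 < rho < r -> r < R0 ->
  (forall z, 0 < cn z < R0 -> ccontz h z) ->
  (forall z, 0 < cn z < R0 -> z != rho%:C -> exists k, cder h z k) ->
  (forall e : R, 0 < e -> exists2 s : R, 0 < s & forall z, 0 < cn z < s -> cn (h z) <= e) ->
  cmean h r = 0.
Proof.
move=> /andP[rho0 rhor] rR hc hd hv; have pi2 := pi2_gt0; apply: cn_small => e e0.
have e20 : 0 < e / 2 / (pi - - pi) by rewrite !divr_gt0.
have [s s0 hs] := hv _ e20.
have m0 : 0 < Num.min rho s by rewrite lt_min rho0.
set r0 := Num.min rho s / 2; have r00 : 0 < r0 by rewrite divr_gt0.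
have [r0r r0s] : r0 < rho /\ r0 < s.
  have : Num.min rho s <= rho by rewrite ge_min lexx.
  have : Num.min rho s <= s by rewrite ge_min lexx orbT.
  by rewrite /r0; split; lra.
have bnd z : r0 <= cn z <= r -> 0 < cn z < R0.
  by move=> /andP[z1 z2]; rewrite (lt_le_trans r00 z1) (le_lt_trans z2 rR).
rewrite -(@cmean_annulus h r0 rho r)//.
- apply: le_trans (cmean_le r00 (M := e / 2 / (pi - - pi)) _ _) _.
  + by move=> z zr; apply: hc; apply: bnd; rewrite zr lexx ltW// (lt_trans r0r).
  + by move=> z zr; apply: hs; rewrite zr r00.
  + by rewrite divfK ?gt_eqF// mulrC divfK.
- by rewrite r0r.
- by move=> z /bnd; exact: hc.
- by move=> z /bnd; exact: hd.
Qed.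

Lemma holo_cont g (R0 : R) z : holo_disk g R0 -> cn z < R0 -> ccontz g z.
Proof. by move=> hg /hg[k]; exact: cder_cont. Qed.

Lemma cder_idX z n : exists k, cder (fun x : C => x ^+ n) z k.
Proof. by apply: cderX; exact: cder_id. Qed.

Lemma cmean_mean g (R0 r : R) : 0 < r < R0 -> holo_disk g R0 ->
  cmean g r = (pi - - pi)%:C * g 0.
Proof.
move=> /andP[r0 rR] hg; have pi2 := pi2_gt0.
have hg' : holo_disk (fun z => g z - g 0) R0.
  move=> z /hg[k hk]; exists (k + 0); apply: cderD hk _; exact: cder_cst.
have := @cmean_vanish (fun z => g z - g 0) R0 (r / 2) r.
move=> H; apply/eqP; rewrite -subr_eq0; apply/eqP; rewrite -{}[RHS]H //.
- rewrite /cmean cintB; last exact: ccont_cst.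
    by rewrite cint_cst ?[g 0 * _]mulrC//; have := pi_gt0 R; lra.
  by apply: (@ccont_circle _ _ g r r0) => z zr; apply: holo_cont hg _; rewrite zr.
- by rewrite divr_gt0//=; lra.
- by move=> z /andP[_ zR]; apply: holo_cont hg' zR.
- by move=> z /andP[_ zR] _; exact: hg'.
- have c0 : cn (0 : C) < R0 by rewrite cn0 (lt_trans r0).
  move=> e e0; have [s s0 hs] := holo_cont hg c0 e0; exists s => //.
  by move=> z /andP[_ zs]; apply: hs; rewrite subr0.
Qed.

(** These integrals are 2 pi times the Taylor coefficients of [g] at 0; the integrand is holomorphic
    off 0. *)
Lemma cmean_power_cst g (R0 r s : R) n : 0 < r < R0 -> 0 < s < R0 -> holo_disk g R0 ->
  cmean (fun z => g z * (z ^+ n)^-1) r = cmean (fun z => g z * (z ^+ n)^-1) s.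
Proof.
move=> /andP[r0 rR] /andP[s0 sR] hg.
have hd z : 0 < cn z < R0 -> exists k, cder (fun z => g z * (z ^+ n)^-1) z k.
  move=> /andP[z0 zR]; have [k hk] := hg z zR; have [l hl] := cder_idX z n.
  have zn : z ^+ n != 0 by rewrite expf_neq0// -cn_gt0.
  have hv := cderV (f := fun x => x ^+ n) zn hl.
  by exists (k * (z ^+ n)^-1 + g z * (- l / (z ^+ n) ^+ 2)); exact: cderM.
have hc z : 0 < cn z < R0 -> ccontz (fun z => g z * (z ^+ n)^-1) z.
  by move=> /hd[k]; exact: cder_cont.
have H (a b : R) : 0 < a -> a < b -> b < R0 ->
    cmean (fun z => g z * (z ^+ n)^-1) a = cmean (fun z => g z * (z ^+ n)^-1) b.
  move=> a0 ab bR; apply: (@cmean_annulus _ a ((a + b) / 2) b) => //.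
  - by apply/andP; split; lra.
  - by move=> z /andP[z1 z2]; apply: hc; rewrite (lt_le_trans a0)// (le_lt_trans z2).
  - by move=> z /andP[z1 z2] _; apply: hd; rewrite (lt_le_trans a0)// (le_lt_trans z2).
have [rs|sr|->//] := ltgtP r s; first exact: H.
by apply/esym; exact: H.
Qed.

Lemma ccontzV z : z != 0 -> ccontz (fun x : C => x^-1) z.
Proof. by move=> z0; have := cderV (f := id) z0 (@cder_id R z); exact: cder_cont. Qed.

(** Cauchy kernel for the measure dt = dz / (i z). A positive real point is enough: the general case
    follows by choosing the complex line. *)
Definition ckern (rho : R) z : C := z / (z - rho%:C).

Lemma cder_ckern (rho : R) z : z != rho%:C -> exists k, cder (ckern rho) z k.
Proof.
move=> zr; have z0 : z - rho%:C != 0 by rewrite subr_eq0.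
have h := cderD (@cder_id R z) (@cder_cst R (- rho%:C) z).
have hv := cderV (f := fun x => x - rho%:C) z0 h.
by have := cderM (@cder_id R z) hv; eexists; eassumption.
Qed.

Lemma circle_neq (rho r : R) z : 0 < rho < r -> cn z = r -> z != rho%:C /\ z != 0.
Proof.
move=> /andP[r0 rr] zr; split; last by rewrite -cn_gt0 zr (lt_trans r0).
by apply/eqP => zE; move: zr rr; rewrite zE cn_real gtr0_norm// => ->; rewrite ltxx.
Qed.

Lemma ckern_le (rho r : R) z : 0 < rho < r -> cn z = r -> cn (ckern rho z) <= (1 - rho / r)^-1.
Proof.
move=> /andP[r0 rr] zr; have r1 := lt_trans r0 rr.
rewrite /ckern cnM cnV zr.
have : r - rho <= cn (z - rho%:C).
  have := cn_dist z rho%:C 0; rewrite !subr0 zr cn_real gtr0_norm//; lra.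
move=> h; have r3 : 0 < r - rho by lra.
rewrite -[leRHS]mul1r ler_pdivlMr; last by rewrite subr_gt0 ltr_pdivrMr// mul1r.
rewrite mulrAC ler_pdivrMr ?(lt_le_trans r3 h)// mul1r.
by apply: le_trans h; rewrite mulrBr mulr1 mulrC divfK// gt_eqF.
Qed.

Lemma ccontz_cst k z : ccontz (fun=> k) z.
Proof. exact: cder_cont (cder_cst k z). Qed.

Lemma eq_cmean h g (r : R) : 0 < r -> (forall z, cn z = r -> h z = g z) -> cmean h r = cmean g r.
Proof.
move=> r0 hg; apply: eq_cint => t _; apply: hg.
by rewrite cnM cn_real cn_cis mulr1 gtr0_norm.
Qed.

Lemma cmeanD h g (r : R) : 0 < r -> (forall z, cn z = r -> ccontz h z) ->
  (forall z, cn z = r -> ccontz g z) -> cmean (fun z => h z + g z) r = cmean h r + cmean g r.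
Proof. by move=> r0 hc gc; rewrite /cmean cintD//; apply: ccont_circle. Qed.

Lemma cmeanZ k h (r : R) : 0 < r -> (forall z, cn z = r -> ccontz h z) ->
  cmean (fun z => k * h z) r = k * cmean h r.
Proof. by move=> r0 hc; rewrite /cmean cintZ//; apply: (@ccont_circle _ _ h r r0). Qed.

(** Finite geometric expansion of the kernel in powers of rho / z, with exact remainder (rho / z)^n
    times the kernel. *)
Lemma cmean_ckern_rem g (rho r : R) n : 0 < rho < r -> (forall z, cn z = r -> ccontz g z) ->
  cmean (fun z => g z * ckern rho z) r =
  \sum_(k < n) rho%:C ^+ k * cmean (fun z => g z * (z ^+ k)^-1) r +
  cmean (fun z => g z * ((rho%:C / z) ^+ n * ckern rho z)) r.
Proof.
move=> rr gc; have r0 : 0 < r by have /andP[a b] := rr; exact: lt_trans b.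
have vc z (k : nat) : cn z = r -> ccontz (fun z => (z ^+ k)^-1) z.
  move=> zr; have [_ z0] := circle_neq rr zr; have [l hl] := cder_idX z k.
  by have := cderV (f := fun x => x ^+ k) (expf_neq0 k z0) hl; exact: cder_cont.
have kc z : cn z = r -> ccontz (ckern rho) z.
  by move=> zr; have [z0 _] := circle_neq rr zr; have [l hl] := cder_ckern z0; exact: cder_cont hl.
have qc z (k : nat) : cn z = r -> ccontz (fun z => (rho%:C / z) ^+ k) z.
  move=> zr; under eq_fun do rewrite expr_div_n.
  by apply: ccontzM; [exact: ccontz_cst|exact: vc].
elim: n => [|n IH].
  by rewrite big_ord0 add0r; apply: eq_cmean => // z zr; rewrite expr0 mul1r.
rewrite big_ord_recr /= IH -addrA; congr (_ + _).
rewrite -cmeanZ//; last by move=> z zr; apply: ccontzM; [exact: gc|exact: vc].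
rewrite -cmeanD//; first last.
- by move=> z zr; apply: ccontzM; [exact: gc|apply: ccontzM; [exact: qc|exact: kc]].
- by move=> z zr; apply: ccontzM; [exact: ccontz_cst|apply: ccontzM; [exact: gc|exact: vc]].
apply: eq_cmean => // z zr; have [z1 z0] := circle_neq rr zr.
rewrite /ckern exprS expr_div_n; field.
by rewrite z0 subr_eq0 z1 expf_neq0.
Qed.

Lemma cmean_ckern_approx g (rho r M : R) n : 0 < rho < r -> (forall z, cn z = r -> ccontz g z) ->
  (forall z, cn z = r -> cn (g z) <= M) ->
  cn (cmean (fun z => g z * ckern rho z) r -
    \sum_(k < n) rho%:C ^+ k * cmean (fun z => g z * (z ^+ k)^-1) r) <=
  2 * (M * ((rho / r) ^+ n / (1 - rho / r)) * (pi - - pi)).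
Proof.
move=> rr gc gM; have /andP[rho0 rhor] := rr; have r0 := lt_trans rho0 rhor.
rewrite (cmean_ckern_rem n rr gc) addrAC subrr add0r.
apply: cmean_le => // z zr; have [z1 z0] := circle_neq rr zr.
  have [l hl] := cder_ckern z1.
  have hv : ccontz (fun z => (rho%:C / z) ^+ n) z.
    have hi := cderM (cder_cst rho%:C z) (cderV (f := id) z0 (@cder_id R z)).
    by have [m hm] := cderX n hi; exact: cder_cont hm.
  by apply: ccontzM; [exact: gc|apply: ccontzM => //; exact: cder_cont hl].
rewrite cnM; apply: ler_pM; rewrite ?cn_ge0//; first exact: gM.
rewrite cnM; apply: ler_pM; rewrite ?cn_ge0//; last exact: ckern_le.
by rewrite cnX cnM cnV cn_real gtr0_norm// zr.
Qed.

Lemma exists_geometric_le (x A e : R) : 0 <= x < 1 -> 0 < e -> exists n, A * x ^+ n <= e.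
Proof.
move=> /andP[x0 x1] e0; have : (fun n => A * x ^+ n) @ \oo --> A * 0.
  by apply: cvgMr; apply: cvg_expr; rewrite ger0_norm.
rewrite mulr0 => /cvgrPdist_le /(_ e e0) [n _ /(_ n (leqnn _))].
by rewrite sub0r normrN => h; exists n; apply: le_trans h; exact: ler_norm.
Qed.

(** Passing from radius r to 2 r multiplies the integral by 2^-(n+1) by homogeneity, yet leaves it
    unchanged by [cmean_power_cst]. *)
Lemma cmean_Xn_inv (r : R) n : 0 < r -> cmean (fun z => 1 * (z ^+ n.+1)^-1) r = 0.
Proof.
move=> r0; have := @cmean_power_cst (fun=> 1) (3 * r) r (2 * r) n.+1.
have -> : cmean (fun z => 1 * (z ^+ n.+1)^-1) (2 * r) =
    ((2 : C) ^+ n.+1)^-1 * cmean (fun z => 1 * (z ^+ n.+1)^-1) r.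
  rewrite -cmeanZ//.
    apply: eq_cint => t _; rewrite !mul1r -invfM -exprMn; congr ((_ ^+ _)^-1).
    by rewrite rmorphM /= mulrA rmorph_nat.
  move=> z zr; have [l hl] := cder_idX z n.+1.
  have z0 : z != 0 by rewrite -cn_gt0 zr.
  by apply: ccontzM; [exact: ccontz_cst|exact: cder_cont (cderV (f := fun x => x ^+ n.+1) (expf_neq0 n.+1 z0) hl)].
move=> H; have {}H : cmean (fun z => 1 * (z ^+ n.+1)^-1) r =
    ((2 : C) ^+ n.+1)^-1 * cmean (fun z => 1 * (z ^+ n.+1)^-1) r.
  apply: H; rewrite ?r0 ?mulr_gt0//=; first by lra.
    by lra.
  by move=> z _; exists 0; exact: cder_cst.
move/eqP: H; rewrite -[X in X == _]mul1r -subr_eq0 -mulrBl mulf_eq0 => /orP[|/eqP//].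
rewrite subr_eq0 => /eqP H1; exfalso; have : (2 : C) ^+ n.+1 = 1.
  by rewrite -[LHS]invrK -H1 invr1.
move=> H2; have : (2 ^ n.+1)%:R = 1%:R :> C by rewrite natrX.
move/eqP; rewrite eqr_nat => /eqP E.
by have := ltn_expl n.+1 (isT : (1 < 2)%N); rewrite E.
Qed.

Lemma cmean_ckern (rho r : R) : 0 < rho < r -> cmean (fun z => 1 * ckern rho z) r = (pi - - pi)%:C.
Proof.
move=> rr; have /andP[rho0 rhor] := rr; have r0 := lt_trans rho0 rhor.
apply/eqP; rewrite -subr_eq0; apply/eqP; apply: cn_small => e e0.
have x01 : 0 <= rho / r < 1 by rewrite divr_ge0 ?ltW//= ltr_pdivrMr// mul1r.
have [n hn] := exists_geometric_le (2 * ((1 - rho / r)^-1 * (pi - - pi))) x01 e0.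
have := @cmean_ckern_approx (fun=> 1) rho r 1 n.+1 rr.
rewrite big_ord_recl /= big1 ?addr0; last first.
  by move=> i _; rewrite cmean_Xn_inv// mulr0.
rewrite expr0 mul1r (_ : cmean (fun z => 1 * (z ^+ 0)^-1) r = (pi - - pi)%:C); last first.
  rewrite (@eq_cmean _ (fun=> 1))//; last by move=> z _; rewrite expr0 invr1 mulr1.
  by rewrite /cmean cint_cst ?mul1r//; have := pi_gt0 R; lra.
move=> H; apply: le_trans (H _ _) _.
- by move=> z _; exact: ccontz_cst.
- by move=> z _; rewrite cn1.
apply: le_trans hn; have pi2 := pi2_gt0; have /andP[x0 x1] := x01.
rewrite mul1r exprS -!mulrA ler_pM2l// mulrCA mulrA mulrC -!mulrA.
rewrite [leLHS](_ : _ = (rho / r) * ((1 - rho / r)^-1 * ((pi - - pi) * (rho / r) ^+ n))); last by ring.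
apply: ler_piMl; last exact: ltW.
have w0 : 0 < 1 - rho / r by rewrite subr_gt0.
by rewrite !mulr_ge0 ?invr_ge0 ?exprn_ge0// ltW.
Qed.

(** The function (g z - g rho) z / (z - rho), given the value g'(rho) rho at rho, is continuous
    there and vanishes at 0, so its circle integral is 0 by [cmean_vanish]. What remains is g rho
    times the integral of the kernel. *)
Lemma cmean_cauchy g (rho r R0 : R) : 0 < rho < r -> r < R0 -> holo_disk g R0 ->
  cmean (fun z => g z * ckern rho z) r = (pi - - pi)%:C * g rho%:C.
Proof.
move=> rr rR hg; have /andP[rho0 rhor] := rr; have r0 := lt_trans rho0 rhor.
have [k hk] : exists k, cder g rho%:C k.
  by apply: hg; rewrite cn_real gtr0_norm// (lt_trans rhor).
pose h z := if z == rho%:C then k * rho%:C else (g z - g rho%:C) * ckern rho z.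
have hd z : 0 < cn z < R0 -> z != rho%:C -> exists l, cder h z l.
  move=> /andP[z0 zR] zr; have [l hl] := hg z zR; have [m hm] := cder_ckern zr.
  exists ((l + 0) * ckern rho z + (g z - g rho%:C) * m).
  have d0 : 0 < cn (z - rho%:C) by rewrite cn_gt0 subr_eq0.
  apply: cder_near d0 _ (cderM (cderD hl (cder_cst (- g rho%:C) z)) hm) => w wz.
  rewrite /h ifN//; apply: contraTneq wz => ->.
  by rewrite -leNgt -(cnN (z - _)) opprB.
have hc z : 0 < cn z < R0 -> ccontz h z.
  move=> zR; have [->|/(hd z zR)[l]] := eqVneq z rho%:C; last exact: cder_cont.
  pose q w := if w == rho%:C then k else (g w - g rho%:C) / (w - rho%:C).
  have -> : h = (fun w => q w * w).
    apply/funext => w; rewrite /h /q /ckern; case: eqP => [->//|_].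
    by rewrite mulrA mulrAC.
  apply: ccontzM; last exact: cder_cont (@cder_id R _).
  move=> e e0; have [s s0 hs] := hk e e0; exists s => // w ws; rewrite /q eqxx.
  have [_|wr] := eqVneq w rho%:C; first by rewrite subrr cn0 ltW.
  have w0 : 0 < cn (w - rho%:C) by rewrite cn_gt0 subr_eq0.
  rewrite -(ler_pM2r w0) -cnM mulrBl divfK ?subr_eq0//; exact: hs.
have Z : cmean h r = 0.
  apply: (@cmean_vanish h R0 rho r) => //.
  move=> e e0.
  have c0 : cn (0 : C) < R0 by rewrite cn0 (lt_trans r0).
  have [s s0 hs] := holo_cont hg c0 ltr01.
  pose B := 1 + cn (g 0 - g rho%:C); have B0 : 0 < B by rewrite ltr_pwDl// cn_ge0.
  exists (Num.min s (Num.min (rho / 2) (e * (rho / 2) / B))).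
    by rewrite !lt_min s0 !divr_gt0// mulr_gt0// divr_gt0.
  move=> z /andP[z0]; rewrite !lt_min => /andP[zs /andP[z2 z3]].
  have zr : cn rho%:C - cn z <= cn (z - rho%:C).
    by have := cn_dist rho%:C z 0; rewrite !subr0 -(cnN (rho%:C - z)) opprB; lra.
  rewrite cn_real gtr0_norm// in zr.
  rewrite /h ifN; last by apply/eqP => zE; move: z2; rewrite zE cn_real gtr0_norm//; lra.
  rewrite cnM /ckern cnM cnV.
  have zr2 : rho / 2 <= cn (z - rho%:C) by lra.
  have zr0 : 0 < cn (z - rho%:C) by apply: lt_le_trans zr2; rewrite divr_gt0.
  rewrite mulrA ler_pdivrMr//.
  have gB : cn (g z - g rho%:C) <= B.
    apply: le_trans (cn_dist _ (g 0) _) _; rewrite /B lerD2r; apply: hs; by rewrite subr0.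
  apply: le_trans (ler_pM (cn_ge0 _) (cn_ge0 _) gB (ltW z3)) _.
  by rewrite mulrC divfK ?gt_eqF// ler_pM2l.
have : cmean (fun z => g z * ckern rho z) r = cmean h r + cmean (fun z => g rho%:C * (1 * ckern rho z)) r.
  rewrite -cmeanD//.
  - apply: eq_cmean => // z zr; have [z1 z0] := circle_neq rr zr.
    by rewrite /h ifN//; ring.
  - by move=> z zr; apply: hc; rewrite zr r0.
  - move=> z zr; have [z1 z0] := circle_neq rr zr; have [m hm] := cder_ckern z1.
    apply: ccontzM; first exact: ccontz_cst.
    by apply: ccontzM; [exact: ccontz_cst|exact: cder_cont hm].
rewrite Z add0r cmeanZ ?cmean_ckern 1?mulrC// => z zr.
have [z1 z0] := circle_neq rr zr; have [m hm] := cder_ckern z1.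
by apply: ccontzM; [exact: ccontz_cst|exact: cder_cont hm].
Qed.

Lemma ccont_bounded a b (f : R -> C) : a <= b -> ccont a b f ->
  exists M : R, forall t, a <= t <= b -> cn (f t) <= M.
Proof.
move=> ab cf; have cn_c : {within `[a, b], continuous (fun t => cn (f t))}.
  apply: continuous_in_subspaceT => x /set_mem /=.
  rewrite in_itv => /= /cf h; apply/cvgrPdist_lt => e /h [r r0 hr].
  apply/nbhs_ballP; exists r => //= y; rewrite /ball /= distrC => /hr.
  apply: le_lt_trans; rewrite ler_norml; apply/andP; split.
    by have := cn_dist (f y) (f x) 0; rewrite !subr0; lra.
  by have := cn_dist (f x) (f y) 0; rewrite !subr0 -(cnN (f x - f y)) opprB; lra.
have [c _ hc] := EVT_max ab cn_c; exists (cn (f c)) => t tab.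
by apply: hc; rewrite in_itv.
Qed.

(** In Cauchy's formula the expansion of the kernel only meets vanishing coefficients, and its
    remainder tends to 0. *)
Lemma holo_unique g (rho r R0 : R) : 0 < rho < r -> r < R0 -> holo_disk g R0 ->
  (forall n, cmean (fun z => g z * (z ^+ n)^-1) r = 0) -> g rho%:C = 0.
Proof.
move=> rr rR hg h0; have /andP[rho0 rhor] := rr; have r0 := lt_trans rho0 rhor.
have gc z : cn z = r -> ccontz g z by move=> zr; apply: holo_cont hg _; rewrite zr.
have pi2 := pi2_gt0.
have ccg := @ccont_circle (- pi) pi g r r0 gc.
have pp : - pi <= pi :> R by have := pi_gt0 R; lra.
have [M0 hM0] := ccont_bounded pp ccg.
pose cM := Num.max M0 0.
have hM t : - pi <= t <= pi -> cn (g (r%:C * cis t)) <= cM.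
  by move=> /hM0 h; rewrite le_max h.
have cM0 : 0 <= cM by rewrite le_max lexx orbT.
have Z : cmean (fun z => g z * ckern rho z) r = 0.
  apply: cn_small => e e0.
  have x01 : 0 <= rho / r < 1 by rewrite divr_ge0 ?ltW//= ltr_pdivrMr// mul1r.
  have [n hn] := exists_geometric_le (2 * (cM / (1 - rho / r) * (pi - - pi))) x01 e0.
  rewrite (cmean_ckern_rem n rr gc) big1 ?add0r; last first.
    by move=> i _; rewrite h0 mulr0.
  apply: le_trans hn.
  apply: le_trans (_ : 2 * (cM * ((rho / r) ^+ n / (1 - rho / r)) * (pi - - pi)) <= _); last first.
    by rewrite le_eqVlt; apply/orP; left; apply/eqP; ring.
  apply: cint_le => //.
    apply: (@ccont_circle _ _ (fun z => g z * ((rho%:C / z) ^+ n * ckern rho z)) r r0) => z zr.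
    have [z1 z0] := circle_neq rr zr; have [l hl] := cder_ckern z1.
    have hi := cderM (cder_cst rho%:C z) (cderV (f := id) z0 (@cder_id R z)).
    have [m hm] := cderX n hi.
    by apply: ccontzM; [exact: gc|apply: ccontzM; [exact: cder_cont hm|exact: cder_cont hl]].
  move=> t tb; have zr : cn (r%:C * cis t) = r by rewrite cnM cn_real cn_cis mulr1 gtr0_norm.
  rewrite cnM; apply: ler_pM; rewrite ?cn_ge0//; first exact: hM.
  rewrite cnM; apply: ler_pM; rewrite ?cn_ge0//; last exact: ckern_le.
  by rewrite cnX cnM cnV cn_real gtr0_norm// zr.
have := cmean_cauchy rr rR hg; rewrite Z => /esym/eqP.
rewrite mulf_eq0 => /orP[|/eqP//]; rewrite -cn_eq0 cn_real normr_eq0.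
by rewrite gt_eqF.
Qed.

(** Taylor remainder of order 2. It depends on [g] only through its bound on the circle, hence is
    uniform along a bounded sequence of polynomials. *)
Lemma holo_quad g (rho r R0 M : R) : 0 < rho < r -> r < R0 -> holo_disk g R0 ->
  (forall z, cn z = r -> cn (g z) <= M) ->
  cn ((pi - - pi)%:C * (g rho%:C - g 0) - rho%:C * cmean (fun z => g z * z^-1) r) <=
  2 * (M * ((rho / r) ^+ 2 / (1 - rho / r)) * (pi - - pi)).
Proof.
move=> rr rR hg hM; have /andP[rho0 rhor] := rr; have r0 := lt_trans rho0 rhor.
have gc z : cn z = r -> ccontz g z by move=> zr; apply: holo_cont hg _; rewrite zr.
have := @cmean_ckern_approx g rho r M 2 rr gc hM.
rewrite (cmean_cauchy rr rR hg) !big_ord_recl big_ord0 /= addr0 expr0 mul1r expr1.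
rewrite (_ : cmean (fun z => g z * (z ^+ 0)^-1) r = (pi - - pi)%:C * g 0); last first.
  rewrite -(@cmean_mean g R0 r)//; last by rewrite r0.
  by apply: eq_cmean => // z _; rewrite expr0 invr1 mulr1.
rewrite (_ : bump 0 0 = 1%N)// => H; apply: le_trans H.
by rewrite mulrBr -addrA -opprD.
Qed.

End PolarCoordinates.

(** * Monomials indexed by words *)

Section Words.
Context (R : realType) (m : nat).
Local Open Scope complex_scope.
Local Notation n := m.+1.
Local Notation C := R[i].
Local Notation V := 'cV[C]_n.
Local Notation word := (seq 'I_n).
Implicit Types (I J K L : word) (i j : 'I_n) (k : nat).

(** Words replace multi-indices: a monomial z^alpha of degree k occurs k!/alpha! times among the
    words of size k, so sums over words carry the multinomial coefficients implicitly. *)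
Definition mono I (z : V) : C := \prod_(i <- I) z i ord0.

Lemma mono_cons i I z : mono (i :: I) z = z i ord0 * mono I z.
Proof. by rewrite /mono big_cons. Qed.

Lemma mono_nil z : mono [::] z = 1. Proof. by rewrite /mono big_nil. Qed.

Lemma mono_perm I J : perm_eq I J -> mono I = mono J.
Proof. by move=> IJ; apply/funext => z; rewrite /mono; apply: perm_big. Qed.

Lemma monoZ (c : C) I z : mono I (c *: z) = c ^+ size I * mono I z.
Proof.
elim: I => [|i I IH]; first by rewrite !mono_nil mulr1.
by rewrite !mono_cons IH mxE /= exprS; ring.
Qed.

Lemma coord_le (z : V) i : csq (z i ord0) <= sqnorm z.
Proof.
rewrite sqnormE (bigD1 i)//= lerDl.
by apply: sumr_ge0 => *; exact: csq_ge0.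
Qed.

Lemma csq_mono I z : sqnorm z < 1 -> csq (mono I z) <= 1.
Proof.
move=> z1; elim: I => [|i I IH]; first by rewrite mono_nil csq1.
rewrite mono_cons csqM -[leRHS]mulr1; apply: ler_pM => //; try exact: csq_ge0.
by apply: le_trans (coord_le z i) _; exact: ltW.
Qed.

(** The words left by deleting one occurrence of [i], with multiplicity: the terms of the partial
    derivative of z^I in z_i. *)
Fixpoint dell i I : seq word :=
  if I is j :: I' then (if i == j then [:: I'] else [::]) ++ [seq j :: K | K <- dell i I']
  else [::].

Lemma size_dell i I K : K \in dell i I -> (size K).+1 = size I.
Proof.
elim: I K => [|j I IH] K //=; rewrite mem_cat => /orP[|/mapP[L /IH LI ->]]; last by rewrite /= LI.
by case: eqP => // _; rewrite inE => /eqP ->.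
Qed.

Fixpoint sumw k (F : word -> C) : C :=
  if k is k'.+1 then \sum_(i < n) sumw k' (fun K => F (i :: K)) else F [::].

Lemma sumwS k F : sumw k.+1 F = \sum_(i < n) sumw k (fun K => F (i :: K)).
Proof. by []. Qed.

Lemma eq_sumw k F G : (forall I, size I = k -> F I = G I) -> sumw k F = sumw k G.
Proof.
elim: k F G => [|k IH] F G FG /=; first exact: FG.
by apply: eq_bigr => i _; apply: IH => I Ik; apply: FG; rewrite /= Ik.
Qed.

Lemma sumwD k F G : sumw k (fun I => F I + G I) = sumw k F + sumw k G.
Proof.
elim: k F G => [|k IH] F G //=.
by rewrite -big_split /=; apply: eq_bigr => i _; rewrite IH.
Qed.

Lemma sumwZ k (c : C) F : sumw k (fun I => c * F I) = c * sumw k F.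
Proof.
by elim: k F => [|k IH] F //=; rewrite mulr_sumr; apply: eq_bigr => i _; rewrite IH.
Qed.

Lemma sumw0 k F : (forall I, size I = k -> F I = 0) -> sumw k F = 0.
Proof.
move=> h; rewrite (eq_sumw (G := fun I => 0 * F I)) ?sumwZ ?mul0r// => I Ik.
by rewrite mul0r h.
Qed.

Lemma sumw_conj k F : cj (sumw k F) = sumw k (fun I => cj (F I)).
Proof.
elim: k F => [|k IH] F //=.
rewrite rmorph_sum /=; by apply: eq_bigr => i _; rewrite IH.
Qed.

Definition perm_inv (F : word -> word -> C) := forall K I J, perm_eq I J -> F K I = F K J.

Lemma sumw_nil F : sumw 0 F = F [::]. Proof. by []. Qed.

#[local] Arguments sumw : simpl never.

(** Each word K of size k arises from the k + 1 insertions of [i] into it, which are all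
    permutations of i :: K. *)
Lemma sumw_dell k i (F : word -> word -> C) : perm_inv F ->
  sumw k.+1 (fun J => \sum_(K <- dell i J) F K J) = k.+1%:R * sumw k (fun K => F K (i :: K)).
Proof.
elim: k F => [|k IH] F pF.
  rewrite mul1r sumwS sumw_nil (bigD1 i)//= sumw_nil eqxx big_seq1 big1 ?addr0// => j ji.
  by rewrite sumw_nil eq_sym (negbTE ji) big_nil.
transitivity (\sum_(j < n) (sumw k.+1 (fun J => if i == j then F J (j :: J) else 0) +
    sumw k.+1 (fun J => \sum_(K <- dell i J) F (j :: K) (j :: J)))).
  rewrite sumwS; apply: eq_bigr => j _; rewrite -sumwD; congr (sumw k.+1 _); apply/funext => J /=.
  rewrite big_cat big_map /=; congr (_ + _).
  by case: ifP; rewrite ?big_seq1 ?big_nil.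
rewrite big_split /= (bigD1 i)//= eqxx.
rewrite [X in _ + X + _]big1 ?addr0; last first.
  by move=> j ji; rewrite eq_sym (negbTE ji); apply: sumw0.
rewrite [X in _ + X](eq_bigr (fun j => k.+1%:R * sumw k (fun K => F (j :: K) (i :: j :: K)))); last first.
  move=> j _; rewrite (IH (fun K J => F (j :: K) (j :: J))); last first.
    by move=> K I J IJ; apply: pF; rewrite perm_cons.
  congr (_ * _); apply: eq_sumw => K _; apply: pF.
  by rewrite (perm_catCA [:: j] [:: i] K).
rewrite -mulr_sumr -[in RHS]natr1 mulrDl mul1r addrC; congr (_ + _).
Qed.

Lemma hdotX (z u : V) k :
  hdot z u ^+ k = sumw k (fun I => mono I z * cj (mono I u)).
Proof.
elim: k => [|k IH]; first by rewrite expr0 sumw_nil !mono_nil rmorph1 mulr1.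
rewrite exprS IH hdotE mulr_suml sumwS; apply: eq_bigr => i _.
rewrite -sumwZ; apply: eq_sumw => I _; rewrite !mono_cons conjM; ring.
Qed.

End Words.

(** * First-order expansions in the boost parameter *)

Section Expansions.
Context (R : realType) (m : nat).
Local Open Scope complex_scope.
Local Notation n := m.+1.
Local Notation C := R[i].
Local Notation V := 'cV[C]_n.
Local Notation word := (seq 'I_n).
Implicit Types (I J K : word) (i j : 'I_n) (s : R).

(** G = G0 + s G1 + O(s^2) uniformly on the ball. The bounds on the two coefficients are included so
    that expansions can be multiplied. *)
Definition expansion (G : R -> V -> C) (G0 G1 : V -> C) := exists M r : R, [/\ 0 < r, r <= 1 &
  forall s z, `|s| < r -> sqnorm z < 1 ->
   [/\ cn (G s z - G0 z - s%:C * G1 z) <= M * s ^+ 2, cn (G0 z) <= M & cn (G1 z) <= M]].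

Lemma expansion_ge1 G G0 G1 : expansion G G0 G1 -> exists M r : R, [/\ 1 <= M, 0 < r, r <= 1 &
  forall s z, `|s| < r -> sqnorm z < 1 ->
   [/\ cn (G s z - G0 z - s%:C * G1 z) <= M * s ^+ 2, cn (G0 z) <= M & cn (G1 z) <= M]].
Proof.
move=> [M [r [r0 r1 h]]]; exists (Num.max M 1), r; split => //; first by rewrite le_max lexx orbT.
move=> s z sr z1; have [h1 h2 h3] := h s z sr z1.
split; rewrite ?le_max ?h2 ?h3//.
by apply: le_trans h1 _; rewrite ler_wpM2r ?sqr_ge0// le_max lexx.
Qed.

Lemma eq_expansion G G0 G1 H H0 H1 : (forall s z, sqnorm z < 1 -> G s z = H s z) ->
  (forall z, sqnorm z < 1 -> G0 z = H0 z) -> (forall z, sqnorm z < 1 -> G1 z = H1 z) ->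
  expansion G G0 G1 -> expansion H H0 H1.
Proof.
move=> e e0 e1 [M [r [r0 r1 h]]]; exists M, r; split => // s z sr z1.
by have [h1 h2 h3] := h s z sr z1; rewrite -e// -e0// -e1.
Qed.

Lemma expansionD G G0 G1 H H0 H1 : expansion G G0 G1 -> expansion H H0 H1 ->
  expansion (fun s z => G s z + H s z) (fun z => G0 z + H0 z) (fun z => G1 z + H1 z).
Proof.
move=> [M [r [r0 r1 h]]] [M' [r' [r0' r1' h']]].
exists (M + M'), (Num.min r r'); split; rewrite ?lt_min ?r0// ?ge_min ?r1//.
move=> s z; rewrite lt_min => /andP[sr sr'] z1.
have [a1 a2 a3] := h s z sr z1; have [b1 b2 b3] := h' s z sr' z1.
split; try by apply: le_trans (cnD _ _) _; apply: lerD.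
rewrite (_ : _ - _ = (G s z - G0 z - s%:C * G1 z) + (H s z - H0 z - s%:C * H1 z)); last by ring.
by apply: le_trans (cnD _ _) _; rewrite mulrDl lerD.
Qed.

Lemma expansionM G G0 G1 H H0 H1 : expansion G G0 G1 -> expansion H H0 H1 ->
  expansion (fun s z => G s z * H s z) (fun z => G0 z * H0 z)
    (fun z => G0 z * H1 z + G1 z * H0 z).
Proof.
move=> /expansion_ge1[M [r [M1 r0 r1 h]]] /expansion_ge1[M' [r' [M1' r0' r1' h']]].
exists (6 * (M * M')), (Num.min r r'); split; rewrite ?lt_min ?r0// ?ge_min ?r1//.
move=> s z; rewrite lt_min => /andP[sr sr'] z1.
have [a1 a2 a3] := h s z sr z1; have [b1 b2 b3] := h' s z sr' z1.
have M0 : 0 <= M by rewrite (le_trans ler01).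
have M0' : 0 <= M' by rewrite (le_trans ler01).
have MM : 0 <= M * M' by rewrite mulr_ge0.
split; last first.
- apply: le_trans (cnD _ _) _; rewrite !cnM.
  have := ler_pM (cn_ge0 _) (cn_ge0 _) a2 b3; have := ler_pM (cn_ge0 _) (cn_ge0 _) a3 b2; lra.
- by rewrite cnM; have := ler_pM (cn_ge0 _) (cn_ge0 _) a2 b2; lra.
have s1 : s ^+ 2 <= 1.
  by rewrite -(real_normK (num_real s)) -[leRHS](expr1n _ 2) ler_sqr ?nnegrE// ltW// (lt_le_trans sr).
have s0 := sqr_ge0 s.
set dG := G s z - G0 z - s%:C * G1 z in a1; set dH := H s z - H0 z - s%:C * H1 z in b1.
rewrite (_ : _ - _ = dG * dH + dG * (H0 z + s%:C * H1 z) + (G0 z + s%:C * G1 z) * dH +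
  (s ^+ 2)%:C * (G1 z * H1 z)); last by rewrite /dG /dH rmorphXn /=; ring.
have sn1 : `|s| <= 1 by apply: ltW; apply: lt_le_trans sr _.
have linb (x y : C) (B : R) : cn x <= B -> cn y <= B -> cn (x + s%:C * y) <= 2 * B.
  move=> xB yB; apply: le_trans (cnD _ _) _; rewrite cnM cn_real.
  have : `|s| * cn y <= 1 * B by apply: ler_pM => //; exact: cn_ge0.
  by lra.
have t1 : cn (dG * dH) <= M * s ^+ 2 * M'.
  rewrite cnM; apply: le_trans (ler_pM (cn_ge0 _) (cn_ge0 _) a1 b1) _.
  by apply: ler_wpM2l; [exact: mulr_ge0|rewrite -[leRHS]mulr1 ler_wpM2l].
have t2 : cn (dG * (H0 z + s%:C * H1 z)) <= M * s ^+ 2 * (2 * M').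
  by rewrite cnM; apply: ler_pM; rewrite ?cn_ge0//; exact: linb.
have t3 : cn ((G0 z + s%:C * G1 z) * dH) <= 2 * M * (M' * s ^+ 2).
  by rewrite cnM; apply: ler_pM; rewrite ?cn_ge0//; exact: linb.
have t4 : cn ((s ^+ 2)%:C * (G1 z * H1 z)) <= s ^+ 2 * (M * M').
  rewrite !cnM cn_real ger0_norm//; apply: ler_wpM2l => //.
  by apply: ler_pM; rewrite ?cn_ge0.
do 3 (apply: le_trans (cnD _ _) _; rewrite -lerBrDr).
apply: le_trans t1 _; nra.
Qed.

Lemma expansionJ G G0 G1 : expansion G G0 G1 ->
  expansion (fun s z => cj (G s z)) (fun z => cj (G0 z)) (fun z => cj (G1 z)).
Proof.
move=> [M [r [r0 r1 h]]]; exists M, r; split => // s z sr z1.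
have [h1 h2 h3] := h s z sr z1; rewrite !cnJ; split => //.
rewrite -[X in cn (_ - X)](_ : cj (s%:C * G1 z) = _); last by rewrite conjM conj_real.
by rewrite -!rmorphB cnJ.
Qed.

Lemma expansion_cst (f : V -> C) (M : R) : (forall z, sqnorm z < 1 -> cn (f z) <= M) ->
  expansion (fun=> f) f (fun=> 0).
Proof.
move=> fM; exists (Num.max M 0), 1; split => // s z _ z1.
rewrite subrr mulr0 subrr cn0 !le_max lexx orbT fM//; split => //.
by rewrite mulr_ge0 ?sqr_ge0// le_max lexx orbT.
Qed.

Lemma cn_coord (z : V) i : sqnorm z < 1 -> cn (z i ord0) <= 1.
Proof.
move=> z1; rewrite -ler_sqr ?nnegrE ?cn_ge0// cn_sq expr1n.
by apply: le_trans (coord_le z i) _; exact: ltW.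
Qed.

Lemma sqrt1D_le (s : R) : 1 <= Num.sqrt (1 + s ^+ 2) <= 1 + s ^+ 2.
Proof.
have s0 := sqr_ge0 s; apply/andP; split.
  by rewrite -{1}(sqrtr1 R) ler_wsqrtr// lerDl.
rewrite -{2}(sqr_sqrtr (_ : 0 <= 1 + s ^+ 2)) ?addr_ge0//.
by rewrite expr2 ler_peMr ?sqrtr_ge0// -{1}(sqrtr1 R) ler_wsqrtr// lerDl.
Qed.

Lemma expansion_sqrt : expansion (fun s _ => (Num.sqrt (1 + s ^+ 2))%:C) (fun=> 1) (fun=> 0).
Proof.
exists 1, 1; split => // s z _ _; rewrite mulr0 subr0 cn1 cn0; split => //.
rewrite -(rmorph1 (real_complex R)) -rmorphB /= cn_real mul1r.
by have /andP[h1 h2] := sqrt1D_le s; rewrite ger0_norm; lra.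
Qed.

Lemma expansion_sC (f : V -> C) (M : R) : (forall z, sqnorm z < 1 -> cn (f z) <= M) ->
  expansion (fun s z => s%:C * f z) (fun=> 0) f.
Proof.
move=> fM; exists (Num.max M 0), 1; split => // s z _ z1.
rewrite subr0 subrr cn0 !le_max lexx orbT fM//; split => //.
by rewrite mulr_ge0 ?sqr_ge0// le_max lexx orbT.
Qed.

Lemma expansion_den i : expansion (boost_den i) (fun=> 1) (fun z => z i ord0).
Proof.
have := expansionD expansion_sqrt (expansion_sC (fun z z1 => cn_coord i z1)).
by apply: eq_expansion => // z _; rewrite ?addr0 ?add0r.
Qed.

(** 1/G - 1 + s G1 = (- (G - 1 - s G1) + s G1 (G - 1)) / G, and the radius 1/(4 M) keeps |G - 1|
    below 1/2. *)
Lemma expansion_inv G G1 : expansion G (fun=> 1) G1 ->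
  expansion (fun s z => (G s z)^-1) (fun=> 1) (fun z => - G1 z).
Proof.
move=> /expansion_ge1[M [r [M1 r0 r1 h]]].
have M0 : 0 < M by rewrite (lt_le_trans ltr01).
exists (8 * M ^+ 2), (Num.min r (4 * M)^-1); split.
- by rewrite lt_min r0 invr_gt0 mulr_gt0.
- by rewrite ge_min r1.
move=> s z; rewrite lt_min => /andP[sr sM] z1.
have [a1 a2 a3] := h s z sr z1; rewrite cnN cn1.
have MM : M <= M ^+ 2 by rewrite expr2 ler_peMr// ltW.
split; [|lra|lra].
have s1 : `|s| <= 1 by apply: ltW; apply: lt_le_trans sr _.
have ss : s ^+ 2 = `|s| ^+ 2 by rewrite real_normK ?num_real.
have s0 := normr_ge0 s.
have s2 : s ^+ 2 <= `|s| by rewrite ss expr2 ler_piMr.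
have d1 : cn (G s z - 1) <= 2 * M * `|s|.
  rewrite (_ : _ - _ = (G s z - 1 - s%:C * G1 z) + s%:C * G1 z); last by ring.
  apply: le_trans (cnD _ _) _; rewrite cnM cn_real.
  have : M * s ^+ 2 <= M * `|s| by rewrite ler_pM2l.
  have : `|s| * cn (G1 z) <= `|s| * M by rewrite ler_wpM2l.
  by lra.
have sM2 : 4 * M * `|s| < 1 by rewrite mulrC -ltr_pdivlMr ?mulr_gt0// mul1r.
have g2 : 1 / 2 <= cn (G s z).
  have := cn_dist 1 (G s z) 0; rewrite !subr0 cn1 -(cnN (1 - _)) opprB; lra.
have g0 : G s z != 0 by rewrite -cn_gt0; lra.
rewrite (_ : _ - _ = (- (G s z - 1 - s%:C * G1 z) + s%:C * G1 z * (G s z - 1)) / G s z); last by field.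
rewrite cnM cnV ler_pdivrMr ?cn_gt0//.
apply: le_trans (_ : 4 * M ^+ 2 * s ^+ 2 <= _); last first.
  have : 0 <= M ^+ 2 * s ^+ 2 by rewrite mulr_ge0 ?sqr_ge0.
  nra.
apply: le_trans (cnD _ _) _; rewrite cnN !cnM cn_real.
have : `|s| * cn (G1 z) * cn (G s z - 1) <= `|s| * M * (2 * M * `|s|).
  apply: ler_pM; rewrite ?mulr_ge0 ?cn_ge0//; exact: ler_wpM2l.
have : M * s ^+ 2 <= M ^+ 2 * s ^+ 2 by rewrite ler_wpM2r ?sqr_ge0.
by rewrite ss; nra.
Qed.

(** The first-order term is the vector field that generates the boosts along the i-th axis. *)
Lemma expansion_boost i j : expansion (fun s z => boost i s z j ord0) (fun z => z j ord0)
  (fun z => (i == j)%:R - z i ord0 * z j ord0).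
Proof.
have cj0 := @expansion_cst (fun z => z j ord0) 1 (fun z z1 => cn_coord j z1).
have num : expansion (fun s (z : V) => if j == i then (Num.sqrt (1 + s ^+ 2))%:C * z i ord0 + s%:C else z j ord0)
    (fun z => z j ord0) (fun=> (i == j)%:R).
  have [<-|_] := eqVneq i j; last exact: cj0.
  have := expansionD (expansionM expansion_sqrt (@expansion_cst (fun z => z i ord0) 1 (fun z z1 => cn_coord i z1)))
    (@expansion_sC (fun=> 1) 1 (fun z _ => ltac:(by rewrite cn1))).
  by apply: eq_expansion => [s z _|z _|z _]; rewrite ?eqxx /=; ring.
have := expansionM (expansion_inv (expansion_den i)) num.
by apply: eq_expansion => [s z _|z _|z _]; rewrite ?boostE //=; ring.
Qed.

Lemma expansion_mono i I : expansion (fun s z => mono I (boost i s z)) (mono I)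
  (fun z => \sum_(K <- dell i I) mono K z - (size I)%:R * (z i ord0 * mono I z)).
Proof.
elim: I => [|j I IH].
  have := @expansion_cst (fun=> 1) 1 (fun z _ => ltac:(by rewrite cn1)).
  by apply: eq_expansion => [s z _|z _|z _]; rewrite ?mono_nil ?big_nil //= mul0r subrr.
have := expansionM (expansion_boost i j) IH.
apply: eq_expansion => [s z _|z _|z _]; rewrite ?mono_cons//.
rewrite /= big_cat big_map /=.
under [\sum_(j0 <- _) mono (j :: j0) z]eq_bigr do rewrite mono_cons.
rewrite -mulr_sumr -natr1.
case: (i == j); rewrite ?big_seq1 ?big_nil /= ?mulr1n ?mulr0n; set S := \sum_(_ <- _) _.
  by ring.
by ring.
Qed.

End Expansions.

(** * Differentiating the invariance of the sesquilinear form *)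

Section SkewSymmetry.
Context (R : realType) (m : nat).
Local Open Scope complex_scope.
Local Notation n := m.+1.
Local Notation C := R[i].
Local Notation V := 'cV[C]_n.
Local Notation word := (seq 'I_n).
Variable lambda : R.
Hypothesis lam_gt : n%:R < lambda.
Local Notation RI := (@RI R m lambda).
Local Notation EI := (@EI R m lambda).
Local Notation CI := (@CI R m lambda).
Local Notation CInt := (@CInt R m lambda).
Implicit Types (I J K : word) (i j : 'I_n) (s : R).
#[local] Arguments sumw : simpl never.

Let lambda_gt0 : 0 < lambda. Proof. exact: le_lt_trans lam_gt. Qed.

(** x - 2 x^2 <= ln (1 + x) <= x, and e^y - 1 - y <= 2 y^2 for y = - lambda ln (1 + x); the second
    hypothesis gives |y| <= 1/2. *)
Lemma powR_expansion (x : R) : `|x| <= 1 / 2 -> 4 * lambda * `|x| <= 1 ->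
  `|(1 + x) `^ (- lambda) - 1 + lambda * x| <= (2 * lambda + 8 * lambda ^+ 2) * x ^+ 2.
Proof.
move=> x2 lx; have [xa xb] : - (1 / 2) <= x /\ x <= 1 / 2 by move: x2; rewrite ler_norml => /andP[].
have x1 : 0 < 1 + x by lra.
have l0 := lambda_gt0.
have L1 : ln (1 + x) <= x by apply: le_ln1Dx; lra.
have L2 : x - 2 * x ^+ 2 <= ln (1 + x).
  have : ln ((1 + x)^-1) <= (1 + x)^-1 - 1.
    have := @le_ln1Dx R ((1 + x)^-1 - 1); rewrite [1 + (_ - 1)]addrC subrK; apply.
    have : 0 < (1 + x)^-1 by rewrite invr_gt0.
    lra.
  rewrite lnV ?posrE// => h.
  have : x - 2 * x ^+ 2 <= 1 - (1 + x)^-1.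
    rewrite -(ler_pM2r x1) [X in _ <= X]mulrBl mulVf ?gt_eqF//.
    have := sqr_ge0 x; nra.
  lra.
set L := ln (1 + x) in L1 L2.
have -> : (1 + x) `^ (- lambda) = expR (- lambda * L) by rewrite /powR gt_eqF.
set y := - lambda * L.
have E1 : 1 + y <= expR y := expR_ge1Dx y.
have xx : x ^+ 2 = `|x| ^+ 2 by rewrite real_normK ?num_real.
have x0 := normr_ge0 x.
have LL : `|L| <= 2 * `|x|.
  rewrite ler_norml; have [hx|hx] := leP 0 x.
    by rewrite (ger0_norm hx); apply/andP; split; nra.
  by rewrite (ltr0_norm hx); apply/andP; split; nra.
have yb : `|y| <= 2 * lambda * `|x|.
  by rewrite /y normrM normrN (gtr0_norm l0); have := ler_wpM2l (ltW l0) LL; lra.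
have y2 : `|y| <= 1 / 2 by lra.
have [ya yc] : - (1 / 2) <= y /\ y <= 1 / 2 by move: y2; rewrite ler_norml => /andP[].
have E2 : expR y * (1 - y) <= 1.
  have := expR_ge1Dx (- y); rewrite expRN => h.
  have e0 := expR_gt0 y.
  by have := ler_wpM2l (ltW e0) h; rewrite divff ?gt_eqF.
have E3 : expR y - 1 - y <= 2 * y ^+ 2.
  have y10 : 0 < 1 - y by lra.
  rewrite -(ler_pM2r y10); have := sqr_ge0 y; nra.
have y3 : y ^+ 2 <= (2 * lambda * `|x|) ^+ 2.
  by rewrite -(real_normK (num_real y)) ler_sqr ?nnegrE// !mulr_ge0// ltW.
have -> : expR y - 1 + lambda * x = (expR y - 1 - y) + lambda * (x - L) by rewrite /y; ring.
rewrite ger0_norm; last by apply: addr_ge0; [lra|apply: mulr_ge0; lra].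
have : lambda * (x - L) <= lambda * (2 * x ^+ 2) by rewrite ler_pM2l//; lra.
have E : (2 * lambda * `|x|) ^+ 2 = 4 * lambda ^+ 2 * x ^+ 2 by rewrite xx; ring.
rewrite E in y3; lra.
Qed.

(** The term - lambda z_i completes the derivative of the holomorphic factor of the form into a
    [raise], and its conjugate does the same for the antiholomorphic factor. *)
Lemma expansion_jacobian i :
  expansion (fun s (z : V) => ((csq (boost_den i s z)) `^ (- lambda))%:C)
   (fun=> 1) (fun z => - lambda%:C * (z i ord0 + cj (z i ord0))).
Proof.
have l0 := lambda_gt0.
have := expansionM (@expansion_den R m i) (expansionJ (@expansion_den R m i)).
move=> /expansion_ge1[M [r [M1 r0 r1 h]]].
have M0 : 0 < M by rewrite (lt_le_trans ltr01).
pose D := (2 * lambda + 8 * lambda ^+ 2) * (2 * M) ^+ 2 + lambda * M.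
have D0 : 0 <= D by rewrite /D !(addr_ge0, mulr_ge0, sqr_ge0)// ltW.
pose M' := D + (1 + lambda * M).
have M'M : lambda * M <= M' by rewrite /M'; lra.
exists M', (Num.min r (Num.min (4 * M)^-1 (8 * lambda * M)^-1)); split.
- by rewrite !lt_min r0 !invr_gt0 !mulr_gt0.
- by rewrite ge_min r1.
move=> s z; rewrite !lt_min => /andP[sr /andP[sM sl]] z1.
have [a1 a2 a3] := h s z sr z1.
rewrite /= rmorph1 !mul1r -csqE mulr1 in a1 a3.
set t := z i ord0 + cj (z i ord0).
have tE : cj (z i ord0) + z i ord0 = t by rewrite addrC.
rewrite tE in a1 a3.
have [tr trE] : exists tr : R, t = tr%:C.
  exists (2 * complex.Re (z i ord0)); rewrite /t; case: (z i ord0) => a b.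
  by apply/eqP; rewrite eq_complex /=; apply/andP; split; apply/eqP; ring.
have rE : (csq (boost_den i s z))%:C - 1 - s%:C * t = (csq (boost_den i s z) - 1 - s * tr)%:C.
  by rewrite trE !rmorphB !rmorphM.
rewrite rE cn_real in a1; rewrite trE cn_real in a3.
set x := csq (boost_den i s z) - 1.
have qx : csq (boost_den i s z) = 1 + x by rewrite /x; ring.
have s0 := normr_ge0 s.
have s1 : `|s| <= 1 by apply: ltW; apply: lt_le_trans sr _.
have ss : s ^+ 2 = `|s| ^+ 2 by rewrite real_normK ?num_real.
have s2 : s ^+ 2 <= `|s| by rewrite ss expr2 ler_piMr.
have xb : `|x| <= 2 * M * `|s|.
  rewrite (_ : x = (x - s * tr) + s * tr); last by ring.
  apply: le_trans (ler_normD _ _) _; rewrite normrM.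
  have : M * s ^+ 2 <= M * `|s| by rewrite ler_pM2l.
  have : `|s| * `|tr| <= `|s| * M by rewrite ler_wpM2l.
  move: a1; rewrite -/x; lra.
have sM2 : 4 * M * `|s| < 1 by rewrite mulrC -ltr_pdivlMr ?mulr_gt0// mul1r.
have sl2 : 8 * lambda * M * `|s| < 1 by rewrite mulrC -ltr_pdivlMr ?mulr_gt0// mul1r.
have x2 : `|x| <= 1 / 2 by lra.
have lx : 4 * lambda * `|x| <= 1.
  have : lambda * `|x| <= lambda * (2 * M * `|s|) by rewrite ler_pM2l.
  lra.
have P := powR_expansion x2 lx; rewrite -qx in P.
split.
- rewrite trE (_ : _ - _ = (csq (boost_den i s z) `^ (- lambda) - 1 + lambda * x -
    lambda * (x - s * tr))%:C); last by rewrite !(rmorphB, rmorphD, rmorphM, rmorphN) /=; ring.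
  rewrite cn_real; apply: le_trans (ler_normB _ _) _; rewrite normrM (gtr0_norm l0).
  have xs : x ^+ 2 <= (2 * M) ^+ 2 * s ^+ 2.
    by rewrite ss -exprMn -(real_normK (num_real x)) ler_sqr ?nnegrE// !mulr_ge0// ltW.
  have c0 : 0 <= 2 * lambda + 8 * lambda ^+ 2 by rewrite !(addr_ge0, mulr_ge0, sqr_ge0)// ltW.
  have := ler_wpM2l c0 xs.
  have : lambda * `|x - s * tr| <= lambda * (M * s ^+ 2) by rewrite ler_pM2l.
  move: P; rewrite /M' /D; have := sqr_ge0 s.
  have : 0 <= (1 + lambda * M) * s ^+ 2 by rewrite mulr_ge0 ?sqr_ge0// addr_ge0// mulr_ge0// ltW.
  by rewrite !mulrDl; lra.
- by rewrite cn1 /M'; have : 0 <= lambda * M by [rewrite mulr_ge0// ltW]; lra.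
rewrite trE -rmorphN -rmorphM cn_real normrM normrN (gtr0_norm l0).
apply: le_trans M'M; by rewrite ler_pM2l.
Qed.

Definition gmeas (f : V -> C) := cmeasurable setT (fun t : cpow R n => f (cvec t)).

Lemma gmeas_bcmeas f : gmeas f -> bcmeas f.
Proof. by move=> h; apply: cmeasS h => //; exact: measurableT. Qed.

Lemma gmeas_mono I : gmeas (mono I).
Proof. by apply: cmeas_prod => i; exact: cmeas_cvec. Qed.

Lemma gmeas_boost f i s : gmeas f -> gmeas (fun z => f (boost i s z)).
Proof. by move=> mf; apply: (cmeas_comp_cinv mf) => j; exact: cmeas_boost. Qed.

Lemma gmeas_jacobian i s : gmeas (fun z => ((csq (boost_den i s z)) `^ (- lambda))%:C).
Proof.
split; last exact: measurable_cst.
apply: (measurableT_comp (measurable_powR _)).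
apply: measurable_csq; apply: cmeasD; first exact: cmeas_cst.
by apply: cmeasM; [exact: cmeas_cst|exact: cmeas_cvec].
Qed.

Lemma csq_cn (x : C) (M : R) : 0 <= M -> (csq x <= M ^+ 2) = (cn x <= M).
Proof. by move=> M0; rewrite -cn_sq ler_sqr ?nnegrE// cn_ge0. Qed.

Lemma CInt_bounded f (M : R) : bcmeas f -> (forall z, sqnorm z < 1 -> cn (f z) <= M) -> CInt f.
Proof.
move=> mf fM; apply: (CInt_le (g := fun=> `|M| * 1) mf (IntBZ _ (IntB1 lam_gt))) => z z1.
rewrite mulr1; split => //; rewrite csq_cn//.
by apply: le_trans (fM z z1) _; exact: ler_norm.
Qed.

Lemma CI_le f (g : V -> R) : CInt f -> IntB lambda g -> (forall z, sqnorm z < 1 -> cn (f z) <= g z) ->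
  cn (CI f) <= 2 * RI g.
Proof.
move=> [f1 f2] ig fg; apply: le_trans (cn_le_ReIm _) _.
rewrite /CI mulr_natl mulr2n; apply: lerD => /=; rewrite ler_norml;
  apply/andP; split; rewrite -?(RIN ig); apply: RI_le => //; try exact: IntBN;
  move=> z /fg h; have := Re_le_cn (f z); have := Im_le_cn (f z);
  rewrite !ler_norml => /andP[h1 h2] /andP[h3 h4]; lra.
Qed.

Lemma ae_CI f g : gmeas f -> gmeas g -> ae_ball (fun z => f z = g z) -> CI f = CI g.
Proof.
move=> [f1 f2] [g1 g2] fg; rewrite /CI; congr (_ +i* _); apply: ae_RI => //;
  try (by apply: bmeasT); by apply: ae_imply fg => t h /h ->.
Qed.

Lemma CI_boost i s f : s != 0 -> bcmeas f ->
  CI (fun z => f (boost i s z) * ((csq (boost_den i s z)) `^ (- lambda))%:C) = CI f.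
Proof.
move=> s0 [f1 f2]; rewrite /CI; congr (_ +i* _); congr fine.
  rewrite -[RHS](EI_boost lambda i s0 f1); congr EI; apply/funext => z.
  by rewrite cReM /= mulr0 subr0.
rewrite -[RHS](EI_boost lambda i s0 f2); congr EI; apply/funext => z.
by rewrite cImM /= mulr0 add0r.
Qed.

Lemma CI_unitary (U : 'M[C]_n) f : unitary U -> bcmeas f -> CI (fun z => f (U *m z)) = CI f.
Proof.
move=> hU [f1 f2]; rewrite /CI; congr (_ +i* _); congr fine.
  exact: (EI_unitary lambda hU f1).
exact: (EI_unitary lambda hU f2).
Qed.

Lemma CIB f g : CInt f -> CInt g -> CI (fun z => f z - g z) = CI f - CI g.
Proof.
move=> fi gi; rewrite -[in RHS]mulN1r -CIZ// -CID//; last exact: CIntZ.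
by congr CI; apply/funext => z; rewrite mulN1r.
Qed.

(** The derivative at s = 0 of z^I composed with the boost, times the power - lambda of
    [boost_den]. *)
Definition raise i I (z : V) : C :=
  \sum_(K <- dell i I) mono K z - (lambda%:C + (size I)%:R) * mono (i :: I) z.

Lemma gmeas_raise i I : gmeas (raise i I).
Proof.
apply: cmeasB; first by apply: cmeas_sum => K; exact: gmeas_mono.
by apply: cmeasM; [exact: cmeas_cst|exact: gmeas_mono].
Qed.

Lemma cn_mono I (z : V) : sqnorm z < 1 -> cn (mono I z) <= 1.
Proof. by move=> z1; rewrite -csq_cn// expr1n csq_mono. Qed.

Definition boost_invariant i (phi : V -> C) :=
  forall s, s != 0 -> ae_ball (fun z => phi (boost i s z) = phi z).

(** By [CI_boost] and the invariance of phi, the integral of phi against the boosted product z^I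
    conj(z^J) does not depend on s. Its expansion then bounds |s| times the first-order coefficient
    by a multiple of s^2, and s tends to 0. *)
Lemma CI_skew i (phi : V -> C) (M : R) I J : gmeas phi -> (forall z, cn (phi z) <= M) ->
  boost_invariant i phi ->
  CI (fun z => phi z * (raise i I z * cj (mono J z) + mono I z * cj (raise i J z))) = 0.
Proof.
move=> mp pM inv.
pose q0 z := mono I z * cj (mono J z) : C.
pose q1 z := raise i I z * cj (mono J z) + mono I z * cj (raise i J z) : C.
pose Q s z := mono I (boost i s z) * cj (mono J (boost i s z)) *
  ((csq (boost_den i s z)) `^ (- lambda))%:C : C.
have mq0 : gmeas q0 by apply: cmeasM; [|apply: cmeasJ]; exact: gmeas_mono.
have mq1 : gmeas q1.
  apply: cmeasD; apply: cmeasM; try apply: cmeasJ;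
    first [exact: gmeas_mono|exact: gmeas_raise].
have mQ s : gmeas (Q s).
  apply: cmeasM; last exact: gmeas_jacobian.
  by apply: cmeasM; [|apply: cmeasJ]; apply: gmeas_boost; exact: gmeas_mono.
have EQ : expansion Q q0 q1.
  have := expansionM (expansionM (expansion_mono R i I) (expansionJ (expansion_mono R i J)))
    (expansion_jacobian i).
  apply: eq_expansion => [s z _|z _|z _] //; first by rewrite mulr1.
  rewrite /q1 /raise !mono_cons !rmorphB /= !conjM conjD conj_real.
  have -> (k : nat) : cj (k%:R : C) = k%:R by rewrite rmorph_nat.
  ring.
have [B [r [r0 r1 hB]]] := EQ.
have B0 : 0 <= B.
  have [_ _ h] := hB 0 0 ltac:(by rewrite normr0) ltac:(by rewrite sqnormE big1 // => j _; rewrite mxE csq0).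
  exact: le_trans (cn_ge0 _) h.
have M0 : 0 <= M by apply: le_trans (cn_ge0 (phi 0)) _.
have mpM f : gmeas f -> gmeas (fun z => phi z * f z) by move=> mf; exact: cmeasM.
have ci f (K : R) : gmeas f -> (forall z, sqnorm z < 1 -> cn (f z) <= K) -> CInt (fun z => phi z * f z).
  move=> mf fK; apply: (@CInt_bounded _ (M * K)); first by apply: gmeas_bcmeas; exact: mpM.
  by move=> z z1; rewrite cnM; apply: ler_pM; rewrite ?cn_ge0// fK.
have z0b : sqnorm (0 : V) < 1 by rewrite sqnormE big1 // => j _; rewrite mxE csq0.
have bq0 z : sqnorm z < 1 -> cn (q0 z) <= B.
  by move=> z1; have [] := hB 0 z; rewrite ?normr0.
have bq1 z : sqnorm z < 1 -> cn (q1 z) <= B.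
  by move=> z1; have [] := hB 0 z; rewrite ?normr0.
have key s : s != 0 -> `|s| < r -> `|s| * cn (CI (fun z => phi z * q1 z)) <=
    2 * (M * (B * s ^+ 2) * RI (fun=> 1)).
  move=> s0 sr; have i0 := ci _ _ mq0 bq0; have i1 := ci _ _ mq1 bq1.
  have d2 z : sqnorm z < 1 -> cn (Q s z - q0 z - s%:C * q1 z) <= B * s ^+ 2.
    by move=> z1; have [] := hB s z sr z1.
  have mD : gmeas (fun z => Q s z - q0 z - s%:C * q1 z).
    apply: cmeasB; first by apply: cmeasB; [exact: mQ|exact: mq0].
    by apply: cmeasM; [exact: cmeas_cst|exact: mq1].
  have iD := ci _ _ mD d2.
  have iQ : CInt (fun z => phi z * Q s z).
    have := CIntD (CIntD iD i0) (CIntZ s%:C i1).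
    by apply: eq_CInt => z _; ring.
  have E1 : CI (fun z => phi z * Q s z) = CI (fun z => phi z * q0 z).
    rewrite -[RHS](CI_boost i s0); last exact: gmeas_bcmeas (mpM _ mq0).
    apply: ae_CI; first exact: mpM.
      apply: cmeasM; last exact: gmeas_jacobian.
      exact: (gmeas_boost (f := fun z => phi z * q0 z)) (mpM _ mq0).
    apply: ae_imply (inv s s0) => t h /h e.
    by rewrite /Q /q0 e !mulrA.
  have E2 : CI (fun z => phi z * (Q s z - q0 z - s%:C * q1 z)) = - (s%:C * CI (fun z => phi z * q1 z)).
    rewrite (_ : (fun z => _) = (fun z => (phi z * Q s z - phi z * q0 z) - s%:C * (phi z * q1 z))); last first.
      by apply/funext => z; ring.
    have iB : CInt (fun z => phi z * Q s z - phi z * q0 z).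
      by have := CIntD iQ (CIntZ (-1) i0); apply: eq_CInt => z _; ring.
    rewrite (CIB iB (CIntZ s%:C i1)).
    by rewrite CIB// E1 subrr sub0r CIZ.
  rewrite -cn_real -cnM -cnN -E2.
  apply: le_trans (@CI_le _ (fun=> M * (B * s ^+ 2) * 1) iD (IntBZ _ (IntB1 lam_gt)) _) _.
    by move=> z z1; rewrite mulr1 cnM; apply: ler_pM; rewrite ?cn_ge0// d2.
  by rewrite (RIZ _ (IntB1 lam_gt)).
apply: cn_small => e e0.
set D := 2 * (M * B * RI (fun=> 1)).
have W0 := RI1_gt0 lam_gt.
have D0 : 0 <= D by rewrite /D !mulr_ge0// ltW.
pose s := Num.min (r / 2) (e / (D + 1)).
have D1 : 0 < D + 1 by rewrite ltr_wpDl.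
have s0 : 0 < s by rewrite lt_min !divr_gt0.
have sr : s <= r / 2 by rewrite /s ge_min lexx.
have se : s <= e / (D + 1) by rewrite /s ge_min lexx orbT.
have := key s (lt0r_neq0 s0); rewrite gtr0_norm// => /(_ ltac:(lra)).
rewrite (_ : 2 * _ = s * (D * s)); last by rewrite /D; ring.
rewrite ler_pM2l// => h; apply: le_trans h _.
move: se; rewrite ler_pdivlMr// => se.
have : D * s <= s * (D + 1) by rewrite mulrC ler_pM2l//; lra.
lra.
Qed.

Lemma eq_opp0 (x : C) : x = - x -> x = 0.
Proof.
move=> h; have : x *+ 2 = 0 by rewrite mulr2n {1}h addNr.
by move=> /eqP; rewrite mulrn_eq0 /= => /eqP.
Qed.

(** The substitution z -> - z changes the sign of the integrand. *)
Lemma CI_parity (phi : V -> C) (M : R) I J : gmeas phi -> (forall z, cn (phi z) <= M) ->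
  ae_ball (fun z => phi (- z) = phi z) -> odd (size I + size J) ->
  CI (fun z => phi z * (mono I z * cj (mono J z))) = 0.
Proof.
move=> mp pM inv oIJ; set F := fun z => _.
have mF : gmeas F.
  by apply: cmeasM => //; apply: cmeasM; [|apply: cmeasJ]; exact: gmeas_mono.
have u1 : unitary ((-1)%:M : 'M[C]_n) by apply: unitary_scalar; rewrite csqN csq1.
have iF : CInt F.
  apply: (@CInt_bounded _ M); first exact: gmeas_bcmeas.
  move=> z z1; rewrite /F !cnM cnJ; have := cn_mono I z1; have := cn_mono J z1.
  move=> h1 h2; rewrite -[leRHS]mulr1; apply: ler_pM; rewrite ?mulr_ge0 ?cn_ge0//.
  by rewrite -[leRHS]mulr1; apply: ler_pM; rewrite ?cn_ge0.
have E : CI F = - CI F.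
  rewrite -{1}(CI_unitary u1 (gmeas_bcmeas mF)) -[RHS]mulN1r -CIZ//.
  apply: ae_CI.
  - by apply: (cmeas_comp_cinv mF); apply: cmeas_mulmx => i; exact: cmeas_cvec.
  - by apply: cmeasM => //; exact: cmeas_cst.
  apply: ae_imply inv => t h /h e.
  rewrite mul_scalar_mx scaleN1r /F e -scaleN1r !monoZ conjM.
  have -> k : cj ((-1 : C) ^+ k) = (-1) ^+ k by rewrite rmorphXn rmorphN1.
  have : (-1 : C) ^+ size I * (-1) ^+ size J = -1 by rewrite -exprD -signr_odd oIJ expr1.
  move=> e2; rewrite -[in RHS]e2; ring.
exact: eq_opp0 E.
Qed.

(** If the sizes differ by d > 0, multiplying z by exp (i pi / d) changes the sign of the
    integrand. *)
Lemma CI_degree I J : size I != size J -> CI (fun z => mono I z * cj (mono J z)) = 0.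
Proof.
move=> dIJ; set F := fun z => _.
have mF : gmeas F by apply: cmeasM; [|apply: cmeasJ]; exact: gmeas_mono.
have iF : CInt F.
  apply: (@CInt_bounded _ 1); first exact: gmeas_bcmeas.
  move=> z z1; rewrite /F !cnM cnJ; have := cn_mono I z1; have := cn_mono J z1.
  by move=> h1 h2; rewrite -[leRHS]mulr1; apply: ler_pM; rewrite ?cn_ge0.
suff [c [c1 c2]] : exists c : C, csq c = 1 /\ c ^+ size I * cj (c ^+ size J) = -1.
  have E : CI F = - CI F.
    rewrite -{1}(CI_unitary (unitary_scalar _ c1) (gmeas_bcmeas mF)) -[RHS]mulN1r -CIZ//.
    apply: eq_CI => z _; rewrite mul_scalar_mx /F !monoZ conjM -c2; ring.
  exact: eq_opp0 E.
have H (a b : nat) : (a < b)%N -> exists c : C, csq c = 1 /\ c ^+ a * cj (c ^+ b) = -1.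
  move=> ab; exists (cis (pi / (b - a)%:R)); split; first exact: csq_cis.
  have ba : (0 < b - a)%N by rewrite subn_gt0.
  rewrite -(subnK (ltnW ab)) exprD conjM mulrCA -csqE.
  have -> k (c : C) : csq c = 1 -> csq (c ^+ k) = 1.
    by move=> h; elim: k => [|k IH]; rewrite ?expr0 ?csq1// exprS csqM h IH mulr1.
  - rewrite mulr1; have cisX (t : R) k : cis t ^+ k = cis (k%:R * t).
      elim: k => [|k IH]; first by rewrite expr0 mul0r cis0.
      by rewrite exprS IH -cisD -natr1 mulrDl mul1r addrC.
    rewrite addnK cisX mulrCA divff ?mulr1 ?pnatr_eq0 -?lt0n// /cis cospi sinpi.
    by apply/eqP; rewrite eq_complex /= oppr0 !eqxx.
  - exact: csq_cis.
move: dIJ; rewrite neq_ltn => /orP[/H//|/H[c [c1 c2]]].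
exists c; split => //; rewrite -[LHS]conjCK conjM conjCK [X in cj X]mulrC c2.
by rewrite rmorphN1.
Qed.

End SkewSymmetry.

(** * Gram matrix of the monomials and the reproducing kernel *)

Section Gram.
Context (R : realType) (m : nat).
Local Open Scope complex_scope.
Local Notation n := m.+1.
Local Notation C := R[i].
Local Notation V := 'cV[C]_n.
Local Notation word := (seq 'I_n).
Variable lambda : R.
Hypothesis lam_gt : n%:R < lambda.
Local Notation CI := (@CI R m lambda).
Local Notation ip := (@ip R n lambda).
Local Notation N2 := (@N2 R m lambda).
Local Notation L2B := (@L2B R m lambda).
Implicit Types (I J K : word) (i j : 'I_n) (k : nat).
#[local] Arguments sumw : simpl never.

Let lambda_gt0 : 0 < lambda. Proof. exact: le_lt_trans lam_gt. Qed.

Lemma L2_mono I : L2B (mono I).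
Proof.
apply: (L2_bounded lam_gt (M := 1)); first by apply: gmeas_bcmeas; exact: gmeas_mono.
by move=> z z1; exact: csq_mono.
Qed.

Lemma L2_0 : L2B (fun=> 0).
Proof.
apply: (L2_bounded lam_gt (M := 0)); first by apply: gmeas_bcmeas; exact: cmeas_cst.
by move=> z _; rewrite csq0.
Qed.

Lemma L2_sum (T : Type) (s : seq T) (P : pred T) (F : T -> V -> C) : (forall x, L2B (F x)) ->
  L2B (fun z => \sum_(x <- s | P x) F x z).
Proof.
move=> hF; elim: s => [|x s IH]; first by under eq_fun do rewrite big_nil; exact: L2_0.
by under eq_fun do rewrite big_cons; case: (P x) => //; exact: L2D.
Qed.

Lemma ip_suml (T : Type) (s : seq T) (P : pred T) (F : T -> V -> C) g : (forall x, L2B (F x)) ->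
  L2B g -> ip (fun z => \sum_(x <- s | P x) F x z) g = \sum_(x <- s | P x) ip (F x) g.
Proof.
move=> hF hg; elim: s => [|x s IH].
  by rewrite big_nil; under [X in ip X]eq_fun do rewrite big_nil; rewrite ip0l.
under [X in ip X]eq_fun do rewrite big_cons; rewrite big_cons.
by case: (P x) => //; rewrite ipDl ?IH//; exact: L2_sum.
Qed.

Lemma L2_sumw k (F : word -> V -> C) : (forall I, L2B (F I)) -> L2B (fun z => sumw k (F^~ z)).
Proof.
elim: k F => [|k IH] F hF; first exact: hF.
by under eq_fun do rewrite sumwS; apply: L2_sum => i; exact: (IH (fun K => F (i :: K))).
Qed.

Lemma ip_sumwl k (F : word -> V -> C) g : (forall I, L2B (F I)) -> L2B g ->
  ip (fun z => sumw k (F^~ z)) g = sumw k (fun I => ip (F I) g).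
Proof.
elim: k F => [|k IH] F hF hg; first by rewrite !sumw_nil.
under [X in ip X]eq_fun do rewrite sumwS.
rewrite ip_suml//; last by move=> i; exact: (L2_sumw k (F := fun K => F (i :: K))).
by rewrite sumwS; apply: eq_bigr => i _; rewrite (IH (fun K => F (i :: K))).
Qed.

Lemma ipJ' f g : L2B f -> L2B g -> ip f g = cj (ip g f).
Proof. by move=> hf hg; rewrite -(ipJ hg hf). Qed.

Lemma ip_sumwr k (F : word -> V -> C) g : (forall I, L2B (F I)) -> L2B g ->
  ip g (fun z => sumw k (F^~ z)) = sumw k (fun I => ip g (F I)).
Proof.
move=> hF hg; rewrite ipJ'//; last exact: L2_sumw.
by rewrite ip_sumwl// sumw_conj; apply: eq_sumw => I _; rewrite -ipJ'.
Qed.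

Lemma ip_sumr (T : Type) (s : seq T) (P : pred T) (F : T -> V -> C) g : (forall x, L2B (F x)) ->
  L2B g -> ip g (fun z => \sum_(x <- s | P x) F x z) = \sum_(x <- s | P x) ip g (F x).
Proof.
move=> hF hg; rewrite ipJ'//; last exact: L2_sum.
by rewrite ip_suml// rmorph_sum; apply: eq_bigr => x _; rewrite [RHS]ipJ'.
Qed.

Definition gram I J := ip (mono I) (mono J).

Lemma gram_conj I J : cj (gram I J) = gram J I.
Proof. by rewrite /gram -ipJ'//; exact: L2_mono. Qed.

Lemma gram_degree I J : size I != size J -> gram I J = 0.
Proof. by move=> IJ; rewrite /gram ipE CI_degree// mulr0. Qed.

Lemma gram_nil : gram [::] [::] = 1.
Proof.
rewrite /gram ip_N2//; apply: congr1; rewrite /N2 c_lambdaE//.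
rewrite (_ : (fun z => csq (mono [::] z)) = fun=> 1); first by rewrite mulVf// gt_eqF// RI1_gt0.
by apply/funext => z; rewrite mono_nil csq1.
Qed.

Lemma ip_skew i (phi : V -> C) (M : R) I J : gmeas phi -> (forall z, cn (phi z) <= M) ->
  boost_invariant i phi ->
  \sum_(K <- dell i I) ip (fun z => phi z * mono K z) (mono J) -
   (lambda%:C + (size I)%:R) * ip (fun z => phi z * mono (i :: I) z) (mono J) +
  (\sum_(K <- dell i J) ip (fun z => phi z * mono I z) (mono K) -
   (lambda%:C + (size J)%:R) * ip (fun z => phi z * mono I z) (mono (i :: J))) = 0.
Proof.
move=> mp pM inv.
have pmono K : L2B (fun z => phi z * mono K z).
  apply: (L2_mulb (M := M ^+ 2)) (L2_mono K); first exact: gmeas_bcmeas.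
  by move=> z _; rewrite csq_cn//; apply: le_trans (cn_ge0 _) (pM 0).
have mono2 := L2_mono.
transitivity (ip (fun z => phi z * raise lambda i I z) (mono J) + ip (fun z => phi z * mono I z) (raise lambda i J)).
  congr (_ + _).
    rewrite (_ : (fun z => phi z * raise lambda i I z) = fun z => (\sum_(K <- dell i I) phi z * mono K z) +
      (- (lambda%:C + (size I)%:R)) * (phi z * mono (i :: I) z)); last first.
      by apply/funext => z; rewrite /raise mulrBr mulr_sumr; ring.
    rewrite ipDl//; [|exact: L2_sum|exact: L2Z].
    by rewrite ip_suml// ipZl// mulNr.
  rewrite (_ : raise lambda i J = fun z => (\sum_(K <- dell i J) mono K z) +
      (- (lambda%:C + (size J)%:R)) * mono (i :: J) z); last first.
    by apply/funext => z; rewrite /raise mulNr.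
  rewrite ipDr//; [|exact: L2_sum|exact: L2Z].
  rewrite ip_sumr// ipZr// rmorphN /= conjD conj_real.
  have -> k : cj (k%:R : C) = k%:R by rewrite rmorph_nat.
  by rewrite mulNr.
have r2 K : L2B (raise lambda i K).
  apply: L2_sub; first by apply: L2_sum => ?.
  exact: L2Z.
have pr : L2B (fun z => phi z * raise lambda i I z).
  apply: (L2_mulb (M := M ^+ 2)) (r2 I); first exact: gmeas_bcmeas.
  by move=> z _; rewrite csq_cn//; apply: le_trans (cn_ge0 _) (pM 0).
rewrite !ipE -mulrDr -CID; [|exact: CInt_mulJ|exact: CInt_mulJ].
rewrite (_ : CI _ = 0) ?mulr0// -[RHS](CI_skew lam_gt I J mp pM inv).
by congr CI; apply/funext => z; ring.
Qed.

(** [ip_skew] for the constant symbol 1: of its four terms, the two that pair words of different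
    sizes vanish. *)
Lemma gram_rec i I J : size J = (size I).+1 ->
  (lambda%:C + (size I)%:R) * gram (i :: I) J = \sum_(K <- dell i J) gram I K.
Proof.
move=> JI; have := @ip_skew i (fun=> 1) 1 I J (@cmeas_cst _ _ _ _ _) (fun _ => ltac:(by rewrite cn1)).
move=> /(_ ltac:(by move=> s s0; exists set0; split => // t []//)).
have E K : (fun z : V => 1 * mono K z) = mono K by apply/funext => z; rewrite mul1r.
under eq_bigr do rewrite E. under [X in _ + (X - _)]eq_bigr do rewrite E.
rewrite !E big_seq big1 ?add0r; last first.
  by move=> K /size_dell KI; apply: gram_degree; rewrite JI -KI; lia.
rewrite [X in _ + (_ - X)](_ : _ = 0) ?subr0; last first.
  by rewrite [ip _ _](_ : _ = 0) ?mulr0//; apply: gram_degree; rewrite /= JI; lia.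
by move=> /eqP; rewrite addrC subr_eq0 => /eqP.
Qed.

(** The coefficient of x^k in (1 - x)^(- lambda), that is, in the reproducing kernel of the weighted
    Bergman space. *)
Fixpoint ck k : R := if k is k'.+1 then ck k' * (lambda + k'%:R) / k'.+1%:R else 1.

Lemma ckS k : ck k.+1 = ck k * (lambda + k%:R) / k.+1%:R. Proof. by []. Qed.

Lemma ck_gt0 k : 0 < ck k.
Proof.
by elim: k => [|k IH]//=; rewrite divr_gt0// mulr_gt0// ltr_wpDr.
Qed.

Let reproducing_aux (F : fieldType) (c l k s w : F) : l != 0 -> k != 0 ->
  c * l / k * (l^-1 * (k * (w * s))) = w * (c * s).
Proof. by move=> l0 k0; field; rewrite l0 k0. Qed.

(** Induction on the degree: [gram_rec] lowers the degree of the Gram entries, [sumw_dell] sums the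
    deletions, and their factors combine into the ratio of consecutive [ck]. This is the Parseval
    frame property. *)
Lemma reproducing k J w : size J = k ->
  (ck k)%:C * sumw k (fun I => gram J I * mono I w) = mono J w.
Proof.
elim: k J => [|k IH] J Jk.
  by move/size0nil: Jk => ->; rewrite sumw_nil gram_nil mono_nil !mul1r.
case: J Jk => [//|i J] [Jk].
have lk : lambda%:C + k%:R != 0 :> C.
  by rewrite -(rmorph_nat (real_complex R)) -rmorphD /= -cn_eq0 cn_real normr_eq0 gt_eqF// ltr_wpDr.
have -> : sumw k.+1 (fun I => gram (i :: J) I * mono I w) =
    (lambda%:C + k%:R)^-1 * (k.+1%:R * sumw k (fun K => gram J K * mono (i :: K) w)).
  rewrite -(sumw_dell k i (F := fun K I => gram J K * mono I w)); last first.
    by move=> K I I' II; rewrite (mono_perm R II).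
  rewrite -sumwZ; apply: eq_sumw => I Ik.
  have g := @gram_rec i J I; rewrite Ik Jk in g.
  by rewrite -mulr_suml -g// mulrA mulKf.
have -> : sumw k (fun K => gram J K * mono (i :: K) w) = w i ord0 * sumw k (fun K => gram J K * mono K w).
  by rewrite -sumwZ; apply: eq_sumw => K _; rewrite mono_cons; ring.
rewrite mono_cons -(IH J Jk) ckS !(rmorphM, rmorphD, fmorphV) /= !rmorph_nat.
have k0 : k.+1%:R != 0 :> C by rewrite pnatr_eq0.
exact: reproducing_aux.
Qed.

(** A family over words is redundant. Coherence says that a J is recovered as the pairing of
    [part a (size J)] with z^J, which is what families of the form <f, z^J> satisfy. *)
Definition coherent (a : word -> C) := forall J,
  (ck (size J))%:C * sumw (size J) (fun I => a I * gram I J) = a J.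

Definition part (a : word -> C) k z : C := (ck k)%:C * sumw k (fun I => a I * mono I z).

Definition psum (a : word -> C) M N z : C := \sum_(M <= k < N) part a k z.

Lemma L2_part a k : L2B (part a k).
Proof.
by apply: L2Z; apply: (L2_sumw k (F := fun I z => a I * mono I z)) => I; apply: L2Z; exact: L2_mono.
Qed.

Lemma L2_psum a M N : L2B (psum a M N). Proof. by apply: L2_sum => k; exact: L2_part. Qed.

Lemma ip_part_l a k g : L2B g -> ip (part a k) g = (ck k)%:C * sumw k (fun I => a I * ip (mono I) g).
Proof.
move=> hg; have h I : L2B (fun z => a I * mono I z) by apply: L2Z; exact: L2_mono.
rewrite /part ipZl//; last exact: (L2_sumw k h).
congr (_ * _); rewrite (ip_sumwl k h hg); apply: eq_sumw => I _.
by rewrite ipZl//; exact: L2_mono.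
Qed.

Lemma ip_part_r a k g : L2B g ->
  ip g (part a k) = (ck k)%:C * sumw k (fun I => cj (a I) * ip g (mono I)).
Proof.
move=> hg; rewrite ipJ'//; last exact: L2_part.
rewrite ip_part_l// conjM conj_real sumw_conj; congr (_ * _); apply: eq_sumw => I _.
by rewrite conjM -ipJ'//; exact: L2_mono.
Qed.

Lemma ip_part_mono a k J : coherent a -> ip (part a k) (mono J) = if k == size J then a J else 0.
Proof.
move=> ha; rewrite ip_part_l; last exact: L2_mono.
case: eqP => [->|kJ]; first exact: ha.
rewrite sumw0 ?mulr0// => I Ik; rewrite [ip _ _]gram_degree ?mulr0//.
by rewrite Ik; apply/eqP.
Qed.

Lemma ip_psum_mono a M N J : coherent a ->
  ip (psum a M N) (mono J) = if (M <= size J < N)%N then a J else 0.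
Proof.
move=> ha; rewrite ip_suml; [|by move=> k; exact: L2_part|exact: L2_mono].
under eq_bigr do rewrite (ip_part_mono _ _ ha).
by rewrite -big_mkcond /= big_nat1_eq.
Qed.

Lemma ip_part_part a b k l : k != l -> ip (part a k) (part b l) = 0.
Proof.
move=> kl; rewrite ip_part_r; last exact: L2_part.
rewrite sumw0 ?mulr0// => J Jl; rewrite ip_part_l; last exact: L2_mono.
rewrite sumw0 ?mulr0// => I Ik; rewrite [ip _ _]gram_degree ?mulr0//.
by rewrite Ik Jl.
Qed.

Lemma N2_psum a M N : N2 (psum a M N) = \sum_(M <= k < N) N2 (part a k).
Proof.
have [MN|MN] := leqP M N; last first.
  rewrite big_geq ?(ltnW MN)// /psum.
  have -> : (fun z : V => \sum_(M <= k < N) part a k z) = (fun z => 0 * 0).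
    by apply/funext => z; rewrite big_geq ?(ltnW MN)// mul0r.
  by rewrite (@N2Z R m lambda 0 (fun=> 0) L2_0) csq0 mul0r.
elim: N MN => [|N IH] MN.
  move: MN; rewrite leqn0 => /eqP ->; rewrite big_nil.
  have -> : psum a 0 0 = (fun z => 0 * 0) by apply/funext => z; rewrite /psum big_nil mul0r.
  by rewrite (@N2Z R m lambda 0 (fun=> 0) L2_0) csq0 mul0r.
have [->|MN'] := eqVneq M N.+1.
  rewrite big_geq//; have -> : psum a N.+1 N.+1 = (fun z => 0 * 0).
    by apply/funext => z; rewrite /psum big_geq// mul0r.
  by rewrite (@N2Z R m lambda 0 (fun=> 0) L2_0) csq0 mul0r.
have {MN'}MN' : (M <= N)%N by rewrite -ltnS ltn_neqAle MN' MN.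
rewrite big_nat_recr//= -IH//.
have -> : psum a M N.+1 = fun z => psum a M N z + part a N z.
  by apply/funext => z; rewrite /psum big_nat_recr.
rewrite N2D//; [|exact: L2_psum|exact: L2_part].
rewrite ip_suml; [|by move=> k; exact: L2_part|exact: L2_part].
rewrite big_nat_cond big1 ?mulr0 ?addr0// => k /andP[/andP[_ kN] _].
by rewrite ip_part_part// ltn_eqF.
Qed.

Lemma N2_psum_le a M N N' : (N <= N')%N -> N2 (psum a M N) <= N2 (psum a M N').
Proof.
move=> NN; rewrite !N2_psum; have [MN|MN] := leqP M N; last first.
  by rewrite big_geq ?(ltnW MN)// sumr_ge0// => k _; exact: N2_ge0.
by rewrite (big_cat_nat MN NN) /= lerDl sumr_ge0// => k _; exact: N2_ge0.
Qed.

Lemma coherent_eval w : coherent (fun I => cj (mono I w)).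
Proof.
move=> J; rewrite -[RHS](congr1 cj (reproducing w (erefl (size J)))).
rewrite conjM conj_real sumw_conj; congr (_ * _); apply: eq_sumw => I _.
by rewrite conjM gram_conj mulrC.
Qed.

(** The value at w is the pairing with the truncated reproducing kernel [psum b M N], whose squared
    norm is its own value at w; Cauchy-Schwarz concludes. *)
Lemma csq_psum a M N w : coherent a ->
  csq (psum a M N w) <= N2 (psum a M N) * \sum_(M <= k < N) ck k * sqnorm w ^+ k.
Proof.
move=> ha; pose b I := cj (mono I w) : C.
have hb : coherent b := coherent_eval w.
have E a' : coherent a' -> ip (psum a' M N) (psum b M N) = psum a' M N w.
  move=> ha'; rewrite ip_sumr; [|by move=> k; exact: L2_part|exact: L2_psum].
  apply: eq_big_nat => k kMN; rewrite ip_part_r; last exact: L2_psum.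
  congr (_ * _); apply: eq_sumw => I Ik.
  by rewrite ip_psum_mono// Ik kMN /b conjCK mulrC.
have E2 : psum b M N w = (\sum_(M <= k < N) ck k * sqnorm w ^+ k)%:C.
  rewrite rmorph_sum; apply: eq_bigr => k _; rewrite rmorphM rmorphXn /= -hdot_sq hdotX.
  by congr (_ * _); apply: eq_sumw => I _; rewrite mulrC.
have := cauchy_schwarz lam_gt (L2_psum a M N) (L2_psum b M N).
rewrite E// => h; apply: le_trans h _.
have e : ip (psum b M N) (psum b M N) = (N2 (psum b M N))%:C by rewrite ip_N2.
by move: e; rewrite (E _ hb) E2 => /complexI ->.
Qed.

Lemma ck_series_bounded (x : R) : 0 <= x < 1 -> exists K : R, 0 <= K /\ forall M N, \sum_(M <= k < N) ck k * x ^+ k <= K.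
Proof.
move=> /andP[x0 x1]; have l0 := lambda_gt0.
pose y := (x + 1) / 2; have [xy y1 y0] : [/\ x < y, y < 1 & 0 < y] by rewrite /y; split; lra.
(* the ratio of consecutive terms is x (lambda + k) / (k + 1) <= y for k >= k0 *)
pose k0 := (Num.truncn (lambda * x / (y - x))).+1.
have ratio k : (k0 <= k)%N -> x * (lambda + k%:R) / k.+1%:R <= y.
  move=> k0k; have yx : 0 < y - x by lra.
  have : lambda * x / (y - x) < k%:R by apply: lt_le_trans (truncnS_gt _) _; rewrite ler_nat.
  rewrite ltr_pdivrMr// ler_pdivrMr ?ltr0n// => h.
  rewrite -natr1; nra.
have k00 : 0 <= ck k0 * x ^+ k0 by rewrite mulr_ge0 ?exprn_ge0// ltW// ck_gt0.
pose A := ck k0 * x ^+ k0.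
have tail (j : nat) : ck (k0 + j) * x ^+ (k0 + j) <= A * y ^+ j.
  elim: j => [|j IH]; first by rewrite addn0 expr0 mulr1.
  rewrite addnS ckS exprS.
  rewrite [leLHS](_ : _ = (ck (k0 + j) * x ^+ (k0 + j)) * (x * (lambda + (k0 + j)%:R) / (k0 + j).+1%:R)); last first.
    by ring.
  rewrite exprSr; set q := x * (lambda + (k0 + j)%:R) / (k0 + j).+1%:R.
  rewrite [leRHS]mulrA; apply: ler_pM.
  - by rewrite mulr_ge0 ?exprn_ge0// ltW// ck_gt0.
  - by rewrite divr_ge0// mulr_ge0// addr_ge0// ltW.
  - exact: IH.
  - by apply: ratio; exact: leq_addr.
pose S := \sum_(0 <= k < k0) ck k * x ^+ k.
have tpos k : 0 <= ck k * x ^+ k by rewrite mulr_ge0 ?exprn_ge0// ltW// ck_gt0.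
have geo (j : nat) : \sum_(0 <= k < j) A * y ^+ k <= A / (1 - y).
  rewrite -mulr_sumr ler_wpM2l// -[leRHS]mul1r ler_pdivlMr; last by lra.
  have -> : (\sum_(0 <= k < j) y ^+ k) * (1 - y) = 1 - y ^+ j.
    elim: j => [|j IH]; first by rewrite big_nil mul0r expr0 subrr.
    by rewrite big_nat_recr//= mulrDl IH exprS; ring.
  by rewrite lerBlDr lerDl exprn_ge0// ltW.
exists (S + A / (1 - y)); split.
  by rewrite addr_ge0 ?sumr_ge0// divr_ge0//; lra.
have main N : \sum_(0 <= k < N) ck k * x ^+ k <= S + A / (1 - y).
  have [Nk|kN] := leqP N k0.
    apply: le_trans (_ : S <= _); last by rewrite lerDl divr_ge0//; lra.
    by rewrite /S (big_cat_nat _ Nk)//= lerDl sumr_ge0.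
  rewrite (big_cat_nat (n := k0))//= ?(ltnW kN)// lerD2l.
  rewrite -{1}[k0]add0n big_addn; apply: le_trans (geo (N - k0)%N).
  by apply: ler_sum => j _; rewrite addnC; exact: tail.
move=> M N; have [MN|MN] := leqP M N; last first.
  rewrite big_geq ?(ltnW MN)// addr_ge0 ?sumr_ge0// divr_ge0//; lra.
apply: le_trans (main N); rewrite [leRHS](big_cat_nat (n := M))//= lerDr sumr_ge0//.
Qed.

End Gram.

(** * Differentials on C^n against explicit estimates *)

Section Differentiability.
Context (R : realType) (m : nat).
Local Open Scope complex_scope.
Local Notation n := m.+1.
Local Notation C := R[i].
Local Notation V := 'cV[C]_n.

Lemma normC (x : C) : `|x| = (cn x)%:C.
Proof. by rewrite normc_def. Qed.

Lemma mx_norm_ge (v : V) i : (cn (v i ord0))%:C <= `|v|.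
Proof.
rewrite -normC [leRHS]/Num.Def.normr /= mx_normE.
have : (\big[Order.max/0%:nng]_ij `|v ij.1 ij.2|%:nng <= \big[Order.max/0%:nng]_ij `|v ij.1 ij.2|%:nng :> {nonneg C}) by [].
by move=> /bigmax_leP[_ /(_ (i, ord0) isT)]; rewrite -num_le.
Qed.

Lemma mx_norm_ge0 (v : V) : exists2 r : R, 0 <= r & `|v| = r%:C.
Proof.
have : 0 <= `|v| by [].
rewrite lecE => /andP[/eqP im re]; exists (complex.Re `|v|) => //.
by apply/eqP; rewrite eq_complex /= eqxx im eqxx.
Qed.

(** The bridge by which the one-variable Cauchy theory applies to elements of the Bergman space,
    along complex lines. *)
Lemma differentiable_line (f : V -> C) (z v : V) : differentiable f z ->
  cder (fun t => f (z + t *: v)) 0 ('d f z v).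
Proof.
move=> df e e0; have [r r0 rE] := mx_norm_ge0 v.
have e1 : 0 < (e / (r + 1))%:C.
  by rewrite ltcR divr_gt0// ltr_wpDl.
have /eqaddoP /(_ _ e1) := diff_locally df.
move=> /nbhs_ballP[s /= s0]; rewrite -ball_normE => hs.
have [s' s0' sE] : exists2 s' : R, 0 < s' & s = s'%:C.
  move: s0; rewrite ltcE => /andP[/eqP im re]; exists (complex.Re s) => //.
  by apply/eqP; rewrite eq_complex /= eqxx im eqxx.
exists (s' / (r + 1)); first by rewrite divr_gt0// ltr_wpDl.
move=> w; rewrite subr0 => wr.
have r1 : 0 < r + 1 by rewrite ltr_wpDl.
have wv : `|w *: v| = (cn w * r)%:C by rewrite normrZ normC rE rmorphM.
have := hs (w *: v); rewrite /ball_ /= sub0r normrN wv sE ltcR => /(_ _).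
rewrite -[(f \o _ - _) _]/(f (w *: v + z) - (f z + 'd f z (w *: v))) normC linearZ /= -rmorphM lecR => H.
rewrite scale0r addr0 (_ : f (z + w *: v) - f z - _ = f (w *: v + z) - (f z + w *: 'd f z v)); last first.
  by rewrite (addrC z) -[w *: 'd f z v]/(w * 'd f z v); ring.
apply: le_trans (H _) _.
  move: wr; rewrite ltr_pdivlMr//; apply: le_lt_trans.
  by rewrite ler_wpM2l ?cn_ge0// lerDl.
rewrite (_ : e / (r + 1) * (cn w * r) = e * cn w * (r / (r + 1))); last by ring.
rewrite ler_piMr ?mulr_ge0 ?cn_ge0//; first exact: ltW.
by rewrite ler_pdivrMr// mul1r lerDl.
Qed.

Definition linear_form (D : 'I_n -> C) (v : V) : C := \sum_j D j * v j ord0.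

Lemma linear_form_is_linear D : linear (linear_form D).
Proof.
move=> a u v; rewrite /linear_form scaler_sumr -big_split /=; apply: eq_bigr => j _.
by rewrite !mxE mulrDr -[a *: _]/(a * _); congr (_ + _); ring.
Qed.

HB.instance Definition _ D := GRing.isLinear.Build C V C _ (linear_form D) (linear_form_is_linear D).

Lemma linear_form_continuous D : continuous (linear_form D).
Proof.
rewrite /linear_form; elim: (index_enum _) => [|j s IH].
  rewrite (_ : (fun v => _) = fun=> 0); first exact: cst_continuous.
  by apply/funext => v; rewrite big_nil.
rewrite (_ : (fun v => _) = fun v : V => D j * v j ord0 + \sum_(j <- s) D j * v j ord0); last first.
  by apply/funext => v; rewrite big_cons.
have cj0 : continuous (fun v : V => D j * v j ord0).
  move=> v; apply: (@continuous_comp _ _ _ (fun v : V => v j ord0) (fun x : C => D j * x)).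
    exact: coord_continuous.
  exact: (@mulrl_continuous C (D j)).
move=> v; have H1 := cj0 v; have H2 := IH v.
exact: (@cvgD C C^o _ _ (nbhs_filter v) (fun v : V => D j * v j ord0 : C^o) (fun v : V => \sum_(j <- s) D j * v j ord0 : C^o) _ _ H1 H2).
Qed.

(** The factors n in the proof come from comparing the Euclidean norm with the sup norm of matrices:
    [sqnorm v] <= n |v|^2. *)
Lemma differentiable_criterion (f : V -> C) (z : V) (D : 'I_n -> C) :
  (forall e : R, 0 < e -> exists2 r : R, 0 < r & forall v : V, sqnorm v < r ->
     cn (f (z + v) - f z - linear_form D v) ^+ 2 <= e * sqnorm v) ->
  differentiable f z.
Proof.
move=> h.
have H (e : C) : 0 < e ->
    \forall v \near (0 : V), `|f (v + z) - (f z + linear_form D v)| <= e * `|v|.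
  move=> e0.
  have [e' e0' eE] : exists2 e' : R, 0 < e' & e = e'%:C.
    move: e0; rewrite ltcE => /andP[/eqP im re]; exists (complex.Re e) => //.
    by apply/eqP; rewrite eq_complex /= eqxx im eqxx.
  have e1 : 0 < e' ^+ 2 / n%:R by rewrite divr_gt0 ?exprn_gt0 ?ltr0n.
  have [r r0 hr] := h _ e1.
  have sq (v : V) (b : R) : `|v| = b%:C -> 0 <= b -> sqnorm v <= n%:R * b ^+ 2.
    move=> vb b0; rewrite sqnormE (le_trans (ler_sum (G := fun=> b ^+ 2) _ _))//.
      move=> i _; rewrite csq_cn//; have := mx_norm_ge v i; rewrite vb lecR//.
    by rewrite sumr_const card_ord mulr_natl.
  apply/nbhs_ballP; exists (Num.sqrt (r / n%:R))%:C.
    by rewrite /= ltcR sqrtr_gt0 divr_gt0 ?ltr0n.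
  rewrite -ball_normE => v /=; rewrite sub0r normrN.
  have [b b0 vb] := mx_norm_ge0 v; rewrite vb ltcR => br.
  have vr : sqnorm v < r.
    apply: le_lt_trans (sq _ _ vb b0) _.
    rewrite mulrC -ltr_pdivlMr ?ltr0n// -(sqr_sqrtr (_ : 0 <= r / n%:R)) ?divr_ge0 ?ltW//.
    by rewrite ltr_sqr ?nnegrE ?sqrtr_ge0.
  rewrite normC eE -rmorphM lecR.
  have e'0 := ltW e0'.
  rewrite -ler_sqr ?nnegrE ?cn_ge0 ?mulr_ge0//.
  rewrite opprD addrA (addrC v); apply: le_trans (hr v vr) _.
  apply: le_trans (ler_wpM2l (ltW e1) (sq _ _ vb b0)) _.
  by rewrite mulrA divfK ?pnatr_eq0// exprMn.
have dE : 'd f z = linear_form D :> (V -> C).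
  by apply: diff_unique; [exact: linear_form_continuous|apply/eqaddoP => e /H].
apply/diff_locallyP; rewrite dE; split; first exact: linear_form_continuous.
by apply/eqaddoP => e /H.
Qed.

End Differentiability.

(** * Limits of complex sequences *)

Section Sequences.
Context (R : realType).
Local Open Scope complex_scope.
Local Notation C := R[i].

Definition clim (u : nat -> C) (l : C) := forall e : R, 0 < e -> exists N, forall k, (N <= k)%N -> cn (u k - l) <= e.

Lemma clim_unique u l l' : clim u l -> clim u l' -> l = l'.
Proof.
move=> h h'; apply/eqP; rewrite -subr_eq0; apply/eqP; apply: cn_small => e e0.
have e2 : 0 < e / 2 by rewrite divr_gt0.
have [N hN] := h _ e2; have [N' hN'] := h' _ e2.
have := hN _ (leq_maxl N N'); have := hN' _ (leq_maxr N N'); set w := u _ => a b.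
have := cn_dist l w l'; rewrite -(cnN (l - w)) opprB; lra.
Qed.

Lemma real_cauchy (u : nat -> R) : (forall e : R, 0 < e -> exists N, forall k, (N <= k)%N -> `|u k - u N| <= e) ->
  exists l : R, u @ \oo --> l.
Proof.
move=> h; apply/cvg_ex; apply: R_complete; apply: cauchy_exP => e e0.
have [N hN] := h _ (divr_gt0 e0 (ltr0n _ 2)); exists (u N); exists N => // k /= /hN hk.
by rewrite /ball /= distrC; apply: le_lt_trans hk _; lra.
Qed.

Lemma clim_cauchy (u : nat -> C) :
  (forall e : R, 0 < e -> exists N, forall k, (N <= k)%N -> cn (u k - u N) <= e) ->
  exists l, clim u l.
Proof.
move=> h; have [a ha] : exists a : R, (fun k => complex.Re (u k)) @ \oo --> a.
  apply: real_cauchy => e /h[N hN]; exists N => k /hN; apply: le_trans.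
  by rewrite -cReN -cReD; exact: Re_le_cn.
have [b hb] : exists b : R, (fun k => complex.Im (u k)) @ \oo --> b.
  apply: real_cauchy => e /h[N hN]; exists N => k /hN; apply: le_trans.
  by rewrite -cImN -cImD; exact: Im_le_cn.
exists (a +i* b) => e e0; have e2 : 0 < e / 2 by rewrite divr_gt0.
have /cvgrPdist_le /(_ _ e2) [N1 _ h1] := ha; have /cvgrPdist_le /(_ _ e2) [N2 _ h2] := hb.
exists (maxn N1 N2) => k; rewrite geq_max => /andP[/h1 k1 /h2 k2].
apply: le_trans (cn_le_ReIm _) _; rewrite cReD cImD cReN cImN /=.
move: k1 k2; rewrite /= distrC (distrC b) => k1 k2; lra.
Qed.

Lemma clim_Re u l : clim u l -> (fun k => complex.Re (u k)) @ \oo --> complex.Re l.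
Proof.
move=> h; apply/cvgrPdist_le => e /h[N hN]; exists N => // k /= /hN; apply: le_trans.
by rewrite distrC -cReN -cReD; exact: Re_le_cn.
Qed.

Lemma clim_Im u l : clim u l -> (fun k => complex.Im (u k)) @ \oo --> complex.Im l.
Proof.
move=> h; apply/cvgrPdist_le => e /h[N hN]; exists N => // k /= /hN; apply: le_trans.
by rewrite distrC -cImN -cImD; exact: Im_le_cn.
Qed.

Lemma clim_csq u l : clim u l -> (fun k => csq (u k)) @ \oo --> csq l.
Proof. by move=> h; rewrite /csq; under eq_fun do rewrite !expr2; rewrite !expr2; apply: cvgD; apply: cvgM;
  solve [exact: clim_Re|exact: clim_Im]. Qed.

Lemma clim_le u l (M : R) : clim u l -> (exists N, forall k, (N <= k)%N -> cn (u k) <= M) -> cn l <= M.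
Proof.
move=> h [N hN]; apply/ler_addgt0Pr => e e0; have [N' hN'] := h _ e0.
have a := hN _ (leq_maxl N N'); have b := hN' _ (leq_maxr N N').
set w := u _ in a b.
have := cn_dist l w 0; rewrite !subr0 -(cnN (l - w)) opprB; lra.
Qed.

Lemma limn_einf_le (u : nat -> \bar R) (M : \bar R) : (forall k, u k <= M)%E -> (limn_einf u <= M)%E.
Proof.
move=> h; rewrite limn_einf_lim; apply: lime_le; first exact: is_cvg_einfs.
by apply: nearW => k; apply: le_trans (h k); apply: ereal_inf_lbound; exists k => //=.
Qed.

End Sequences.

(** * Cauchy estimates for polynomials on C^n *)

Section HolomorphicPolynomials.
Context (R : realType) (m : nat).
Local Open Scope complex_scope.
Local Notation n := m.+1.
Local Notation C := R[i].
Local Notation V := 'cV[C]_n.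
Local Notation word := (seq 'I_n).
#[local] Arguments sumw : simpl never.

(** The derivative [D] is known only along complex lines and through its linearity in the direction;
    its size will come from Cauchy estimates instead of formulas. *)
Definition lineder (F : V -> C) (D : V -> V -> C) :=
  (forall z v t, cder (fun t => F (z + t *: v)) t (D (z + t *: v) v)) /\
  (forall z v, D z v = linear_form (fun j => D z (delta_mx j 0)) v).

Definition holo_poly F := exists D, lineder F D.

Lemma holo_poly_cst (k : C) : holo_poly (fun=> k).
Proof.
exists (fun _ _ => 0); split=> [z v t|z v]; first exact: cder_cst.
by rewrite /linear_form big1// => j _; rewrite mul0r.
Qed.

Lemma linear_formD (D D' : 'I_n -> C) v :
  linear_form (fun j => D j + D' j) v = linear_form D v + linear_form D' v.
Proof. by rewrite -big_split; apply: eq_bigr => j _; rewrite mulrDl. Qed.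

Lemma linear_formZ (k : C) (D : 'I_n -> C) v :
  linear_form (fun j => k * D j) v = k * linear_form D v.
Proof. by rewrite mulr_sumr; apply: eq_bigr => j _; rewrite mulrA. Qed.

Lemma linear_formZr (k : C) (D : 'I_n -> C) v : linear_form D (k *: v) = k * linear_form D v.
Proof. by rewrite mulr_sumr; apply: eq_bigr => j _; rewrite mxE mulrCA. Qed.

Lemma holo_poly_coord i : holo_poly (fun z => z i ord0).
Proof.
exists (fun _ v => v i ord0); split=> [z v t|z v].
  have := cderD (cder_cst (z i ord0) t) (cderM (@cder_id R t) (cder_cst (v i ord0) t)).
  rewrite add0r mulr0 addr0 mul1r; congr (cder _ _ _).
  by apply/funext => w; rewrite !mxE.
rewrite /linear_form (bigD1 i)//= big1 ?addr0; last first.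
  by move=> j ji; rewrite mxE eq_sym (negbTE ji) mul0r.
by rewrite mxE !eqxx mul1r.
Qed.

Lemma holo_polyD F G : holo_poly F -> holo_poly G -> holo_poly (fun z => F z + G z).
Proof.
move=> [D [d1 d2]] [D' [d1' d2']]; exists (fun z v => D z v + D' z v); split=> [z v t|z v].
  exact: cderD.
by rewrite linear_formD -d2 -d2'.
Qed.

Lemma holo_polyM F G : holo_poly F -> holo_poly G -> holo_poly (fun z => F z * G z).
Proof.
move=> [D [d1 d2]] [D' [d1' d2']].
exists (fun z v => D z v * G z + F z * D' z v); split=> [z v t|z v].
  exact: cderM.
rewrite linear_formD; congr (_ + _); last by rewrite linear_formZ -d2'.
rewrite (_ : linear_form _ v = linear_form (fun j => G z * D z (delta_mx j 0)) v).
  by rewrite linear_formZ -d2 mulrC.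
by congr linear_form; apply/funext => j; rewrite mulrC.
Qed.

Lemma holo_poly_mono I : holo_poly (mono I).
Proof.
elim: I => [|i I IH].
  rewrite (_ : mono [::] = fun=> 1); first exact: holo_poly_cst.
  by apply/funext => z; rewrite mono_nil.
rewrite (_ : mono (i :: I) = fun z => z i ord0 * mono I z).
  by apply: holo_polyM => //; exact: holo_poly_coord.
by apply/funext => z; rewrite mono_cons.
Qed.

Lemma holo_poly_sum (T : Type) (s : seq T) (F : T -> V -> C) : (forall x, holo_poly (F x)) ->
  holo_poly (fun z => \sum_(x <- s) F x z).
Proof.
move=> hF; elim: s => [|x s IH].
  rewrite (_ : (fun z => _) = fun=> 0); first exact: holo_poly_cst.
  by apply/funext => z; rewrite big_nil.
rewrite (_ : (fun z => _) = fun z => F x z + \sum_(x <- s) F x z); first exact: holo_polyD.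
by apply/funext => z; rewrite big_cons.
Qed.

Lemma holo_poly_sumw k (F : word -> V -> C) : (forall I, holo_poly (F I)) ->
  holo_poly (fun z => sumw k (F^~ z)).
Proof.
elim: k F => [|k IH] F hF; first exact: hF.
under eq_fun do rewrite sumwS; apply: holo_poly_sum => i.
exact: (IH (fun K => F (i :: K))).
Qed.

Lemma linederB F G D D' : lineder F D -> lineder G D' ->
  lineder (fun z => F z - G z) (fun z v => D z v - D' z v).
Proof.
move=> [d1 d2] [d1' d2']; split=> [z v t|z v].
  have := cderD (d1 z v t) (cderM (cder_cst (-1) t) (d1' z v t)).
  rewrite mul0r add0r mulN1r; congr (cder _ _ _).
  by apply/funext => w; rewrite mulN1r.
rewrite linear_formD -d2 (_ : linear_form (fun j => - D' z (delta_mx j 0)) v =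
  linear_form (fun j => -1 * D' z (delta_mx j 0)) v); last first.
  by congr linear_form; apply/funext => j; rewrite mulN1r.
by rewrite linear_formZ -d2' mulN1r.
Qed.

Lemma climB (u v : nat -> C) k l : clim u k -> clim v l -> clim (fun N => u N - v N) (k - l).
Proof.
move=> hu hv e e0; have e2 : 0 < e / 2 by rewrite divr_gt0.
have [N hN] := hu _ e2; have [N' hN'] := hv _ e2; exists (maxn N N') => j.
rewrite geq_max => /andP[/hN a /hN' b].
rewrite (_ : _ - _ = (u j - k) - (v j - l)); last by ring.
by apply: le_trans (cnB _ _) _; lra.
Qed.

Lemma clim_linear_form (D : nat -> 'I_n -> C) (Dl : 'I_n -> C) v :
  (forall j, clim (fun N => D N j) (Dl j)) ->
  clim (fun N => linear_form (D N) v) (linear_form Dl v).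
Proof.
move=> h; rewrite /linear_form; elim: (index_enum _) => [|j s IH].
  by move=> e e0; exists 0%N => k _; rewrite !big_nil subrr cn0 ltW.
move=> e e0; have e2 : 0 < e / 2 by rewrite divr_gt0.
have v0 : 0 < cn (v j ord0) + 1 by rewrite ltr_wpDl// cn_ge0.
have [N hN] := IH _ e2; have [N' hN'] := h j _ (divr_gt0 e2 v0); exists (maxn N N') => k.
rewrite geq_max => /andP[/hN a /hN' b]; rewrite !big_cons.
set S := \sum_(_ <- s) _ in a *; set S' := \sum_(_ <- s) _ in a *.
rewrite (_ : _ - _ = (D k j - Dl j) * v j ord0 + (S - S')); last by ring.
apply: le_trans (cnD _ _) _; rewrite cnM.
have : cn (D k j - Dl j) * cn (v j ord0) <= e / 2.
  move: b; rewrite ler_pdivlMr// => b; apply: le_trans b.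
  by rewrite ler_wpM2l ?cn_ge0// lerDl.
lra.
Qed.

(** The function (g z - g 0) / z - k tends to 0 at the origin, so its circle integral is 0, and so
    is that of g 0 / z. *)
Lemma cmean_deriv (g : C -> C) (r R0 : R) (k : C) : 0 < r < R0 -> holo_disk g R0 ->
  cder g 0 k -> cmean (fun z => g z * z^-1) r = (pi - - pi)%:C * k.
Proof.
move=> /andP[r0 rR] hg hk.
have hv z : 0 < cn z -> exists l, cder (fun x : C => x^-1) z l.
  by move=> z0; have := cderV (f := id) (_ : z != 0) (@cder_id R z);
    rewrite -cn_gt0 => /(_ z0) ?; eexists; eassumption.
pose h z := (g z - g 0) * z^-1 - k.
have hd z : 0 < cn z < R0 -> exists l, cder h z l.
  move=> /andP[z0 zR]; have [l hl] := hg z zR; have [l' hl'] := hv z z0.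
  have := cderD (cderM (cderD hl (cder_cst (- g 0) z)) hl') (cder_cst (- k) z).
  by move=> ?; eexists; eassumption.
have Z : cmean h r = 0.
  apply: (@cmean_vanish R h R0 (r / 2) r) => //.
  - by apply/andP; split; lra.
  - by move=> z /hd[l]; exact: cder_cont.
  - by move=> z /hd.
  move=> e e0; have [s s0 hs] := hk e e0; exists s => // z /andP[z0 zs].
  have := hs z; rewrite !subr0 => /(_ zs) H.
  have zn : z != 0 by rewrite -cn_gt0.
  rewrite (_ : h z = (g z - g 0 - k * z) * z^-1); last by rewrite /h; field.
  by rewrite cnM cnV ler_pdivrMr.
have gc z : cn z = r -> ccontz (fun z => g z * z^-1) z.
  move=> zr; have [l hl] := hg z ltac:(by rewrite zr); have [l' hl'] := hv z ltac:(by rewrite zr).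
  exact: cder_cont (cderM hl hl').
have E : cmean (fun z => g z * z^-1) r =
    cmean (fun z => (h z + g 0 * (1 * (z ^+ 1)^-1)) + k) r.
  by apply: eq_cmean => // z _; rewrite /h expr1; ring.
rewrite E cmeanD//; last by move=> z _; exact: ccontz_cst.
  rewrite cmeanD//.
  - rewrite Z add0r cmeanZ ?cmean_Xn_inv ?mulr0 ?add0r//.
      by rewrite /cmean cint_cst ?[k * _]mulrC//; have := pi_gt0 R; lra.
    move=> z zr; have [l hl] := hv z ltac:(by rewrite zr).
    by apply: ccontzM; [exact: ccontz_cst|exact: cder_cont hl].
  - by move=> z zr; have [l hl] := hd z ltac:(by rewrite zr r0); exact: cder_cont hl.
  - move=> z zr; have [l hl] := hv z ltac:(by rewrite zr).
    by apply: ccontzM; [exact: ccontz_cst|apply: ccontzM; [exact: ccontz_cst|exact: cder_cont hl]].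
move=> z zr; have [l hl] := hd z ltac:(by rewrite zr r0); have [l' hl'] := hv z ltac:(by rewrite zr).
have := cder_cont (cderD hl (cderM (cder_cst (g 0) z) (cderM (cder_cst 1 z) hl'))).
exact.
Qed.

(** Both bounds see F only through its size on a circle of the line z + C u, hence are uniform over
    the partial sums to which they are applied. *)
Lemma holo_poly_quad F D (z u : V) (rho r M : R) : lineder F D -> 0 < rho < r -> 0 <= M ->
  (forall t : C, cn t = r -> cn (F (z + t *: u)) <= M) ->
  cn (D z u) <= 2 * M / r /\
  cn (F (z + rho%:C *: u) - F z - D z (rho%:C *: u)) <= 2 * (M * ((rho / r) ^+ 2 / (1 - rho / r))).
Proof.
move=> [d1 d2] rr M0 hM; have /andP[rho0 rhor] := rr; have r0 := lt_trans rho0 rhor.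
pose g t := F (z + t *: u).
have hg : holo_disk g (2 * r) by move=> t _; exists (D (z + t *: u) u); exact: d1.
have pi2 := pi2_gt0 R.
have rR : 0 < r < 2 * r by apply/andP; split; lra.
have r2 : r < 2 * r by lra.
have g0 : cder g 0 (D z u) by have := d1 z u 0; rewrite scale0r addr0.
have E := cmean_deriv rR hg g0.
have gc t : cn t = r -> ccontz g t by move=> tr; apply: holo_cont hg _; rewrite tr.
have tc t : cn t = r -> t != 0 by move=> tr; rewrite -cn_gt0 tr.
split.
  rewrite -(ler_pM2l pi2) -[X in X * _](gtr0_norm pi2) -(cn_real (pi - - pi)) -cnM -E.
  apply: le_trans (cmean_le r0 (M := M / r) _ _) _.
  - move=> t tr; apply: ccontzM; first exact: gc.
    by apply: ccontzV; exact: tc.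
  - by move=> t tr; rewrite cnM cnV tr ler_pM2r ?invr_gt0// hM.
  - by rewrite le_eqVlt; apply/orP; left; apply/eqP; ring.
have := holo_quad rr r2 hg hM.
rewrite E (_ : _ - _ = (pi - - pi)%:C * (F (z + rho%:C *: u) - F z - D z (rho%:C *: u))); last first.
  rewrite /g scale0r addr0 [D z (_ *: _)]d2 linear_formZr -d2; ring.
by rewrite cnM cn_real gtr0_norm// mulrA mulrC ler_pM2r.
Qed.

Lemma sqnorm_near (z : V) : sqnorm z < 1 -> exists rho1 r : R, [/\ rho1 < 1, 0 < r, sqnorm z <= rho1 &
  forall (t : C) (u : V), cn t <= r -> sqnorm u <= 1 -> sqnorm (z + t *: u) <= rho1].
Proof.
move=> z1; have z0 := sqnorm_ge0 z; set s := sqnorm z in z0 z1 *.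
(* From |a + b|^2 <= (1 + eta) |a|^2 + (1 + 1/eta) |b|^2, the perturbed point has squared norm at
   most (1 + eta) s + eta <= s + 2 eta = (1 + s) / 2. *)
pose eta := (1 - s) / 4; have eta0 : 0 < eta by rewrite divr_gt0// subr_gt0.
have K0 : 0 < 1 + eta^-1 by rewrite ltr_wpDl// invr_gt0.
pose r := Num.min 1 (eta / (1 + eta^-1)); have r0 : 0 < r by rewrite lt_min ltr01 divr_gt0.
have r1 : r <= 1 by rewrite /r ge_min lexx.
have rK : (1 + eta^-1) * r <= eta.
  by rewrite mulrC -ler_pdivlMr// /r ge_min lexx orbT.
have csqD (a b : C) : csq (a + b) <= (1 + eta) * csq a + (1 + eta^-1) * csq b.
  case: a b => a1 a2 [b1 b2]; rewrite /csq /=.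
  have h (x y : R) : (x + y) ^+ 2 <= (1 + eta) * x ^+ 2 + (1 + eta^-1) * y ^+ 2.
    have : 0 <= (eta * x - y) ^+ 2 / eta by rewrite divr_ge0 ?sqr_ge0// ltW.
    rewrite (_ : (eta * x - y) ^+ 2 / eta = eta * x ^+ 2 - 2 * x * y + eta^-1 * y ^+ 2); last first.
      by field; rewrite gt_eqF.
    by nra.
  by have := h a1 b1; have := h a2 b2; lra.
exists ((1 + s) / 2), r; split => //; [lra|lra|].
move=> t u tr u1.
have -> : sqnorm (z + t *: u) = \sum_i csq (z i ord0 + t * u i ord0).
  by rewrite sqnormE; apply: eq_bigr => i _; rewrite !mxE.
apply: le_trans (ler_sum _ (fun i _ => csqD _ _)) _.
rewrite big_split /= -!mulr_sumr -sqnormE -/s.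
rewrite (_ : \sum_i csq (t * u i ord0) = sqnorm (t *: u)); last first.
  by rewrite sqnormE; apply: eq_bigr => i _; rewrite !mxE.
rewrite sqnormZ; have t2 : csq t * sqnorm u <= r.
  rewrite -[leRHS]mulr1; apply: ler_pM => //; [exact: csq_ge0|exact: sqnorm_ge0|].
  rewrite -cn_sq; apply: le_trans (_ : r ^+ 2 <= _); first by rewrite ler_sqr ?nnegrE ?cn_ge0// ltW.
  by rewrite expr2 ler_piMr// ltW.
have := ler_wpM2l (ltW K0) t2.
have : eta * s <= eta by rewrite ler_piMr ?ltW.
by rewrite /eta in rK *; lra.
Qed.

End HolomorphicPolynomials.

(** * Functions with prescribed coefficients *)

Section Riesz.
Context (R : realType) (m : nat).
Local Open Scope complex_scope.
Local Notation n := m.+1.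
Local Notation C := R[i].
Local Notation V := 'cV[C]_n.
Local Notation word := (seq 'I_n).
Variable lambda : R.
Hypothesis lam_gt : n%:R < lambda.
Local Notation leb := (lebesgue_Cn R n).
Local Notation wt := (@wt R m lambda).
Local Notation RI := (@RI R m lambda).
Local Notation IntB := (@IntB R m lambda).
Local Notation ip := (@ip R n lambda).
Local Notation N2 := (@N2 R m lambda).
Local Notation L2B := (@L2B R m lambda).
Local Notation psum := (@psum R m lambda).
Local Notation part := (@part R m lambda).
Local Notation coherent := (@coherent R m lambda).
Implicit Types (a : word -> C) (I J : word).
#[local] Arguments sumw : simpl never.

Lemma bmeas_cvg (u : nat -> V -> R) (v : V -> R) : (forall k, bmeas (u k)) ->
  (forall z, sqnorm z < 1 -> (fun k => u k z) @ \oo --> v z) -> bmeas v.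
Proof.
move=> mu uv; apply: (@measurable_fun_cvg _ _ R _ (fun k t => u k (cvec t))) => // t tb.
exact: uv.
Qed.

Lemma fatou_RI (u : nat -> V -> R) (v : V -> R) (M : R) :
  (forall k z, sqnorm z < 1 -> 0 <= u k z) -> (forall k, IntB (u k)) -> (forall k, RI (u k) <= M) ->
  (forall z, sqnorm z < 1 -> (fun k => u k z) @ \oo --> v z) -> IntB v /\ RI v <= M.
Proof.
move=> u0 ui uM uv.
have mv : bmeas v by apply: bmeas_cvg uv => k; exact: IntB_bmeas (ui k).
have uw k z : 0 <= u k z * wt z.
  have [z1|z1] := ltP (sqnorm z) 1; last by rewrite (wt_out lambda z1) mulr0.
  by rewrite mulr_ge0 ?u0// wt_ge0.
have vw z : (fun k => u k z * wt z) @ \oo --> v z * wt z.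
  have [z1|z1] := ltP (sqnorm z) 1.
    by apply: cvgMr_tmp; exact: uv.
  by rewrite (wt_out lambda z1) mulr0; under eq_fun do rewrite mulr0; exact: cvg_cst.
have vw0 z : 0 <= v z * wt z.
  rewrite -(cvg_lim (@Rhausdorff R) (vw z)); apply: limr_ge; first exact: cvgP (vw z).
  by apply: nearW => k; exact: uw.
have F := @fatou _ _ R leb setT measurableT (fun k t => (u k (cvec t) * wt (cvec t))%:E)
  (fun k => ltac:(by apply/measurable_EFinP; exact: bmeas_wt (IntB_bmeas (ui k))))
  (fun k t _ => ltac:(by rewrite lee_fin; exact: uw)).
have EF : (\int[leb]_t (v (cvec t) * wt (cvec t))%:E <= M%:E)%E.
  apply: le_trans (le_trans F _).
    rewrite le_eqVlt; apply/orP; left; apply/eqP; apply: eq_integral => t _.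
    have cE : (fun k => (u k (cvec t) * wt (cvec t))%:E) @ \oo --> (v (cvec t) * wt (cvec t))%:E.
      by apply: cvg_EFin; [exact: nearW|exact: vw].
    by have [-> _] := cvg_limn_einf_sup cE.
  apply: limn_einf_le => k.
  rewrite -[X in (X <= _)%E]fineK ?lee_fin; first exact: uM.
  exact: integrable_fin_num (ui k).
have iv : IntB v.
  apply/integrableP; split; first by apply/measurable_EFinP; exact: bmeas_wt.
  apply: le_lt_trans (ltry M); apply: le_trans EF.
  by rewrite le_eqVlt; apply/orP; left; apply/eqP; apply: eq_integral => t _; rewrite /= ger0_norm.
split => //; rewrite -lee_fin; apply: le_trans EF; rewrite fineK//.
exact: integrable_fin_num iv.
Qed.

Lemma ipBl f g h : L2B f -> L2B g -> L2B h -> ip (fun z => f z - g z) h = ip f h - ip g h.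
Proof.
move=> hf hg hh; rewrite (_ : (fun z => f z - g z) = fun z => f z + (-1) * g z); last first.
  by apply/funext => z; rewrite mulN1r.
by rewrite ipDl ?ipZl ?mulN1r//; exact: L2Z.
Qed.

Lemma psum_cat a M N N' : (M <= N)%N -> (N <= N')%N -> forall z,
  psum a M N' z = psum a M N z + psum a N N' z.
Proof. by move=> MN NN z; rewrite /psum (big_cat_nat MN NN). Qed.

Section Limit.
Variables (a : word -> C) (B : R).
Hypotheses (ha : coherent a) (hB : forall N, N2 (psum a 0 N) <= B).

(** The squared norms of the partial sums are nondecreasing and bounded, and by orthogonality of the
    degrees their increments are the squared norms of the blocks. *)
Lemma psum_tail (e : R) : 0 < e -> exists N0, forall N N', (N0 <= N)%N -> (N <= N')%N ->
  N2 (psum a N N') <= e.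
Proof.
move=> e0; pose S N := N2 (psum a 0 N).
have hs : has_sup (range S) by split; [exists (S 0%N), 0%N|exists B => _ [k _ <-]; exact: hB].
have [_ [N0 _ <-] hN0] := sup_adherent e0 hs.
exists N0 => N N' NN NN'.
have h1 : S N0 <= S N by apply: N2_psum_le.
have h2 : S N' <= sup (range S) by apply: (sup_upper_bound hs); exists N'.
have : S N' = S N + N2 (psum a N N').
  by rewrite /S !N2_psum// (big_cat_nat (leq0n N) NN').
move: hN0; rewrite /= -/(S N0); lra.
Qed.

Lemma psum_unif (x e : R) : 0 <= x < 1 -> 0 < e -> exists N0, forall N N' z,
  (N0 <= N)%N -> (N <= N')%N -> sqnorm z <= x -> cn (psum a N N' z) <= e.
Proof.
move=> x01 e0; have [K [K0 hK]] := ck_series_bounded lam_gt x01.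
have K1 : 0 < K + 1 by rewrite ltr_wpDl.
have [N0 hN] := psum_tail (divr_gt0 (exprn_gt0 2 e0) K1).
exists N0 => N N' z NN NN' zx.
rewrite -ler_sqr ?nnegrE ?cn_ge0 ?(ltW e0)// cn_sq.
apply: le_trans (csq_psum lam_gt N N' z ha) _.
apply: le_trans (ler_pM (N2_ge0 lam_gt _) _ (hN _ _ NN NN') (_ : _ <= K)) _.
- by apply: sumr_ge0 => k _; rewrite mulr_ge0 ?exprn_ge0 ?sqnorm_ge0// ltW// (ck_gt0 lam_gt).
- apply: le_trans (hK N N'); apply: ler_sum => k _; rewrite ler_wpM2l ?(ltW (ck_gt0 lam_gt _))//.
  by rewrite lerXn2r ?nnegrE ?sqnorm_ge0//; case/andP: x01.
- rewrite mulrAC ler_pdivrMr// ler_pM2l ?exprn_gt0// lerDl//.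
Qed.

Lemma psum_bounded (x : R) : 0 <= x < 1 -> exists2 M : R, 0 < M & forall N z,
  sqnorm z <= x -> cn (psum a 0 N z) <= M.
Proof.
move=> x01; have [K [K0 hK]] := ck_series_bounded lam_gt x01.
have B0 : 0 <= B := le_trans (N2_ge0 lam_gt _) (hB 0).
exists (B * K + 1); first by rewrite ltr_wpDl// mulr_ge0.
move=> N z zx; have BK : 0 <= B * K by rewrite mulr_ge0.
rewrite -ler_sqr ?nnegrE ?cn_ge0 ?addr_ge0// cn_sq.
apply: le_trans (csq_psum lam_gt 0 N z ha) _.
apply: le_trans (ler_pM (N2_ge0 lam_gt _) _ (hB N) (_ : _ <= K)) _.
- by apply: sumr_ge0 => k _; rewrite mulr_ge0 ?exprn_ge0 ?sqnorm_ge0// ltW// (ck_gt0 lam_gt).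
- apply: le_trans (hK 0%N N); apply: ler_sum => k _; rewrite ler_wpM2l ?(ltW (ck_gt0 lam_gt _))//.
  by rewrite lerXn2r ?nnegrE ?sqnorm_ge0//; case/andP: x01.
- nra.
Qed.

(** The pointwise limit of the partial sums, extended by 0 like every element of the Bergman
    space. *)
Definition hlim (z : V) : C :=
  if sqnorm z < 1 then xget 0 [set l | clim (fun N => psum a 0 N z) l] else 0.

Lemma hlimP z : sqnorm z < 1 -> clim (fun N => psum a 0 N z) (hlim z).
Proof.
move=> z1; rewrite /hlim z1.
have [l hl] : exists l, clim (fun N => psum a 0 N z) l.
  apply: clim_cauchy => e e0; have [|N0 hN] := @psum_unif (sqnorm z) e _ e0.
    by rewrite sqnorm_ge0.
  by exists N0 => k kN; rewrite (psum_cat a (leq0n N0) kN) addrC addKr; exact: hN.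
by apply: (@xgetPex _ 0 [set l | clim (fun N => psum a 0 N z) l]); exists l.
Qed.

Lemma bcmeas_hlim : bcmeas hlim.
Proof.
have mp k : bcmeas (psum a 0 k) by case: (L2_psum lam_gt a 0 k).
split.
  have := @bmeas_cvg (fun k z => complex.Re (psum a 0 k z)) (fun z => complex.Re (hlim z)).
  by apply => [k|z /hlimP/clim_Re//]; case: (mp k).
have := @bmeas_cvg (fun k z => complex.Im (psum a 0 k z)) (fun z => complex.Im (hlim z)).
by apply => [k|z /hlimP/clim_Im//]; case: (mp k).
Qed.

(** Fatou's lemma, applied to the blocks from N on, turns pointwise convergence and the tail bound
    into convergence in norm; completeness of L^2 is thereby avoided. *)
Lemma hlim_approx (e : R) : 0 < e -> exists N0, forall N, (N0 <= N)%N ->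
  L2B (fun z => hlim z - psum a 0 N z) /\ N2 (fun z => hlim z - psum a 0 N z) <= e.
Proof.
move=> e0; have [N0 hN] := psum_tail e0; exists N0 => N NN.
have cl0 := c_lambda_gt0 lam_gt.
have [||||i r] := @fatou_RI (fun k z => csq (psum a N (N + k) z)) (fun z => csq (hlim z - psum a 0 N z))
  (e / c_lambda n lambda).
- by move=> *; exact: csq_ge0.
- by move=> k; have [] := L2_psum lam_gt a N (N + k).
- move=> k; rewrite ler_pdivlMr// mulrC; exact: (hN N (N + k)%N NN (leq_addr _ _)).
- move=> z /hlimP h; apply: clim_csq => e' /h[N1 hN1]; exists N1 => k kN.
  have := hN1 (N + k)%N (leq_trans kN (leq_addl _ _)).
  by rewrite (psum_cat a (leq0n N) (leq_addr k N)); congr (cn _ <= _); ring.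
split; first split => //.
  apply: cmeasB; first exact: bcmeas_hlim.
  by have [] := L2_psum lam_gt a 0 N.
by rewrite /N2 mulrC -ler_pdivlMr.
Qed.

Lemma L2_hlim : L2B hlim.
Proof.
have [N0 hN] := hlim_approx ltr01; have [h _] := hN _ (leqnn N0).
have := L2D h (L2_psum lam_gt a 0 N0).
by apply: eq_L2 => z _; rewrite subrK.
Qed.

Lemma ip_hlim J : ip hlim (mono J) = a J.
Proof.
apply/eqP; rewrite -subr_eq0; apply/eqP; apply: cn_small => e e0.
have M0 := N2_ge0 lam_gt (mono J).
have M1 : 0 < N2 (mono J) + 1 by rewrite ltr_wpDl.
have [N0 hN] := hlim_approx (divr_gt0 (exprn_gt0 2 e0) M1).
have [h1 h2] := hN (maxn N0 (size J).+1) (leq_maxl _ _).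
have := cauchy_schwarz lam_gt h1 (L2_mono lam_gt J).
have E : ip (psum a 0 (maxn N0 (size J).+1)) (mono J) = a J.
  by rewrite ip_psum_mono//= leq_max ltnSn orbT.
rewrite (ipBl L2_hlim (L2_psum lam_gt a 0 _) (L2_mono lam_gt J)) E.
move=> H; rewrite -ler_sqr ?nnegrE ?cn_ge0 ?(ltW e0)// cn_sq; apply: le_trans H _.
apply: le_trans (ler_wpM2r M0 h2) _.
by rewrite mulrAC ler_pdivrMr// ler_pM2l ?exprn_gt0// lerDl.
Qed.

Lemma holo_psum M N : holo_poly (psum a M N).
Proof.
rewrite -[psum a M N]/(fun z => \sum_(M <= k < N) part a k z); apply: holo_poly_sum => k.
apply: holo_polyM; first exact: holo_poly_cst.
apply: (holo_poly_sumw k (F := fun I z => a I * mono I z)) => I.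
by apply: holo_polyM; [exact: holo_poly_cst|exact: holo_poly_mono].
Qed.

(** The derivatives of the partial sums converge by the Cauchy estimates, and the quadratic
    remainder, being uniform in N, passes to the limit. *)
Lemma differentiable_hlim z : sqnorm z < 1 -> differentiable hlim z.
Proof.
move=> z1; have [x [r [x1 r0 zx near]]] := sqnorm_near z1.
have x01 : 0 <= x < 1 by rewrite (le_trans (sqnorm_ge0 z) zx).
have [M M0 hM] := psum_bounded x01.
have [D hD] := choice (fun N => holo_psum 0 N).
have d1 (j : 'I_n) : sqnorm (delta_mx j 0 : V) <= 1.
  rewrite sqnormE (bigD1 j)//= big1 ?addr0; last first.
    by move=> i ij; rewrite mxE (negbTE ij) csq0.
  by rewrite mxE !eqxx csq1.
have cauchyD j : exists l, clim (fun N => D N z (delta_mx j 0)) l.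
  apply: clim_cauchy => e e0; have e1 : 0 < e * r / 2 by rewrite divr_gt0// mulr_gt0.
  have [N0 hN] := psum_unif x01 e1; exists N0 => k kN.
  have r2 : 0 < r / 2 < r by apply/andP; split; lra.
  have := holo_poly_quad (z := z) (u := delta_mx j 0) (linederB (hD k) (hD N0)) r2 (ltW e1).
  case.
    move=> t tr; rewrite (psum_cat a (leq0n N0) kN) addrC addKr.
    by apply: hN => //; apply: near; rewrite ?tr.
  by move=> H _; apply: le_trans H _; rewrite ler_pdivrMr//; lra.
have [Dl hDl] := choice cauchyD.
apply: (differentiable_criterion (D := Dl)) => e e0.
(* For q = rho / r <= 1/2 the remainder 2 M q^2 / (1 - q) is at most 4 M q^2. *)
pose K := 4 * M / r ^+ 2; have K0 : 0 <= K by rewrite divr_ge0 ?mulr_ge0 ?exprn_ge0 ?ltW.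
have K1 : 0 < K ^+ 2 + 1 by rewrite ltr_wpDl// sqr_ge0.
exists (Num.min ((r / 2) ^+ 2) (Num.min (1 - x) (e / (K ^+ 2 + 1)))).
  by rewrite !lt_min exprn_gt0 ?divr_gt0// subr_gt0 x1.
move=> v; rewrite !lt_min => /andP[vr /andP[_ ve]].
have [v0|v0] := eqVneq (sqnorm v) 0.
  have -> : v = 0.
    apply/matrixP => i j; rewrite (ord1 j) mxE; apply/eqP; rewrite -csq_eq0 eq_le csq_ge0 andbT -v0.
    exact: coord_le.
  rewrite addr0 subrr /linear_form big1 ?subrr ?cn0 ?expr0n ?mulr_ge0 ?sqnorm_ge0 ?ltW//.
  by move=> j _; rewrite mxE mulr0.
have v1 : 0 < sqnorm v by rewrite lt_neqAle eq_sym v0 sqnorm_ge0.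
pose rho := Num.sqrt (sqnorm v); have rho0 : 0 < rho by rewrite sqrtr_gt0.
have rho2 : rho ^+ 2 = sqnorm v by rewrite sqr_sqrtr// ltW.
have rhor : rho < r / 2 by rewrite -ltr_sqr ?nnegrE ?ltW ?divr_gt0// rho2.
pose u := (rho^-1)%:C *: v.
have vu : v = rho%:C *: u by rewrite scalerA -rmorphM divff ?gt_eqF// scale1r.
have u1 : sqnorm u <= 1 by rewrite sqnormZ csq_real exprVn rho2 mulVf.
have zv : sqnorm (z + v) < 1.
  apply: le_lt_trans x1; rewrite vu; apply: near => //.
  by rewrite cn_real gtr0_norm//; lra.
have rr : 0 < rho < r by rewrite rho0; lra.
have Q N : cn (psum a 0 N (z + v) - psum a 0 N z - D N z v) <= K * sqnorm v.
  have := holo_poly_quad (z := z) (u := u) (hD N) rr (ltW M0).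
  case.
    by move=> t tr; apply: hM; apply: near; rewrite ?tr.
  move=> _; rewrite -vu => H; apply: le_trans H _.
  have q2 : rho / r <= 1 / 2 by rewrite ler_pdivrMr//; lra.
  have q0 : 0 <= rho / r by rewrite divr_ge0// ltW.
  rewrite (_ : K * sqnorm v = 4 * M * (rho / r) ^+ 2); last by rewrite /K -rho2 expr_div_n; ring.
  set q := rho / r in q2 q0 *.
  have q3 : q ^+ 2 / (1 - q) <= 2 * q ^+ 2.
    by rewrite ler_pdivrMr; [have := sqr_ge0 q; nra|lra].
  have := ler_wpM2l (ltW M0) q3; lra.
have L : clim (fun N => psum a 0 N (z + v) - psum a 0 N z - D N z v)
    (hlim (z + v) - hlim z - linear_form Dl v).
  apply: climB; first by apply: climB; exact: hlimP.
  have -> : (fun N => D N z v) = fun N => linear_form (fun j => D N z (delta_mx j 0)) v.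
    by apply/funext => N; have [_ ->] := hD N.
  by apply: clim_linear_form.
have F := clim_le L (ex_intro _ 0%N (fun N _ => Q N)).
apply: le_trans (_ : (K * sqnorm v) ^+ 2 <= _).
  by rewrite ler_sqr ?nnegrE ?cn_ge0// mulr_ge0// ltW.
rewrite exprMn expr2 mulrA ler_pM2r//; move: ve; rewrite ltr_pdivlMr// => ve.
by rewrite mulrC; apply: le_trans (ltW ve); rewrite ler_pM2l// lerDl.
Qed.

Lemma bergman_hlim : bergman_space lambda hlim.
Proof.
split; first by apply/L2E => //; exact: L2_hlim.
- by move=> z z1; exact: differentiable_hlim.
- by move=> z /negP z1; rewrite /hlim (negbTE z1).
Qed.

End Limit.

End Riesz.

(** * Shifting the angle in a periodic integral *)

Section PeriodicShift.
Context (R : realType).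
Local Open Scope complex_scope.
Local Notation C := R[i].
Local Notation mu := (@lebesgue_measure R).

Lemma Rintegral_shift (a b c : R) (h : R -> R) : continuous h ->
  \int[mu]_(x in `[a, b]) h (x + c) = \int[mu]_(x in `[a + c, b + c]) h x.
Proof.
move=> ch; rewrite /Rintegral; congr fine.
rewrite [LHS]integral_mkcond [RHS]integral_mkcond.
pose g : measurableTypeR R -> \bar R := (fun x => (h x)%:E) \_ `[a + c, b + c].
have mg : measurable_fun setT g.
  apply/(measurable_restrictT _ (measurable_itv _)); apply/measurable_EFinP.
  by apply: measurable_funTS; exact: continuous_measurable_fun.
have -> : ((fun x => (h (x + c))%:E) \_ `[a, b]) = (fun x : measurableTypeR R => g (x + c)).
  apply/funext => x; rewrite /g !patchE !mem_setE !in_itv /= !lerD2r.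
  by [].
rewrite -/g integralE [RHS]integralE; congr (_ - _)%E.
  rewrite -(integral_translate c (measurable_funepos mg) (fun x => funepos_ge0 g x)).
  by apply: eq_integral => x _; rewrite !funeposE.
rewrite -(integral_translate c (measurable_funeneg mg) (fun x => funeneg_ge0 g x)).
by apply: eq_integral => x _; rewrite !funenegE.
Qed.

Lemma cint_shift (a b c : R) (f : R -> C) : (forall x, ccont_at f x) ->
  cint a b (fun x => f (x + c)) = cint (a + c) (b + c) f.
Proof.
move=> cf; have c1 : continuous (fun x => complex.Re (f x)).
  move=> x; apply/cvgrPdist_lt => e /(cf x)[r r0 hr]; apply/nbhs_ballP; exists r => //= y.
  rewrite /ball /= distrC => /hr; apply: le_lt_trans; rewrite distrC -cReN -cReD; exact: Re_le_cn.
have c2 : continuous (fun x => complex.Im (f x)).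
  move=> x; apply/cvgrPdist_lt => e /(cf x)[r r0 hr]; apply/nbhs_ballP; exists r => //= y.
  rewrite /ball /= distrC => /hr; apply: le_lt_trans; rewrite distrC -cImN -cImD; exact: Im_le_cn.
by rewrite /cint -(Rintegral_shift a b c c1) -(Rintegral_shift a b c c2).
Qed.

Lemma cint_periodic (alpha : R) (f : R -> C) : 0 <= alpha <= 2 * pi -> (forall x, ccont_at f x) ->
  (forall x, f (x + 2 * pi) = f x) ->
  cint (- pi) pi (fun x => f (x + alpha)) = cint (- pi) pi f.
Proof.
move=> /andP[a0 a1] cf pf; have cc a b : ccont a b f by move=> x _; exact: cf.
have p0 := pi_ge0 R.
have b1 : - pi + alpha <= pi + alpha by lra.
have b2 : - pi <= - pi + alpha by lra.
rewrite cint_shift//.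
have E1 : cint (- pi) (pi + alpha) f = cint (- pi) (- pi + alpha) f + cint (- pi + alpha) (pi + alpha) f.
  exact: cint_split.
have E2 : cint (- pi) (pi + alpha) f = cint (- pi) pi f + cint pi (pi + alpha) f.
  by apply: cint_split => //; lra.
have E3 : cint pi (pi + alpha) f = cint (- pi) (- pi + alpha) f.
  have e1 : pi = - pi + 2 * pi :> R by ring.
  have e2 : pi + alpha = - pi + alpha + 2 * pi by ring.
  rewrite e2 [X in cint X _ _ = _]e1.
  by rewrite -cint_shift//; apply: eq_cint => x _.
by apply: (addrI (cint (- pi) (- pi + alpha) f)); rewrite -E1 E2 E3 addrC.
Qed.

Lemma exists_arg (u : C) : csq u = 1 -> exists2 alpha : R, 0 <= alpha <= 2 * pi & u = cis alpha.
Proof.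
case: u => a b; rewrite /csq /= => ab; have p0 := pi_ge0 R.
have a1 : -1 <= a <= 1.
  by rewrite -ler_norml -ler_sqr ?nnegrE// real_normK ?num_real// expr1n -ab lerDl sqr_ge0.
have ca := acosK a1; have sa := sin_acos a1.
have /andP[h1 h2] : 0 <= acos a <= pi by rewrite acos_ge0// acos_lepi.
have s2 : 1 - a ^+ 2 = b ^+ 2 by rewrite -ab addrAC subrr add0r.
have [b0|b0] := leP 0 b.
  exists (acos a); first by rewrite h1/=; lra.
  by rewrite /cis ca sa s2 sqrtr_sqr ger0_norm.
exists (2 * pi - acos a); first by apply/andP; split; lra.
rewrite /cis mulr_natl addrC cosD2pi sinD2pi cosN sinN ca sa s2 sqrtr_sqr ltr0_norm//.
by rewrite opprK.
Qed.

End PeriodicShift.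

(** * Averages over one-parameter families of unitary matrices *)

Section Averaging.
Context (R : realType) (m : nat).
Local Open Scope complex_scope.
Local Notation n := m.+1.
Local Notation C := R[i].
Local Notation V := 'cV[C]_n.
Variable lambda : R.
Hypothesis lam_gt : n%:R < lambda.
Local Notation leb := (lebesgue_Cn R n).
Local Notation mu := (@lebesgue_measure R).
Local Notation wt := (@wt R m lambda).
Local Notation RI := (@RI R m lambda).
Local Notation EI := (@EI R m lambda).
Local Notation CI := (@CI R m lambda).
Local Notation CInt := (@CInt R m lambda).
Local Notation IntB := (@IntB R m lambda).

Variable A : R -> 'M[C]_n.
Hypothesis uA : forall t, unitary (A t).
Hypothesis mA : forall i j, cmeasurable setT (fun t : measurableTypeR R => A t i j).

(** Fubini on [-pi, pi] times the ball; unitary invariance makes the integral over the ball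
    independent of the angle. *)
Lemma average_RI (h : V -> R) : measurable_fun setT (fun t => h (cvec t)) -> IntB h ->
  (forall z, sqnorm z < 1 -> mu.-integrable `[- pi, pi] (EFin \o (fun x => h (A x *m z)))) ->
  IntB (fun z => \int[mu]_(x in `[- pi, pi]) h (A x *m z)) /\
  RI (fun z => \int[mu]_(x in `[- pi, pi]) h (A x *m z)) = (pi - - pi) * RI h.
Proof.
move=> mh ih hi; have pi2 := pi2_gt0 R.
pose D : set (measurableTypeR R) := `[- pi, pi]%classic.
have mD : measurable D by exact: measurable_itv.
pose f (p : cpow R n * measurableTypeR R) : \bar R :=
  (\1_D p.2 * (h (A p.2 *m cvec p.1) * wt (cvec p.1)))%:E.
have mhA : measurable_fun setT (fun p : cpow R n * measurableTypeR R => h (A p.2 *m cvec p.1)).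
  apply: (meas_comp_cinv mh) => i.
  rewrite (_ : (fun x => _) = fun p : cpow R n * measurableTypeR R => \sum_j A p.2 i j * cvec p.1 j 0); last first.
    by apply/funext => p; rewrite mxE.
  apply: cmeas_sum => j; apply: cmeasM.
    have [m1 m2] := mA i j.
    by split; apply: (measurableT_comp (f := fun t => _ (A t i j))) => //; exact: measurable_snd.
  by apply: cmeas_comp_cvec; exact: measurable_fst.
have mw : measurable_fun setT (fun p : cpow R n * measurableTypeR R => wt (cvec p.1)).
  by apply: measurable_wt => i; apply: cmeas_comp_cvec; exact: measurable_fst.
have mf : measurable_fun setT f.
  apply/measurable_EFinP; apply: measurable_funM; last exact: measurable_funM.
  by apply: measurableT_comp => //; exact: measurable_indic.
have mhx x : measurable_fun setT (fun t => h (A x *m cvec t)).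
  by apply: (meas_comp_cinv mh); apply: cmeas_mulmx => i; exact: cmeas_cvec.
have mwt : measurable_fun setT (fun t : cpow R n => wt (cvec t)).
  by apply: measurable_wt => i; exact: cmeas_cvec.
have mah : bmeas (fun z : V => `|h z|) by apply: bmeasT; exact: measurableT_comp.
have inner x : (\int[leb]_t `|f (t, x)| = (\1_D x)%:E * EI (fun z => `|h z|%R))%E.
  rewrite -(EI_unitary lambda (uA x) mah) /EI /EV -ge0_integralZl//.
  - apply: eq_integral => t _; have w0 := wt_ge0 lambda (cvec t).
    by rewrite /f /= normrM [X in (_ * X)%:E]normrM (ger0_norm w0) (ger0_norm (_ : 0 <= \1_D x)) ?EFinM.
  - by apply/measurable_EFinP; apply: measurable_funM => //; exact: measurableT_comp.
  - by move=> t _; rewrite lee_fin mulr_ge0// wt_ge0.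
have Kfin : (EI (fun z => `|h z|%R) < +oo)%E.
  have /integrableP[_] := ih; apply: le_lt_trans; rewrite le_eqVlt; apply/orP; left; apply/eqP.
  by apply: eq_integral => t _; rewrite /= normrM (ger0_norm (wt_ge0 lambda _)).
have K0 : (0 <= EI (fun z => `|h z|%R))%E.
  by apply: integral_ge0 => t _; rewrite lee_fin mulr_ge0// wt_ge0.
have muD : mu D = (pi - - pi)%:E.
  by rewrite /D lebesgue_measure_itv /= lte_fin ifT -?EFinB//; lra.
have indE : (\int[mu]_x (\1_D x)%:E = (pi - - pi)%:E)%E by rewrite integral_indic// setIT.
have ffin : (\int[mu]_x \int[leb]_t `|f (t, x)| < +oo)%E.
  under eq_integral do rewrite inner.
  have -> : (\int[mu]_x ((\1_D x)%:E * EI (fun z => `|h z|%R)) =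
      (\int[mu]_x (\1_D x)%:E) * EI (fun z => `|h z|%R))%E.
    apply: ge0_integralZr => //; by apply/measurable_EFinP; exact: measurable_indic.
  by rewrite indE lte_mul_pinfty// lee_fin ltW.
have imf := iffRL (@integrable21ltyP _ _ _ _ R leb mu f mf) ffin.
have GE t : (fubini_F mu f t = (\int[mu]_(x in `[- pi, pi]) h (A x *m cvec t) * wt (cvec t))%:E).
  rewrite /fubini_F /f /=.
  have [z1|z1] := ltP (sqnorm (cvec t)) 1; last first.
    by rewrite (wt_out lambda z1) mulr0; under eq_integral do rewrite !mulr0; rewrite integral0.
  have hit := hi _ z1.
  rewrite EFinM /Rintegral fineK; last exact: integrable_fin_num hit.
  rewrite muleC -integralZl//.
  rewrite [RHS]integral_mkcond; apply: eq_integral => x _.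
  rewrite patchE indicE /D; case: ifP => xD; rewrite ?mul1r ?mul0r// -EFinM mulrC.
  by [].
have FE x : (fubini_G leb f x = (\1_D x)%:E * EI h)%E.
  rewrite -(EI_unitary lambda (uA x) (bmeasT mh)) /EI /EV /fubini_G -integralZl//.
    apply/integrableP; split; first by apply/measurable_EFinP; exact: measurable_funM.
    apply: le_lt_trans Kfin; rewrite -(EI_unitary lambda (uA x) mah) le_eqVlt; apply/orP; left; apply/eqP.
    by apply: eq_integral => t _; rewrite /= normrM (ger0_norm (wt_ge0 lambda _)).
have iG := integrable_fubini_F imf.
have iG' : IntB (fun z => \int[mu]_(x in `[- pi, pi]) h (A x *m z)).
  by apply: eq_integrable iG => // t _; rewrite GE.
split => //.
have E : (EI (fun z => (\int[mu]_(x in `[- pi, pi]) h (A x *m z))%R) = (pi - - pi)%:E * EI h)%E.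
  transitivity (\int[leb]_t fubini_F mu f t)%E; first by apply: eq_integral => t _; rewrite GE.
  rewrite integral12_prod_meas1// -integral21_prod_meas1//.
  under eq_integral do rewrite FE.
  have hfin : EI h \is a fin_num by exact: integrable_fin_num ih.
  rewrite -(fineK hfin).
  under eq_integral do rewrite muleC.
  rewrite integralZl//; last first.
    apply/integrableP; split; first by apply/measurable_EFinP; exact: measurable_indic.
    under eq_integral do rewrite /= ger0_norm//.
    by rewrite indE ltry.
  by rewrite indE muleC.
rewrite /RI E; have hfin : EI h \is a fin_num by exact: integrable_fin_num ih.
by rewrite fineM.
Qed.

Lemma average_CI (F : V -> C) : gmeas F -> CInt F ->
  (forall z, sqnorm z < 1 -> ccont (- pi) pi (fun x => F (A x *m z))) ->
  CInt (fun z => cint (- pi) pi (fun x => F (A x *m z))) /\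
  CI (fun z => cint (- pi) pi (fun x => F (A x *m z))) = (pi - - pi)%:C * CI F.
Proof.
move=> [m1 m2] [i1 i2] cF.
have [|I1 E1] := average_RI m1 i1; first by move=> z /cF/ccont_integrable[].
have [|I2 E2] := average_RI m2 i2; first by move=> z /cF/ccont_integrable[].
split => //; rewrite /CI /= E1 E2.
by apply/eqP; rewrite eq_complex /= !mul0r subr0 addr0 !eqxx.
Qed.

End Averaging.

(** * Density of the polynomials in the Bergman space *)

Section Density.
Context (R : realType) (m : nat).
Local Open Scope complex_scope.
Local Notation n := m.+1.
Local Notation C := R[i].
Local Notation V := 'cV[C]_n.
Variable lambda : R.
Hypothesis lam_gt : n%:R < lambda.
Local Notation CI := (@CI R m lambda).
Local Notation CInt := (@CInt R m lambda).
Local Notation ip := (@ip R n lambda).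
Local Notation L2B := (@L2B R m lambda).
Local Notation part := (@part R m lambda).
Local Notation bergman := (@bergman_space R n lambda).
#[local] Arguments sumw : simpl never.

Lemma bcmeas_gmeas (f : V -> C) : bcmeas f -> (forall z, ~ unit_ball z -> f z = 0) -> gmeas f.
Proof.
move=> [m1 m2] f0.
have H (h : V -> R) : measurable_fun (@mball R n) (fun t => h (cvec t)) ->
    (forall z, ~ unit_ball z -> h z = 0) -> measurable_fun setT (fun t : cpow R n => h (cvec t)).
  move=> mh h0; have -> : (fun t : cpow R n => h (cvec t)) = (fun t => h (cvec t)) \_ (@mball R n).
    by apply/funext => t; rewrite patchE; case: ifPn => //; rewrite notin_setE => /h0.
  exact: (iffLR (measurable_restrictT _ (@measurable_mball R m)) mh).
split; first by apply: (H (fun z => complex.Re (f z))) => // z /f0 ->.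
by apply: (H (fun z => complex.Im (f z))) => // z /f0 ->.
Qed.

Lemma A2_L2 f : bergman f -> L2B f.
Proof. by move=> [/L2E h _ _]; exact: h. Qed.

Lemma gmeas_bergman f : bergman f -> gmeas f.
Proof. by move=> hf; have [mf _] := A2_L2 hf; case: hf => _ _ f0; exact: bcmeas_gmeas. Qed.

Lemma cder_shift (g : C -> C) (t k : C) : cder (fun s => g (t + s)) 0 k -> cder g t k.
Proof.
move=> h e /h[r r0 hr]; exists r => // w wt.
by have := hr (w - t); rewrite !subr0 (addrC t) subrK addr0; apply.
Qed.

Lemma bergman_line f (z v : V) (t : C) : bergman f -> unit_ball (z + t *: v) ->
  exists k, cder (fun s => f (z + s *: v)) t k.
Proof.
move=> [_ df _] zt; exists ('d f (z + t *: v) v); apply: cder_shift.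
rewrite (_ : (fun s => _) = fun s => f (z + t *: v + s *: v)).
  exact: differentiable_line (df _ zt).
by apply/funext => s; rewrite scalerDl addrA.
Qed.

Lemma hdotDl (a b c : V) : hdot (a + b) c = hdot a c + hdot b c.
Proof. by rewrite !hdotE -big_split; apply: eq_bigr => i _; rewrite mxE mulrDl. Qed.

Lemma hdotZl (k : C) (a c : V) : hdot (k *: a) c = k * hdot a c.
Proof. by rewrite !hdotE mulr_sumr; apply: eq_bigr => i _; rewrite mxE mulrA. Qed.

Lemma hdotC (a b : V) : hdot a b = cj (hdot b a).
Proof.
rewrite !hdotE rmorph_sum /=; apply: eq_bigr => i _.
by rewrite conjM conjCK mulrC.
Qed.

Lemma hdotDr (a b c : V) : hdot c (a + b) = hdot c a + hdot c b.
Proof. by rewrite hdotC hdotDl conjD -!hdotC. Qed.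

Lemma hdotZr (k : C) (a c : V) : hdot c (k *: a) = cj k * hdot c a.
Proof. by rewrite hdotC hdotZl conjM -hdotC. Qed.

Section Direction.
Variable u : V.
Hypothesis u1 : hdot u u = 1.

(** For a unit vector u: the identity on the line of u and multiplication by exp (i t) on its
    orthogonal complement. *)
Definition rot (t : R) : 'M[C]_n := (cis t)%:M + (1 - cis t) *: (u *m (map_mx conjc u)^T).

Lemma rotE t z : rot t *m z = hdot z u *: u + cis t *: (z - hdot z u *: u).
Proof.
rewrite /rot mulmxDl mul_scalar_mx -scalemxAl -mulmxA -hdot_mx mul_mx_scalar.
by rewrite scalerBr scalerBl scale1r addrCA.
Qed.

Lemma unitary_rot t : unitary (rot t).
Proof.
rewrite /unitary; pose P : 'M[C]_n := u *m (map_mx conjc u)^T.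
have PE i j : P i j = u i ord0 * cj (u j ord0) by rewrite /P mxE big_ord1 !mxE.
have PP : P *m P = P.
  rewrite /P mulmxA -(mulmxA u) -hdot_mx u1 mulmx1 //.
have -> : (map_mx conjc (rot t))^T = (cj (cis t))%:M + (1 - cj (cis t)) *: P.
  have rE i j : rot t i j = cis t *+ (i == j) + (1 - cis t) * P i j.
    by rewrite /rot -/P mxE [X in X + _]mxE [X in _ + X]mxE.
  apply/matrixP => i j; rewrite [LHS]mxE [LHS]mxE rE [RHS]mxE [X in _ = X + _]mxE [X in _ = _ + X]mxE.
  rewrite !PE -[conjc _]/(cj _) conjD rmorphMn conjM.
  by rewrite rmorphB rmorph1 /= conjM conjCK eq_sym (mulrC (u i ord0)).
have cc : cj (cis t) * cis t = 1 by rewrite mulrC -csqE csq_cis.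
rewrite /rot -/P mulmxDl !mulmxDr -scalar_mxM cc -addrA -[RHS]addr0; congr (_ + _).
rewrite !mul_scalar_mx !mul_mx_scalar -scalemxAl -scalemxAr PP !scalerA -!scalerDl.
have -> : cj (cis t) * (1 - cis t) + (cis t * (1 - cj (cis t)) +
    (1 - cj (cis t)) * (1 - cis t)) = 1 - cj (cis t) * cis t by ring.
by rewrite cc subrr scale0r.
Qed.

Lemma gmeas_hdot : gmeas (fun z : V => hdot z u).
Proof.
rewrite (_ : (fun z : V => _) = fun z : V => \sum_i z i ord0 * cj (u i ord0)).
  apply: cmeas_sum => i; apply: cmeasM; first exact: cmeas_cvec.
  exact: cmeas_cst.
by apply/funext => z; rewrite hdotE.
Qed.

Lemma hdot_rot t z : hdot (rot t *m z) u = hdot z u.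
Proof. by rewrite rotE hdotDl !hdotZl hdotDl -scaleN1r hdotZl hdotZl u1 mulr1 mulN1r subrr mulr0 addr0. Qed.

Lemma sqnorm_orth (z : V) (t : C) : sqnorm (hdot z u *: u + t *: (z - hdot z u *: u)) =
  csq (hdot z u) + csq t * sqnorm (z - hdot z u *: u).
Proof.
set w := hdot z u; set z' := z - w *: u.
have z'u : hdot z' u = 0.
  by rewrite /z' hdotDl -scaleN1r !hdotZl u1 mulr1 -/w mulN1r subrr.
apply: complexI; rewrite -hdot_sq hdotDl !hdotDr !hdotZl !hdotZr u1 mulr1.
rewrite (hdotC u z') z'u rmorph0 !mulr0 !addr0 add0r hdot_sq.
by rewrite rmorphD rmorphM /= !csqE; ring.
Qed.

Lemma csq_hdot_le (z : V) : csq (hdot z u) <= sqnorm z.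
Proof.
have := sqnorm_orth z 1; rewrite scale1r addrC subrK csq1 mul1r => ->.
by rewrite lerDl sqnorm_ge0.
Qed.

(** Writing z = w u + z' with z' orthogonal to u, this is the mean value property on the unit circle
    of s -> f (w u + s z'). *)
Lemma bergman_rot_mean f z : bergman f -> sqnorm z < 1 ->
  ccont (- pi) pi (fun t => f (rot t *m z)) /\
  cint (- pi) pi (fun t => f (rot t *m z)) = (pi - - pi)%:C * f (hdot z u *: u).
Proof.
move=> hf z1; set w := hdot z u; set z' := z - w *: u.
pose g (s : C) := f (w *: u + s *: z').
have zE : sqnorm z = csq w + sqnorm z'.
  by have := sqnorm_orth z 1; rewrite scale1r addrC subrK csq1 mul1r.
(* The disc must be larger than the unit disc: for |s|^2 < 1 + d the point w u + s z' has squared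
   norm at most |z|^2 + d < 1. *)
pose d := (1 - sqnorm z) / 2; have d0 : 0 < d by rewrite divr_gt0// subr_gt0.
have [z'0 w0] : 0 <= sqnorm z' /\ 0 <= csq w by rewrite sqnorm_ge0 csq_ge0.
have hg : holo_disk g (Num.sqrt (1 + d)).
  move=> s; rewrite -ltr_sqr ?nnegrE ?cn_ge0 ?sqrtr_ge0// cn_sq sqr_sqrtr; last by lra.
  move=> sd; apply: bergman_line => //; rewrite /unit_ball /= sqnorm_orth -/w -/z'.
  have : csq s * sqnorm z' <= (1 + d) * sqnorm z' by rewrite ler_wpM2r// ltW.
  have : d * sqnorm z' <= d by rewrite ler_piMr//; lra.
  by rewrite /d in d0 *; lra.
have R1 : (0 : R) < 1 < Num.sqrt (1 + d).
  by apply/andP; split; [exact: ltr01|rewrite -ltr_sqr ?nnegrE ?sqrtr_ge0// expr1n sqr_sqrtr; lra].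
have E : (fun t => f (rot t *m z)) = (fun t => g (1%:C * cis t)).
  by apply/funext => t; rewrite rotE mul1r.
rewrite E; split.
  by apply: (@ccont_circle _ _ _ g 1 ltr01) => s s1; apply: holo_cont hg _; rewrite s1; case/andP: R1.
rewrite -[LHS]/(cmean g 1) (cmean_mean R1 hg) /g scale0r addr0 //.
Qed.

Let hb (k : nat) : coherent lambda (fun I => cj (mono I u)).
Proof. exact: coherent_eval. Qed.

Lemma part_eval k z : part (fun I => cj (mono I u)) k z = (ck lambda k)%:C * hdot z u ^+ k.
Proof. by rewrite /part hdotX; congr (_ * _); apply: eq_sumw => I _; rewrite mulrC. Qed.

Lemma L2_hdotX k : L2B (fun z => hdot z u ^+ k).
Proof.
have := L2Z ((ck lambda k)%:C^-1) (L2_part lam_gt (fun I => cj (mono I u)) k).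
apply: eq_L2 => z _; rewrite part_eval mulKf// -cn_eq0 cn_real normr_eq0 gt_eqF//.
exact: (ck_gt0 lam_gt).
Qed.

Lemma ip_hdotX f k : L2B f -> ip f (fun z => hdot z u ^+ k) = sumw k (fun I => mono I u * ip f (mono I)).
Proof.
move=> hf; rewrite (_ : (fun z => hdot z u ^+ k) = fun z => sumw k (fun I => cj (mono I u) * mono I z)).
  rewrite (ip_sumwr lam_gt k (F := fun I z => cj (mono I u) * mono I z))//.
    apply: eq_sumw => I _; rewrite ipZr ?conjCK//; exact: L2_mono.
  by move=> I; apply: L2Z; exact: L2_mono.
by apply/funext => z; rewrite hdotX; apply: eq_sumw => I _; rewrite mulrC.
Qed.

Lemma CInt_hdot_pow k : CInt (fun z => ((csq (hdot z u)) ^+ k)%:C).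
Proof.
have := CInt_mulJ (L2_hdotX k) (L2_hdotX k); apply: eq_CInt => z _.
by rewrite rmorphXn /= -exprMn -csqE -rmorphXn.
Qed.

(** By the reproducing property at the unit vector u, the squared norm of <z, u>^k is exactly 1 /
    [ck lambda k]. *)
Lemma CI_hdot_pow k : CI (fun z => ((csq (hdot z u)) ^+ k)%:C) != 0.
Proof.
apply/eqP => CI0.
have E : ip (fun z => hdot z u ^+ k) (fun z => hdot z u ^+ k) = 0.
  rewrite ipE (@eq_CI R m lambda _ (fun z => ((csq (hdot z u)) ^+ k)%:C)) ?CI0 ?mulr0// => z _.
  by rewrite rmorphXn /= -exprMn -csqE -rmorphXn.
have hp := L2_hdotX k.
have : (ck lambda k)%:C * ip (fun z => hdot z u ^+ k) (fun z => hdot z u ^+ k) = 1.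
  rewrite ip_hdotX// -sumwZ.
  transitivity (hdot u u ^+ k); last by rewrite u1 expr1n.
  rewrite hdotX; apply: eq_sumw => I Ik; rewrite mulrCA; congr (_ * _).
  rewrite -ipZl//; last exact: L2_mono.
  rewrite (_ : (fun z => _) = part (fun I => cj (mono I u)) k); last first.
    by apply/funext => z; rewrite part_eval.
  by rewrite ip_part_mono ?Ik ?eqxx//; exact: hb.
by rewrite E mulr0 => /eqP; rewrite eq_sym oner_eq0.
Qed.

Lemma bergman_moment f k : bergman f -> (forall I, ip f (mono I) = 0) ->
  let F := fun z => f z * cj (hdot z u) ^+ k in [/\ gmeas F, CInt F & CI F = 0].
Proof.
move=> hf f0 F; have lf := A2_L2 hf.
have FE z : F z = f z * cj (hdot z u ^+ k) by rewrite /F rmorphXn.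
split.
- rewrite (_ : F = fun z => f z * cj (hdot z u ^+ k)); last by apply/funext.
  apply: cmeasM; first exact: gmeas_bergman.
  apply: cmeasJ; have gh := gmeas_hdot.
  elim: k {F FE} => [|k IH]; first by under eq_fun do rewrite expr0; exact: cmeas_cst.
  by under eq_fun do rewrite exprS; exact: cmeasM.
- by have := CInt_mulJ lf (L2_hdotX k); apply: eq_CInt => z _; rewrite FE.
have : ip f (fun z => hdot z u ^+ k) = 0.
  by rewrite ip_hdotX// sumw0// => I _; rewrite f0 mulr0.
rewrite ipE => /eqP; rewrite mulf_eq0 -[_%:C == 0]cn_eq0 cn_real normr_eq0.
rewrite gt_eqF ?c_lambda_gt0//= => /eqP <-.
by apply: eq_CI => z _; rewrite FE.
Qed.

Lemma cmeas_cis : cmeasurable setT (fun t : measurableTypeR R => cis t).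
Proof.
by split; apply: continuous_measurable_fun; [exact: continuous_cos|exact: continuous_sin].
Qed.

(** Averaging f(z) conj(<z,u>)^k over [rot] replaces f(z) by f(<z,u> u). Averaging next over the
    scalar rotations leaves a |<z,u>|^(2k), with a the k-th Taylor coefficient along u, up to 2 pi.
    Both averages preserve the integral up to a factor 2 pi; it is 0, while |<z,u>|^(2k) has a
    nonzero integral. *)
Lemma cmean_bergman f k : bergman f -> (forall I, ip f (mono I) = 0) ->
  forall r, 0 < r < 1 -> cmean (fun t => f (t *: u) * (t ^+ k)^-1) r = 0.
Proof.
move=> hf f0 r r01; have [gF iF F0] := bergman_moment k hf f0.
set F := (fun z => _) in gF iF F0.
pose g (t : C) := f (t *: u).
have nu : sqnorm u = 1 by apply: complexI; rewrite -hdot_sq u1.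
have hg : holo_disk g 1.
  move=> t t1; have [|l hl] := @bergman_line f 0 u t hf.
    by rewrite add0r /unit_ball /= sqnormZ nu mulr1 -cn_sq -[X in _ < X](expr1n _ 2) ltr_sqr ?nnegrE ?cn_ge0.
  by exists l; rewrite (_ : g = fun s => f (0 + s *: u))//; apply/funext => s; rewrite add0r.
have pi2 := pi2_gt0 R.
have pi2C : (pi - - pi)%:C != 0 :> C by rewrite -cn_eq0 cn_real normr_eq0 gt_eqF.
have mrot i j : cmeasurable setT (fun t : measurableTypeR R => rot t i j).
  rewrite (_ : (fun t => _) = fun t : measurableTypeR R => cis t *+ (i == j) + (1 - cis t) * (u *m (map_mx conjc u)^T) i j); last first.
    by apply/funext => t; rewrite /rot !mxE.
  apply: cmeasD.
    by case: (i == j); rewrite ?mulr1n ?mulr0n; [exact: cmeas_cis|exact: cmeas_cst].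
  apply: cmeasM; last exact: cmeas_cst.
  by apply: cmeasB; [exact: cmeas_cst|exact: cmeas_cis].
have Frot t z : F (rot t *m z) = cj (hdot z u) ^+ k * f (rot t *m z).
  by rewrite /F hdot_rot mulrC.
have [|iG G0] := @average_CI R m lambda rot unitary_rot mrot F gF iF.
  move=> z z1; rewrite (_ : (fun x => _) = fun x => cj (hdot z u) ^+ k * f (rot x *m z)).
    by apply: ccontZ; case: (bergman_rot_mean hf z1).
  by apply/funext => t; rewrite Frot.
pose F2 z := f (hdot z u *: u) * cj (hdot z u) ^+ k.
have GE z : sqnorm z < 1 -> cint (- pi) pi (fun x => F (rot x *m z)) = (pi - - pi)%:C * F2 z.
  move=> z1; have [h1 h2] := bergman_rot_mean hf z1.
  rewrite (_ : (fun x => _) = fun x => cj (hdot z u) ^+ k * f (rot x *m z)).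
    by rewrite cintZ// h2 /F2; ring.
  by apply/funext => t; rewrite Frot.
have iF2 : CInt F2.
  have := CIntZ (pi - - pi)%:C^-1 iG; apply: eq_CInt => z z1.
  by rewrite GE// mulKf.
have CF2 : CI F2 = 0.
  apply: (mulfI pi2C); rewrite mulr0 -CIZ// -[RHS](mulr0 (pi - - pi)%:C) -F0 -G0.
  by apply: eq_CI => z z1; rewrite GE.
have gF2 : gmeas F2.
  apply: cmeasM.
    apply: (cmeas_comp_cinv (gmeas_bergman hf)) => i.
    under eq_fun do rewrite mxE; apply: cmeasM; first exact: gmeas_hdot.
    exact: cmeas_cst.
  have gh := cmeasJ gmeas_hdot.
  elim: k {F iF gF F0 Frot iG G0 F2 GE iF2 CF2} => [|k IH]; first by under eq_fun do rewrite expr0; exact: cmeas_cst.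
  by under eq_fun do rewrite exprS; exact: cmeasM.
pose S t : 'M[C]_n := (cis t)%:M.
have uS t : unitary (S t) by apply: unitary_scalar; exact: csq_cis.
have mS i j : cmeasurable setT (fun t : measurableTypeR R => S t i j).
  rewrite (_ : (fun t => _) = fun t : measurableTypeR R => cis t *+ (i == j)); last first.
    by apply/funext => t; rewrite /S mxE.
  by case: (i == j); rewrite ?mulr1n ?mulr0n; [exact: cmeas_cis|exact: cmeas_cst].
pose h (t : C) := g t * cj t ^+ k.
have F2S t z : F2 (S t *m z) = h (hdot z u * cis t).
  by rewrite /F2 /S mul_scalar_mx hdotZl /h /g (mulrC (cis t)).
have hJ t : ccontz (fun s : C => cj s ^+ k) t.
  elim: k {F iF gF F0 Frot iG G0 F2 GE iF2 CF2 gF2 F2S h} => [|k IH].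
    by under eq_fun do rewrite expr0; exact: ccontz_cst.
  under eq_fun do rewrite exprS; apply: ccontzM => //.
  by move=> e e0; exists e => // w /ltW; rewrite -rmorphB cnJ.
have hh t : cn t < 1 -> ccontz h t by move=> t1; apply: ccontzM => //; exact: holo_cont hg t1.
have hS z : sqnorm z < 1 -> forall x, ccont_at (fun t => h (hdot z u * cis t)) x.
  move=> z1 x; pose h' (s : C) := h (hdot z u * s).
  have w1 : cn (hdot z u) < 1.
    rewrite -ltr_sqr ?nnegrE ?cn_ge0// cn_sq expr1n; exact: le_lt_trans (csq_hdot_le z) z1.
  have h'c s : cn s = 1 -> ccontz h' s.
    move=> s1 e e0; have [|r' r'0 hr'] := hh (hdot z u * s) _ e e0; first by rewrite cnM s1 mulr1.
    exists r' => // w ws; apply: hr'; rewrite -mulrBr cnM.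
    by apply: le_lt_trans ws; rewrite ler_piMl ?cn_ge0// ltW.
  have := @ccont_circle R x x h' 1 ltr01 h'c x.
  rewrite lexx => /(_ isT); congr (ccont_at _ x).
  by apply/funext => t; rewrite /h' mul1r.
have [|iH H0] := @average_CI R m lambda S uS mS F2 gF2 iF2.
  move=> z z1; rewrite (_ : (fun x => _) = fun t => h (hdot z u * cis t)); last first.
    by apply/funext => t; rewrite F2S.
  by move=> x _; exact: hS.
set a := cmean _ r.
have aE r' : 0 < r' < 1 -> cmean (fun t => g t * (t ^+ k)^-1) r' = a.
  by move=> r'1; exact: (cmean_power_cst _ r'1 r01 hg).
have HE z : sqnorm z < 1 -> cint (- pi) pi (fun x => F2 (S x *m z)) = a * ((csq (hdot z u)) ^+ k)%:C.
  move=> z1; rewrite (_ : (fun x => _) = fun t => h (hdot z u * cis t)); last first.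
    by apply/funext => t; rewrite F2S.
  have [w0|w0] := eqVneq (hdot z u) 0.
    rewrite w0 csq0; under [X in cint _ _ X]eq_fun do rewrite mul0r.
    rewrite cint_cst; last by have := pi_gt0 R; lra.
    have [k0|k0] := eqVneq k 0%N; last by rewrite /h rmorph0 !expr0n (negbTE k0) !mulr0 mul0r.
    rewrite /h -(aE _ r01) k0 !expr0 !mulr1.
    have := cmean_mean r01 hg; rewrite mulrC => <-.
    by apply: eq_cmean => [|s _]; [case/andP: r01|rewrite expr0 invr1 mulr1].
  pose rr := cn (hdot z u); have rr0 : 0 < rr by rewrite cn_gt0.
  have rr1 : rr < 1.
    rewrite -ltr_sqr ?nnegrE ?cn_ge0// cn_sq expr1n; exact: le_lt_trans (csq_hdot_le z) z1.
  have rrC : rr%:C != 0 :> C by rewrite -cn_eq0 cn_real normr_eq0 gt_eqF.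
  have [|alpha ab aw] := @exists_arg R (hdot z u / rr%:C).
    by rewrite csqM csqV csq_real -cn_sq divff// expf_neq0// gt_eqF.
  have wE : hdot z u = rr%:C * cis alpha by rewrite -aw mulrC divfK.
  pose q x := h (rr%:C * cis x).
  have qc x : ccont_at q x.
    have := @ccont_circle R x x h rr rr0 _ x; rewrite lexx => H; apply: H => // s sr.
    by apply: hh; rewrite sr.
  have qp x : q (x + 2 * pi) = q x.
    by rewrite /q /cis mulr_natl cosD2pi sinD2pi.
  have -> : (fun t => h (hdot z u * cis t)) = fun t => q (t + alpha).
    by apply/funext => t; rewrite /q wE addrC cisD mulrA.
  rewrite (cint_periodic ab qc qp) -(aE rr) ?rr0// mulrC -cmeanZ//; last first.
    move=> s sr; have s0 : s != 0 by rewrite -cn_gt0 sr.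
    have [l hl] := cder_idX s k.
    apply: ccontzM; first by apply: holo_cont hg _; rewrite sr.
    exact: cder_cont (cderV (f := fun x => x ^+ k) (expf_neq0 k s0) hl).
  apply: eq_cmean => // s sr; have s0 : s != 0 by rewrite -cn_gt0 sr.
  rewrite /h -cn_sq -/rr -sr cn_sq rmorphXn /= csqE exprMn; field.
  by rewrite expf_neq0.
have : a * CI (fun z => ((csq (hdot z u)) ^+ k)%:C) = 0.
  rewrite -CIZ ?CF2 ?mulr0; last exact: CInt_hdot_pow.
  rewrite -[RHS](mulr0 (pi - - pi)%:C) -CF2 -H0; by apply: eq_CI => z z1; rewrite HE.
by move=> /eqP; rewrite mulf_eq0 (negbTE (CI_hdot_pow k)) orbF => /eqP.
Qed.

End Direction.

(* By unitary invariance it is enough to look at the line through z; averaging f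
   over the rotations fixing this line leaves a function of one variable, whose
   Taylor coefficients are the pairings of f with powers of <., z>. *)
Lemma bergman_density f : bergman f -> (forall I, ip f (mono I) = 0) -> f = fun=> 0.
Proof.
move=> hf f0; apply/funext => z.
have [z1|z1] := boolP (sqnorm z < 1); last first.
  by case: hf => _ _; apply; apply/negP.
have V1 (u : V) : sqnorm u = 1 -> hdot u u = 1 by move=> h; rewrite hdot_sq h.
have line (u : V) : sqnorm u = 1 -> holo_disk (fun t => f (t *: u)) 1.
  move=> nu t t1; have [|l hl] := @bergman_line f 0 u t hf.
    by rewrite add0r /unit_ball /= sqnormZ nu mulr1 -cn_sq -[X in _ < X](expr1n _ 2) ltr_sqr ?nnegrE ?cn_ge0.
  by exists l; rewrite (_ : (fun t => _) = fun s => f (0 + s *: u))//; apply/funext => s; rewrite add0r.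
have [z0|z0] := eqVneq (sqnorm z) 0.
  pose u : V := delta_mx ord0 0.
  have nu : sqnorm u = 1.
    rewrite sqnormE (bigD1 ord0)//= big1 ?addr0; last first.
      by move=> i ij; rewrite mxE (negbTE ij) csq0.
    by rewrite mxE !eqxx csq1.
  have -> : z = 0 *: u.
    apply/matrixP => i j; rewrite (ord1 j) scale0r mxE; apply/eqP; rewrite -csq_eq0 eq_le csq_ge0 andbT -z0.
    exact: coord_le.
  have r01 : 0 < (1 / 2 : R) < 1 by apply/andP; split; lra.
  have := cmean_bergman (V1 _ nu) 0 hf f0 r01.
  have := cmean_mean r01 (line u nu).
  rewrite (_ : cmean _ _ = cmean (fun t => f (t *: u) * (t ^+ 0)^-1) (1 / 2)); last first.
    by apply: eq_cmean => [|s _]; [case/andP: r01|rewrite expr0 invr1 mulr1].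
  move=> -> /eqP; rewrite mulf_eq0 -[_%:C == 0]cn_eq0 cn_real normr_eq0 gt_eqF ?pi2_gt0//=.
  by move=> /eqP.
have q0 : 0 < sqnorm z by rewrite lt_neqAle eq_sym z0 sqnorm_ge0.
pose rho := Num.sqrt (sqnorm z); have rho0 : 0 < rho by rewrite sqrtr_gt0.
have rho2 : rho ^+ 2 = sqnorm z by rewrite sqr_sqrtr// ltW.
have rho1 : rho < 1 by rewrite -ltr_sqr ?nnegrE ?(ltW rho0)// rho2 expr1n.
pose u := (rho^-1)%:C *: z.
have nu : sqnorm u = 1 by rewrite sqnormZ csq_real exprVn rho2 mulVf.
have zu : z = rho%:C *: u by rewrite scalerA -rmorphM divff ?gt_eqF// scale1r.
rewrite zu; apply: (@holo_unique R (fun t => f (t *: u)) rho ((rho + 1) / 2) 1 _ _ (line u nu)).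
- by apply/andP; split; lra.
- by lra.
- move=> k; apply: (cmean_bergman (V1 _ nu) k hf f0).
  by apply/andP; split; lra.
Qed.

End Density.

(** * Functionals, Parseval's identity and adjoints *)

Section BergmanOperators.
Context (R : realType) (m : nat).
Local Open Scope complex_scope.
Local Notation n := m.+1.
Local Notation C := R[i].
Local Notation V := 'cV[C]_n.
Local Notation word := (seq 'I_n).
Variable lambda : R.
Hypothesis lam_gt : n%:R < lambda.
Local Notation ip := (@ip R n lambda).
Local Notation N2 := (@N2 R m lambda).
Local Notation L2B := (@L2B R m lambda).
Local Notation part := (@part R m lambda).
Local Notation hpsum := (psum lambda).
Local Notation coherent := (@coherent R m lambda).
Local Notation gram := (@gram R m lambda).
Local Notation hlim := (@hlim R m lambda).
Local Notation bergman := (@bergman_space R n lambda).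
#[local] Arguments sumw : simpl never.
Implicit Types (f g h : V -> C) (I J K : word).

Lemma bergman_lin (a : C) f g : bergman f -> bergman g -> bergman (fun z => a * f z + g z).
Proof.
move=> hf hg; split.
- apply/L2E => //; apply: L2D; last exact: A2_L2 hg.
  by apply: L2Z; exact: A2_L2 hf.
- move=> z z1; have [_ df _] := hf; have [_ dg _] := hg.
  exact: (differentiableD (differentiableZ a (df z z1)) (dg z z1)).
- move=> z z1; have [_ _ f0] := hf; have [_ _ g0] := hg.
  by rewrite f0// g0// mulr0 addr0.
Qed.

Lemma bergman0 : bergman (fun=> 0).
Proof.
by split=> //; apply/L2E => //; exact: L2_0.
Qed.

Lemma bergmanZ (a : C) f : bergman f -> bergman (fun z => a * f z).
Proof.
move=> hf; have := bergman_lin a hf bergman0.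
by congr (bergman _); apply/funext => z; rewrite addr0.
Qed.

Lemma bergmanD f g : bergman f -> bergman g -> bergman (fun z => f z + g z).
Proof.
move=> hf hg; have := bergman_lin 1 hf hg.
by congr (bergman _); apply/funext => z; rewrite mul1r.
Qed.

Lemma bergmanB f g : bergman f -> bergman g -> bergman (fun z => f z - g z).
Proof.
move=> hf hg; have := bergman_lin (-1) hg hf.
by congr (bergman _); apply/funext => z; rewrite mulN1r addrC.
Qed.

Lemma ip_linl (a : C) f g h : L2B f -> L2B g -> L2B h ->
  ip (fun z => a * f z + g z) h = a * ip f h + ip g h.
Proof. by move=> lf lg lh; rewrite ipDl ?ipZl//; exact: L2Z. Qed.

Lemma ip_linr (a : C) f g h : L2B f -> L2B g -> L2B h ->
  ip h (fun z => a * f z + g z) = cj a * ip h f + ip h g.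
Proof. by move=> lf lg lh; rewrite ipDr ?ipZr//; exact: L2Z. Qed.

Lemma N2_sq f : N2 f = complex.Re (ip f f). Proof. by rewrite ip_N2. Qed.

Lemma eq_bergman f g : bergman f -> bergman g -> (forall J, ip f (mono J) = ip g (mono J)) -> f = g.
Proof.
move=> hf hg fg; apply/funext => z; apply/eqP; rewrite -subr_eq0.
have := @bergman_density R m lambda lam_gt (fun z => f z - g z) (bergmanB hf hg).
have H J : ip (fun z => f z - g z) (mono J) = 0.
  by rewrite ipBl ?fg ?subrr//; try exact: A2_L2; exact: L2_mono.
by move=> /(_ H) /(congr1 (fun F => F z)) ->.
Qed.

Lemma N2_psum_coef a N : coherent a ->
  (N2 (hpsum a 0 N))%:C = \sum_(0 <= k < N) (ck lambda k)%:C * sumw k (fun I => a I * cj (a I)).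
Proof.
move=> ha; rewrite -ip_N2// {2}/psum ip_sumr//; [|by move=> k; exact: L2_part|exact: L2_psum].
apply: eq_big_nat => k kN; rewrite ip_part_r//; last exact: L2_psum.
by congr (_ * _); apply: eq_sumw => I Ik; rewrite ip_psum_mono// Ik kN mulrC.
Qed.

(** Elements of [bergman_space] vanish outside the ball, so a monomial belongs to it only after this
    truncation. *)
Definition onball f (z : V) : C := if sqnorm z < 1 then f z else 0.

Lemma onballE f z : sqnorm z < 1 -> onball f z = f z. Proof. by rewrite /onball => ->. Qed.

Lemma ip_onball f g : ip (onball f) g = ip f g.
Proof. by apply: eq_ip => // z z1; rewrite onballE. Qed.

Lemma clim_eventually (u : nat -> C) l : (exists N, forall k, (N <= k)%N -> u k = l) -> clim u l.
Proof. by move=> [N hN] e e0; exists N => k /hN ->; rewrite subrr cn0 ltW. Qed.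

Lemma coherent_ip g : L2B g -> coherent (fun J => ip g (mono J)).
Proof.
move=> hg J; rewrite -[in RHS](_ : part (gram J) (size J) = mono J); last first.
  by apply/funext => z; exact: reproducing.
rewrite ip_part_r//; congr (_ * _); apply: eq_sumw => I _.
by rewrite gram_conj// mulrC.
Qed.

Lemma coherent_gram I : coherent (gram I).
Proof. exact: coherent_ip (L2_mono lam_gt I). Qed.

Lemma bergman_mono I : bergman (onball (mono I)).
Proof.
have hP N : hpsum (gram I) 0 N = if (size I < N)%N then mono I else fun=> 0.
  apply/funext => z; rewrite /psum; case: ifPn => IN.
    rewrite (bigD1_seq (size I)) ?iota_uniq ?mem_index_iota//= big1 ?addr0.
      exact: reproducing.
    move=> k kI; rewrite /part sumw0 ?mulr0// => K Kk.
    by rewrite gram_degree ?mul0r// Kk eq_sym.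
  rewrite big_nat_cond big1// => k /andP[/andP[_ kN] _].
  rewrite /part sumw0 ?mulr0// => K Kk; rewrite gram_degree ?mul0r// Kk.
  by apply: contraNneq IN => ->.
have hB N : N2 (hpsum (gram I) 0 N) <= N2 (mono I).
  rewrite hP; case: ifP => // _; apply: le_trans (N2_ge0 lam_gt _).
  by rewrite N2_sq ip0l.
have := bergman_hlim lam_gt (coherent_gram I) hB.
congr (bergman _); apply/funext => z; rewrite /onball; case: ifPn => z1; last first.
  by rewrite /hlim (negbTE z1).
apply: (clim_unique (hlimP lam_gt (coherent_gram I) hB z1)); apply: clim_eventually.
by exists (size I).+1 => k Ik; rewrite hP Ik.
Qed.

Lemma bergman_onball_sum (T : Type) (s : seq T) (F : T -> V -> C) :
  (forall x, bergman (onball (F x))) -> bergman (onball (fun z => \sum_(x <- s) F x z)).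
Proof.
move=> hF; elim: s => [|x s IH].
  have := bergman0; congr (bergman _); apply/funext => z.
  by rewrite /onball big_nil; case: ifP.
have := bergmanD (hF x) IH; congr (bergman _); apply/funext => z.
by rewrite /onball big_cons; case: ifP => //; rewrite addr0.
Qed.

Lemma bergman_onballZ (a : C) f : bergman (onball f) -> bergman (onball (fun z => a * f z)).
Proof.
move=> hf; have := bergmanZ a hf; congr (bergman _); apply/funext => z.
by rewrite /onball; case: ifP => //; rewrite mulr0.
Qed.

Lemma bergman_onball_sumw k (F : word -> V -> C) : (forall I, bergman (onball (F I))) ->
  bergman (onball (fun z => sumw k (F^~ z))).
Proof.
elim: k F => [|k IH] F hF; first exact: hF.
by under eq_fun do rewrite sumwS; apply: bergman_onball_sum => i; apply: IH => I; exact: hF.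
Qed.

Lemma bergman_part a k : bergman (onball (part a k)).
Proof.
apply: bergman_onballZ; apply: (@bergman_onball_sumw k (fun I z => a I * mono I z)) => I.
by apply: bergman_onballZ; exact: bergman_mono.
Qed.

Lemma bergman_psum a M N : bergman (onball (hpsum a M N)).
Proof. by apply: bergman_onball_sum => k; exact: bergman_part. Qed.

Section Riesz.
Variables (Lam : (V -> C) -> C) (M : R).
Hypothesis Lam_lin : forall (a : C) f g, bergman f -> bergman g ->
  Lam (fun z => a * f z + g z) = cj a * Lam f + Lam g.
Hypothesis Lam_bound : forall f, bergman f -> csq (Lam f) <= M * N2 f.

Let Lam0 : Lam (fun=> 0) = 0.
Proof.
have := Lam_lin (-1) bergman0 bergman0.
by under eq_fun do rewrite mulr0 addr0; rewrite rmorphN rmorph1 mulN1r addNr.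
Qed.

Let LamZ a f : bergman (onball f) -> Lam (onball (fun z => a * f z)) = cj a * Lam (onball f).
Proof.
move=> hf; have := Lam_lin a hf bergman0; rewrite Lam0 addr0 => <-.
by congr Lam; apply/funext => z; rewrite /onball addr0; case: ifP => //; rewrite mulr0.
Qed.

Let Lam_sum (T : Type) (s : seq T) (F : T -> V -> C) : (forall x, bergman (onball (F x))) ->
  Lam (onball (fun z => \sum_(x <- s) F x z)) = \sum_(x <- s) Lam (onball (F x)).
Proof.
move=> hF; elim: s => [|x s IH].
  rewrite big_nil -[RHS]Lam0; congr Lam; apply/funext => z.
  by rewrite /onball big_nil; case: ifP.
rewrite big_cons -IH; have := Lam_lin 1 (hF x) (bergman_onball_sum s hF).
rewrite rmorph1 mul1r => <-; congr Lam; apply/funext => z.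
by rewrite /onball big_cons mul1r; case: ifP => //; rewrite addr0.
Qed.

Let Lam_sumw k (F : word -> V -> C) : (forall I, bergman (onball (F I))) ->
  Lam (onball (fun z => sumw k (F^~ z))) = sumw k (fun I => Lam (onball (F I))).
Proof.
elim: k F => [|k IH] F hF; first by [].
under [X in onball X]eq_fun do rewrite sumwS.
rewrite Lam_sum; last by move=> i; apply: (@bergman_onball_sumw k (fun I => F (i :: I))) => I; exact: hF.
by rewrite sumwS; apply: eq_bigr => i _; exact: (IH (fun I => F (i :: I))).
Qed.

Let a I := Lam (onball (mono I)).

Let Lam_part b k : Lam (onball (part b k)) =
  (ck lambda k)%:C * sumw k (fun I => cj (b I) * a I).
Proof.
rewrite /part LamZ; last first.
  apply: (@bergman_onball_sumw k (fun I z => b I * mono I z)) => I.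
  by apply: bergman_onballZ; exact: bergman_mono.
rewrite conj_real; congr (_ * _).
rewrite (@Lam_sumw k (fun I z => b I * mono I z)); last first.
  by move=> I; apply: bergman_onballZ; exact: bergman_mono.
by apply: eq_sumw => I _; rewrite LamZ//; exact: bergman_mono.
Qed.

Let coherent_a : coherent a.
Proof.
move=> J; rewrite /a -[in RHS](_ : part (gram J) (size J) = mono J); last first.
  by apply/funext => z; exact: reproducing.
rewrite Lam_part; congr (_ * _); apply: eq_sumw => I _.
by rewrite gram_conj// mulrC.
Qed.

(** The functional applied to the partial sum of its own coefficients returns the squared norm of
    that sum, and the bound on the functional gives N2^2 <= M N2. *)
Let bound_a N : N2 (hpsum a 0 N) <= M.
Proof.
have H : Lam (onball (hpsum a 0 N)) = (N2 (hpsum a 0 N))%:C.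
  rewrite N2_psum_coef// /psum (@Lam_sum _ _ (part a)); last by move=> k; exact: bergman_part.
  apply: eq_bigr => k _; rewrite Lam_part; congr (_ * _); apply: eq_sumw => I _.
  by rewrite mulrC.
have := Lam_bound (bergman_psum a 0 N); rewrite H csq_real.
have -> : N2 (onball (hpsum a 0 N)) = N2 (hpsum a 0 N).
  by rewrite !N2_sq; congr complex.Re; apply: eq_ip => z z1; rewrite onballE.
move=> h; have x0 := N2_ge0 lam_gt (hpsum a 0 N).
have [e|xp] := eqVneq (N2 (hpsum a 0 N)) 0; last first.
  by rewrite -(ler_pM2r (_ : 0 < N2 (hpsum a 0 N))) -?expr2// lt_neqAle eq_sym xp.
(* If the partial sum has norm 0, it remains to know M >= 0, which is read off the constant function
   1. *)
rewrite e; have := Lam_bound (bergman_mono [::]).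
have -> : N2 (onball (mono [::])) = 1.
  rewrite N2_sq ip_onball; have <- : complex.Re (gram [::] [::]) = 1 by rewrite gram_nil.
  by congr complex.Re; apply: eq_ip => // z z1; rewrite onballE.
by rewrite mulr1; apply: le_trans; exact: csq_ge0.
Qed.

(** Only the pairings with monomials are identified here: the equality on the whole space waits for
    [bergman_approx], which is itself deduced from this lemma for the functional <f, .>. *)
Lemma functional_limit : exists h, [/\ bergman h, (forall J, ip h (mono J) = Lam (onball (mono J))) &
  forall e, 0 < e -> exists N0, forall N, (N0 <= N)%N ->
    N2 (fun z => h z - hpsum (fun J => Lam (onball (mono J))) 0 N z) <= e].
Proof.
exists (hlim a); split.
- exact: (bergman_hlim lam_gt coherent_a bound_a).
- by move=> J; exact: (ip_hlim lam_gt coherent_a bound_a).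
by move=> e /(hlim_approx lam_gt coherent_a bound_a)[N0 H]; exists N0 => N /H[].
Qed.

Lemma functional_psum b M' N : Lam (onball (hpsum b M' N)) =
  \sum_(M' <= k < N) (ck lambda k)%:C * sumw k (fun I => cj (b I) * Lam (onball (mono I))).
Proof.
rewrite /psum Lam_sum; last by move=> k; exact: bergman_part.
by apply: eq_bigr => k _; exact: Lam_part.
Qed.

Lemma functionalB f g : bergman f -> bergman g -> Lam (fun z => f z - g z) = Lam f - Lam g.
Proof.
move=> hf hg; have := Lam_lin (-1) hg hf.
rewrite rmorphN rmorph1 mulN1r addrC => <-; congr Lam; apply/funext => z.
by rewrite mulN1r addrC.
Qed.

End Riesz.

(** The limit built from the coefficients of f has the same coefficients as f, hence is f by
    density. *)
Lemma bergman_approx f e : bergman f -> 0 < e -> exists N0, forall N, (N0 <= N)%N ->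
  N2 (fun z => f z - hpsum (fun J => ip f (mono J)) 0 N z) <= e.
Proof.
move=> hf e0; have lf := A2_L2 hf.
have L1 (a : C) g h : bergman g -> bergman h ->
    ip f (fun z => a * g z + h z) = cj a * ip f g + ip f h.
  by move=> /A2_L2 hg /A2_L2 hh; exact: ip_linr.
have L2 g : bergman g -> csq (ip f g) <= N2 f * N2 g.
  by move=> /A2_L2 hg; exact: cauchy_schwarz.
have E J : ip f (onball (mono J)) = ip f (mono J) by apply: eq_ip => // z z1; rewrite onballE.
have [h [hh hJ]] := functional_limit L1 L2.
have -> : h = f by apply: eq_bergman => // J; rewrite hJ.
have -> : (fun J => ip f (onball (mono J))) = fun J => ip f (mono J) by apply/funext.
by move=> /(_ e e0).
Qed.

Lemma functional_eq0 Lam (M : R) :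
  (forall (a : C) f g, bergman f -> bergman g -> Lam (fun z => a * f z + g z) = cj a * Lam f + Lam g) ->
  (forall f, bergman f -> csq (Lam f) <= M * N2 f) ->
  (forall I, Lam (onball (mono I)) = 0) -> forall f, bergman f -> Lam f = 0.
Proof.
move=> L1 L2 L0 f hf; apply: cn_small => e e0.
have [->|M0] := eqVneq (Lam f) 0; first by rewrite cn0 ltW.
have f0 : 0 < M * N2 f by apply: lt_le_trans (L2 _ hf); rewrite lt_neqAle eq_sym csq_eq0 M0 csq_ge0.
have Mp : 0 < M.
  by rewrite ltNge; apply/negP => M1; move: f0; have := N2_ge0 lam_gt f; nra.
have [N0 /(_ N0 (leqnn _)) H] := bergman_approx hf (divr_gt0 (exprn_gt0 2 e0) Mp).
set p := psum _ _ _ _ in H.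
have hp : bergman (onball p) by exact: bergman_psum.
have p0 : Lam (onball p) = 0.
  rewrite (functional_psum L1) big1// => k _; rewrite sumw0 ?mulr0// => I _.
  by rewrite L0 mulr0.
rewrite -csq_cn; last exact: ltW.
rewrite -[Lam f]subr0 -p0 -(functionalB L1)//.
rewrite (le_trans (L2 _ (bergmanB hf hp)))// mulrC -ler_pdivlMr//.
apply: le_trans H; rewrite le_eqVlt; apply/orP; left; apply/eqP.
by rewrite !N2_sq; congr complex.Re; apply: eq_ip => z z1; rewrite onballE.
Qed.

Lemma riesz Lam (M : R) :
  (forall (a : C) f g, bergman f -> bergman g -> Lam (fun z => a * f z + g z) = cj a * Lam f + Lam g) ->
  (forall f, bergman f -> csq (Lam f) <= M * N2 f) ->
  exists2 h, bergman h & forall f, bergman f -> ip h f = Lam f.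
Proof.
move=> L1 L2; have [h [hh hJ _]] := functional_limit L1 L2; exists h => // f hf.
have lh := A2_L2 hh.
apply/eqP; rewrite -subr_eq0; apply/eqP.
apply: (@functional_eq0 (fun g => ip h g - Lam g) (2 * N2 h + 2 * M)) => //.
- move=> a g k hg hk; rewrite L1// (ip_linr _ (A2_L2 hg) (A2_L2 hk))//.
  by ring.
- move=> g hg; have := csq_add_le (ip h g) (- Lam g).
  have := cauchy_schwarz lam_gt lh (A2_L2 hg); have := L2 _ hg.
  rewrite csqN; lra.
- move=> I; rewrite -hJ (_ : ip h (onball _) = ip h (mono I)) ?subrr//.
  by apply: eq_ip => // z z1; rewrite onballE.
Qed.

Lemma parseval f h (e : R) : bergman f -> L2B h -> 0 < e -> exists N0, forall N, (N0 <= N)%N ->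
  cn (\sum_(0 <= k < N) (ck lambda k)%:C * sumw k (fun I => ip f (mono I) * cj (ip h (mono I))) - ip f h) <= e.
Proof.
move=> hf lh e0; have lf := A2_L2 hf.
have [h0|h0] := eqVneq (N2 h) 0.
  have Z g : L2B g -> ip g h = 0.
    move=> lg; apply/eqP; rewrite -csq_eq0 eq_le csq_ge0 andbT.
    by have := cauchy_schwarz lam_gt lg lh; rewrite h0 mulr0.
  exists 0%N => N _; rewrite Z// subr0 big1 ?cn0 ?ltW// => k _; rewrite sumw0 ?mulr0// => I _.
  by rewrite -ipJ ?Z ?mulr0//; exact: L2_mono.
have hp : 0 < N2 h by rewrite lt_neqAle eq_sym h0 N2_ge0.
have [N0 H] := bergman_approx hf (divr_gt0 (exprn_gt0 2 e0) hp); exists N0 => N /H{}H.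
set s := \sum_(_ <= k < N) _; set p := psum _ _ _ _ in H.
have -> : s = ip p h.
  rewrite /p /psum ip_suml//; last by move=> k; exact: L2_part.
  apply: eq_bigr => k _; rewrite ip_part_l//; congr (_ * _); apply: eq_sumw => I _.
  by rewrite -ipJ//; exact: L2_mono.
have lp : L2B p by exact: L2_psum.
rewrite -cnN opprB -ipBl// -csq_cn; last exact: ltW.
by rewrite (le_trans (cauchy_schwarz lam_gt (L2_sub lf lp) lh))// -ler_pdivlMr.
Qed.

Definition bounded := @bounded_operator R n lambda.

Lemma bounded_N2 S : bounded S ->
  exists2 M : R, 0 <= M & forall f, bergman f -> N2 (S f) <= M * N2 f.
Proof.
move=> [S1 S2 [M hM]]; exists (M ^+ 2); first exact: sqr_ge0.
move=> f hf; have := hM f hf; rewrite !L2normE// => h.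
have h2 : Num.sqrt (N2 (S f)) ^+ 2 <= (M * Num.sqrt (N2 f)) ^+ 2.
  by rewrite ler_sqr ?nnegrE ?sqrtr_ge0//; apply: le_trans h; rewrite sqrtr_ge0.
by move: h2; rewrite exprMn !sqr_sqrtr// N2_ge0.
Qed.

Lemma N2_bounded S (M : R) : 0 <= M -> (forall f, bergman f -> N2 (S f) <= M * N2 f) ->
  exists M' : R, forall f, bergman f -> L2norm lambda (S f) <= M' * L2norm lambda f.
Proof.
move=> M0 h; exists (Num.sqrt M) => f hf; rewrite !L2normE// -sqrtrM//.
by rewrite ler_sqrt ?h// mulr_ge0// N2_ge0.
Qed.

(** S' g represents the functional f -> <g, S f>; its linearity follows from the fact that
    coefficients determine a function, and its bound from Cauchy-Schwarz applied to <g, S (S'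
    g)>. *)
Lemma adjoint_exists S : bounded S -> exists2 S', bounded S' &
  forall f g, bergman f -> bergman g -> ip (S f) g = ip f (S' g).
Proof.
move=> hS; have [M M0 hM] := bounded_N2 hS; have [S1 S2 _] := hS.
have lb := A2_L2.
have ex g : exists h, bergman g -> bergman h /\ forall f, bergman f -> ip h f = ip g (S f).
  have [hg|] := pselect (bergman g); last by exists (fun=> 0).
  have [||h hh hE] := @riesz (fun f => ip g (S f)) (N2 g * M).
  - by move=> a f k hf hk; rewrite S2//; apply: ip_linr; try exact: lb; exact/lb/S1.
  - move=> f hf; rewrite (le_trans (cauchy_schwarz lam_gt (lb _ _ _ _ hg) (lb _ _ _ _ (S1 _ hf))))//.
    by rewrite -mulrA ler_wpM2l ?N2_ge0// hM.
  by exists h.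
have [S' hS'] := choice ex; exists S'; last first.
  move=> f g hf hg; have [h1 h2] := hS' g hg.
  have l1 := lb _ _ _ _ (S1 _ hf); have l2 := lb _ _ _ _ hg.
  have l3 := lb _ _ _ _ h1; have l4 := lb _ _ _ _ hf.
  by rewrite ipJ'// -h2// -ipJ.
have B g : bergman g -> bergman (S' g) by move=> /hS'[].
split=> //.
- move=> a f g hf hg; apply: eq_bergman => [||J]; try by [apply/B/bergman_lin|apply: bergman_lin; exact: B].
  have oJ F : ip F (mono J) = ip F (onball (mono J)) by apply: eq_ip => // z z1; rewrite onballE.
  have hJ := bergman_mono J.
  rewrite !oJ (proj2 (hS' _ (bergman_lin a hf hg)))//.
  rewrite !ip_linl//; try by [exact: lb|exact/lb/S1|exact/lb/B].
  by rewrite (proj2 (hS' _ hf))// (proj2 (hS' _ hg)).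
apply: (N2_bounded M0) => g hg.
have [h1 h2] := hS' g hg.
have [z0|z0] := eqVneq (N2 (S' g)) 0; first by rewrite z0 mulr_ge0// N2_ge0.
have zp : 0 < N2 (S' g) by rewrite lt_neqAle eq_sym z0 N2_ge0.
have := cauchy_schwarz lam_gt (lb _ _ _ _ hg) (lb _ _ _ _ (S1 _ h1)).
rewrite -h2// ip_N2// csq_real => h3.
rewrite -(ler_pM2r zp) -expr2; apply: le_trans h3 _.
by have := ler_wpM2l (N2_ge0 lam_gt g) (hM _ h1); clear; lra.
Qed.

End BergmanOperators.

(** * Integration by parts for the raising operators *)

Section SkewPairing.
Context (R : realType) (m : nat).
Local Open Scope complex_scope.
Local Notation n := m.+1.
Local Notation C := R[i].
Local Notation V := 'cV[C]_n.
Local Notation word := (seq 'I_n).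
Variable lambda : R.
Hypothesis lam_gt : n%:R < lambda.
Local Notation ip := (@ip R n lambda).
Local Notation N2 := (@N2 R m lambda).
Local Notation L2B := (@L2B R m lambda).
Local Notation bergman := (@bergman_space R n lambda).
#[local] Arguments sumw : simpl never.
Implicit Types (f g h p : V -> C) (I J K : word) (i : 'I_n).

(** If l were nonzero, v k would behave like l / (x + k), and its blocks from M to 2 M could not
    become small, just as those of the harmonic series. *)
Lemma harmonic_limit (x : R) (v : nat -> C) (l : C) : 0 < x ->
  (forall e : R, 0 < e -> exists M0, forall M N, (M0 <= M)%N -> (M <= N)%N ->
     cn (\sum_(M <= k < N) v k) <= e) ->
  clim (fun k => (x + k%:R)%:C * v k) l -> l = 0.
Proof.
move=> x0 hv hl; apply: cn_small => e e0; have e4 : 0 < e / 4 by rewrite divr_gt0.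
have [M0 hM] := hv _ e4; have [N0 hN] := hl _ e4.
pose B := (Num.bound x).+1; have xB : x <= B%:R.
  by apply: ltW (lt_le_trans (archi_boundP (ltW x0)) _); rewrite ler_nat.
pose M := maxn M0 (maxn N0 B).
have [M1 M2 M3] : [/\ M0 <= M, N0 <= M & B <= M]%N by rewrite /M; split; lia.
have Mx : x <= M%:R by apply: le_trans xB _; rewrite ler_nat.
have Mp : 0 < M%:R :> R by exact: lt_le_trans Mx.
have k0 k : 0 < x + k%:R by rewrite ltr_pwDl.
pose T : R := \sum_(M <= k < M + M) (x + k%:R)^-1.
(* M is at least x, so x + k <= 3 M for each of the M terms of the block. *)
have T1 : 1 / 3 <= T.
  rewrite -[X in X <= _](_ : \sum_(M <= k < M + M) (3 * M%:R)^-1 = 1 / 3 :> R); last first.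
    by rewrite sumr_const_nat addnK -mulr_natr; field; rewrite gt_eqF.
  apply: ler_sum_nat => k /andP[Mk kM]; rewrite lef_pV2 ?posrE ?mulr_gt0//.
  by have : k%:R <= M%:R + M%:R :> R; [rewrite -natrD ler_nat ltnW|lra].
have H k : (M <= k < M + M)%N -> cn (l * (x + k%:R)^-1%:C - v k) <= e / 4 * (x + k%:R)^-1.
  move=> /andP[Mk _]; have kC : (x + k%:R)%:C != 0 :> C by rewrite -cn_eq0 cn_real normr_eq0 gt_eqF.
  rewrite (_ : _ - _ = - (((x + k%:R)%:C * v k - l) * (x + k%:R)^-1%:C)); last first.
    by rewrite fmorphV mulrBl (mulrC (_%:C)) mulfK// opprB.
  rewrite cnN cnM cn_real gtr0_norm ?invr_gt0// ler_pM2r ?invr_gt0//.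
  by apply: hN; exact: leq_trans Mk.
have D : cn (l * T%:C - \sum_(M <= k < M + M) v k) <= e / 4 * T.
  rewrite /T rmorph_sum !mulr_sumr -sumrB; apply: le_trans (cn_sum _ _ _) _.
  by rewrite big_nat_cond [leRHS]big_nat_cond; apply: ler_sum => k /andP[kM _]; exact: H.
have S : cn (\sum_(M <= k < M + M) v k) <= e / 4 by apply: hM => //; rewrite leq_addr.
have L : cn (l * T%:C) <= e / 4 * T + e / 4.
  rewrite -[l * _](subrK (\sum_(M <= k < M + M) v k)).
  by apply: le_trans (cnD _ _) _; rewrite lerD.
move: L; rewrite cnM cn_real ger0_norm; last by lra.
have := cn_ge0 l; nra.
Qed.

Lemma natC k : lambda%:C + k%:R = (lambda + k%:R)%:C :> C.
Proof. by rewrite rmorphD rmorph_nat. Qed.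

Lemma ip_raise f i J : L2B f ->
  ip f (raise lambda i J) = \sum_(K <- dell i J) ip f (mono K) -
    (lambda%:C + (size J)%:R) * ip f (mono (i :: J)).
Proof.
move=> lf; have lm K : L2B (mono K) by exact: L2_mono.
rewrite /raise ipDr//; [|by apply: L2_sum|by apply: L2N; exact: L2Z].
rewrite ip_sumr//; congr (_ + _).
rewrite (_ : (fun z => _) = fun z => - (lambda%:C + (size J)%:R) * mono (i :: J) z); last first.
  by apply/funext => z; rewrite mulNr.
rewrite ipZr// -mulNr; congr (_ * _).
by rewrite natC -rmorphN conj_real.
Qed.

Lemma L2_coord i f : L2B f -> L2B (fun z => z i ord0 * f z).
Proof.
move=> lf; have z1 (z : V) : sqnorm z < 1 -> csq (z i ord0) <= 1.
  by move=> /ltW; exact: le_trans (coord_le z i).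
apply: (L2_mulb _ z1 lf); have := gmeas_bcmeas (@gmeas_mono R m [:: i]).
by rewrite (_ : mono [:: i] = fun z => z i ord0)//; apply/funext => z; rewrite mono_cons mono_nil mulr1.
Qed.

Lemma N2_coord i f : L2B f -> N2 (fun z => z i ord0 * f z) <= N2 f.
Proof.
move=> lf; have [_ I1] := L2_coord i lf; have [_ I2] := lf.
rewrite /N2 ler_pM2l ?c_lambda_gt0//; apply: RI_le => // z z1.
rewrite csqM ler_piMl ?csq_ge0//; exact: le_trans (coord_le z i) (ltW z1).
Qed.

Lemma N2_sub_le f g : L2B f -> L2B g -> N2 (fun z => f z - g z) <= 2 * N2 f + 2 * N2 g.
Proof.
move=> lf lg; have lN : L2B (fun z => -1 * g z) by exact: L2Z.
rewrite (_ : (fun z => _) = fun z => f z + -1 * g z); last by apply/funext => z; rewrite mulN1r.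
have := N2_ge0 lam_gt (fun z => f z + g z).
rewrite !N2D// N2Z// ipZr// csqN csq1 rmorphN rmorph1 mulN1r cReN; lra.
Qed.

Lemma psum_approx f (e : R) : bergman f -> 0 < e -> exists N0, forall M N, (N0 <= M)%N -> (M <= N)%N ->
  N2 (psum lambda (fun J => ip f (mono J)) M N) <= e.
Proof.
move=> hf e0; have e4 : 0 < e / 4 by rewrite divr_gt0.
have [N0 H] := bergman_approx lam_gt hf e4; exists N0 => M N N0M MN.
have h1 := H _ N0M; have h2 := H _ (leq_trans N0M MN).
set a := (fun J => _) in h1 h2 *.
have lp N' : L2B (psum lambda a 0 N') by exact: L2_psum.
have lf := A2_L2 hf.
have := N2_sub_le (L2_sub lf (lp M)) (L2_sub lf (lp N)).
rewrite (_ : (fun z => f z - psum lambda a 0 M z - (f z - psum lambda a 0 N z)) =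
  psum lambda a M N); last first.
  by apply/funext => z; rewrite (psum_cat _ _ (leq0n M) MN z); ring.
by move=> h; lra.
Qed.

Lemma ip_coord_psum a i M N g : L2B g ->
  ip (fun z => z i ord0 * psum lambda a M N z) g =
  \sum_(M <= k < N) (ck lambda k)%:C * sumw k (fun I => a I * ip (mono (i :: I)) g).
Proof.
move=> lg; have lm K : L2B (mono K) by exact: L2_mono.
rewrite (_ : (fun z => _) = fun z => \sum_(M <= k < N)
    (ck lambda k)%:C * sumw k (fun I => a I * mono (i :: I) z)); last first.
  apply/funext => z; rewrite /psum mulr_sumr; apply: eq_bigr => k _.
  rewrite /part mulrCA; congr (_ * _); rewrite -sumwZ; apply: eq_sumw => I _.
  by rewrite mono_cons mulrCA.
have lS k : L2B (fun z => sumw k (fun I => a I * mono (i :: I) z)).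
  by apply: (L2_sumw lam_gt k (F := fun I z => a I * mono (i :: I) z)) => I; exact: L2Z.
rewrite (ip_suml lam_gt _ _ (F := fun k z => (ck lambda k)%:C * sumw k (fun I => a I * mono (i :: I) z)))//; last first.
  by move=> k; apply: L2Z; exact: lS.
apply: eq_bigr => k _; rewrite ipZl//; congr (_ * _).
rewrite (ip_sumwl lam_gt k (F := fun I z => a I * mono (i :: I) z))//; last by move=> I; exact: L2Z.
by apply: eq_sumw => I _; rewrite ipZl.
Qed.

(* Truncating the expansions at degree N leaves a boundary term that converges
   as N grows; its sum against 1 / (lambda + k) converges too, so its limit is 0
   by [harmonic_limit]. *)
Lemma skew_pairing i f g h p : bergman f -> bergman g -> bergman h -> bergman p ->
  (forall J, ip g (mono J) = - ip f (raise lambda i J)) ->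
  (forall J, ip p (mono J) = - ip h (raise lambda i J)) -> ip g h + ip f p = 0.
Proof.
move=> hf hg hh hp gE pE; have lf := A2_L2 hf; have lg := A2_L2 hg.
have lh := A2_L2 hh; have lp := A2_L2 hp.
have lm K : L2B (mono K) by exact: L2_mono.
pose a I := ip f (mono I); pose b I := cj (ip h (mono I)).
have bE I : b I = ip (mono I) h by rewrite /b -ipJ.
pose G k := (ck lambda k)%:C * sumw k (fun I => ip g (mono I) * cj (ip h (mono I))).
pose W k := (ck lambda k)%:C * sumw k (fun I => ip f (mono I) * cj (ip p (mono I))).
(* The degree-k terms G k of <g, h> and W k of <f, p> are P k - Q (k-1) and Q k - P (k-1), so the
   sum of both up to N telescopes to P N + Q N. *)
pose P k := (ck lambda k)%:C * ((lambda%:C + k%:R) * sumw k (fun I => a (i :: I) * b I)).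
pose Q k := (ck lambda k)%:C * ((lambda%:C + k%:R) * sumw k (fun I => a I * b (i :: I))).
have ckC k : (ck lambda k.+1)%:C * k.+1%:R = (ck lambda k)%:C * (lambda%:C + k%:R) :> C.
  rewrite -[k.+1%:R](rmorph_nat (real_complex R)) -rmorphM ckS divfK ?pnatr_eq0//.
  by rewrite rmorphM rmorphD rmorph_nat.
have aperm I J : perm_eq I J -> a I = a J by move=> IJ; rewrite /a (mono_perm _ IJ).
have bperm I J : perm_eq I J -> b I = b J by move=> IJ; rewrite /b (mono_perm _ IJ).
have GE k : G k = P k - (if k is k'.+1 then Q k' else 0).
  rewrite /G (eq_sumw (G := fun I => (lambda%:C + k%:R) * (a (i :: I) * b I) -
     \sum_(K <- dell i I) a K * b I)); last first.
    move=> I Ik; rewrite gE ip_raise// Ik -/(b I) opprB mulrBl mulr_suml; congr (_ - _).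
    by rewrite mulrA.
  rewrite -[fun I => _](_ : (fun I => (lambda%:C + k%:R) * (a (i :: I) * b I) +
     -1 * \sum_(K <- dell i I) a K * b I) = _); last by apply/funext => I; rewrite mulN1r.
  rewrite sumwD !sumwZ mulN1r mulrBr; congr (_ - _).
  case: k => [|k]; first by rewrite sumw_nil /= big_nil mulr0.
  rewrite (sumw_dell k i (F := fun K I => a K * b I)); last by move=> K I J /bperm ->.
  by rewrite mulrA ckC -mulrA.
have WE k : W k = Q k - (if k is k'.+1 then P k' else 0).
  rewrite /W (eq_sumw (G := fun I => (lambda%:C + k%:R) * (a I * b (i :: I)) -
     \sum_(K <- dell i I) b K * a I)); last first.
    move=> I Ik; have -> : cj (ip p (mono I)) =
        (lambda%:C + k%:R) * b (i :: I) - \sum_(K <- dell i I) b K.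
      rewrite pE ip_raise// Ik opprB -[- \sum_(_ <- _) _]mulN1r conjD !conjM natC conj_real.
      by rewrite rmorph_sum rmorphN rmorph1 mulN1r.
    rewrite -/(a I) mulrBr mulr_sumr mulrCA; congr (_ - _).
    by apply: eq_bigr => K _; rewrite mulrC.
  rewrite -[fun I => _](_ : (fun I => (lambda%:C + k%:R) * (a I * b (i :: I)) +
     -1 * \sum_(K <- dell i I) b K * a I) = _); last by apply/funext => I; rewrite mulN1r.
  rewrite sumwD !sumwZ mulN1r mulrBr; congr (_ - _).
  case: k => [|k]; first by rewrite sumw_nil /= big_nil mulr0.
  rewrite (sumw_dell k i (F := fun K I => b K * a I)); last by move=> K I J /aperm ->.
  rewrite mulrA ckC -mulrA /P; congr (_ * (_ * _)); apply: eq_sumw => K _; exact: mulrC.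
(* v k is the degree-k contribution to <z_i f, h> + conj <z_i h, f>; its sums are Cauchy because
   multiplication by z_i does not increase the norm. *)
pose v k := (ck lambda k)%:C * sumw k (fun I => a I * b (i :: I)) +
  cj ((ck lambda k)%:C * sumw k (fun I => ip h (mono I) * cj (a (i :: I)))).
have PQ k : P k + Q k = (lambda + k%:R)%:C * v k.
  rewrite /v conjM conj_real sumw_conj -natC.
  rewrite (eq_sumw (F := fun I => cj (_ * _)) (G := fun I => a (i :: I) * b I)).
    by rewrite /P /Q; ring.
  by move=> I _; rewrite conjM conjCK mulrC.
have S N : \sum_(0 <= k < N.+1) G k + \sum_(0 <= k < N.+1) W k = (lambda + N%:R)%:C * v N.
  rewrite -PQ; elim: N => [|N IH]; first by rewrite big_nat1 big_nat1 GE WE !subr0.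
  rewrite (big_nat_recr N.+1)//= [X in _ + X](big_nat_recr N.+1)//= addrACA IH GE WE.
  have R4 (w x y z : C) : w + x + (y - x + (z - w)) = y + z by ring.
  exact: R4.
apply: (@harmonic_limit lambda v).
- exact: le_lt_trans lam_gt.
- move=> e e0; have e2 : 0 < e / 2 by rewrite divr_gt0.
  have tail f1 f2 : bergman f1 -> L2B f2 -> exists M0, forall M N, (M0 <= M)%N -> (M <= N)%N ->
     cn (\sum_(M <= k < N) (ck lambda k)%:C * sumw k (fun I => ip f1 (mono I) * ip (mono (i :: I)) f2)) <= e / 2.
    move=> h1 l2; have q0 : 0 < N2 f2 + 1 by rewrite ltr_wpDl// N2_ge0.
    have [M0 H] := psum_approx h1 (divr_gt0 (exprn_gt0 2 e2) q0).
    exists M0 => M N M0M MN; have {}H := H _ _ M0M MN.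
    rewrite -ip_coord_psum//; set q := psum _ _ _ _ in H *.
    have lq : L2B q by exact: L2_psum.
    rewrite -csq_cn; last exact: ltW.
    rewrite (le_trans (cauchy_schwarz lam_gt (L2_coord i lq) l2))//.
    move: H; rewrite ler_pdivlMr// => H; apply: le_trans H.
    rewrite ler_pM ?N2_ge0//; first exact: N2_coord.
    by rewrite lerDl.
  have [M1 H1] := tail _ _ hf lh; have [M2 H2] := tail _ _ hh lf.
  exists (maxn M1 M2) => M N; rewrite geq_max => /andP[h1 h2] MN.
  rewrite /v big_split /=; apply: le_trans (cnD _ _) _.
  rewrite (splitr e) lerD//.
    rewrite (eq_bigr (fun k => (ck lambda k)%:C * sumw k (fun I => ip f (mono I) * ip (mono (i :: I)) h))).
      exact: H1.
    by move=> k _; rewrite (eq_sumw (G := fun I => ip f (mono I) * ip (mono (i :: I)) h))// => I _; rewrite bE.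
  rewrite -rmorph_sum cnJ.
  rewrite (eq_bigr (fun k => (ck lambda k)%:C * sumw k (fun I => ip h (mono I) * ip (mono (i :: I)) f))).
    exact: H2.
  by move=> k _; rewrite (eq_sumw (G := fun I => ip h (mono I) * ip (mono (i :: I)) f))// => I _; rewrite /a -ipJ.
move=> e e0; have e2 : 0 < e / 2 by rewrite divr_gt0.
have [N1 H1] := parseval lam_gt hg lh e2; have [N2' H2] := parseval lam_gt hf lp e2.
exists (maxn N1 N2') => N; rewrite geq_max => /andP[h1 h2].
rewrite -S opprD addrACA; apply: le_trans (cnD _ _) _; rewrite (splitr e) lerD//.
  by apply: H1; exact: leq_trans h1 _.
by apply: H2; exact: leq_trans h2 _.
Qed.

End SkewPairing.

(** * Toeplitz operators with bounded symbols *)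

Section Toeplitz.
Context (R : realType) (m : nat).
Local Open Scope complex_scope.
Local Notation n := m.+1.
Local Notation C := R[i].
Local Notation V := 'cV[C]_n.
Local Notation word := (seq 'I_n).
Variable lambda : R.
Hypothesis lam_gt : n%:R < lambda.
Local Notation ip := (@ip R n lambda).
Local Notation N2 := (@N2 R m lambda).
Local Notation L2B := (@L2B R m lambda).
Local Notation bergman := (@bergman_space R n lambda).
Local Notation bounded := (@bounded R m lambda).
Local Notation toep := (@toeplitz R n lambda).
#[local] Arguments sumw : simpl never.
Implicit Types (f g h phi : V -> C) (I J K : word) (i : 'I_n).

(** A symbol is bounded only almost everywhere and measurable only on the ball; this representative
    is bounded everywhere and measurable on the whole space. *)
Definition clip (M : R) phi : V -> C :=
  onball (fun z => if csq (phi z) <= M ^+ 2 then phi z else 0).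

Definition essentially_bounded (M : R) phi :=
  [/\ 0 <= M, bcmeas phi & ae_ball (fun z => ComplexField.Normc.normc (phi z) <= M)].

Lemma Linfty_bounded phi : Linfty phi -> exists M, essentially_bounded M phi.
Proof.
move=> [m1 [M hM]]; exists `|M|; split => //.
by apply: ae_imply hM => t h b; apply: le_trans (h b) (ler_norm M).
Qed.

Lemma bcmeas_onball f : bcmeas f -> bcmeas (onball f).
Proof.
move=> [m1 m2]; split; [move: m1|move: m2]; apply: eq_measurable_fun => t;
  by rewrite inE => t1; rewrite onballE.
Qed.

Lemma gmeas_onball f : bcmeas f -> gmeas (onball f).
Proof.
move=> hf; apply: bcmeas_gmeas; first exact: bcmeas_onball.
by move=> z /negP z1; rewrite /onball (negbTE z1).
Qed.

Lemma clipE M phi z : clip M phi z =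
  if csq (onball phi z) <= M ^+ 2 then onball phi z else 0.
Proof. by rewrite /clip /onball; case: ifP => // _; rewrite if_same. Qed.

Lemma gmeas_clip M phi : bcmeas phi -> gmeas (clip M phi).
Proof.
move=> /gmeas_onball[m1 m2].
have mb : measurable_fun setT (fun t : cpow R n => csq (onball phi (cvec t)) <= M ^+ 2).
  apply: measurable_fun_ler; last exact: measurable_cst.
  by apply: measurable_funD; exact: measurable_funX.
split; under eq_fun do rewrite clipE.
  rewrite (_ : (fun t => _) = fun t : cpow R n => if csq (onball phi (cvec t)) <= M ^+ 2 then
    complex.Re (onball phi (cvec t)) else 0); last by apply/funext => t; case: ifP.
  by apply: measurable_fun_ifT => //; exact: measurable_cst.
rewrite (_ : (fun t => _) = fun t : cpow R n => if csq (onball phi (cvec t)) <= M ^+ 2 then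
  complex.Im (onball phi (cvec t)) else 0); last by apply/funext => t; case: ifP.
by apply: measurable_fun_ifT => //; exact: measurable_cst.
Qed.

Lemma csq_clip M phi z : csq (clip M phi z) <= M ^+ 2.
Proof. by rewrite clipE; case: ifP => // _; rewrite csq0 sqr_ge0. Qed.

Lemma cn_clip M phi z : 0 <= M -> cn (clip M phi z) <= M.
Proof. by move=> M0; rewrite -csq_cn//; exact: csq_clip. Qed.

Lemma ae_clip M phi : essentially_bounded M phi -> ae_ball (fun z => phi z = clip M phi z).
Proof.
move=> [M0 _]; apply: ae_imply => t h b; rewrite clipE onballE// csq_cn//.
by rewrite -cnE h.
Qed.

Lemma clip_conj M phi z : clip M (fun z => cj (phi z)) z = cj (clip M phi z).
Proof.
by rewrite /clip /onball; case: ifP => // _; rewrite ?csqJ ?rmorph0//; case: ifP => // _; rewrite rmorph0.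
Qed.

Lemma clip_eq M phi z w : sqnorm z < 1 -> sqnorm w < 1 -> phi z = phi w -> clip M phi z = clip M phi w.
Proof. by move=> z1 w1 e; rewrite /clip !onballE// e. Qed.

Lemma L2_clip M phi f : bcmeas phi -> L2B f -> L2B (fun z => clip M phi z * f z).
Proof.
move=> hp; apply: (@L2_mulb R m lambda _ _ (M ^+ 2)); last by move=> z _; exact: csq_clip.
exact/gmeas_bcmeas/gmeas_clip.
Qed.

Lemma N2_clip M phi f : bcmeas phi -> L2B f -> N2 (fun z => clip M phi z * f z) <= M ^+ 2 * N2 f.
Proof.
move=> hp lf; have [_ I1] := L2_clip M hp lf; have [_ I2] := lf.
rewrite /N2 mulrCA ler_pM2l ?c_lambda_gt0// -RIZ//; apply: RI_le => //; first exact: IntBZ.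
by move=> z z1; rewrite csqM ler_wpM2r ?csq_ge0//; exact: csq_clip.
Qed.

Lemma N2_dual (K : R) h : 0 <= K -> csq (ip h h) <= K * N2 h -> N2 h <= K.
Proof.
move=> K0; rewrite ip_N2// csq_real; have [->//|h0] := eqVneq (N2 h) 0.
by rewrite expr2 ler_pM2r// lt_neqAle eq_sym h0 N2_ge0.
Qed.

(** [bergman_proj] is a choice with default value 0, so the projection must be shown to exist; the
    Riesz representation provides it. [F] will be phi f itself and [F'] its clipped version, which
    is in L^2 and has the same pairings. *)
Lemma bergman_projP F F' : L2B F' ->
  (forall h g, bergman h -> bergman g -> ip (fun z => F z - h z) g = ip (fun z => F' z - h z) g) ->
  bergman (bergman_proj lambda F) /\ forall g, bergman g -> ip (bergman_proj lambda F) g = ip F' g.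
Proof.
move=> lF FF.
have [||h hh hE] := @riesz R m lambda lam_gt (ip F') (N2 F').
- by move=> a f g /A2_L2 lf /A2_L2 lg; exact: ip_linr.
- by move=> f /A2_L2 lf; exact: cauchy_schwarz.
have B k : bergman k -> L2B k by exact: A2_L2.
have := @xgetI _ (fun=> 0) [set k | bergman k /\ forall g, bergman g -> ip (fun z => F z - k z) g = 0] h.
rewrite -/(bergman_proj lambda F); case.
  split=> // g hg; rewrite FF// ipBl ?hE ?subrr//; exact: B.
move=> bp pE; split=> // g hg; have := pE g hg.
by rewrite FF// ipBl//; [move/eqP; rewrite subr_eq0 eq_sym => /eqP|exact: B|exact: B].
Qed.

Lemma toeplitzP M phi f : essentially_bounded M phi -> bergman f ->
  bergman (toep phi f) /\ forall g, bergman g -> ip (toep phi f) g = ip (fun z => clip M phi z * f z) g.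
Proof.
move=> hM hf; have [M0 mphi _] := hM; apply: bergman_projP.
  by apply: L2_clip => //; exact: A2_L2.
move=> h g hh hg; have [mf mg mh] := And3 (gmeas_bergman hf) (gmeas_bergman hg) (gmeas_bergman hh).
rewrite (@eq_ip R m lambda _ (fun z => onball phi z * f z - h z) _ g)//; last first.
  by move=> z z1; rewrite onballE.
have G psi : gmeas psi -> gmeas (fun z => (psi z * f z - h z) * cj (g z)).
  by move=> mpsi; exact: cmeasM (cmeasB (cmeasM mpsi mf) mh) (cmeasJ mg).
rewrite !ipE; congr (_ * _); apply: (ae_CI lambda (G _ (gmeas_onball mphi)) (G _ (gmeas_clip M mphi))).
by apply: ae_imply (ae_clip hM) => t e b; rewrite onballE// e.
Qed.

Lemma ip_mono_onball f J : ip f (onball (mono J)) = ip f (mono J).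
Proof. by apply: eq_ip => // z z1; rewrite onballE. Qed.

Lemma toeplitz_bounded phi : Linfty phi -> bounded (toep phi).
Proof.
move=> /Linfty_bounded[M hM]; have [M0 mphi _] := hM.
have B f : bergman f -> bergman (toep phi f) by move=> hf; case: (toeplitzP hM hf).
have E f g : bergman f -> bergman g -> ip (toep phi f) g = ip (fun z => clip M phi z * f z) g.
  by move=> hf; case: (toeplitzP hM hf) => _; apply.
split=> //.
  move=> a f g hf hg; have hfg := bergman_lin a hf hg.
  apply: (eq_bergman lam_gt (B _ hfg) (bergman_lin a (B _ hf) (B _ hg))) => J.
  have hJ := bergman_mono lam_gt J; rewrite -!ip_mono_onball.
  have lJ := A2_L2 hJ; have lf := L2_clip M mphi (A2_L2 hf); have lg := L2_clip M mphi (A2_L2 hg).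
  rewrite (E _ _ hfg hJ).
  rewrite (ip_linl a (A2_L2 (B _ hf)) (A2_L2 (B _ hg)) lJ) !E// -(ip_linl a lf lg lJ).
  by apply: eq_ip => // z _; ring.
apply: (N2_bounded lam_gt (sqr_ge0 M)) => f hf.
have lf := A2_L2 hf; apply: N2_dual; first by rewrite mulr_ge0 ?sqr_ge0 ?N2_ge0.
rewrite E//; last exact: B.
apply: le_trans (cauchy_schwarz lam_gt (L2_clip M mphi lf) (A2_L2 (B _ hf))) _.
by rewrite ler_wpM2r ?N2_ge0//; exact: N2_clip.
Qed.

Lemma toeplitz_adjoint phi f g : Linfty phi -> bergman f -> bergman g ->
  Linfty (fun z => cj (phi z)) /\ ip (toep phi f) g = ip f (toep (fun z => cj (phi z)) g).
Proof.
move=> lphi hf hg; have [M hM] := Linfty_bounded lphi.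
have hM' : essentially_bounded M (fun z => cj (phi z)).
  have [M0 mphi ae] := hM; split=> //; first exact: cmeasJ.
  by apply: ae_imply ae => t h /h; rewrite !cnE cnJ.
split; first by have [_ m1 m2] := hM'; split=> //; exists M.
have [hT E] := toeplitzP hM hf; have [hT' E'] := toeplitzP hM' hg.
rewrite E// (ipJ' (A2_L2 hf) (A2_L2 hT')) E'//.
have [_ mp _] := hM; have [_ mp' _] := hM'.
rewrite -(ipJ (L2_clip M mp' (A2_L2 hg)) (A2_L2 hf)) !ipE; congr (_ * _).
by apply: eq_CI => z _; rewrite conjM clip_conj conjCK; ring.
Qed.

End Toeplitz.

(** * Operators skew for the raising operators commute *)

Section Commutativity.
Context (R : realType) (m : nat).
Local Open Scope complex_scope.
Local Notation n := m.+1.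
Local Notation C := R[i].
Local Notation V := 'cV[C]_n.
Local Notation word := (seq 'I_n).
Variable lambda : R.
Hypothesis lam_gt : n%:R < lambda.
Local Notation ip := (@ip R n lambda).
Local Notation N2 := (@N2 R m lambda).
Local Notation L2B := (@L2B R m lambda).
Local Notation bergman := (@bergman_space R n lambda).
Local Notation bounded := (@bounded R m lambda).
Local Notation em := (fun I => onball (@mono R m I)).
#[local] Arguments sumw : simpl never.
Implicit Types (f g h phi : V -> C) (I J K : word) (i : 'I_n) (S T : operator R n).

Lemma bergman_raise i I : bergman (onball (raise lambda i I)).
Proof.
have h1 : bergman (onball (fun z => \sum_(K <- dell i I) mono K z)).
  by apply: (bergman_onball_sum lam_gt) => K; exact: bergman_mono.
have h2 := bergman_lin (- (lambda%:C + (size I)%:R)) (bergman_mono lam_gt (i :: I)) h1.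
rewrite (_ : onball _ = fun z => - (lambda%:C + (size I)%:R) * onball (mono (i :: I)) z +
  onball (fun z => \sum_(K <- dell i I) mono K z) z)//.
by apply/funext => z; rewrite /onball /raise; case: ifP => _; ring.
Qed.

Lemma L2_raise i I : L2B (raise lambda i I).
Proof.
have := A2_L2 (bergman_raise i I).
by apply: eq_L2 => z z1; rewrite onballE.
Qed.

Lemma ip_onballr f g : ip f (onball g) = ip f g.
Proof. by apply: eq_ip => // z z1; rewrite onballE. Qed.

(** Skewness and parity are expressed through matrix entries, which are continuous in the operator
    norm by [ip_limit]; the unbounded raising operators are thus only applied to monomials. *)
Definition good S := [/\ bounded S,
  (forall i I J, ip (S (onball (raise lambda i I))) (mono J) +
                 ip (S (em I)) (raise lambda i J) = 0) &
  (forall I J, odd (size I + size J) -> ip (S (em I)) (mono J) = 0)].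

Lemma ip_limit S f g (e : R) : bounded S -> bergman f -> L2B g -> 0 < e ->
  exists2 d : R, 0 < d & forall T, bounded T -> op_dist_le lambda S T d ->
    cn (ip (S f) g - ip (T f) g) <= e.
Proof.
move=> [bS _ _] hf lg e0; pose q := 1 + N2 f + N2 g.
have f0 := N2_ge0 lam_gt f; have g0 := N2_ge0 lam_gt g.
have q0 : 0 < q by rewrite /q; lra.
exists (e / q); first by rewrite divr_gt0.
move=> T [bT _ _] h; have lS := A2_L2 (bS _ hf); have lT := A2_L2 (bT _ hf).
rewrite -ipBl// -csq_cn; last exact: ltW.
apply: le_trans (cauchy_schwarz lam_gt (L2_sub lS lT) lg) _.
have := h f hf; rewrite !L2normE// => h1.
have h2 : Num.sqrt (N2 (fun z => S f z - T f z)) ^+ 2 <= (e / q * Num.sqrt (N2 f)) ^+ 2.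
  by rewrite ler_sqr ?nnegrE ?sqrtr_ge0//; apply: le_trans h1; rewrite sqrtr_ge0.
move: h2; rewrite exprMn !sqr_sqrtr// ?N2_ge0// => h2.
apply: le_trans (ler_wpM2r g0 h2) _; rewrite -mulrA expr_div_n -mulrA ler_piMr ?sqr_ge0//.
rewrite mulrC ler_pdivrMr ?exprn_gt0// mul1r /q; nra.
Qed.

(** The adjoint inherits both properties by conjugation; skewness is put in the form of the
    hypotheses of [skew_pairing]. *)
Lemma good_adjoint S : good S -> exists S', [/\ bounded S',
  forall f g, bergman f -> bergman g -> ip (S f) g = ip f (S' g),
  forall i J I, ip (S' (onball (raise lambda i J))) (mono I) = - ip (S' (em J)) (raise lambda i I) &
  forall I J, odd (size I + size J) -> ip (S' (em J)) (mono I) = 0].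
Proof.
move=> [bS skS evS]; have [S' bS' adj] := adjoint_exists lam_gt bS.
have hm I := bergman_mono lam_gt I.
have A f g : bergman f -> bergman g -> ip (S' g) f = cj (ip (S f) g).
  move=> hf hg; rewrite adj// -ipJ//; first exact: A2_L2 hf.
  by have [h _ _] := bS'; exact: A2_L2 (h _ hg).
exists S'; split=> // [i J I|I J IJ].
  apply/eqP; rewrite -subr_eq0 opprK; apply/eqP.
  rewrite -(ip_onballr _ (mono I)) -(ip_onballr _ (raise lambda i I)) !A//; try exact: bergman_raise.
  by rewrite -conjD !ip_onballr addrC skS rmorph0.
by rewrite -(ip_onballr _ (mono I)) A// ip_onballr evS ?rmorph0.
Qed.

Lemma bounded_comp S T : bounded S -> bounded T -> bounded (fun f => S (T f)).
Proof.
move=> bS bT; have [S1 S2 _] := bS; have [T1 T2 _] := bT; split.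
- by move=> f hf; exact/S1/T1.
- by move=> a f g hf hg; rewrite T2// S2//; exact: T1.
have [K K0 hK] := bounded_N2 lam_gt bS; have [L L0 hL] := bounded_N2 lam_gt bT.
apply: (N2_bounded lam_gt (mulr_ge0 K0 L0)) => f hf.
by apply: le_trans (hK _ (T1 _ hf)) _; rewrite -mulrA ler_wpM2l// hL.
Qed.

(** Moving S to its adjoint, skewness of the product is [skew_pairing] for f = T e_I, g = T (X_i
    e_I), h = S' e_J and p = S' (X_i e_J). For parity, in each term of the Parseval expansion of <T
    e_I, S' e_J> one of the two factors joins degrees of opposite parity. *)
Lemma good_comp S T : good S -> good T -> good (fun f => S (T f)).
Proof.
move=> gS gT; have [S' [bS' adj skS' evS']] := good_adjoint gS.
have [[S1 S2 [MS hS]] _ _] := gS; have [[T1 T2 [MT hT]] skT evT] := gT.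
have hm I := bergman_mono lam_gt I; have [S1' _ _] := bS'.
have bST := bounded_comp (And3 S1 S2 (ex_intro _ MS hS)) (And3 T1 T2 (ex_intro _ MT hT)).
split=> // [i I J|I J IJ].
  have hr := bergman_raise i I; have hr' := bergman_raise i J.
  rewrite -(ip_onballr _ (mono J)) -(ip_onballr _ (raise lambda i J)) !adj//; try exact: T1.
  apply: (skew_pairing lam_gt (i := i)); try by [exact: T1|exact: S1'].
    move=> K; apply/eqP; rewrite -subr_eq0 opprK; apply/eqP; exact: skT.
  by move=> K; exact: skS'.
rewrite -(ip_onballr _ (mono J)) adj//; last exact: T1.
have hTI := T1 _ (hm I); have lS := A2_L2 (S1' _ (hm J)).
apply/eqP; rewrite -oppr_eq0; apply/eqP; apply: cn_small => e e0.
have [N0 /(_ N0 (leqnn _))] := parseval lam_gt hTI lS e0.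
rewrite big1 ?sub0r// => k _; rewrite sumw0 ?mulr0// => K _.
have [od|od] := boolP (odd (size I + size K)); first by rewrite evT// mul0r.
rewrite evS' ?rmorph0 ?mulr0//.
by move: IJ od; rewrite !oddD; case: (odd _); case: (odd _); case: (odd _).
Qed.

Lemma bounded0 : bounded (fun _ _ => 0).
Proof.
split; first by move=> f _; exact: bergman0.
  by move=> a f g _ _; apply/funext => z; rewrite mulr0 addr0.
apply: (@N2_bounded R m lambda lam_gt (fun _ _ => 0) 0) => // f hf.
by rewrite mul0r N2_sq// ip0l.
Qed.

Lemma bounded_lin (a : C) S T : bounded S -> bounded T -> bounded (fun f z => a * S f z + T f z).
Proof.
move=> bS bT; have [S1 S2 _] := bS; have [T1 T2 _] := bT; split.
- by move=> f hf; apply: bergman_lin; [exact: S1|exact: T1].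
- by move=> b f g hf hg; apply/funext => z; rewrite S2// T2//; ring.
have [K K0 hK] := bounded_N2 lam_gt bS; have [L L0 hL] := bounded_N2 lam_gt bT.
have M0 : 0 <= 2 * (csq a * K) + 2 * L by rewrite addr_ge0// mulr_ge0// mulr_ge0// csq_ge0.
apply: (N2_bounded lam_gt M0) => f hf; have lS := A2_L2 (S1 _ hf); have lT := A2_L2 (T1 _ hf).
have := N2_sub_le lam_gt (L2Z a lS) (L2Z (-1) lT).
rewrite !N2Z// csqN csq1 mul1r.
rewrite (_ : (fun z => _ - _) = fun z => a * S f z + T f z); last by apply/funext => z; rewrite mulN1r opprK.
move=> h; apply: le_trans h _.
have := ler_wpM2l (csq_ge0 a) (hK f hf); have := hL f hf; lra.
Qed.

Lemma closed_bounded : closed_subalgebra lambda bounded.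
Proof.
split; [by []|exact: bounded0|exact: bounded_lin|exact: bounded_comp|by []].
Qed.

Lemma closed_good : closed_subalgebra lambda good.
Proof.
have hm I := bergman_mono lam_gt I; have lm I := L2_mono lam_gt I.
split.
- by move=> S [].
- split; first exact: bounded0.
    by move=> i I J; rewrite !ip0l// addr0.
  by move=> I J _; rewrite ip0l.
- move=> a S T [bS skS evS] [bT skT evT]; split; first exact: bounded_lin.
    have [S1 _ _] := bS; have [T1 _ _] := bT.
    move=> i I J; have hr := bergman_raise i I.
    rewrite (ip_linl a (A2_L2 (S1 _ hr)) (A2_L2 (T1 _ hr)) (lm J)).
    rewrite (ip_linl a (A2_L2 (S1 _ (hm I))) (A2_L2 (T1 _ (hm I))) (L2_raise i J)).
    by rewrite addrACA -mulrDr skS skT mulr0 addr0.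
  have [S1 _ _] := bS; have [T1 _ _] := bT.
  move=> I J IJ; rewrite (ip_linl a (A2_L2 (S1 _ (hm I))) (A2_L2 (T1 _ (hm I))) (lm J)).
  by rewrite evS// evT// mulr0 addr0.
- exact: good_comp.
move=> S bS hS; split=> // [i I J|I J IJ].
  apply: cn_small => e e0; have e2 : 0 < e / 2 by rewrite divr_gt0.
  have [d1 d10 h1] := ip_limit bS (bergman_raise i I) (lm J) e2.
  have [d2 d20 h2] := ip_limit bS (hm I) (L2_raise i J) e2.
  have d0 : 0 < Num.min d1 d2 by rewrite lt_min d10.
  have [T [bT skT _] hT] := hS _ d0.
  have le_d d : Num.min d1 d2 <= d -> op_dist_le lambda S T d.
    by move=> h f hf; apply: le_trans (hT f hf) _; rewrite ler_wpM2r ?sqrtr_ge0.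
  rewrite -[_ + _]subr0 -(skT i I J) opprD addrACA; apply: le_trans (cnD _ _) _.
  rewrite (splitr e) lerD//; [apply: h1|apply: h2] => //; apply: le_d.
    by rewrite ge_min lexx.
  by rewrite ge_min lexx orbT.
apply: cn_small => e e0.
have [d d0 h] := ip_limit bS (hm I) (lm J) e0.
have [T [bT _ evT] hT] := hS _ d0.
by have := h T bT hT; rewrite evT// subr0.
Qed.

Let transfer (F : fieldType) (x y u c v : F) : x != 0 ->
  - (y * (u * c * v)) = x * (-1 * u * (c * (y / x)) * v).
Proof. by move=> x0; field. Qed.

(** Let A be M minus its transpose. By induction on the total degree the deletion terms cancel,
    which leaves (lambda + |I|) A(iI, J) = - (lambda + |J|) A(I, iJ). Letters can thus be moved from
    the left index to the right one, each at the price of a sign and a positive factor. *)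
Lemma skew_symmetric (M : word -> word -> C) :
  (forall I I' J, perm_eq I I' -> M I J = M I' J) ->
  (forall I J J', perm_eq J J' -> M I J = M I J') ->
  (forall i I J, \sum_(K <- dell i I) M K J - (lambda%:C + (size I)%:R) * M (i :: I) J +
    (\sum_(K <- dell i J) M I K - (lambda%:C + (size J)%:R) * M I (i :: J)) = 0) ->
  (forall I J, odd (size I + size J) -> M I J = 0) -> forall I J, M I J = M J I.
Proof.
move=> pl pr rel par I J; apply/eqP; rewrite -subr_eq0; apply/eqP.
pose A I J := M I J - M J I; rewrite -/(A I J).
have Asym I1 J1 : A I1 J1 = - A J1 I1 by rewrite /A opprB.
have Apr I1 J1 J1' : perm_eq J1 J1' -> A I1 J1 = A I1 J1' by move=> h; rewrite /A (pr _ _ _ h) (pl _ _ _ h).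
have [N] := ubnP (size I + size J); elim: N I J => // N IH I J IJ.
have l0 k : 0 < lambda + k%:R :> R by rewrite ltr_pwDl//; exact: le_lt_trans lam_gt.
have step i I1 J1 : (size I1 + size J1 < N)%N ->
    (lambda + (size I1)%:R)%:C * A (i :: I1) J1 = - ((lambda + (size J1)%:R)%:C * A I1 (i :: J1)).
  move=> h; have := congr2 (fun x y => x - y) (rel i I1 J1) (rel i J1 I1).
  have s1 : \sum_(K <- dell i I1) M K J1 = \sum_(K <- dell i I1) M J1 K.
    rewrite big_seq [RHS]big_seq; apply: eq_bigr => K /size_dell hK; apply/eqP.
    by rewrite -subr_eq0; apply/eqP/IH; lia.
  have s2 : \sum_(K <- dell i J1) M I1 K = \sum_(K <- dell i J1) M K I1.
    rewrite big_seq [RHS]big_seq; apply: eq_bigr => K /size_dell hK; apply/eqP.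
    by rewrite -subr_eq0; apply/eqP/IH; lia.
  rewrite s1 s2 !natC /A subrr => E; apply/eqP; rewrite -subr_eq0 opprK -oppr_eq0; apply/eqP.
  by rewrite -[RHS]E; ring.
have claim I1 J1 : (size I1 + size J1 <= N)%N -> exists2 c : R, 0 < c &
    A I1 J1 = (-1) ^+ size I1 * c%:C * A [::] (I1 ++ J1).
  elim: I1 J1 => [|i I1 IHI] J1 h; first by exists 1 => //; rewrite expr0 !mul1r.
  have [|c c0 hc] := IHI (i :: J1); first by rewrite /= addnS.
  exists (c * ((lambda + (size J1)%:R) / (lambda + (size I1)%:R))).
    by rewrite mulr_gt0// divr_gt0.
  have q0 : (lambda + (size I1)%:R)%:C != 0 :> C by rewrite -cn_eq0 cn_real normr_eq0 gt_eqF.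
  apply: (mulfI q0); rewrite step// hc.
  rewrite (Apr [::] (I1 ++ i :: J1) ((i :: I1) ++ J1)); last by rewrite perm_catC /= perm_cons perm_catC.
  by rewrite !rmorphM fmorphV /= exprS; exact: transfer.
have [od|od] := boolP (odd (size I + size J)).
  by rewrite /A par// par ?subrr// addnC.
have [c c0 ->] := claim I J IJ.
(* The total degree is even here, so moving all the letters of [I ++ J] gives a positive factor,
   while A is antisymmetric: the entry is minus a positive multiple of itself. *)
suff -> : A [::] (I ++ J) = 0 by rewrite mulr0.
have [|d d0] := claim (I ++ J) [::]; first by rewrite size_cat addn0.
rewrite cats0 Asym => /eqP; rewrite -signr_odd size_cat (negbTE od) expr0 mul1r.
rewrite -subr_eq0 -opprD oppr_eq0 -[X in X + _]mul1r -mulrDl mulf_eq0 => /orP[|/eqP//].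
by rewrite -[1]/(1%:C) -rmorphD -cn_eq0 cn_real normr_eq0 gt_eqF ?addr_gt0.
Qed.

Lemma good_symmetric S I J : good S -> ip (S (em I)) (mono J) = ip (S (em J)) (mono I).
Proof.
move=> gS; have [S' [bS' adj skS' evS']] := good_adjoint gS; have [bS skS evS] := gS.
have hm K := bergman_mono lam_gt K; have lm K := L2_mono lam_gt K.
have [S1' _ _] := bS'; have [S1 _ _] := bS.
have E K L : ip (S (em K)) (mono L) = ip (mono K) (S' (em L)).
  by rewrite -ip_onballr adj// ip_onball.
apply: (@skew_symmetric (fun I J => ip (S (em I)) (mono J))) => //.
- by move=> K K' L /(@mono_perm R) ->.
- by move=> K L L' /(@mono_perm R) ->.
move=> i K L; apply: etrans (skS i K L); rewrite (ip_raise lam_gt _ _ (A2_L2 (S1 _ (hm K)))).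
congr (_ + _).
have hr := bergman_raise i K; have lS := A2_L2 (S1' _ (hm L)).
have -> : ip (S (onball (raise lambda i K))) (mono L) = ip (raise lambda i K) (S' (em L)).
  by rewrite -ip_onballr adj// ip_onball.
rewrite (ipJ' (L2_raise i K) lS).
have cB (x y : C) : cj (x - y) = cj x - cj y by rewrite rmorphB.
rewrite (ip_raise lam_gt _ _ lS) cB conjM natC conj_real rmorph_sum.
rewrite -ipJ// E; congr (_ - _); apply: eq_bigr => K' _.
by rewrite E; exact: (ipJ lS (lm K')).
Qed.

Lemma eq_operator S T : bounded S -> bounded T ->
  (forall I J, ip (S (em I)) (mono J) = ip (T (em I)) (mono J)) ->
  forall f, bergman f -> S f = T f.
Proof.
move=> bS bT ST f hf; have [S1 _ _] := bS; have [T1 _ _] := bT.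
have [S' [S1' _ _] adS] := adjoint_exists lam_gt bS.
have [T' [T1' _ _] adT] := adjoint_exists lam_gt bT.
have hm K := bergman_mono lam_gt K.
apply: (eq_bergman lam_gt (S1 _ hf) (T1 _ hf)) => J.
rewrite -(ip_onballr (S f)) -(ip_onballr (T f)) adS// adT//; congr (Defs.ip _ _ _).
apply: (eq_bergman lam_gt (S1' _ (hm J)) (T1' _ (hm J))) => I.
have lS := A2_L2 (S1' _ (hm J)); have lT := A2_L2 (T1' _ (hm J)); have lI := A2_L2 (hm I).
rewrite -ip_onballr -[RHS]ip_onballr (ipJ' lS lI) (ipJ' lT lI) -adS// -adT//.
by rewrite !ip_onballr ST.
Qed.

(** The sum over words in Parseval's identity plays the role of the matrix product; comparing the
    truncated sums of both sides avoids any rearrangement of series. *)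
Lemma good_commute S T : good S -> good T -> forall f, bergman f -> S (T f) = T (S f).
Proof.
move=> gS gT; have gST := good_comp gS gT; have gTS := good_comp gT gS.
have [bST _ _] := gST; have [bTS _ _] := gTS.
apply: (eq_operator bST bTS) => I J.
have hm K := bergman_mono lam_gt K.
have E S1 T1 K L (e : R) : good S1 -> good T1 -> 0 < e -> exists N0, forall N, (N0 <= N)%N ->
    cn (\sum_(0 <= k < N) (ck lambda k)%:C *
      sumw k (fun W => ip (T1 (em K)) (mono W) * ip (S1 (em W)) (mono L)) -
      ip (S1 (T1 (em K))) (mono L)) <= e.
  move=> gS1 gT1 e0; have [S' [[bS' _ _] adj _ _]] := good_adjoint gS1; have [[bT _ _] _ _] := gT1.
  have lS := A2_L2 (bS' _ (hm L)).
  have [N0 H] := parseval lam_gt (bT _ (hm K)) lS e0; exists N0 => N /H.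
  have -> : ip (S1 (T1 (em K))) (mono L) = ip (T1 (em K)) (S' (em L)).
    by rewrite -(ip_onballr (S1 _)) adj//; exact: bT.
  rewrite (eq_bigr (fun k => (ck lambda k)%:C *
      sumw k (fun W => ip (T1 (em K)) (mono W) * ip (S1 (em W)) (mono L))))//.
  move=> k _; rewrite (eq_sumw (G := fun W => ip (T1 (em K)) (mono W) * ip (S1 (em W)) (mono L)))// => W _.
  have lW := A2_L2 (hm W); have -> : ip (S1 (em W)) (mono L) = ip (em W) (S' (em L)).
    by rewrite -(ip_onballr (S1 _)) adj.
  by rewrite -(ip_onballr (S' _) (mono W)) (ipJ' lW lS).
rewrite (good_symmetric I J gST).
apply/eqP; rewrite -subr_eq0; apply/eqP; apply: cn_small => e e0; have e2 : 0 < e / 2 by rewrite divr_gt0.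
have [N1 H1] := E S T J I _ gS gT e2; have [N2' H2] := E T S I J _ gT gS e2.
have {}H1 := H1 _ (leq_maxl N1 N2'); have {}H2 := H2 _ (leq_maxr N1 N2').
rewrite (splitr e); set X := \sum_(_ <= _ < _) _ in H1; set Y := \sum_(_ <= _ < _) _ in H2.
have XY : X = Y.
  apply: eq_bigr => k _; congr (_ * _); apply: eq_sumw => W _.
  by rewrite mulrC; congr (_ * _); exact: good_symmetric.
rewrite XY in H1; apply: le_trans (cn_dist _ Y _) _; rewrite lerD//.
by rewrite -cnN opprB.
Qed.

End Commutativity.

(** * The algebra generated by the Toeplitz operators *)

Section ToeplitzAlgebra.
Context (R : realType) (m : nat).
Local Open Scope complex_scope.
Local Notation n := m.+1.
Local Notation C := R[i].
Local Notation V := 'cV[C]_n.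
Local Notation word := (seq 'I_n).
Variable lambda : R.
Hypothesis lam_gt : n%:R < lambda.
Local Notation ip := (@ip R n lambda).
Local Notation N2 := (@N2 R m lambda).
Local Notation CI := (@CI R m lambda).
Local Notation bergman := (@bergman_space R n lambda).
Local Notation bounded := (@bounded R m lambda).
Local Notation toep := (@toeplitz R n lambda).
Local Notation good := (@good R m lambda).
Implicit Types (f g h phi : V -> C) (I J K : word) (i : 'I_n) (S T : operator R n).

Lemma boost_in_ball i s (z : V) : sqnorm z < 1 -> sqnorm (boost i s z) < 1.
Proof.
move=> z1; have d0 := boost_den_neq0 i s z1.
rewrite -subr_gt0 sqnorm_boost// divr_gt0 ?subr_gt0//.
by rewrite lt_neqAle eq_sym csq_eq0 d0 csq_ge0.
Qed.

Lemma toeplitz_good phi : Linfty phi -> (forall i, boost_invariant i phi) ->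
  ae_ball (fun z => phi (- z) = phi z) -> good (toep phi).
Proof.
move=> lphi bphi ephi; have [M hM] := Linfty_bounded lphi; have [M0 mphi _] := hM.
have gc := gmeas_clip M mphi; have cM z := cn_clip phi z M0.
have bc i : boost_invariant i (clip M phi).
  move=> s s0; apply: ae_imply (bphi i s s0) => t H b; apply: clip_eq => //; last exact: H.
  exact: boost_in_ball.
have ec : ae_ball (fun z => clip M phi (- z) = clip M phi z).
  apply: ae_imply ephi => t H b; apply: clip_eq => //; last exact: H.
  by rewrite -scaleN1r sqnormZ csqN csq1 mul1r.
have E f g : bergman (onball f) -> bergman (onball g) ->
    ip (toep phi (onball f)) g = ip (fun z => clip M phi z * f z) g.
  move=> hf hg; have [_ H] := toeplitzP lam_gt hM hf.
  by rewrite -ip_onballr H//; apply: eq_ip => z z1; rewrite !onballE.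
have hm I := bergman_mono lam_gt I; have hr i I := bergman_raise lam_gt i I.
have lm I : L2B lambda (mono I) by exact: L2_mono.
have lr i I : L2B lambda (raise lambda i I) by exact: L2_raise.
split; first exact: toeplitz_bounded.
  move=> i I J; rewrite !E// !ipE -mulrDr -CID; first last.
  - by apply: CInt_mulJ => //; exact: L2_clip.
  - by apply: CInt_mulJ => //; exact: L2_clip.
  have := CI_skew lam_gt I J gc cM (bc i).
  rewrite (_ : CI _ = CI (fun z => clip M phi z * raise lambda i I z * cj (mono J z) +
     clip M phi z * mono I z * cj (raise lambda i J z))); first by move=> ->; rewrite mulr0.
  by apply: eq_CI => z _; ring.
move=> I J IJ; rewrite E// ipE.
have := CI_parity lam_gt gc cM ec IJ.
rewrite (_ : CI _ = CI (fun z => clip M phi z * mono I z * cj (mono J z))); first by move=> ->; rewrite mulr0.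
by apply: eq_CI => z _; rewrite mulrA.
Qed.

Variable X : set (V -> C).
Hypothesis X_Linfty : X `<=` @Linfty R n.
Local Notation TA := (toeplitz_algebra lambda X).

Lemma toeplitz_algebra_gen phi : X phi -> TA (toep phi).
Proof. by move=> Xphi A [_]; apply; exists phi. Qed.

Lemma toeplitz_algebra_min A : closed_subalgebra lambda A -> (forall phi, X phi -> A (toep phi)) -> TA `<=` A.
Proof. by move=> cA XA S; apply; split=> // _ [phi Xphi <-]; exact: XA. Qed.

Lemma toeplitz_algebra_bounded : TA `<=` bounded.
Proof.
apply: toeplitz_algebra_min; first exact: closed_bounded.
by move=> phi /X_Linfty; exact: toeplitz_bounded.
Qed.

Lemma toeplitz_algebra_closed : closed_subalgebra lambda TA.
Proof.
split; first exact: toeplitz_algebra_bounded.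
- by move=> A [[_ A0 _ _ _] _].
- by move=> a S T hS hT A hA; have [[_ _ A1 _ _] _] := hA; apply: A1; [exact: hS|exact: hT].
- by move=> S T hS hT A hA; have [[_ _ _ A1 _] _] := hA; apply: A1; [exact: hS|exact: hT].
move=> S bS hS A hA; have [[_ _ _ _ A1] _] := hA; apply: A1 => // e /hS[T hT ST].
by exists T => //; exact: hT.
Qed.

(** The elements of the algebra that have an adjoint in it form a closed subalgebra containing the
    generators. *)
Lemma toeplitz_algebra_adjoint : (forall phi, X phi -> X (fun z => cj (phi z))) ->
  adjoint_closed lambda TA.
Proof.
move=> Xconj.
pose A := [set S | TA S /\ exists2 S', TA S' &
  forall f g, bergman f -> bergman g -> ip (S f) g = ip f (S' g)].
suff : TA `<=` A by move=> TAA S /TAA[].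
have [T1 T2 T3 T4 T5] := toeplitz_algebra_closed.
apply: toeplitz_algebra_min; last first.
  move=> phi Xphi; split; first exact: toeplitz_algebra_gen.
  exists (toep (fun z => cj (phi z))); first exact: toeplitz_algebra_gen (Xconj _ Xphi).
  by move=> f g hf hg; have [] := toeplitz_adjoint lam_gt (X_Linfty Xphi) hf hg.
split.
- by move=> S [/T1].
- split=> //; exists (fun _ _ => 0) => // f g hf hg.
  by rewrite ip0l// (ipJ' (A2_L2 hf) (L2_0 lam_gt)) ip0l// rmorph0.
- move=> a S T [hS [S' hS' SS]] [hT [T' hT' TT]]; split; first exact: T3.
  exists (fun f z => cj a * S' f z + T' f z); first exact: T3.
  have [[S1 _ _] [U1 _ _] [S1' _ _] [U1' _ _]] := And4 (T1 _ hS) (T1 _ hT) (T1 _ hS') (T1 _ hT').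
  move=> f g hf hg.
  rewrite (ip_linl a (A2_L2 (S1 _ hf)) (A2_L2 (U1 _ hf)) (A2_L2 hg)).
  rewrite (ip_linr _ (A2_L2 (S1' _ hg)) (A2_L2 (U1' _ hg)) (A2_L2 hf)).
  by rewrite conjCK SS// TT.
- move=> S T [hS [S' hS' SS]] [hT [T' hT' TT]]; split; first exact: T4.
  exists (fun f => T' (S' f)); first exact: T4.
  have [U1 _ _] := T1 _ hT; have [S1' _ _] := T1 _ hS'.
  by move=> f g hf hg; rewrite SS ?TT//; [exact: S1'|exact: U1].
move=> S bS hS; split; first by apply: T5 => // e /hS[T [hT _] ST]; exists T.
have [S' bS' adj] := adjoint_exists lam_gt bS; exists S' => //.
apply: T5 => // e e0; have [T [hT [T' hT' TT]] ST] := hS e e0; exists T' => // g hg.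
have [[S1 _ _] [U1 _ _]] := conj bS (T1 _ hT).
have [[S1' _ _] [U1' _ _]] := conj bS' (T1 _ hT').
(* Adjoints are no farther apart than the operators: <k, k> = <(S - T) k, g>, and Cauchy-Schwarz
   lets the norm of k be divided out. *)
pose k z := S' g z - T' g z; have hk : bergman k := bergmanB (S1' _ hg) (U1' _ hg).
have lk := A2_L2 hk; have lg := A2_L2 hg.
have kE : ip k k = ip (fun z => S k z - T k z) g.
  rewrite (ipBl (A2_L2 (S1 _ hk)) (A2_L2 (U1 _ hk)) lg) adj// TT//.
  rewrite (ipJ' lk (A2_L2 (S1' _ hg))) (ipJ' lk (A2_L2 (U1' _ hg))).
  rewrite -[RHS](rmorphB cj) -ipBl//; [|exact/A2_L2/S1'|exact/A2_L2/U1'].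
  exact: (ipJ lk lk).
rewrite -/k !L2normE//.
have -> : e * Num.sqrt (N2 g) = Num.sqrt (e ^+ 2 * N2 g).
  have e2 := sqr_ge0 e; have h0 := N2_ge0 lam_gt g.
  apply/eqP; rewrite -(@eqrXn2 _ 2) ?mulr_ge0 ?sqrtr_ge0 ?(ltW e0)//.
  by rewrite exprMn (sqr_sqrtr h0) (sqr_sqrtr (mulr_ge0 e2 h0)).
have eg0 : 0 <= e ^+ 2 * N2 g by apply: mulr_ge0; [exact: sqr_ge0|exact: N2_ge0].
rewrite ler_sqrt//; apply: N2_dual => //.
rewrite kE; have ld := A2_L2 (bergmanB (S1 _ hk) (U1 _ hk)).
apply: le_trans (cauchy_schwarz lam_gt ld lg) _.
have := ST k hk; rewrite !L2normE// => h1.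
have h2 : Num.sqrt (N2 (fun z => S k z - T k z)) ^+ 2 <= (e * Num.sqrt (N2 k)) ^+ 2.
  by rewrite ler_sqr ?nnegrE ?sqrtr_ge0//; apply: le_trans h1; rewrite sqrtr_ge0.
move: h2; rewrite exprMn !sqr_sqrtr ?N2_ge0// => /(ler_wpM2r (N2_ge0 lam_gt g)); lra.
Qed.

Lemma toeplitz_algebra_commutative :
  (forall phi, X phi -> forall i, boost_invariant i phi) ->
  (forall phi, X phi -> ae_ball (fun z => phi (- z) = phi z)) -> commutative_algebra lambda TA.
Proof.
move=> Xboost Xneg S T hS hT f hf.
have TAgood : TA `<=` good.
  apply: toeplitz_algebra_min; first exact: closed_good.
  by move=> phi Xphi; apply: toeplitz_good; [exact: X_Linfty|exact: Xboost|exact: Xneg].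
exact: (good_commute lam_gt (TAgood _ hS) (TAgood _ hT) hf).
Qed.

End ToeplitzAlgebra.

(** * From almost everywhere to everywhere, by continuity *)

Section AlmostEverywhere.
Context (R : realType) (m : nat).
Local Open Scope complex_scope.
Local Notation n := m.+1.
Local Notation C := R[i].
Local Notation V := 'cV[C]_n.
Implicit Types (F G : V -> C) (z : V).

(** A small box around z0 inside the ball has positive volume, so it meets the set where P holds. *)
Lemma ae_ball_near (P : V -> Prop) (z0 : V) (e : R) : ae_ball P -> sqnorm z0 < 1 -> 0 < e ->
  exists z, [/\ sqnorm z < 1, sqnorm (z - z0) < e & P z].
Proof.
move=> aeP z01 e0; apply: contrapT => noz.
have [rho1 [r [r1 r0 _ near]]] := sqnorm_near z01.
pose d : R := Num.min (e / 2) (r ^+ 2).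
have d0 : 0 < d by rewrite lt_min divr_gt0//= exprn_gt0.
(* In a square of half-side s each squared modulus is at most 2 s^2 = d / n, and the n coordinates
   add up to d. *)
pose s : R := Num.sqrt (d / (2 * n%:R)).
have s0 : 0 < s by rewrite sqrtr_gt0 divr_gt0// mulr_gt0// ltr0n.
have s2 : s ^+ 2 = d / (2 * n%:R) by rewrite sqr_sqrtr// divr_ge0 ?(ltW d0)// mulr_ge0.
have near_box z : 0 < box s z0 z -> sqnorm z < 1 /\ sqnorm (z - z0) < e.
  move=> /box_subset hb; have h : sqnorm (z - z0) <= d.
    rewrite sqnormE; apply: le_trans (_ : \sum_(i < n) d / n%:R <= _).
      apply: ler_sum => i _; rewrite -csqN !mxE opprB; apply: le_trans (cbox_csq (hb i)) _.
      have E (x y : R) : y != 0 -> x / (2 * y) *+ 2 = x / y by move=> y0; field.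
      by rewrite s2 E// pnatr_eq0.
    by rewrite sumr_const card_ord -[X in X <= _]mulr_natr divfK// pnatr_eq0.
  have dr : d <= r ^+ 2 by rewrite ge_min lexx orbT.
  have de : d <= e / 2 by rewrite ge_min lexx.
  split; last by apply: le_lt_trans h _; lra.
  have rC : r%:C != 0 :> C by rewrite -cn_eq0 cn_real normr_eq0 gt_eqF.
  rewrite -[z](subrK z0) addrC -[z - z0](scalerK rC) scalerA mulrC -scalerA.
  apply: le_lt_trans r1; apply: near; first by rewrite cn_real gtr0_norm.
  rewrite sqnormZ -fmorphV csq_real exprVn mulrC ler_pdivrMr ?exprn_gt0// mul1r.
  exact: le_trans h dr.
have : IV (fun v => (box s z0 v)%:E) = 0%E.
  rewrite /IV; rewrite (@ae_eq_integral _ _ _ _ _ (cst 0%E)) ?integral0//.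
    exact: mV_box.
  apply: ae_imply aeP => t h _ /=; have [->//|[b1 _]] := box_val s z0 (cvec t).
  have [|z1 ze] := near_box (cvec t); first by rewrite b1.
  by case: noz; exists (cvec t); split=> //; exact: h.
rewrite IV_box ?(ltW s0)// => -[] /eqP; rewrite !expf_eq0 mulrn_eq0 /= gt_eqF//.
Qed.

Definition vcont F z0 := forall e : R, 0 < e -> exists2 d : R, 0 < d &
  forall z, sqnorm (z - z0) < d -> cn (F z - F z0) <= e.

Lemma vcont_cst (k : C) z0 : vcont (fun=> k) z0.
Proof. by move=> e e0; exists 1 => // z _; rewrite subrr cn0 ltW. Qed.

Lemma vcont_coord i z0 : vcont (fun z => z i ord0) z0.
Proof.
move=> e e0; exists (e ^+ 2); first exact: exprn_gt0.
move=> z /ltW h; rewrite -csq_cn ?(ltW e0)//; apply: le_trans h.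
by have := coord_le (z - z0) i; rewrite !mxE.
Qed.

Lemma vcontD F G z0 : vcont F z0 -> vcont G z0 -> vcont (fun z => F z + G z) z0.
Proof.
move=> hF hG e e0; have e2 : 0 < e / 2 by rewrite divr_gt0.
have [d d0 h] := hF _ e2; have [d' d'0 h'] := hG _ e2.
exists (Num.min d d'); first by rewrite lt_min d0.
move=> z; rewrite lt_min => /andP[/h a /h' b].
by rewrite opprD addrACA; apply: le_trans (cnD _ _) _; rewrite (splitr e) lerD.
Qed.

Lemma vcontM F G z0 : vcont F z0 -> vcont G z0 -> vcont (fun z => F z * G z) z0.
Proof.
move=> hF hG e e0; pose K := 1 + cn (F z0) + cn (G z0).
have f0 := cn_ge0 (F z0); have g0 := cn_ge0 (G z0).
have K0 : 0 < K by rewrite /K; lra.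
pose q := Num.min 1 (e / (2 * K)); have q0 : 0 < q by rewrite lt_min ltr01 divr_gt0// mulr_gt0.
have [d d0 h] := hF _ q0; have [d' d'0 h'] := hG _ q0.
exists (Num.min d d'); first by rewrite lt_min d0.
move=> z; rewrite lt_min => /andP[/h a /h' b].
rewrite (_ : _ - _ = (F z - F z0) * (G z - G z0) + ((F z - F z0) * G z0 + F z0 * (G z - G z0))); last by ring.
apply: le_trans (cnD _ _) _; rewrite cnM; have := cnD ((F z - F z0) * G z0) (F z0 * (G z - G z0)).
rewrite !cnM => H; have q1 : q <= 1 by rewrite ge_min lexx.
have qK : q * K <= e / 2.
  have : q <= e / (2 * K) by rewrite ge_min lexx orbT.
  by rewrite ler_pdivlMr ?mulr_gt0// => H2; rewrite ler_pdivlMr//; lra.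
have x0 := cn_ge0 (F z - F z0); have y0 := cn_ge0 (G z - G z0).
have h1 : cn (F z - F z0) * cn (G z - G z0) <= q by nra.
have h2 : cn (F z - F z0) * cn (G z0) <= q * cn (G z0) by rewrite ler_wpM2r.
have h3 : cn (F z0) * cn (G z - G z0) <= q * cn (F z0) by rewrite mulrC ler_wpM2r.
by move: qK; rewrite /K; lra.
Qed.

Lemma vcontJ F z0 : vcont F z0 -> vcont (fun z => cj (F z)) z0.
Proof.
move=> hF e /hF[d d0 h]; exists d => // z /h.
by rewrite -rmorphB cnJ.
Qed.

Lemma vcont_sum (T : Type) (s : seq T) (F : T -> V -> C) z0 : (forall x, vcont (F x) z0) ->
  vcont (fun z => \sum_(x <- s) F x z) z0.
Proof.
move=> hF; elim: s => [|x s IH].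
  by under [X in vcont X]eq_fun do rewrite big_nil; exact: vcont_cst.
by under [X in vcont X]eq_fun do rewrite big_cons; apply: vcontD.
Qed.

Lemma ae_eq0 F : (forall z, vcont F z) -> ae_ball (fun z => F z = 0) ->
  forall z, sqnorm z < 1 -> F z = 0.
Proof.
move=> cF aeF z z1; apply: cn_small => e e0; have [d d0 h] := cF z e e0.
have [w [w1 wz w0]] := ae_ball_near aeF z1 d0.
by have := h w wz; rewrite w0 sub0r cnN.
Qed.

End AlmostEverywhere.

(** * The projective action in homogeneous coordinates *)

Section BallAction.
Context (R : realType) (m : nat).
Local Open Scope complex_scope.
Local Notation n := m.+1.
Local Notation C := R[i].
Local Notation V := 'cV[C]_n.
Local Notation M := 'M[C]_(n + 1).
Local Notation J := (form_n1 R n).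
Implicit Types (g h Q : M) (z : V).

Definition adj p q (A : 'M[C]_(p, q)) : 'M[C]_(q, p) := (map_mx conjc A)^T.

Lemma adjM p q r (A : 'M[C]_(p, q)) (B : 'M[C]_(q, r)) : adj (A *m B) = adj B *m adj A.
Proof. by rewrite /adj map_mxM trmx_mul. Qed.

Lemma adj_entry p q (A : 'M[C]_(p, q)) i j : adj A i j = cj (A j i).
Proof. by rewrite !mxE. Qed.

Lemma adjZ p q (c : C) (A : 'M[C]_(p, q)) : adj (c *: A) = cj c *: adj A.
Proof. by apply/matrixP => i j; rewrite adj_entry mxE [RHS]mxE adj_entry conjM. Qed.

Lemma adj1 p : adj (1%:M : 'M[C]_p) = 1%:M.
Proof. by apply/matrixP => i j; rewrite adj_entry !mxE eq_sym rmorph_nat. Qed.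

(** Homogeneous coordinates, in which the action is linear up to the factor [act_den]; see
    [lift_act]. *)
Definition lift z : 'cV[C]_(n + 1) := col_mx z 1%:M.

Definition qf Q (u : 'cV[C]_(n + 1)) : C := (adj u *m Q *m u) ord0 ord0.

Definition act_den g z : C := (dlsubmx g *m z + drsubmx g) ord0 ord0.

Lemma qfZ Q (c : C) u : qf Q (c *: u) = (csq c)%:C * qf Q u.
Proof. by rewrite /qf adjZ -scalemxAr -!scalemxAl !mxE csqE; ring. Qed.

Lemma qf_mul Q g u : qf Q (g *m u) = qf (adj g *m Q *m g) u.
Proof. by rewrite /qf adjM !mulmxA. Qed.

Lemma mul_lift g z : g *m lift z =
  col_mx (ulsubmx g *m z + ursubmx g) (dlsubmx g *m z + drsubmx g).
Proof. by rewrite -{1}[g]submxK mul_block_col !mulmx1. Qed.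

Lemma qfJ (a : V) (b : 'cV[C]_1) : qf J (col_mx a b) = (sqnorm a - csq (b ord0 ord0))%:C.
Proof.
rewrite /qf /adj map_col_mx tr_col_mx /form_n1 mul_row_block !mulmx0 addr0 add0r mulmx1.
rewrite mul_row_col mul_mx_scalar scaleN1r mulNmx -hdot_mx -hdot_mx mxE [X in _ + X]mxE.
rewrite [X in X + _]mxE [X in _ - X]mxE !eqxx !mulr1n !hdot_sq rmorphB; congr (_ - _%:C).
by rewrite sqnormE big_ord1.
Qed.

Definition preserves g := adj g *m J *m g = J.

Section Preserves.
Variables (g : M) (z : V).
Hypotheses (hg : preserves g) (z1 : sqnorm z < 1).

Lemma qfJ_mul : qf J (g *m lift z) = (sqnorm z - 1)%:C.
Proof. by rewrite qf_mul hg qfJ mxE eqxx mulr1n csq1. Qed.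

(** The indefinite form takes the value |z|^2 - 1 < 0 at g (z, 1); with a vanishing last coordinate
    it would be nonnegative. *)
Lemma act_den_neq0 : act_den g z != 0.
Proof.
apply/eqP => d0; have := qfJ_mul; rewrite mul_lift qfJ -/(act_den g z) d0 csq0 subr0.
by move=> /complexI h; have := sqnorm_ge0 (ulsubmx g *m z + ursubmx g); rewrite h subr_ge0 leNgt z1.
Qed.

Lemma lift_act : g *m lift z = act_den g z *: lift (ball_act g z).
Proof.
rewrite mul_lift /lift scale_col_mx /ball_act scalerA divff ?act_den_neq0// scale1r.
congr col_mx; rewrite /act_den; apply/matrixP => i j; rewrite !ord1 [RHS]mxE [X in _ * X]mxE.
by rewrite mulr1.
Qed.

Lemma act_ball : sqnorm (ball_act g z) < 1.
Proof.
have := qfJ_mul; rewrite lift_act qfZ qfJ mxE eqxx mulr1n csq1 -rmorphM => /complexI h.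
have d0 : 0 < csq (act_den g z) by rewrite lt_neqAle eq_sym csq_eq0 act_den_neq0 csq_ge0.
by rewrite -subr_lt0 -(pmulr_rlt0 _ d0) h subr_lt0.
Qed.

End Preserves.

Lemma ball_actZ (c : C) g z : c != 0 -> ball_act (c *: g) z = ball_act g z.
Proof.
move=> c0; rewrite /ball_act.
rewrite (_ : ulsubmx _ = c *: ulsubmx g); last by apply/matrixP => i j; rewrite !mxE.
rewrite (_ : ursubmx _ = c *: ursubmx g); last by apply/matrixP => i j; rewrite !mxE.
rewrite (_ : dlsubmx _ = c *: dlsubmx g); last by apply/matrixP => i j; rewrite !mxE.
rewrite (_ : drsubmx _ = c *: drsubmx g); last by apply/matrixP => i j; rewrite !mxE.
rewrite -!scalemxAl -!scalerDr scalerA [X in X^-1]mxE.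
by rewrite invfM mulrAC mulVf// mul1r.
Qed.

Definition real_mx p q (A : 'M[C]_(p, q)) := forall i j, cj (A i j) = A i j.

(** Says that g is real up to a common scalar without naming the scalar: a closed condition, which
    can be checked entrywise on products and inverses. *)
Definition projectively_real g :=
  forall i j k l, cj (g i j * cj (g k l)) = g i j * cj (g k l).

Definition SOn1 : set M := [set g | SU_n1 g /\ projectively_real g].

Lemma adj_real p q (A : 'M[C]_(p, q)) : real_mx A -> adj A = A^T.
Proof. by move=> rA; apply/matrixP => i j; rewrite adj_entry rA mxE. Qed.

(** Used with d the determinant of a real isometry of the form: a phase corrects it to 1, so that
    also the isometries of determinant -1 act through [SOn1]. *)
Lemma sign_root (N : nat) (d : C) : d ^+ 2 = 1 -> exists2 c : C, csq c = 1 & c ^+ N.+1 * d = 1.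
Proof.
move=> /eqP; rewrite sqrf_eq1 => /orP[/eqP->|/eqP->].
  by exists 1; rewrite ?csq1// expr1n mulr1.
exists (cis (pi / N.+1%:R)); first exact: csq_cis.
have cisX k (x : R) : cis x ^+ k = cis (k%:R * x).
  by elim: k => [|k IH]; [rewrite mul0r cis0|rewrite exprS IH -cisD -natr1 mulrDl mul1r addrC].
rewrite cisX (mulrC N.+1%:R) divfK ?pnatr_eq0// /cis cospi sinpi.
by apply/eqP; rewrite eq_complex /=; apply/andP; split; apply/eqP; ring.
Qed.

Lemma SOn1_scaled (A : M) : real_mx A -> preserves A -> exists2 c : C, csq c = 1 & SOn1 (c *: A).
Proof.
move=> rA pA; have dJ : \det J != 0.
  by rewrite /form_n1 det_ublock !det_scalar expr1n mul1r expf_neq0// oppr_eq0 oner_eq0.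
have dA : \det A ^+ 2 = 1.
  have := congr1 (fun X => \det X) pA; rewrite /preserves adj_real// !det_mulmx det_tr.
  move=> h; apply: (mulfI dJ); rewrite mulr1 -[RHS]h; ring.
have [c c1 cN] := sign_root (n + 1).-1 dA; exists c => //.
have cc : cj c * c = 1 by rewrite mulrC -csqE c1.
split; last first.
  move=> i j k l; rewrite !mxE !conjM !rA conjCK.
  by rewrite mulrACA cc [RHS]mulrACA [c * _]mulrC cc.
split; last by rewrite detZ -[X in c ^+ X](_ : (n + 1).-1.+1 = _)// addn1.
rewrite -/(adj _) adjZ -!scalemxAl -scalemxAr scalerA cc scale1r; exact: pA.
Qed.

Lemma SOn1_preserves g : SOn1 g -> preserves g.
Proof. by move=> [[]]. Qed.

End BallAction.

(** * The group of projectively real isometries *)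

Section LorentzGroup.
Context (R : realType) (m : nat).
Local Open Scope complex_scope.
Local Notation n := m.+1.
Local Notation C := R[i].
Local Notation V := 'cV[C]_n.
Local Notation M := 'M[C]_(n + 1).
Local Notation J := (form_n1 R n).
Local Notation SOn1 := (@SOn1 R m).
Implicit Types (g h Q : M) (z u : V) (c s : R).

(** Matrix of the boost along a real unit vector u, with hyperbolic cosine c and sine s; it fixes
    the orthogonal complement of u in the first n coordinates. *)
Definition bmx u c s : M := block_mx (1%:M + (c%:C - 1) *: (u *m u^T)) (s%:C *: u)
  (s%:C *: u^T) (c%:C)%:M.

Lemma real_bmx u c s : real_mx u -> real_mx (bmx u c s).
Proof.
move=> ru; have rE p (k : R) (i j : 'I_p) : cj (k%:C%:M i j : C) = k%:C%:M i j.
  by rewrite mxE; case: eqP => _; rewrite ?mulr1n ?mulr0n ?conj_real ?rmorph0.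
have c1 : c%:C - 1 = (c - 1)%:C :> C by rewrite rmorphB.
move=> i j; case: (split_ordP i) => i' ->; case: (split_ordP j) => j' ->.
- rewrite /bmx block_mxEul mxE conjD (rE _ 1); congr (_ + _).
  by rewrite !mxE big_ord1 !mxE c1 !conjM conj_real !ru.
- by rewrite /bmx block_mxEur mxE conjM conj_real ru.
- by rewrite /bmx block_mxEdl !mxE conjM conj_real ru.
- by rewrite /bmx block_mxEdr rE.
Qed.

Lemma bmx_tr u c s : (bmx u c s)^T = bmx u c s.
Proof.
rewrite /bmx tr_block_mx !linearD !linearZ /= trmx_mul trmxK !tr_scalar_mx.
by [].
Qed.

Lemma preserves_bmx u c s : real_mx u -> u^T *m u = 1%:M -> c ^+ 2 = 1 + s ^+ 2 ->
  preserves (bmx u c s).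
Proof.
move=> ru u1 cs; rewrite /preserves adj_real; last exact: real_bmx.
rewrite bmx_tr /bmx /form_n1 !mulmx_block !mulmx0 !mulmx1 !addr0 !add0r.
have csC : (c%:C : C) * c%:C = 1 + s%:C * s%:C.
  by rewrite -!rmorphM -(rmorph1 (real_complex R)) -rmorphD -!expr2 cs.
set E := u *m u^T; have EE : E *m E = E by rewrite /E mulmxA -(mulmxA u) u1 mulmx1.
have Eu : E *m u = u by rewrite /E -mulmxA u1 mulmx1.
have uE : u^T *m E = u^T by rewrite /E mulmxA u1 mul1mx.
congr block_mx.
- rewrite !mul_mx_scalar scaleN1r mulNmx -scalemxAl -scalemxAr -/E.
  rewrite mulmxDl !mulmxDr !mul1mx mulmx1 -!scalemxAl -!scalemxAr EE !scalerA.
  move: E {EE Eu uE} => E; apply/matrixP => i j; rewrite !mxE; ring: csC.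
- rewrite !mul_mx_scalar scaleN1r mulmxDl mul1mx -!scalemxAl -!scalemxAr Eu !scalerA.
  by apply/matrixP => i j; rewrite !mxE; ring.
- rewrite !mul_mx_scalar scaleN1r mulmxDr mulmx1 -!scalemxAr -!scalemxAl uE mulNmx mul_scalar_mx !scalerA.
  by apply/matrixP => i j; rewrite !mxE; ring.
rewrite -!scalemxAl -!scalemxAr u1 -!scalar_mxM.
apply/matrixP => i j; rewrite !ord1 !mxE /= !mulr1n; ring: csC.
Qed.

Lemma SOn1_act (A : M) z : real_mx A -> preserves A -> exists2 g, SOn1 g & forall z, ball_act g z = ball_act A z.
Proof.
move=> rA pA; have [c c1 hc] := SOn1_scaled rA pA; exists (c *: A) => // w.
by apply: ball_actZ; rewrite -csq_eq0 c1 oner_eq0.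
Qed.

Lemma bmx_boost i s z : ball_act (bmx (delta_mx i 0) (Num.sqrt (1 + s ^+ 2)) s) z = boost i s z.
Proof.
set c := Num.sqrt _; rewrite /ball_act /bmx block_mxKul block_mxKur block_mxKdl block_mxKdr.
have eE : (delta_mx i 0)^T *m z = (z i ord0)%:M :> 'M[C]_1.
  by rewrite trmx_delta -rowE; apply/matrixP => a b; rewrite !ord1 !mxE.
have -> : (s%:C *: (delta_mx i 0)^T *m z + c%:C%:M) ord0 ord0 = boost_den i s z :> C.
  by rewrite -scalemxAl eE !mxE eqxx !mulr1n addrC.
rewrite /boost -/c -/(boost_den i s z); congr (_ *: _); apply/matrixP => j k; rewrite (ord1 k).
rewrite mulmxDl mul1mx -scalemxAl -mulmxA eE mul_mx_scalar !mxE eqxx andbT.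
by case: eqP => [->|_]; rewrite ?mulr1 ?mulr0 ?addr0//; ring.
Qed.

Lemma formK : J *m J = 1%:M.
Proof.
rewrite /form_n1 mulmx_block !mulmx0 !mul0mx !addr0 !add0r mulmx1 -scalar_mxM mulrNN mulr1.
by rewrite -scalar_mx_block.
Qed.

(** - J is -1 on the first n coordinates and 1 on the last, so it acts on the ball as z -> - z. *)
Lemma preservesN : real_mx (- J) /\ preserves (- J).
Proof.
have rJ : real_mx (- J).
  move=> i j; rewrite /form_n1 mxE rmorphN; congr (- _).
  case: (split_ordP i) => i' ->; case: (split_ordP j) => j' ->.
  - by rewrite block_mxEul mxE rmorph_nat.
  - by rewrite block_mxEur mxE rmorph0.
  - by rewrite block_mxEdl mxE rmorph0.
  - by rewrite block_mxEdr mxE rmorphMn rmorphN rmorph1.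
split=> //; rewrite /preserves adj_real//.
have -> : (- J)^T = - J by rewrite linearN /= /form_n1 tr_block_mx !trmx0 !tr_scalar_mx.
by rewrite mulmxN !mulNmx opprK formK mul1mx.
Qed.

Lemma act_neg z : ball_act (- J) z = - z.
Proof.
rewrite /form_n1 opp_block_mx /ball_act block_mxKul block_mxKur block_mxKdl block_mxKdr.
rewrite !oppr0 mul0mx addr0 add0r mulNmx mul1mx mxE mxE eqxx mulr1n opprK invr1 scale1r.
by [].
Qed.

Lemma invariant_boost phi i : invariant_symbols SOn1 phi -> boost_invariant i phi.
Proof.
move=> [_ hphi] s s0; pose u : V := delta_mx i 0.
have ru : real_mx u by move=> a b; rewrite mxE rmorph_nat.
have u1 : u^T *m u = 1%:M.
  by rewrite trmx_delta mul_delta_mx; apply/matrixP => a b; rewrite !ord1 !mxE.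
have cs : Num.sqrt (1 + s ^+ 2) ^+ 2 = 1 + s ^+ 2 by rewrite sqr_sqrtr// addr_ge0// sqr_ge0.
have [g hg gE] := SOn1_act 0 (real_bmx _ _ ru) (preserves_bmx ru u1 cs).
by apply: ae_imply (hphi g hg) => t H b; rewrite -bmx_boost -gE; exact: H.
Qed.

Lemma invariant_neg phi : invariant_symbols SOn1 phi -> ae_ball (fun z => phi (- z) = phi z).
Proof.
move=> [_ hphi]; have [rJ pJ] := preservesN; have [g hg gE] := SOn1_act 0 rJ pJ.
by apply: ae_imply (hphi g hg) => t H b; rewrite -act_neg -gE; exact: H.
Qed.

Lemma Linfty_conj (phi : V -> C) : Linfty phi -> Linfty (fun z => cj (phi z)).
Proof.
move=> [m1 [B hB]]; split; first exact: cmeasJ m1.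
by exists B; apply: ae_imply hB => t h b; rewrite cnE cnJ -cnE; exact: h.
Qed.

Lemma invariant_conj phi : invariant_symbols SOn1 phi -> invariant_symbols SOn1 (fun z => cj (phi z)).
Proof.
move=> [lphi hphi]; split; first exact: Linfty_conj.
by move=> h /hphi; apply: ae_imply => t H b; rewrite H.
Qed.

Lemma preserves_inv g : preserves g -> g *m (J *m adj g *m J) = 1%:M /\ g \in unitmx.
Proof.
move=> pg; have h : (J *m adj g *m J) *m g = 1%:M by rewrite -!mulmxA (mulmxA (adj g)) pg formK.
by have [_ gu] := mulmx1_unit h; split=> //; exact: mulmx1C.
Qed.

Lemma preserves_invmx g : preserves g -> invmx g = J *m adj g *m J.
Proof.
move=> pg; have [h gu] := preserves_inv pg.
by have := congr1 (mulmx (invmx g)) h; rewrite (mulKmx gu) mulmx1.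
Qed.

Lemma preservesM g h : preserves g -> preserves h -> preserves (g *m h).
Proof. by move=> pg ph; rewrite /preserves adjM -!mulmxA (mulmxA J) (mulmxA (adj g)) [adj g *m _]mulmxA pg mulmxA. Qed.

Lemma real_sum (I : finType) (F : I -> C) : (forall i, cj (F i) = F i) ->
  cj (\sum_i F i) = \sum_i F i.
Proof. by move=> h; rewrite rmorph_sum; apply: eq_bigr => i _; exact: h. Qed.

Definition sgn_n1 (i : 'I_(n + 1)) : R := if fintype.split i is inl _ then 1 else -1.

Lemma formE i j : J i j = (sgn_n1 i)%:C *+ (i == j).
Proof.
rewrite /form_n1 /sgn_n1; case: (split_ordP i) => i' ->; case: (split_ordP j) => j' ->.
- by rewrite block_mxEul mxE (inj_eq (@lshift_inj _ _)).
- by rewrite block_mxEur mxE eq_lrshift.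
- by rewrite block_mxEdl mxE eq_rlshift.
by rewrite block_mxEdr mxE (inj_eq (@rshift_inj _ _)) rmorphN rmorph1.
Qed.

Lemma form_mulE (A : M) i j : (J *m A *m J) i j = (sgn_n1 i * sgn_n1 j)%:C * A i j.
Proof.
rewrite mxE (bigD1 j)//= big1 ?addr0; last by move=> k kj; rewrite formE (negbTE kj) mulr0.
rewrite mxE (bigD1 i)//= big1 ?addr0; last by move=> k ki; rewrite formE eq_sym (negbTE ki) mul0r.
by rewrite !formE !eqxx !mulr1n rmorphM; ring.
Qed.

(** For a product, each g_ij conj(g_kl) expands into a sum of products of two such real numbers. The
    inverse J g^H J, with g^H the conjugate transpose, has the entries of g up to sign, conjugation
    and transposition. *)
Lemma SOn1_subgroup : is_subgroup SOn1.
Proof.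
split.
- by move=> g [].
- split; first by split; rewrite ?det1// -/(adj _) adj1 mul1mx mulmx1.
  by move=> i j k l; rewrite !mxE !rmorph_nat conjM !rmorph_nat.
- move=> g h [[pg dg] rg] [[ph dh] rh]; split.
    by split; [exact: preservesM|rewrite det_mulmx dg dh mulr1].
  move=> i j k l; rewrite !mxE rmorph_sum mulr_suml; apply: real_sum => a.
  rewrite mulr_sumr; apply: real_sum => b /=.
  rewrite (_ : _ * _ = g i a * cj (g k b) * (h a j * cj (h b l))).
    by rewrite conjM rg rh.
  by rewrite conjM; ring.
move=> g [[pg dg] rg]; have iE := preserves_invmx pg; have [gi gu] := preserves_inv pg.
have uniti : invmx g *m g = 1%:M by exact: mulVmx.
split.
  split; last by rewrite det_inv dg invr1.
  have E : adj (invmx g) *m (adj g *m J *m g) *m invmx g = J.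
    by rewrite !mulmxA -adjM mulmxV// adj1 mul1mx -mulmxA mulmxV// mulmx1.
  by move: E; rewrite pg.
move=> i j k l; rewrite iE !form_mulE !adj_entry.
rewrite !conjM !conj_real !conjCK; have := rg l k j i; rewrite conjM conjCK => e.
rewrite mulrACA [RHS]mulrACA; congr (_ * _).
by rewrite [RHS]mulrC -e mulrC.
Qed.

End LorentzGroup.

(** * The group is closed and not Abelian *)

Section LorentzTopology.
Context (R : realType) (m : nat).
Local Open Scope complex_scope.
Local Notation n := m.+1.
Local Notation C := R[i].
Local Notation V := 'cV[C]_n.
Local Notation M := 'M[C]_(n + 1).
Local Notation J := (form_n1 R n).
Local Notation SOn1 := (@SOn1 R m).
Implicit Types (g h Q : M) (z u : V) (c s : R).

Lemma delta_real (i : 'I_n) : real_mx (delta_mx i 0 : V) /\ (delta_mx i 0 : V)^T *m delta_mx i 0 = 1%:M.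
Proof.
split; first by move=> a b; rewrite mxE rmorph_nat.
by rewrite trmx_delta mul_delta_mx; apply/matrixP => a b; rewrite !ord1 !mxE.
Qed.

Lemma SOn1_boost (i : 'I_n) s : exists2 a : C, csq a = 1 &
  SOn1 (a *: bmx (delta_mx i 0) (Num.sqrt (1 + s ^+ 2)) s).
Proof.
have [ru u1] := delta_real i.
have cs : Num.sqrt (1 + s ^+ 2) ^+ 2 = 1 + s ^+ 2 by rewrite sqr_sqrtr// addr_ge0// sqr_ge0.
exact: (SOn1_scaled (real_bmx _ _ ru) (preserves_bmx ru u1 cs)).
Qed.

Lemma scaled_comm (a b : C) (A B : M) : a != 0 -> b != 0 ->
  (a *: A) *m (b *: B) = (b *: B) *m (a *: A) -> A *m B = B *m A.
Proof.
move=> a0 b0; rewrite -!scalemxAl -!scalemxAr !scalerA (mulrC b).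
by move=> /(scalerI (mulf_neq0 a0 b0)).
Qed.

(** Conjugation by J reverses the off-diagonal blocks of a boost, and these are nonzero for s = 1;
    phases do not affect commutation. *)
Lemma SOn1_nonabelian : ~ is_abelian SOn1.
Proof.
move=> ab; have [a a1 ha] := SOn1_boost ord0 1.
have [rJ pJ] := preservesN R m; have [b b1 hb] := SOn1_scaled rJ pJ.
have nz (x : C) : csq x = 1 -> x != 0 by move=> h; rewrite -csq_eq0 h oner_eq0.
have := scaled_comm (nz _ a1) (nz _ b1) (ab _ _ ha hb); set A := bmx _ _ _.
rewrite mulmxN mulNmx => /oppr_inj h.
have : (J *m A *m J) (lshift 1 ord0) (rshift n ord0) = A (lshift 1 ord0) (rshift n ord0).
  by rewrite -h -mulmxA formK mulmx1.
rewrite form_mulE /sgn_n1 -[lshift _ _]/(unsplit (inl _)) -[rshift _ _]/(unsplit (inr _)) !unsplitK /=.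
rewrite /A /bmx block_mxEur !mxE !eqxx mulr1 => /eqP.
rewrite mul1r rmorphN rmorph1 mulN1r -subr_eq0 -opprD oppr_eq0 -mulr2n pnatr_eq0 //.
Qed.

Lemma conj_continuous : continuous (fun x : C => cj x).
Proof.
move=> x; apply/(@cvgrPdist_le C C C (nbhs x) (nbhs_filter x)) => e e0.
have := iffLR (@cvgrPdist_le C C C (nbhs x) (nbhs_filter x) id x) (@cvg_id _ _) e e0.
by apply: (@filterS _ _ (nbhs_filter x)) => y; rewrite -rmorphB norm_conjC.
Qed.

Lemma entry_continuous i j : continuous (fun g => g i j : C).
Proof. exact: coord_continuous. Qed.

Lemma continuous_sum (T : topologicalType) (I : Type) (r : seq I) (F : I -> T -> C) :
  (forall i, continuous (F i)) -> continuous (fun x => \sum_(i <- r) F i x).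
Proof.
move=> hF; elim: r => [|i r IH] x.
  by under [X in continuous_at _ X]eq_fun do rewrite big_nil; exact: cvg_cst.
by under [X in continuous_at _ X]eq_fun do rewrite big_cons; exact: (cvgD (hF i x) (IH x)).
Qed.

Lemma continuous_prod (T : topologicalType) (I : Type) (r : seq I) (F : I -> T -> C) :
  (forall i, continuous (F i)) -> continuous (fun x => \prod_(i <- r) F i x).
Proof.
move=> hF; elim: r => [|i r IH] x.
  by under [X in continuous_at _ X]eq_fun do rewrite big_nil; exact: cvg_cst.
by under [X in continuous_at _ X]eq_fun do rewrite big_cons; exact: (cvgM (hF i x) (IH x)).
Qed.

Lemma closed_eq (F G : M -> C) : continuous F -> continuous G -> closed [set g | F g = G g].
Proof.
move=> cF cG; rewrite (_ : [set g | _] = (fun g => F g - G g) @^-1` [set 0]).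
  apply: closed_comp; first by move=> x _; exact: (cvgB (cF x) (cG x)).
  exact/accessible_closed_set1/hausdorff_accessible/norm_hausdorff.
by apply/seteqP; split=> g /= /eqP; rewrite ?subr_eq0 => h; apply/eqP; rewrite ?subr_eq0.
Qed.

Lemma continuousMx (F G : M -> C) : continuous F -> continuous G -> continuous (fun g => F g * G g).
Proof. by move=> cF cG x; exact: (cvgM (cF x) (cG x)). Qed.

Lemma continuousJ (F : M -> C) : continuous F -> continuous (fun g => cj (F g)).
Proof. by move=> cF x; apply: continuous_comp; [exact: cF|exact: conj_continuous]. Qed.

(** The group is cut out by equations between continuous functions of the entries. The index type
    lists those for the form, the determinant and projective reality. *)
Lemma SOn1_closed : closed SOn1.
Proof.
pose idx : Type := ('I_(n + 1) * 'I_(n + 1) + unit + 'I_(n + 1) * 'I_(n + 1) * 'I_(n + 1) * 'I_(n + 1))%type.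
pose F (a : idx) : M -> C := match a with
  | inl (inl (i, j)) => fun g => \sum_k (\sum_l cj (g l i) * J l k) * g k j
  | inl (inr _) => fun g => \det g
  | inr (i, j, k, l) => fun g => cj (g i j * cj (g k l)) end.
pose G (a : idx) : M -> C := match a with
  | inl (inl (i, j)) => fun=> J i j
  | inl (inr _) => fun=> 1
  | inr (i, j, k, l) => fun g => g i j * cj (g k l) end.
have -> : SOn1 = \bigcap_(a in setT) [set g | F a g = G a g].
  apply/seteqP; split=> g.
    move=> [[pg dg] rg] [[[i j]|[]]|[[[i j] k] l]] _; [|exact: dg|exact: (rg i j k l)].
    rewrite /F /G /= -[in RHS]pg [RHS]mxE; apply: eq_bigr => k _; rewrite mxE; congr (_ * _).
    by apply: eq_bigr => l _; rewrite !mxE.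
  move=> h; split; last by move=> i j k l; exact: (h (inr (i, j, k, l)) I).
  split; last exact: (h (inl (inr tt)) I).
  apply/matrixP => i j; rewrite -[RHS](h (inl (inl (i, j))) I) /= mxE.
  apply: eq_bigr => k _; rewrite mxE; congr (_ * _).
  by apply: eq_bigr => l _; rewrite !mxE.
apply: closed_bigI => a _; apply: closed_eq.
  case: a => [[[i j]|[]]|[[[i j] k] l]] /=.
  - apply: continuous_sum => k; apply: continuousMx; last exact: entry_continuous.
    by apply: continuous_sum => l; apply: continuousMx; [apply: continuousJ|exact: cst_continuous]; exact: entry_continuous.
  - apply: continuous_sum => p; apply: continuousMx; first exact: cst_continuous.
    apply: continuous_prod => i; exact: entry_continuous.
  - by apply: continuousJ; apply: continuousMx; [|apply: continuousJ]; exact: entry_continuous.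
case: a => [[[i j]|[]]|[[[i j] k] l]] /=; try exact: cst_continuous.
by apply: continuousMx; [|apply: continuousJ]; exact: entry_continuous.
Qed.

End LorentzTopology.

Lemma ae_imply2 d (T : measurableType d) (R : realType) (mu : {measure set T -> \bar R})
    (P Q S : T -> Prop) : (forall t, P t -> Q t -> S t) ->
  {ae mu, forall t, P t} -> {ae mu, forall t, Q t} -> {ae mu, forall t, S t}.
Proof. by move=> PQS; apply: filterS2. Qed.

(** * Comparison with the symbols of Abelian groups *)

Section InvariantSymbols.
Context (R : realType) (m : nat).
Local Open Scope complex_scope.
Local Notation n := m.+1.
Local Notation C := R[i].
Local Notation V := 'cV[C]_n.
Local Notation M := 'M[C]_(n + 1).
Local Notation J := (form_n1 R n).
Local Notation SOn1 := (@SOn1 R m).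
Implicit Types (g h Q : M) (z u : V) (c s : R).

Lemma qf_sum Q (u : 'cV[C]_(n + 1)) : qf Q u = \sum_k (\sum_l cj (u l ord0) * Q l k) * u k ord0.
Proof.
rewrite /qf mxE; apply: eq_bigr => k _; rewrite mxE; congr (_ * _).
by apply: eq_bigr => l _; rewrite adj_entry.
Qed.

Lemma lift_coord k : (exists i : 'I_n, forall z, lift z k ord0 = z i ord0) \/ (forall z, lift z k ord0 = 1).
Proof.
case: (split_ordP k) => i ->; [left; exists i|right] => z; rewrite /lift ?col_mxEu ?col_mxEd//.
by rewrite mxE (ord1 i).
Qed.

Lemma vcont_lift k z0 : vcont (fun z => lift z k ord0) z0.
Proof.
have [[i E]|E] := lift_coord k.
  by rewrite (_ : (fun z => _) = fun z => z i ord0); [exact: vcont_coord|exact/funext].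
by rewrite (_ : (fun z => _) = fun=> 1); [exact: vcont_cst|exact/funext].
Qed.

Lemma vcont_qf Q z0 : vcont (fun z => qf Q (lift z)) z0.
Proof.
rewrite (_ : (fun z => _) = fun z => \sum_k (\sum_l cj (lift z l ord0) * Q l k) * lift z k ord0); last first.
  by apply/funext => z; exact: qf_sum.
apply: vcont_sum => k; apply: vcontM; last exact: vcont_lift.
apply: vcont_sum => l; apply: vcontM; last exact: vcont_cst.
by apply: vcontJ; exact: vcont_lift.
Qed.

Lemma gmeas_lift k : gmeas (fun z => lift z k ord0).
Proof.
have [[i E]|E] := lift_coord k.
  by rewrite (_ : (fun z => _) = fun z => z i ord0); [exact: cmeas_cvec|exact/funext].
by rewrite (_ : (fun z => _) = fun=> 1); [exact: cmeas_cst|exact/funext].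
Qed.

Lemma gmeas_qf Q : gmeas (fun z => qf Q (lift z)).
Proof.
rewrite (_ : (fun z => _) = fun z => \sum_k (\sum_l cj (lift z l ord0) * Q l k) * lift z k ord0); last first.
  by apply/funext => z; exact: qf_sum.
apply: cmeas_sum => k; apply: cmeasM; last exact: gmeas_lift.
apply: cmeas_sum => l; apply: cmeasM; last exact: cmeas_cst.
by apply: cmeasJ; exact: gmeas_lift.
Qed.

Lemma qf_lift Q z : qf Q (lift z) = (adj z *m ulsubmx Q *m z) ord0 ord0 +
  (adj z *m ursubmx Q) ord0 ord0 + (dlsubmx Q *m z) ord0 ord0 + drsubmx Q ord0 ord0.
Proof.
rewrite /qf /lift /adj map_col_mx tr_col_mx -{1}[Q]submxK mul_row_block mul_row_col !mulmx1.
rewrite map_mx1 trmx1 !mul1mx mulmxDl mxE mxE [X in _ + X]mxE -!addrA; congr (_ + _).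
by rewrite addrCA.
Qed.

Let iC : C := 0 +i* 1.

Let csq_iC : csq iC = 1. Proof. by rewrite /csq /= expr0n expr1n add0r. Qed.

Let iC_neq0 : iC != 0. Proof. by rewrite -csq_eq0 csq_iC oner_eq0. Qed.

Let conj_iC : cj iC = - iC.
Proof. by apply/eqP; rewrite eq_complex /= oppr0 !eqxx. Qed.

Let frac_cancel (x y a : C) : a != 0 -> x / y = a * x / (a * y).
Proof. by move=> a0; rewrite -mulf_div divff// mul1r. Qed.

(** On a line t v the form splits into parts in |t|^2, conj(t), t and 1, which the values t = 0, r,
    - r, i r separate; r = 1 / (1 + |v|^2) keeps the points in the ball. The quadratic block is then
    killed by polarization. *)
Lemma qf_eq0 Q : (forall z, sqnorm z < 1 -> qf Q (lift z) = 0) -> Q = 0.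
Proof.
move=> h.
pose al (v : V) := (adj v *m ulsubmx Q *m v) ord0 ord0.
pose be (v : V) := (adj v *m ursubmx Q) ord0 ord0.
pose ga (v : V) := (dlsubmx Q *m v) ord0 ord0.
have hT (t : C) (v : V) : csq t * sqnorm v < 1 ->
    (csq t)%:C * al v + cj t * be v + t * ga v + drsubmx Q ord0 ord0 = 0.
  move=> tv; rewrite -(h (t *: v)) ?sqnormZ// qf_lift adjZ -!scalemxAr -!scalemxAl /al /be /ga.
  rewrite [X in _ = X + _ + _ + _]mxE [X in _ = _ * X + _ + _ + _]mxE.
  by rewrite [X in _ = _ + X + _ + _]mxE [X in _ = _ + _ + X + _]mxE csqE; ring.
have d0 : drsubmx Q ord0 ord0 = 0.
  by have := hT 0 0; rewrite csq0 !mul0r rmorph0 !mul0r !add0r; apply.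
have key (v : V) : [/\ al v = 0, be v = 0 & ga v = 0].
  pose r : R := (1 + sqnorm v)^-1; have v0 := sqnorm_ge0 v.
  have r0 : 0 < r by rewrite invr_gt0; lra.
  have rv : r ^+ 2 * sqnorm v < 1.
    rewrite /r exprVn mulrC ltr_pdivrMr ?exprn_gt0//; [nra|lra].
  have rC : r%:C != 0 :> C by rewrite -cn_eq0 cn_real normr_eq0 gt_eqF.
  have e1 := hT r%:C v; have e2 := hT (- r%:C) v; have e3 := hT (iC * r%:C) v.
  rewrite !csqN !csqM !csq_real in e1 e2 e3.
  rewrite csq_iC mul1r in e3; have {}e1 := e1 rv; have {}e2 := e2 rv; have {}e3 := e3 rv.
  rewrite d0 !addr0 conjN !conjM !conj_real in e1 e2 e3.
  rewrite conj_iC in e3; rewrite rmorphXn /= in e1 e2 e3.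
  have two : (2 : C) != 0 by rewrite pnatr_eq0.
  have a0 : al v = 0.
    apply: (mulfI (mulf_neq0 two (mulf_neq0 rC rC))); rewrite mulr0 -[RHS]addr0 -{1}e1 -e2; ring.
  move: e1 e3; rewrite a0 mulr0 add0r => e1 e3.
  have b0 : be v = 0.
    apply: (mulfI (mulf_neq0 two (mulf_neq0 iC_neq0 rC))); rewrite mulr0.
    transitivity (iC * (r%:C * be v + r%:C * ga v) - (0 + - iC * r%:C * be v + iC * r%:C * ga v)); first by ring.
    by rewrite e1 e3 mulr0 subr0.
  by split=> //; apply: (mulfI rC); rewrite mulr0 -e1 b0; ring.
have E (i : 'I_n) p (X : 'M[C]_(n, p)) k : (adj (delta_mx i 0 : V) *m X) ord0 k = X i k.
  rewrite mxE (bigD1 i)//= big1 ?addr0; last by move=> j ji; rewrite adj_entry mxE (negbTE ji) rmorph0 mul0r.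
  by rewrite adj_entry mxE !eqxx rmorph1 mul1r.
have E' (i : 'I_n) p (X : 'M[C]_(p, n)) k : (X *m (delta_mx i 0 : V)) k ord0 = X k i.
  rewrite mxE (bigD1 i)//= big1 ?addr0; last by move=> j ji; rewrite mxE (negbTE ji) mulr0.
  by rewrite mxE !eqxx mulr1.
have adjD (x y : V) : adj (x + y) = adj x + adj y.
  by apply/matrixP => i j; rewrite adj_entry mxE conjD [RHS]mxE !adj_entry.
rewrite -[Q]submxK; have -> : ulsubmx Q = 0.
  set a := ulsubmx Q; apply/matrixP => i j; rewrite [RHS]mxE.
  have al_e (t : C) : a i i + t * a i j + cj t * a j i + (csq t)%:C * a j j = 0.
    have [] := key (delta_mx i 0 + t *: delta_mx j 0); rewrite /al -/a => <- _ _.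
    rewrite adjD adjZ !mulmxDl !mulmxDr -!scalemxAl -!scalemxAr.
    have mD (A B : 'M[C]_1) : (A + B) ord0 ord0 = A ord0 ord0 + B ord0 ord0 by rewrite mxE.
    have mZ (k : C) (A : 'M[C]_1) : (k *: A) ord0 ord0 = k * A ord0 ord0 by rewrite mxE.
    by rewrite !mD !mZ !E' !E csqE; ring.
  have ai k : a k k = 0.
    by have [] := key (delta_mx k 0); rewrite /al -/a E' E.
  have e1 := al_e 1; have e2 := al_e iC.
  rewrite !ai csq1 rmorph1 !mulr0 !add0r !addr0 !mul1r in e1.
  rewrite !ai conj_iC mulr0 add0r addr0 in e2.
  have two : (2 : C) != 0 by rewrite pnatr_eq0.
  apply: (mulfI (mulf_neq0 two iC_neq0)); rewrite mulr0.
  transitivity (iC * (a i j + a j i) + (iC * a i j + - iC * a j i)); first by ring.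
  by rewrite e1 e2 mulr0 addr0.
have -> : ursubmx Q = 0.
  apply/matrixP => i j; rewrite (ord1 j) [RHS]mxE.
  by have [_ ] := key (delta_mx i 0); rewrite /be E.
have -> : dlsubmx Q = 0.
  apply/matrixP => i j; rewrite (ord1 i) [RHS]mxE.
  by have [_ _] := key (delta_mx j 0); rewrite /ga E'.
have -> : drsubmx Q = 0 by apply/matrixP => i j; rewrite !ord1 d0 mxE.
by rewrite block_mx0.
Qed.

(** Commuting with - J makes g block diagonal; commuting with the boost along the j-th axis makes
    the j-th column of the upper block d times a basis vector, with d the lower entry. *)
Lemma commutes_SOn1_scalar g : (forall h, SOn1 h -> g *m h = h *m g) -> exists d, g = d%:M.
Proof.
move=> gh.
have nz (x : C) : csq x = 1 -> x != 0 by move=> h; rewrite -csq_eq0 h oner_eq0.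
have gh' (A : M) (a : C) : csq a = 1 -> SOn1 (a *: A) -> g *m A = A *m g.
  move=> /nz a0 /gh; rewrite -scalemxAr -scalemxAl; exact: scalerI.
have [rJ pJ] := preservesN R m; have [b b1 hb] := SOn1_scaled rJ pJ.
have := gh' _ _ b1 hb; rewrite mulmxN mulNmx => /oppr_inj gJ.
have gJE i j : (sgn_n1 R i * sgn_n1 R j)%:C * g i j = g i j.
  by rewrite -form_mulE -gJ -mulmxA formK mulmx1.
have sl (i : 'I_n) : sgn_n1 R (lshift 1 i) = 1 by rewrite /sgn_n1 -[lshift _ _]/(unsplit (inl _)) unsplitK.
have sr (i : 'I_1) : sgn_n1 R (rshift n i) = -1 by rewrite /sgn_n1 -[rshift _ _]/(unsplit (inr _)) unsplitK.
have g12 : ursubmx g = 0.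
  apply/matrixP => i j; have := gJE (lshift 1 i) (rshift n j); rewrite sl sr mul1r rmorphN rmorph1 mulN1r.
  by rewrite !mxE => /esym /eq_opp0.
have g21 : dlsubmx g = 0.
  apply/matrixP => i j; have := gJE (rshift n i) (lshift 1 j); rewrite sl sr mulr1 rmorphN rmorph1 mulN1r.
  by rewrite !mxE => /esym /eq_opp0.
pose d : C := drsubmx g ord0 ord0; exists d.
have gE : g = block_mx (ulsubmx g) 0 0 d%:M.
  rewrite -{1}[g]submxK g12 g21; congr block_mx.
  by apply/matrixP => i j; rewrite !ord1 [RHS]mxE eqxx mulr1n.
rewrite gE (_ : ulsubmx g = d%:M) -?scalar_mx_block//.
apply/matrixP => i j; have [a a1 ha] := SOn1_boost j (1 : R); have := gh' _ _ a1 ha.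
rewrite {1 2}gE /bmx !mulmx_block => /(congr1 (fun X => ursubmx X i ord0)).
rewrite !block_mxKur !mul0mx !mulmx0 addr0 add0r rmorph1 !scale1r => e.
move: e; rewrite mul_mx_scalar mxE (bigD1 j)//= big1 ?addr0; last first.
  by move=> k kj; rewrite [X in _ * X]mxE (negbTE kj) mulr0.
rewrite [X in _ * X]mxE !eqxx mulr1 => ->; rewrite !mxE eqxx andbT.
by case: eqP => _; rewrite ?mulr1 ?mulr0.
Qed.

Lemma symbols_neq (H' : set M) : is_subgroup H' -> is_abelian H' ->
  invariant_symbols SOn1 <> invariant_symbols H'.
Proof.
move=> [HSU _ _ _] Hab HH.
have pH h : H' h -> preserves h by move=> /HSU[].
have scalar g : H' g -> exists d, g = d%:M.
  move=> Hg; apply: commutes_SOn1_scalar => h hh.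
  pose F z := qf (J *m g) (lift z) / qf J (lift z).
  have den z : qf J (lift z) = (sqnorm z - 1)%:C by rewrite qfJ mxE eqxx mulr1n csq1.
  have den0 z : sqnorm z < 1 -> qf J (lift z) != 0.
    by move=> z1; rewrite den -cn_eq0 cn_real normr_eq0 subr_eq0 lt_eqF.
  have FE k z : preserves k -> sqnorm z < 1 ->
      F (ball_act k z) = qf (adj k *m (J *m g) *m k) (lift z) / qf J (lift z).
    move=> pk z1; have H Q : qf (adj k *m Q *m k) (lift z) =
        (csq (act_den k z))%:C * qf Q (lift (ball_act k z)).
      by rewrite -qf_mul lift_act// qfZ.
    have w0 : (csq (act_den k z))%:C != 0 :> C.
      by rewrite -cn_eq0 cn_real normr_eq0 csq_eq0 act_den_neq0.
    have -> : qf J (lift z) = (csq (act_den k z))%:C * qf J (lift (ball_act k z)) by rewrite -H pk.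
    by rewrite H /F; exact: frac_cancel.
  (* F may be unbounded near the sphere, so it is not a symbol. The functions 1/q and F/q are
     bounded, inherit the invariance of F, and their quotient recovers F. *)
  pose q z := 1 + F z * cj (F z).
  have qE z : q z = (1 + csq (F z))%:C by rewrite /q -csqE -[X in X + _ = _]/((1 : R)%:C) -rmorphD.
  have q1 z : 1 <= 1 + csq (F z) by rewrite lerDl csq_ge0.
  have mF : gmeas F by apply: cmeasM; [exact: gmeas_qf|apply: cmeasV; exact: gmeas_qf].
  have mq : gmeas (fun z => (q z)^-1).
    apply: cmeasV; apply: cmeasD; first exact: cmeas_cst.
    by apply: cmeasM => //; exact: cmeasJ.
  have inv G : gmeas G -> (forall z, csq (G z) <= 1) -> (forall z w, F z = F w -> G z = G w) ->
      invariant_symbols H' G.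
    move=> mG bG FG; split.
      split; first by have := gmeas_bcmeas mG.
      exists 1; apply: aeW => t _; rewrite cnE -csq_cn// expr1n; exact: bG.
    move=> k Hk; apply: aeW => t t1; apply: FG; rewrite (FE _ _ (pH _ Hk) t1).
    by rewrite -!mulmxA (Hab _ _ Hg Hk) !mulmxA (pH _ Hk).
  have qinv z : csq (q z)^-1 <= 1.
    rewrite csqV qE csq_real invf_le1 ?exprn_gt0//; last exact: lt_le_trans (q1 z).
    by rewrite expr_ge1// (le_trans ler01).
  have i2 : invariant_symbols H' (fun z => (q z)^-1).
    by apply: (inv _ mq qinv) => z w zw; rewrite /q zw.
  have i1 : invariant_symbols H' (fun z => F z / q z).
    apply: inv; first exact: cmeasM.
      move=> z; rewrite csqM csqV qE csq_real ler_pdivrMr ?mul1r ?exprn_gt0//; last exact: lt_le_trans (q1 z).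
      by have := csq_ge0 (F z); nra.
    by move=> z w zw; rewrite /q zw.
  rewrite -HH in i1 i2; have [_ /(_ h hh) ae1] := i1; have [_ /(_ h hh) ae2] := i2.
  have ph := SOn1_preserves hh.
  have aeF : ae_ball (fun z => qf (adj h *m (J *m g) *m h - J *m g) (lift z) = 0).
    apply: ae_imply2 ae1 ae2 => t e1 e2 t1; have {}e1 := e1 t1; have {}e2 := e2 t1.
    have q0 z : q z != 0.
      rewrite qE -cn_eq0 cn_real normr_eq0 gt_eqF//; exact: lt_le_trans (q1 z).
    have FF : F (ball_act h (cvec t)) = F (cvec t).
      by rewrite e2 in e1; apply: (mulIf _ e1); rewrite invr_neq0.
    rewrite FE// /F in FF; have {}FF := mulIf (invr_neq0 (den0 _ t1)) FF.
    by rewrite /qf mulmxBr mulmxBl mxE [X in _ + X]mxE; apply/eqP; rewrite subr_eq0; apply/eqP.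
  have /qf_eq0 /eqP := ae_eq0 (vcont_qf _) aeF; rewrite subr_eq0 => /eqP E.
  have [hi hu] := preserves_inv ph.
  (* Multiplying [adj h *m (J *m g) *m h = J *m g] on the left by h J now yields g h = h g. *)
  have hJ : h *m (J *m adj h) = J by rewrite -[RHS]mul1mx -hi -!mulmxA formK mulmx1.
  have := congr1 (mulmx (h *m J)) E; rewrite -!mulmxA (mulmxA J (adj h)) (mulmxA h) hJ.
  by rewrite (mulmxA J J) formK mul1mx => ->; rewrite (mulmxA J J) formK mul1mx.
pose psi z : C := z ord0 ord0.
have ipsi : invariant_symbols H' psi.
  split.
    split; first exact: (@gmeas_bcmeas R m psi (@cmeas_cvec R n ord0)).
    exists 1; apply: aeW => t t1; rewrite cnE -csq_cn// expr1n; exact: le_trans (coord_le _ _) (ltW t1).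
  move=> h Hh; apply: aeW => t t1; have [d hd] := scalar h Hh.
  have d0 : d != 0.
    apply/eqP => d0; have [_] := HSU _ Hh; rewrite hd d0 => /eqP.
    by rewrite det_scalar expr0n addn1 eq_sym oner_eq0.
  congr psi; rewrite hd (_ : d%:M = d *: 1%:M); last by rewrite scalemx1.
  rewrite ball_actZ// /ball_act scalar_mx_block block_mxKul block_mxKur block_mxKdl block_mxKdr.
  by rewrite mul1mx addr0 mul0mx add0r mxE eqxx mulr1n invr1 scale1r.
rewrite -HH in ipsi; have aep := invariant_neg ipsi.
have : ae_ball (fun z => psi z = 0).
  by apply: ae_imply aep => t e t1; apply: eq_opp0; rewrite -[LHS](e t1) /psi mxE.
move=> /(ae_eq0 (vcont_coord ord0)) /(_ ((1 / 2 : R)%:C *: delta_mx ord0 0)).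
rewrite sqnormZ csq_real [sqnorm _](_ : _ = 1); last first.
  rewrite sqnormE (bigD1 ord0)//= big1 ?addr0; first by rewrite mxE !eqxx csq1.
  by move=> i /negbTE i0; rewrite mxE i0 csq0.
have half : (1 / 2 : R) ^+ 2 * 1 < 1 by lra.
move=> /(_ half) /eqP; rewrite /psi !mxE !eqxx mulr1 -cn_eq0 cn_real normr_eq0.
by rewrite mul1r invr_eq0 pnatr_eq0.
Qed.

End InvariantSymbols.

(** * Rules for directional derivatives *)

Section DirectionalDerivatives.
Context (R : realType) (N : nat).
Local Notation W := 'rV[R]_N.
Implicit Types (f g : W -> R) (x v : W).

(** Lets the rules of one real variable, such as the derivative of ln, act in a fixed direction. *)
Lemma derive_line f v x : 'D_v f x = 'D_1 (fun t : R => f (t *: v + x)) 0.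
Proof.
rewrite /derive /=.
suff -> : (fun h : R => h^-1 *: (f (h *: v + x) - f x)) =
  (fun h : R => h^-1 *: (f ((h *: (1 : R) + 0) *: v + x) - f (0 *: v + x))) by [].
apply/funext => h; have e : h *: (1 : R) + 0 = h by rewrite addr0; exact: mulr1.
by rewrite e scale0r add0r.
Qed.

Lemma is_derive_line f x v d :
  is_derive x v f d <-> is_derive (0 : R) 1 (fun t : R => f (t *: v + x)) d.
Proof.
split=> -[h1 h2].
  by apply: DeriveDef; [exact: (iffLR (derivable1P _ _ _))|rewrite -(derive_line f)].
by apply: DeriveDef; [exact: (iffRL (derivable1P _ _ _))|rewrite derive_line].
Qed.

Lemma is_derive_coord x v a : is_derive x v (fun y => y ord0 a) (v ord0 a).
Proof.
apply/is_derive_line; have H : is_derive (0 : R) 1 ((v ord0 a) *: (@id R) + cst (x ord0 a)) (v ord0 a *: 1 + 0).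
  exact: is_deriveD.
rewrite (_ : (fun t => _) = (v ord0 a) *: (@id R) + cst (x ord0 a)); last first.
  by apply/funext => t; rewrite !mxE mulrC.
have [h1 h2] := H; apply: DeriveDef; first exact: h1.
by rewrite h2 addr0; exact: mulr1.
Qed.

Lemma is_deriveMf f g x v df dg : is_derive x v f df -> is_derive x v g dg ->
  is_derive x v (fun y => f y * g y) (f x * dg + g x * df).
Proof. by move=> hf hg; exact: (is_deriveM hf hg). Qed.

Lemma is_deriveDf f g x v df dg : is_derive x v f df -> is_derive x v g dg ->
  is_derive x v (fun y => f y + g y) (df + dg).
Proof. by move=> hf hg; exact: (is_deriveD hf hg). Qed.

Lemma is_derive_const (k : R) x v : is_derive x v (fun=> k) 0.
Proof. exact: is_derive_cst. Qed.

Lemma is_derive_inv f x v df : f x != 0 -> is_derive x v f df ->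
  is_derive x v (fun y => (f y)^-1) (- (f x) ^- 2 * df).
Proof.
move=> f0 [h1 h2]; apply: DeriveDef; first exact: derivableV.
by rewrite deriveV// h2.
Qed.

Lemma is_derive_ln f x v df : 0 < f x -> is_derive x v f df ->
  is_derive x v (fun y => ln (f y)) ((f x)^-1 * df).
Proof.
move=> f0 /is_derive_line hf; apply/is_derive_line.
have l0 : is_derive (f (0 *: v + x)) 1 (@ln R) (f x)^-1.
  by rewrite scale0r add0r; exact: is_derive1_ln.
exact: (@is_derive1_comp R (@ln R) (fun t => f (t *: v + x)) 0 _ _ l0 hf).
Qed.

Lemma is_derive_sumf (I : Type) (s : seq I) (F : I -> W -> R) x v (dF : I -> R) :
  (forall i, is_derive x v (F i) (dF i)) ->
  is_derive x v (fun y => \sum_(i <- s) F i y) (\sum_(i <- s) dF i).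
Proof.
move=> hF; elim: s => [|i s IH].
  by rewrite big_nil; under eq_fun do rewrite big_nil; exact: is_derive_const.
by rewrite big_cons; under eq_fun do rewrite big_cons; exact: is_deriveDf.
Qed.

Lemma eq_derive f g x v : (forall y, f y = g y) -> 'D_v f x = 'D_v g x.
Proof. by move=> fg; have -> : f = g by exact/funext. Qed.

Lemma derive_eq_near f g x v : (\near x, f x = g x) -> 'D_v f x = 'D_v g x.
Proof. exact: near_eq_derive. Qed.

(** Also true without convergence, [lim] having then the default value 0. The sign rules below thus
    hold with no derivability hypothesis, which lets the symmetry of the metric be stated at every
    point. *)
Lemma lim_opp (T : Type) (F : set_system T) (q : T -> R) : ProperFilter F ->
  lim ((fun t => - q t) @ F) = - lim (q @ F).
Proof.
move=> PF; have [cq|dq] := pselect (cvg (q @ F)).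
  exact: limN.
have nq : ~ cvg ((fun t => - q t) @ F).
  move=> c; apply: dq; rewrite (_ : q = fun t => - - q t); first exact: is_cvgN.
  by apply/funext => t; rewrite opprK.
by rewrite (dvgP dq) (dvgP nq); exact/esym/oppr0.
Qed.

Lemma dnbhs0N : (-%R @ (0 : R)^') = 0^'.
Proof.
by apply/seteqP; split=> A [e /= e0 H]; exists e => //= t te t0;
  [rewrite -[t]opprK|]; apply: H => /=; rewrite ?sub0r ?normrN ?oppr_eq0//; move: te; rewrite /= sub0r normrN.
Qed.

Lemma derive_oppf f x v : 'D_v (fun y => - f y) x = - 'D_v f x.
Proof.
rewrite /derive -lim_opp /=.
suff -> : (fun h : R => h^-1 *: (- f (h *: v + x) - - f x)) =
  (fun h : R => - (h^-1 *: (f (h *: v + x) - f x))) by [].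
by apply/funext => h; rewrite -opprD scalerN.
Qed.

Lemma derive_oppdir f x v : 'D_(- v) f x = - 'D_v f x.
Proof.
rewrite /derive -lim_opp /=.
pose q (h : R) := - (h^-1 *: (f (h *: v + x) - f x)).
have -> : (fun h : R => h^-1 *: (f (h *: - v + x) - f x)) = q \o -%R.
  by apply/funext => h; rewrite /q /= invrN scaleNr opprK scalerN scaleNr.
by rewrite fmap_comp dnbhs0N.
Qed.

Lemma derive_sign (b : bool) f x v : 'D_((-1) ^+ b *: v) f x = (-1) ^+ b * 'D_v f x.
Proof. by case: b; rewrite ?scaleN1r ?derive_oppdir ?mulN1r ?scale1r ?mul1r. Qed.

Lemma derive_signf (b : bool) f x v : 'D_v (fun y => (-1) ^+ b * f y) x = (-1) ^+ b * 'D_v f x.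
Proof.
case: b; last by rewrite mul1r; congr ('D_v _ x); apply/funext => y; rewrite mul1r.
by rewrite mulN1r -derive_oppf; congr ('D_v _ x); apply/funext => y; rewrite mulN1r.
Qed.

Lemma derive_mulmx (A : 'M[R]_N) f x v : 'D_(v *m A) f (x *m A) = 'D_v (fun y => f (y *m A)) x.
Proof.
rewrite !derive_line; suff -> : (fun t : R => f (t *: (v *m A) + x *m A)) =
  (fun t : R => f ((t *: v + x) *m A)) by [].
by apply/funext => t; rewrite mulmxDl scalemxAl.
Qed.

Definition dotr x v : R := \sum_a x ord0 a * v ord0 a.
Definition sqr_norm x : R := dotr x x.

Lemma is_derive_dotr x u v : is_derive x u (fun y => dotr y v) (dotr u v).
Proof.
apply: is_derive_sumf => a; rewrite -[X in is_derive _ _ _ X]addr0.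
rewrite (_ : _ + 0 = x ord0 a * 0 + v ord0 a * u ord0 a); last by rewrite mulr0 add0r addr0 mulrC.
exact: (is_deriveMf (is_derive_coord _ _ _) (is_derive_const _ _ _)).
Qed.

Lemma is_derive_sqr_norm x u : is_derive x u sqr_norm (2 * dotr x u).
Proof.
rewrite (_ : 2 * _ = \sum_a (x ord0 a * u ord0 a + x ord0 a * u ord0 a)); last first.
  by rewrite big_split /= mulr2n mulrDl mul1r.
by apply: is_derive_sumf => a; apply: is_deriveMf; exact: is_derive_coord.
Qed.

Lemma continuous_sqr_norm : continuous sqr_norm.
Proof.
move=> x; rewrite /sqr_norm /dotr; elim: (index_enum _) => [|a s IH].
  by under eq_fun do rewrite big_nil; exact: cst_continuous.
under eq_fun do rewrite big_cons.
have ca := @coord_continuous R 1 N ord0 a x.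
exact: (cvgD (cvgM ca ca) IH).
Qed.

Lemma open_ball_sqr : open [set x | sqr_norm x < 1].
Proof.
rewrite (_ : [set x | _] = sqr_norm @^-1` [set t | t < 1])//.
by apply: open_comp; [move=> x _; exact: continuous_sqr_norm|exact: open_lt].
Qed.

Lemma near_ball_sqr x : sqr_norm x < 1 -> \forall y \near x, sqr_norm y < 1.
Proof. by move=> x1; exact: (open_nbhs_nbhs (conj open_ball_sqr x1)). Qed.

End DirectionalDerivatives.

(** * The Bergman metric and its symmetry under conjugation *)

Section BergmanMetricFormula.
Context (R : realType) (n : nat).
Local Open Scope complex_scope.
Local Notation W := 'rV[R]_(n + n).
Local Notation C := R[i].
Local Notation G := (@bergman_metric R n).
Implicit Types (p q u v : W) (a b c : 'I_(n + n)).

Lemma sqnorm_to_complex p : sqnorm (to_complex p) = sqr_norm p.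
Proof.
rewrite sqnormE /sqr_norm /dotr [RHS]big_split_ord /= -[RHS]big_split /=.
by apply: eq_bigr => j _; rewrite !mxE /csq /= !expr2.
Qed.

Lemma potentialE p : sqr_norm p < 1 ->
  bergman_potential p = - (n.+1%:R) * ln (1 - sqr_norm p).
Proof.
move=> p1; have s0 : 0 < 1 - sqr_norm p by rewrite subr_gt0.
rewrite /bergman_potential /bergman_kernel hdot_sq sqnorm_to_complex.
rewrite -[1 - _](_ : (1 - sqr_norm p)%:C = _); last by rewrite rmorphB.
rewrite -rmorphXn -fmorphV /= lnV ?posrE ?exprn_gt0// lnXn// mulNr.
by rewrite mulr_natl.
Qed.

Lemma derive_potential p v : sqr_norm p < 1 ->
  'D_v (@bergman_potential R n) p = 2 * n.+1%:R * (dotr p v * (1 - sqr_norm p)^-1).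
Proof.
move=> p1; have s0 : 0 < 1 - sqr_norm p by rewrite subr_gt0.
rewrite (@derive_eq_near _ _ _ (fun q => - (n.+1%:R) * ln (1 + -1 * sqr_norm q))); last first.
  by apply: filterS (near_ball_sqr p1) => q q1; rewrite potentialE// mulN1r.
have h1 := is_deriveDf (is_derive_const 1 p v)
  (is_deriveMf (is_derive_const (-1) p v) (is_derive_sqr_norm p v)).
have s0' : 0 < 1 + -1 * sqr_norm p by rewrite mulN1r.
have h2 := is_deriveMf (is_derive_const (- (n.+1%:R)) p v) (is_derive_ln s0' h1).
rewrite (@derive_val _ _ _ _ _ _ _ h2) mulN1r; field.
by rewrite gt_eqF.
Qed.

Opaque derive.

Definition hess (u v p : W) : R := 'D_u (fun q => 'D_v (@bergman_potential R n) q) p.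

Lemma metric_hess p a b : G p a b = 4^-1 * (hess (delta_mx 0 a) (delta_mx 0 b) p +
  hess ((delta_mx 0 a : W) *m mul_i R n) ((delta_mx 0 b : W) *m mul_i R n) p).
Proof. by rewrite /bergman_metric mxE. Qed.

Lemma hessE u v p : sqr_norm p < 1 -> hess u v p = 2 * n.+1%:R *
  (dotr u v * (1 - sqr_norm p)^-1 + 2 * (dotr p u * dotr p v) * (1 - sqr_norm p)^-1 ^+ 2).
Proof.
move=> p1; have s0 : 0 < 1 - sqr_norm p by rewrite subr_gt0.
rewrite /hess (@derive_eq_near _ _ _ (fun q => 2 * n.+1%:R * (dotr q v * (1 + -1 * sqr_norm q)^-1))); last first.
  by apply: filterS (near_ball_sqr p1) => q q1; rewrite derive_potential// mulN1r.
have h1 := is_deriveDf (is_derive_const 1 p u)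
  (is_deriveMf (is_derive_const (-1) p u) (is_derive_sqr_norm p u)).
have s0' : 1 + -1 * sqr_norm p != 0 by rewrite mulN1r gt_eqF.
have h2 := is_deriveMf (is_derive_const (2 * n.+1%:R) p u)
  (is_deriveMf (is_derive_dotr p u v) (is_derive_inv s0' h1)).
rewrite (@derive_val _ _ _ _ _ _ _ h2) mulN1r; field.
by rewrite gt_eqF.
Qed.

Let hess_mean (k x y x' y' t : R) :
  4^-1 * (2 * k * (x * t + 2 * y * t ^+ 2) + 2 * k * (x' * t + 2 * y' * t ^+ 2)) =
  k * ((x + x') / 2 * t + (y + y') * t ^+ 2).
Proof. by field. Qed.

Lemma metricE p a b : sqr_norm p < 1 ->
  let u : W := delta_mx 0 a in let v : W := delta_mx 0 b in
  let iu := u *m mul_i R n in let iv := v *m mul_i R n in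
  G p a b = n.+1%:R * ((dotr u v + dotr iu iv) / 2 * (1 - sqr_norm p)^-1 +
    (dotr p u * dotr p v + dotr p iu * dotr p iv) * (1 - sqr_norm p)^-1 ^+ 2).
Proof. by move=> p1 u v iu iv; rewrite metric_hess !hessE//; exact: hess_mean. Qed.

Lemma dotr_delta p a : dotr p (delta_mx 0 a) = p ord0 a.
Proof.
rewrite /dotr (bigD1 a)//= big1 ?addr0; first by rewrite mxE !eqxx mulr1.
by move=> c /negbTE ca; rewrite mxE ca andbF mulr0.
Qed.

Lemma delta_mul_i (i : 'I_n) : (delta_mx 0 (lshift n i) : W) *m mul_i R n = delta_mx 0 (rshift n i).
Proof.
rewrite -rowE; apply/matrixP => x c; rewrite (ord1 x) [LHS]mxE [RHS]mxE eqxx /= /mul_i.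
case: (split_ordP c) => j ->.
  by rewrite block_mxEul mxE eq_lrshift.
by rewrite block_mxEur mxE (inj_eq (@rshift_inj _ _)) eq_sym.
Qed.

Lemma metric_ll p (i j : 'I_n) : sqr_norm p < 1 ->
  G p (lshift n i) (lshift n j) = n.+1%:R * ((i == j)%:R * (1 - sqr_norm p)^-1 +
   (p ord0 (lshift n i) * p ord0 (lshift n j) + p ord0 (rshift n i) * p ord0 (rshift n j)) *
     (1 - sqr_norm p)^-1 ^+ 2).
Proof.
move=> p1; rewrite metricE//= !delta_mul_i !dotr_delta !mxE !eqxx /=.
rewrite (inj_eq (@rshift_inj _ _)) (inj_eq (@lshift_inj _ _)).
by congr (_ * (_ * _ + _)); rewrite eq_sym; field.
Qed.

(** Complex conjugation in the real coordinates (x, y); [sg] marks the coordinates whose sign it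
    changes. *)
Definition tau : 'M[R]_(n + n) := block_mx 1%:M 0 0 (- 1%:M).
Definition sg (a : 'I_(n + n)) : bool := if fintype.split a is inl _ then false else true.

Lemma sg_l i : sg (lshift n i) = false.
Proof. by rewrite /sg -[lshift _ _]/(unsplit (inl _)) unsplitK. Qed.

Lemma sg_r i : sg (rshift n i) = true.
Proof. by rewrite /sg -[rshift _ _]/(unsplit (inr _)) unsplitK. Qed.

Lemma tauE a b : tau a b = (-1) ^+ sg a *+ (a == b).
Proof.
rewrite /tau; case: (split_ordP a) => i ->; case: (split_ordP b) => j ->; rewrite ?sg_l ?sg_r.
- by rewrite block_mxEul mxE (inj_eq (@lshift_inj _ _)).
- by rewrite block_mxEur mxE eq_lrshift.
- by rewrite block_mxEdl mxE eq_rlshift.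
by rewrite block_mxEdr !mxE (inj_eq (@rshift_inj _ _)) expr1 mulNrn.
Qed.

Lemma tau_coord p a : (p *m tau) ord0 a = (-1) ^+ sg a * p ord0 a.
Proof.
rewrite mxE (bigD1 a)//= big1 ?addr0; first by rewrite tauE eqxx mulr1n mulrC.
by move=> c /negbTE ca; rewrite tauE ca mulr0.
Qed.

Lemma tau_delta a : (delta_mx 0 a : W) *m tau = (-1) ^+ sg a *: delta_mx 0 a.
Proof.
apply/matrixP => x c; rewrite (ord1 x) tau_coord !mxE eqxx /=.
by case: eqP => [->//|_]; rewrite !mulr0.
Qed.

Lemma tau_mul_i : mul_i R n *m tau = - (tau *m mul_i R n).
Proof.
rewrite /tau /mul_i !mulmx_block !mulmx0 !mul0mx !addr0 !add0r !mulmx1 !mul1mx.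
by rewrite ?mulmxN ?mulNmx ?mulmx1 ?mul1mx ?opprK opp_block_mx oppr0 ?opprK.
Qed.

Lemma potential_tau p : bergman_potential (p *m tau) = bergman_potential p.
Proof.
rewrite /bergman_potential /bergman_kernel !hdot_sq !sqnorm_to_complex.
suff -> : sqr_norm (p *m tau) = sqr_norm p by [].
by apply: eq_bigr => a _; rewrite tau_coord mulrACA -signr_addb addbb mul1r.
Qed.

Lemma derive_tau (f : W -> R) (e : bool) v p : v *m tau = (-1) ^+ e *: v ->
  'D_v f (p *m tau) = (-1) ^+ e * 'D_v (fun q => f (q *m tau)) p.
Proof.
move=> ve; have vE : v = ((-1) ^+ e *: v) *m tau.
  by rewrite -scalemxAl ve scalerA -signr_addb addbb scale1r.
by rewrite {1}vE derive_mulmx derive_sign.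
Qed.

Lemma hess_tau (e e' : bool) u v p : u *m tau = (-1) ^+ e *: u -> v *m tau = (-1) ^+ e' *: v ->
  hess u v (p *m tau) = (-1) ^+ e * (-1) ^+ e' * hess u v p.
Proof.
move=> hu hv; pose P := @bergman_potential R n.
have h q : 'D_v P (q *m tau) = (-1) ^+ e' * 'D_v P q.
  have e1 := derive_tau P q hv.
  have e2 : 'D_v (fun r => P (r *m tau)) q = 'D_v P q by exact: (@eq_derive R _ _ _ q v potential_tau).
  by rewrite e2 in e1.
rewrite -mulrA; apply: etrans (derive_tau _ p hu) _; apply: (congr1 (fun x => (-1) ^+ e * x)).
by apply: etrans (@eq_derive R _ _ _ p u h) _; exact: derive_signf.
Qed.

Lemma metric_tau p a b : G (p *m tau) a b = (-1) ^+ sg a * (-1) ^+ sg b * G p a b.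
Proof.
have itau c : (delta_mx 0 c : W) *m mul_i R n *m tau = (-1) ^+ (~~ sg c) *: ((delta_mx 0 c : W) *m mul_i R n).
  by rewrite -mulmxA tau_mul_i mulmxN mulmxA tau_delta -scalemxAl -scaleNr signrN.
have F (b1 b2 : bool) (X Y : R) : 4^-1 * ((-1) ^+ b1 * (-1) ^+ b2 * X + (-1) ^+ (~~ b1) * (-1) ^+ (~~ b2) * Y) =
    (-1) ^+ b1 * (-1) ^+ b2 * (4^-1 * (X + Y)) by rewrite !signrN mulrNN; ring.
apply: etrans (metric_hess _ _ _) _.
apply: etrans (congr1 (fun x => 4^-1 * x) (congr2 +%R (hess_tau p (tau_delta a) (tau_delta b))
  (hess_tau p (itau a) (itau b)))) _.
apply: etrans (F _ _ _ _) _; apply: (congr1 (fun x => (-1) ^+ sg a * (-1) ^+ sg b * x)).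
exact/esym/metric_hess.
Qed.

Lemma metric_tauE p : G (p *m tau) = tau *m G p *m tau.
Proof.
apply/matrixP => a b; rewrite metric_tau [RHS]mxE (bigD1 b)//= big1 ?addr0; last first.
  by move=> c /negbTE cb; rewrite tauE cb mulr0.
rewrite [X in _ = X * _]mxE (bigD1 a)//= big1 ?addr0; last first.
  by move=> c /negbTE ca; rewrite tauE eq_sym ca mul0r.
by rewrite !tauE !eqxx !mulr1n; ring.
Qed.

Lemma tau_sq : tau *m tau = 1%:M.
Proof.
rewrite /tau mulmx_block !mulmx0 !mul0mx !addr0 !add0r mulmx1 mulNmx mulmxN opprK mulmx1.
by rewrite -scalar_mx_block.
Qed.

(** It extends to singular A, which [invmx] leaves unchanged, so invertibility of the metric need
    not be established. *)
Lemma invmx_conj (A : 'M[R]_(n + n)) : invmx (tau *m A *m tau) = tau *m invmx A *m tau.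
Proof.
have tu : tau \in unitmx by have [] := mulmx1_unit tau_sq.
have ti : invmx tau = tau by rewrite -[LHS]mulmx1 -tau_sq mulKmx.
have [uA|nA] := boolP (A \in unitmx).
  have h : (tau *m A *m tau) *m (tau *m invmx A *m tau) = 1%:M.
    by rewrite !mulmxA -(mulmxA _ tau tau) tau_sq mulmx1 -(mulmxA tau A) mulmxV// mulmx1 tau_sq.
  have [uX _] := mulmx1_unit h.
  by have := congr1 (mulmx (invmx (tau *m A *m tau))) h; rewrite mulKmx// mulmx1.
by rewrite /invmx !unitmx_mul tu (negbTE nA) andbF.
Qed.

Lemma pd_metric_tau p a b c : pd a (fun y => G y b c) (p *m tau) =
  (-1) ^+ sg a * ((-1) ^+ sg b * (-1) ^+ sg c) * pd a (fun y => G y b c) p.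
Proof.
rewrite /pd (derive_tau _ _ (tau_delta a)) -mulrA -signr_addb; congr (_ * _); rewrite -derive_signf.
by apply: eq_derive => q; rewrite signr_addb; exact: metric_tau.
Qed.

Lemma invmx_metric_tau p k l : invmx (G (p *m tau)) k l = (-1) ^+ sg k * (-1) ^+ sg l * invmx (G p) k l.
Proof.
rewrite metric_tauE invmx_conj [LHS]mxE (bigD1 l)//= big1 ?addr0; last first.
  by move=> c /negbTE cl; rewrite tauE cl mulr0.
rewrite [X in X * _ = _]mxE (bigD1 k)//= big1 ?addr0; last first.
  by move=> c /negbTE ck; rewrite tauE eq_sym ck mul0r.
by rewrite !tauE !eqxx !mulr1n; ring.
Qed.

(** Each free index contributes its sign; the summed index occurs twice in every term, so its sign
    cancels. *)
Lemma christoffel_tau k i j p : christoffel G k i j (p *m tau) =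
  (-1) ^+ sg k * (-1) ^+ sg i * (-1) ^+ sg j * christoffel G k i j p.
Proof.
have F (b : bool) (y z t a x1 x2 x3 : R) : y * (-1) ^+ b * a * (z * (t * (-1) ^+ b) * x1 +
    t * (z * (-1) ^+ b) * x2 - (-1) ^+ b * (z * t) * x3) = y * z * t * (a * (x1 + x2 - x3)).
  by case: b; ring.
rewrite /christoffel mulrCA; apply: (congr1 (fun x => 2^-1 * x)); rewrite mulr_sumr.
apply: eq_bigr => l _; apply: etrans _ (F (sg l) _ _ _ _ _ _ _).
apply: (congr2 (fun x y => x * y)); first exact: invmx_metric_tau.
apply: (congr2 (fun x y => x - y)); last exact: pd_metric_tau.
by apply: (congr2 (fun x y => x + y)); exact: pd_metric_tau.
Qed.

Transparent derive.

End BergmanMetricFormula.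

(** * Geometry of the real ball *)

Section RealBall.
Context (R : realType) (n : nat).
Local Notation W := 'rV[R]_(n + n).
Local Notation G := (@bergman_metric R n).
Implicit Types (p q : W) (x y : 'rV[R]_n).

Definition real_ball : set W := [set p | rsubmx p = 0 /\ sqr_norm p < 1].
Definition emb x : W := row_mx x 0.
Definition embM : 'M[R]_(n, n + n) := row_mx 1%:M 0.
Let U0 : set 'rV[R]_n := [set x | sqr_norm x < 1].

Lemma emb_l x i : emb x ord0 (lshift n i) = x ord0 i. Proof. by rewrite /emb row_mxEl. Qed.

Lemma emb_r x i : emb x ord0 (rshift n i) = 0. Proof. by rewrite /emb row_mxEr mxE. Qed.

Lemma sqr_norm_emb x : sqr_norm (emb x) = sqr_norm x.
Proof.
rewrite /sqr_norm /dotr big_split_ord /= [X in _ + X]big1 ?addr0; last by move=> i _; rewrite emb_r mulr0.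
by apply: eq_bigr => i _; rewrite emb_l.
Qed.

Lemma Ck_const k (U : set 'rV[R]_n) (c : R) : Ck k U (fun=> c).
Proof.
elim: k c => [|k IH] c; split=> //; try by [move=> x _; exact: cst_continuous].
move=> i; split; first by move=> x _; exact: derivable_cst.
by rewrite (_ : pd i _ = fun=> 0); [exact: IH|apply/funext => x; exact: derive_cst].
Qed.

Lemma pd_coord (i j : 'I_n) x : pd i (fun y => y ord0 j) x = (i == j)%:R.
Proof.
rewrite /pd (@derive_val _ _ _ _ _ _ _ (is_derive_coord x (delta_mx 0 i) j)).
by rewrite mxE eqxx /= eq_sym.
Qed.

Lemma Ck_coord k (U : set 'rV[R]_n) (j : 'I_n) : Ck k U (fun y => y ord0 j).
Proof.
have cc x : {for x, continuous (fun y : 'rV[R]_n => y ord0 j)} by exact: coord_continuous.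
case: k => [|k]; split=> // i; split.
  by move=> x _; have [] := is_derive_coord x (delta_mx 0 i) j.
by rewrite (_ : pd i _ = fun=> (i == j)%:R); [exact: Ck_const|apply/funext => x; exact: pd_coord].
Qed.

Lemma jac_emb x : jac emb x = embM.
Proof.
apply/matrixP => i j; rewrite mxE; case: (split_ordP j) => l ->.
  rewrite (_ : (fun y => _) = fun y => y ord0 l); last by apply/funext => y; exact: emb_l.
  by rewrite pd_coord /embM row_mxEl mxE.
rewrite (_ : (fun y => _) = fun=> 0); last by apply/funext => y; exact: emb_r.
by rewrite /embM row_mxEr mxE; exact: derive_cst.
Qed.

Lemma embM_tr : embM *m embM^T = 1%:M.
Proof. by rewrite /embM tr_row_mx mul_row_col trmx1 trmx0 mulmx1 mulmx0 addr0. Qed.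

Lemma local_param_emb : local_param real_ball U0 emb.
Proof.
split.
- exact: open_ball_sqr.
- move=> k j; case: (split_ordP j) => l ->.
    rewrite (_ : (fun y => _) = fun y => y ord0 l); [exact: Ck_coord|by apply/funext => y; exact: emb_l].
  rewrite (_ : (fun y => _) = fun=> 0); [exact: Ck_const|by apply/funext => y; exact: emb_r].
- move=> x _; rewrite jac_emb; apply/eqP; change (row_free embM).
  by apply/row_freeP; exists embM^T; exact: embM_tr.
- by move=> x y _ _ /eq_row_mx[].
move=> U' oU' U'U; exists (lsubmx @^-1` U').
  by apply: open_comp => // p _; exact: continuous_lsubmx.
apply/seteqP; split=> p.
  move=> [x U'x <-]; split; last by rewrite /= /emb row_mxKl.
  by split; [rewrite /emb row_mxKr|rewrite sqr_norm_emb; exact: U'U].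
by move=> [[r0 _] U'p]; exists (lsubmx p) => //; rewrite /emb -r0 hsubmxK.
Qed.

Lemma emb_surj p : real_ball p -> U0 (lsubmx p) /\ emb (lsubmx p) = p.
Proof.
move=> [r0 p1]; have e : emb (lsubmx p) = p by rewrite /emb -r0 hsubmxK.
by split=> //; rewrite /U0 /= -sqr_norm_emb e.
Qed.

Lemma real_ball_submanifold : submanifold n real_ball.
Proof.
split.
  by exists 0; split; [apply/matrixP => i j; rewrite !mxE|rewrite /sqr_norm /dotr big1// => a _; rewrite mxE mulr0].
move=> p /emb_surj[up pe]; exists U0, emb; split; first exact: local_param_emb.
by exists (lsubmx p).
Qed.

Lemma real_ball_tau p : real_ball p -> p *m tau R n = p.
Proof.
move=> /emb_surj[_ <-]; apply/matrixP => i c; rewrite (ord1 i) tau_coord.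
by case: (split_ordP c) => l ->; rewrite ?sg_l ?mul1r ?emb_r ?mulr0.
Qed.

Lemma metric_rl p (i j : 'I_n) : real_ball p -> G p (rshift n i) (lshift n j) = 0.
Proof.
move=> /real_ball_tau pt; have := metric_tau p (rshift n i) (lshift n j).
rewrite pt sg_r sg_l expr1 expr0 mulr1 mulN1r; lra.
Qed.

Lemma christoffel_rll p (k i j : 'I_n) : real_ball p ->
  christoffel G (rshift n k) (lshift n i) (lshift n j) p = 0.
Proof.
move=> /real_ball_tau pt; have := christoffel_tau (rshift n k) (lshift n i) (lshift n j) p.
rewrite pt sg_r !sg_l expr1 expr0 !mulr1 mulN1r; lra.
Qed.

Section LocalParam.
Variables (U : set 'rV[R]_n) (X : 'rV[R]_n -> W).
Hypothesis lp : local_param real_ball U X.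

Lemma local_param_in x : U x -> real_ball (X x).
Proof.
move=> Ux; have [oU _ _ _ H] := lp; have [V _ HV] := H U oU (@subset_refl _ U).
have : (X @` U) (X x) by exists x.
by rewrite HV => -[].
Qed.

Lemma local_param_r x i : U x -> X x ord0 (rshift n i) = 0.
Proof.
move=> /local_param_in[r0 _]; have := congr1 (fun A : 'rV[R]_n => A ord0 i) r0.
by rewrite !mxE.
Qed.

Lemma near_dom x : U x -> \forall y \near x, U y.
Proof. by move=> Ux; have [oU _ _ _ _] := lp; exact: (open_nbhs_nbhs (conj oU Ux)). Qed.

Lemma pd_r x i j : U x -> pd i (fun y => X y ord0 (rshift n j)) x = 0.
Proof.
move=> Ux; rewrite /pd (@derive_eq_near _ _ _ (fun=> 0)) ?derive_cst//.
by apply: filterS (near_dom Ux) => y; exact: local_param_r.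
Qed.

(** The tangent spaces of the real ball are all the fixed space R^n x 0, so an arbitrary local
    parametrization differs from [emb] by an invertible factor at first order. *)
Lemma jac_split x : U x -> jac X x = lsubmx (jac X x) *m embM /\ lsubmx (jac X x) \in unitmx.
Proof.
move=> Ux; have e : jac X x = lsubmx (jac X x) *m embM.
  rewrite /embM mul_mx_row mulmx1 mulmx0 -[LHS]hsubmxK; congr row_mx.
  by apply/matrixP => i j; rewrite !mxE; exact: pd_r.
split=> //; have [_ _ /(_ x Ux) rk _ _] := lp.
rewrite -row_full_unit /row_full eqn_leq rank_leq_col /= -{1}rk {1}e.
exact: mxrankM_maxl.
Qed.

Lemma local_param_lagrangian x : U x -> jac X x *m kahler_form (X x) *m (jac X x)^T = 0.
Proof.
move=> Ux; have [e _] := jac_split Ux; rewrite e trmx_mul.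
have : embM *m kahler_form (X x) *m embM^T = 0.
  rewrite /kahler_form -[G _]submxK /mul_i /embM tr_row_mx trmx1 trmx0 mulmxA.
  rewrite mul_row_block !mul1mx !mul0mx ?mulmx0 ?addr0 ?add0r mul_row_block !mul1mx !mul0mx !add0r.
  rewrite mul_row_col mulmx1 mulmx0 addr0.
  apply/matrixP => i j; rewrite [RHS]mxE -(metric_rl i j (local_param_in Ux)).
  by rewrite -[in RHS](submxK (G (X x))) block_mxEdl.
move: (kahler_form _) (lsubmx _) => K B h.
by rewrite -mulmxA (mulmxA K) -(mulmxA B) (mulmxA embM) (mulmxA embM) h mul0mx mulmx0.
Qed.

Lemma local_param_geodesic x i j : U x -> (cov_deriv G X i j x <= jac X x)%MS.
Proof.
move=> Ux; have [e Bu] := jac_split Ux; set B := lsubmx (jac X x) in e Bu.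
have jr a l : jac X x a (rshift n l) = 0 by rewrite mxE; exact: pd_r.
set v := cov_deriv G X i j x.
have vE : v = (lsubmx v *m invmx B) *m jac X x.
  rewrite [X in _ *m X]e mulmxA mulmxKV// /embM mul_mx_row mulmx1 mulmx0 -[LHS]hsubmxK; congr row_mx.
  apply/matrixP => a l; rewrite (ord1 a) !mxE.
  rewrite [X in X + _](_ : _ = 0) ?add0r; last first.
    rewrite /pd (@derive_eq_near _ _ _ (fun=> 0)) ?derive_cst//.
    by apply: filterS (near_dom Ux) => y; exact: pd_r.
  rewrite big1// => b _; rewrite big1// => c _.
  case: (split_ordP b) => b' ->; last by rewrite jr mulr0 mul0r.
  case: (split_ordP c) => c' ->; last by rewrite jr mulr0.
  by rewrite christoffel_rll ?mul0r//; exact: local_param_in.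
by rewrite vE submxMl.
Qed.

End LocalParam.

Lemma real_ball_lagrangian : lagrangian real_ball.
Proof.
split; first exact: real_ball_submanifold.
by move=> U X lp x; exact: local_param_lagrangian.
Qed.

Lemma real_ball_geodesic : totally_geodesic n G real_ball.
Proof. by move=> U X lp x Ux i j; exact: (local_param_geodesic lp i j Ux). Qed.

Local Notation g := (induced_metric G emb).
Let tt x : R := (1 + -1 * sqr_norm x)^-1.

Lemma induced_emb x (i j : 'I_n) : U0 x -> g x i j =
  n.+1%:R * ((i == j)%:R * tt x + x ord0 i * x ord0 j * (tt x * tt x)).
Proof.
move=> x1; have e : g x = ulsubmx (G (emb x)).
  rewrite /induced_metric jac_emb -[in LHS](submxK (G (emb x))) /embM tr_row_mx trmx1 trmx0.
  by rewrite mul_row_block !mul1mx !mul0mx !addr0 mul_row_col mulmx1 mulmx0 addr0.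
rewrite e mxE mxE metric_ll ?sqr_norm_emb// !emb_l !emb_r mulr0 addr0 /tt mulN1r.
by rewrite expr2.
Qed.

Lemma is_derive_tt x v : U0 x -> is_derive x v tt (2 * dotr x v * (tt x * tt x)).
Proof.
move=> x1; have s0 : 0 < 1 - sqr_norm x by rewrite subr_gt0.
have s0' : 1 + -1 * sqr_norm x != 0 by rewrite mulN1r gt_eqF.
have h := is_derive_inv s0' (is_deriveDf (is_derive_const 1 x v)
  (is_deriveMf (is_derive_const (-1) x v) (is_derive_sqr_norm x v))).
rewrite (_ : 2 * _ * _ = - (1 + -1 * sqr_norm x) ^- 2 * (0 + (-1 * (2 * dotr x v) + sqr_norm x * 0))); first exact: h.
by rewrite /tt; field.
Qed.

Lemma pd_induced x (l i j : 'I_n) : U0 x -> pd l (fun y => g y i j) x =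
  n.+1%:R * ((i == j)%:R * (2 * x ord0 l * (tt x * tt x)) +
   ((l == i)%:R * x ord0 j + x ord0 i * (l == j)%:R) * (tt x * tt x) +
   x ord0 i * x ord0 j * (2 * tt x * (2 * x ord0 l * (tt x * tt x)))).
Proof.
move=> x1; rewrite /pd (@derive_eq_near _ _ _ (fun y => n.+1%:R * ((i == j)%:R * tt y +
  y ord0 i * y ord0 j * (tt y * tt y)))); last first.
  by apply: filterS (near_ball_sqr x1) => y; exact: induced_emb.
set v := delta_mx 0 l.
have ht := is_derive_tt v x1; have hi := is_derive_coord x v i; have hj := is_derive_coord x v j.
have h := is_deriveMf (is_derive_const n.+1%:R x v) (is_deriveDf
  (is_deriveMf (is_derive_const (i == j)%:R x v) ht)
  (is_deriveMf (is_deriveMf hi hj) (is_deriveMf ht ht))).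
rewrite (@derive_val _ _ _ _ _ _ _ h) /v !mxE !eqxx /= (eq_sym i l) (eq_sym j l).
have -> : dotr x (delta_mx 0 l) = x ord0 l.
  rewrite /dotr (bigD1 l)//= big1 ?addr0; first by rewrite mxE !eqxx mulr1.
  by move=> c /negbTE ca; rewrite mxE ca andbF mulr0.
by move: (tt x) (x ord0 l) (x ord0 i) (x ord0 j) => *; ring.
Qed.

(** With t = 1 / (1 - |x|^2), g is (n + 1) t times 1 + t x^T x, a rank-one perturbation of the
    identity; the inverse of 1 + t x^T x is 1 - x^T x. *)
Lemma induced_unit x : U0 x -> g x \in unitmx.
Proof.
move=> x1; have s0 : 0 < 1 - sqr_norm x by rewrite subr_gt0.
have ts : tt x * (1 - sqr_norm x) = 1 by rewrite /tt mulN1r mulVf// gt_eqF.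
pose xx := x^T *m x; have xE i j : xx i j = x ord0 i * x ord0 j.
  by rewrite mxE big_ord1 mxE.
have gE : g x = (n.+1%:R * tt x) *: (1%:M + tt x *: xx).
  by apply/matrixP => i j; rewrite induced_emb// !mxE -/xx -xE mxE; case: (i == j); ring.
have x2 : xx *m xx = sqr_norm x *: xx.
  rewrite /xx mulmxA -(mulmxA x^T) (_ : x *m x^T = (sqr_norm x)%:M) ?mul_mx_scalar -?scalemxAl//.
  apply/matrixP => i j; rewrite !ord1 !mxE eqxx mulr1n; apply: eq_bigr => k _; rewrite mxE//.
have h : g x *m ((n.+1%:R^-1 * (1 - sqr_norm x)) *: (1%:M - xx)) = 1%:M.
  rewrite gE -scalemxAl -scalemxAr scalerA mulmxBr mulmx1 mulmxDl mul1mx -scalemxAl x2 scalerA.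
  have -> : n.+1%:R * tt x * (n.+1%:R^-1 * (1 - sqr_norm x)) = 1.
    by rewrite mulrACA mulfV ?pnatr_eq0// mul1r.
  apply/matrixP => i j; rewrite !mxE.
  have -> : (tt x * sqr_norm x) = tt x - 1 by rewrite -ts; ring.
  ring.
by have [] := mulmx1_unit h.
Qed.

(** The candidate symbols are multiplied by g and compared with the symbols of the first kind, so
    the inverse metric is never expanded. Their form reflects that geodesics of the Klein model are
    straight segments. *)
Lemma christoffel_induced x (k i j : 'I_n) : U0 x -> christoffel g k i j x =
  (x ord0 i * (k == j)%:R + x ord0 j * (k == i)%:R) * tt x.
Proof.
move=> x1; pose gam : 'cV[R]_n := \col_k ((x ord0 i * (k == j)%:R + x ord0 j * (k == i)%:R) * tt x).
pose low : 'cV[R]_n := \col_l (2^-1 * (pd i (fun y => g y j l) x + pd j (fun y => g y i l) x - pd l (fun y => g y i j) x)).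
have ge : g x *m gam = low.
  apply/matrixP => l z; rewrite (ord1 z) [LHS]mxE [RHS]mxE !pd_induced//.
  have pick (c : 'I_n) (F : 'I_n -> R) : \sum_a F a * (a == c)%:R = F c.
    rewrite (bigD1 c)//= big1 ?addr0; first by rewrite eqxx mulr1.
    by move=> a /negbTE ->; rewrite mulr0.
  rewrite (eq_bigr (fun a => (g x l a * (x ord0 i * tt x)) * (a == j)%:R + (g x l a * (x ord0 j * tt x)) * (a == i)%:R)); last first.
    by move=> a _; rewrite [gam _ _]mxE; ring.
  rewrite big_split /= !pick !induced_emb// (eq_sym j i) (eq_sym l j) (eq_sym l i).
  move: (i == j)%:R (i == l)%:R (j == l)%:R (tt x) (x ord0 l) (x ord0 i) (x ord0 j) => *.
  by field.
have : gam = invmx (g x) *m low by rewrite -ge mulKmx// induced_unit.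
move=> /(congr1 (fun A : 'cV[R]_n => A k ord0)); rewrite mxE => ->.
rewrite mxE /christoffel mulr_sumr; apply: eq_bigr => l _.
by rewrite [low _ _]mxE mulrCA.
Qed.

Lemma real_ball_nonflat : (2 <= n)%N -> ~ flat n G real_ball.
Proof.
move=> n2 fl; pose o : 'I_n := Ordinal (ltnW n2); pose e : 'I_n := Ordinal n2.
have z1 : U0 0 by rewrite /U0 /= /sqr_norm /dotr big1// => a _; rewrite mxE mulr0.
(* The Christoffel symbols vanish at the origin, so this curvature component, in the plane of the
   first two axes, is a difference of two of their derivatives; it equals 1. *)
have := fl _ _ local_param_emb 0 z1 e o o e; rewrite /riemann big1; last first.
  by move=> s _; rewrite !christoffel_induced// !mxE !mul0r !addr0 !mul0r subrr.
have t1 : tt 0 = 1 by rewrite /tt /sqr_norm /dotr big1 ?mulr0 ?addr0 ?invr1// => a _; rewrite mxE mulr0.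
have d0 v : dotr (0 : 'rV[R]_n) v = 0 by rewrite /dotr big1// => a _; rewrite mxE mul0r.
have P (l k i j : 'I_n) : pd l (christoffel g k i j) 0 = (l == i)%:R * (k == j)%:R + (l == j)%:R * (k == i)%:R.
  rewrite /pd (@derive_eq_near _ _ _ (fun x => (x ord0 i * (k == j)%:R + x ord0 j * (k == i)%:R) * tt x)); last first.
    by apply: filterS (near_ball_sqr z1) => y; exact: christoffel_induced.
  set v := delta_mx 0 l.
  have h := is_deriveMf (is_deriveDf
    (is_deriveMf (is_derive_coord 0 v i) (is_derive_const (k == j)%:R 0 v))
    (is_deriveMf (is_derive_coord 0 v j) (is_derive_const (k == i)%:R 0 v))) (is_derive_tt v z1).
  rewrite (@derive_val _ _ _ _ _ _ _ h) t1 d0 /v !mxE !eqxx /= (eq_sym i l) (eq_sym j l); ring.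
have oe : (o == e) = false by [].
have eo : (e == o) = false by [].
rewrite !P !eqxx oe eo !mulr1 !mulr0 !addr0 subr0 => /eqP; by rewrite ?add0r ?oner_eq0.
Qed.

End RealBall.

(** * The orbit of the origin *)

Section Orbit.
Context (R : realType) (m : nat).
Local Open Scope complex_scope.
Local Notation n := m.+1.
Local Notation C := R[i].
Local Notation V := 'cV[C]_n.

Lemma act0 (g : 'M[C]_(n + 1)) i :
  ball_act g 0 i ord0 = (drsubmx g ord0 ord0)^-1 * ursubmx g i ord0.
Proof. by rewrite /ball_act !mulmx0 !add0r mxE. Qed.

(** The image of 0 is the last column of g divided by its corner entry, which is real by projective
    reality. Conversely a nonzero real point x is reached from 0 by the boost along x / |x|. *)
Lemma orbit_real_ball : real_orbit (@SOn1 R m) 0 = @real_ball R n.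
Proof.
have z0 : sqnorm (0 : V) < 1 by rewrite sqnormE big1// => i _; rewrite mxE csq0.
apply/seteqP; split=> p.
  move=> [g hg gp]; have pg := SOn1_preserves hg; have [_ rg] := hg.
  split; last by rewrite -sqnorm_to_complex -gp; exact: act_ball.
  apply/matrixP => i j; rewrite (ord1 i) [LHS]mxE [RHS]mxE.
  have := congr1 (fun v : V => complex.Im (v j ord0)) gp; rewrite act0 [to_complex p _ _]mxE /= => <-.
  set d := drsubmx g ord0 ord0; set b := ursubmx g j ord0.
  have db : cj (b * cj d) = b * cj d.
    by have := rg (lshift 1 j) (rshift n ord0) (rshift n ord0) (rshift n ord0); rewrite /b /d !mxE.
  have -> : d^-1 * b = (csq d)^-1%:C * (b * cj d).
    have [->|d0] := eqVneq d 0; first by rewrite invr0 mul0r rmorph0 !mulr0.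
    have c0 : cj d != 0 by rewrite fmorph_eq0.
    by rewrite fmorphV /= csqE; field; rewrite c0.
  have : complex.Im (b * cj d) = 0.
    by have := cImJ (b * cj d); rewrite db; lra.
  move: (b * cj d) => w w0; rewrite cImM w0 mulr0 add0r.
  by rewrite (_ : complex.Im _ = 0) ?mul0r.
move=> [pr p1]; pose x := lsubmx p.
have xE : to_complex p = \col_j (x ord0 j)%:C.
  apply/matrixP => j k; rewrite !mxE; have := congr1 (fun A : 'rV[R]_n => A ord0 j) pr.
  by rewrite !mxE => ->.
have q1 : sqr_norm x < 1.
  have := p1; have [_ <-] := emb_surj (conj pr p1); by rewrite sqr_norm_emb.
have [x0|x0] := eqVneq (sqr_norm x) 0.
  exists 1%:M; first by have [_ h _ _] := SOn1_subgroup R m.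
  have xz j : x ord0 j = 0.
    apply/eqP; rewrite -sqrf_eq0 eq_le sqr_ge0 andbT -x0 /sqr_norm /dotr (bigD1 j)//= expr2 lerDl.
    by apply: sumr_ge0 => k _; rewrite -expr2 sqr_ge0.
  rewrite xE; apply/matrixP => j k; rewrite (ord1 k) act0 [RHS]mxE xz.
  have -> : ursubmx (1%:M : 'M[C]_(n + 1)) j ord0 = 0 by rewrite !mxE eq_lrshift.
  by rewrite mulr0.
have q0 : 0 < sqr_norm x.
  by rewrite lt_neqAle eq_sym x0 /sqr_norm /dotr sumr_ge0// => k _; rewrite -expr2 sqr_ge0.
pose r := Num.sqrt (sqr_norm x); have r0 : 0 < r by rewrite sqrtr_gt0.
have r2 : r ^+ 2 = sqr_norm x by rewrite sqr_sqrtr// ltW.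
pose u : V := \col_j (r^-1 * x ord0 j)%:C.
have ru : real_mx u by move=> a b; rewrite mxE conj_real.
have uu : u^T *m u = 1%:M.
  apply/matrixP => a b; rewrite !ord1 !mxE eqxx mulr1n.
  rewrite (eq_bigr (fun k => (r^-1 ^+ 2 * (x ord0 k * x ord0 k))%:C)); last first.
    by move=> k _; rewrite !mxE -rmorphM; congr (_%:C); ring.
  by rewrite -rmorph_sum -mulr_sumr -/(dotr x x) -/(sqr_norm x) -r2 exprVn mulVf// expf_neq0// gt_eqF.
(* Hyperbolic cosine and sine with quotient s / c = r = |x|, as the boost along u sends 0 to (s / c)
   u. *)
pose c := Num.sqrt (1 - r ^+ 2)^-1; pose s := r * c.
have t0 : 0 < 1 - r ^+ 2 by rewrite r2 subr_gt0.
have c0 : 0 < c by rewrite sqrtr_gt0 invr_gt0.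
have c2 : c ^+ 2 = (1 - r ^+ 2)^-1 by rewrite sqr_sqrtr// invr_ge0 ltW.
have cs : c ^+ 2 = 1 + s ^+ 2.
  by rewrite /s exprMn c2; field; rewrite gt_eqF.
have [g hg gE] := SOn1_act 0 (real_bmx c s ru) (preserves_bmx ru uu cs).
exists g => //; rewrite gE xE; apply/matrixP => j k; rewrite (ord1 k) act0 [RHS]mxE.
have -> : drsubmx (bmx u c s) ord0 ord0 = c%:C by rewrite /bmx block_mxKdr mxE eqxx mulr1n.
have -> : ursubmx (bmx u c s) j ord0 = (s * (r^-1 * x ord0 j))%:C by rewrite /bmx block_mxKur [LHS]mxE [u _ _]mxE -rmorphM.
by rewrite -fmorphV -rmorphM; congr (_%:C); rewrite /s; field; rewrite !gt_eqF.
Qed.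

End Orbit.

Theorem theorem5p7 (R : realType) (n : nat) (hn : (2 <= n)%N) :
  exists H : set 'M[R[i]]_(n + 1),
    [/\ is_subgroup H, closed H & ~ is_abelian H] /\
    [/\ (forall lambda : R, n%:R < lambda ->
           Cstar_algebra lambda
             (toeplitz_algebra lambda (invariant_symbols H)) /\
           commutative_algebra lambda
             (toeplitz_algebra lambda (invariant_symbols H))),
        (exists2 z0 : 'cV[R[i]]_n, unit_ball z0 &
           let M := real_orbit H z0 in
           [/\ submanifold n M,
               ~ flat n (@bergman_metric R n) M,
               lagrangian M &
               totally_geodesic n (@bergman_metric R n) M]) &
        (forall H' : set 'M[R[i]]_(n + 1), connected_maximal_abelian H' ->
           invariant_symbols H <> invariant_symbols H')].
Proof.
case: n hn => // m hm; exists (@SOn1 R m); split.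
  by split; [exact: SOn1_subgroup|exact: SOn1_closed|exact: SOn1_nonabelian].
split.
- move=> lambda hl; have XL : invariant_symbols (@SOn1 R m) `<=` @Linfty R m.+1 by move=> phi [].
  split; first split.
  + exact: toeplitz_algebra_closed.
  + by apply: toeplitz_algebra_adjoint => // phi; exact: invariant_conj.
  apply: toeplitz_algebra_commutative => // phi hphi; last exact: invariant_neg.
  by move=> i; exact: invariant_boost.
- exists 0; first by rewrite /unit_ball /= sqnormE big1// => i _; rewrite mxE csq0.
  rewrite /= orbit_real_ball; split.
  + exact: real_ball_submanifold.
  + exact: real_ball_nonflat.
  + exact: real_ball_lagrangian.
  exact: real_ball_geodesic.
move=> H' [sH _ aH _]; exact: symbols_neq.
Qed.
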